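(* Let $S(x)=\sum_{n=1}^\infty a_nX_n\phi_n(\lambda_n x)$ be the random complex series described in the context, with associated exponents $\sigma$ and $\tau$. Suppose $0<\sigma\le\tau<\infty$. Then for any Borel set $A\subset\mathbb{R}$: (i) almost surely, $$\min\Bigl\{2,\ \frac{\dim_{\mathcal H}A}{\tau}\Bigr\}\le \dim_{\mathcal H}S(A)\le \min\Bigl\{2,\ \frac{\dim_{\mathcal H}A}{\min\{\sigma,1\}}\Bigr\};$$ (ii) if $0<\tau<\frac12\dim_{\mathcal H}A$, then $S(A)$ has positive two-dimensional Lebesgue measure almost surely; (iii) if $0<\tau<\frac14\dim_{\mathcal H}A$, then $S(A)$ has nonempty interior (in $\mathbb{C}\cong\mathbb{R}^2$) almost surely. Moreover, if (instead of $0<\sigma\le\tau<\infty$) one has $\tau=0$, and $A\subset\mathbb{R}$ is a Borel set with $\dim_{\mathcal H}A>0$, then $S(A)$ has nonempty interior almost surely.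
   Context: Functions $\phi_n:\mathbb{R}\to\mathbb{C}$ ($n\ge1$) are given that are uniformly bounded and locally uniformly bi-Lipschitz: $\sup_n\|\phi_n\|_\infty<\infty$ and there are constants $L\ge1$, $\delta>0$ with $L^{-1}|x-y|\le|\phi_n(x)-\phi_n(y)|\le L|x-y|$ for all $n$ and all $x,y$ with $|x-y|\le\delta$. The coefficients satisfy $a_n\in\mathbb{C}\setminus\{0\}$ and $\sum_n|a_n|<\infty$. The sequence $(\lambda_n)_{n\ge1}$ of real numbers is increasing with $\lambda_1=1$ and $q:=\sup_n\lambda_{n+1}/\lambda_n<\infty$, $q>1$. For $k\ge0$ put $$s_k=\Bigl(\sum_{n:\,q^k\le\lambda_n<q^{k+1}}|a_n|^2\Bigr)^{1/2},\qquad \sigma=\liminf_{k\to\infty}\frac{-\log s_k}{k\log q},\qquad \tau=\limsup_{k\to\infty}\frac{-\log s_k}{k\log q}$$ (with $-\log 0=+\infty$). The $\theta_n$ are independent random variables uniformly distributed on $[0,1]$, and $X_n=e^{2\pi i\theta_n}$ (Steinhaus sequence). $\dim_{\mathcal H}$ is Hausdorff dimension; $\mathbb{C}$ is identified with $\mathbb{R}^2$; $S(A)$ is the image of $A$. ''Almost surely'' is with respect to $(\theta_n)$, and the exceptional null event may depend on $A$. *)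

(* Defs.v *)
From HB Require Import structures.
From mathcomp Require Import all_boot all_order all_algebra finmap.
From mathcomp Require Import all_classical all_reals all_analysis.
From mathcomp Require Import complex.
Set Implicit Arguments.
Unset Strict Implicit.
Unset Printing Implicit Defensive.
Import Order.TTheory GRing.Theory Num.Theory.
Import numFieldNormedType.Exports.
Local Open Scope classical_set_scope.
Local Open Scope ring_scope.

(* All sequences indexed by n >= 1 in the mathematics are indexed here by
   n : nat starting at 0, so that lambda 0 is the first frequency. *)

(* [dist] is intended to be a metric on T; the Hausdorff measures below are
   built from countable covers by arbitrary subsets of T. *)
Section Hausdorff.
Context (R : realType) (T : Type).
Variable dist : T -> T -> R.
Local Open Scope ereal_scope.

(* -oo on the empty set, which is treated separately below *)
Definition diameter (U : set T) : \bar R :=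
  ereal_sup [set z | exists x y, [/\ U x, U y & z = (dist x y)%:E]].

(* |U|^s, with the convention that the empty set contributes 0 even if s = 0 *)
Definition diameter_pow (s : R) (U : set T) : \bar R :=
  if U == set0 then 0 else poweR (diameter U) s.

Definition hausdorff_content (s delta : R) (A : set T) : \bar R :=
  ereal_inf [set \sum_(i <oo) diameter_pow s (U i) | U in
    [set U : nat -> set T | (forall i, diameter (U i) <= delta%:E) /\
                            A `<=` \bigcup_i U i]].

Definition hausdorff_measure (s : R) (A : set T) : \bar R :=
  ereal_sup [set hausdorff_content s delta A | delta in
    [set delta : R | (0 < delta)%R]].

Definition hausdorff_dim (A : set T) : \bar R :=
  ereal_inf [set s%:E | s in
    [set s : R | (0 <= s)%R /\ hausdorff_measure s A = 0]].

End Hausdorff.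

Definition distR (R : realType) (x y : R) : R := `|x - y|.

Definition distC (R : realType) (z w : R[i]) : R := Normc.normc (z - w).

Definition toR2 (R : realType) (z : R[i]) : R * R :=
  (complex.Re z, complex.Im z).

(* Two-dimensional Lebesgue (outer) measure of a set of complex numbers:
   defined on every set, and equal to Lebesgue measure on the Lebesgue
   measurable ones, in particular on continuous images of Borel sets. *)
Definition lebesgue2 (R : realType) (X : set R[i]) : \bar R :=
  mu_ext (lebesgue_measure \x lebesgue_measure)%E (@toR2 R @` X).

Definition has_interior (R : realType) (X : set R[i]) : Prop :=
  (@toR2 R @` X)° !=set0.

(* R[i] carries no topology in the library, so real and imaginary parts are
   summed separately. *)
Definition complex_series (R : realType) (u : nat -> R[i]) : R[i] :=
  Complex (limn (series (fun n => complex.Re (u n))))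
          (limn (series (fun n => complex.Im (u n)))).

Definition expi (R : realType) (t : R) : R[i] := Complex (cos t) (sin t).

Section Exponents.
Context (R : realType).
Variables (q : R) (lambda : nat -> R) (a : nat -> R[i]).
Local Open Scope ereal_scope.

Definition block_norm (k : nat) : \bar R :=
  sqrte (\sum_(0 <= n <oo | (q ^+ k <= lambda n < q ^+ k.+1)%R)
    (Normc.normc (a n) ^+ 2)%:E).

(* lne 0 = -oo. The value at k = 0, where the denominator vanishes, is
   irrelevant to the limits below. *)
Definition block_exponent (k : nat) : \bar R :=
  (- lne (block_norm k)) / (k%:R * ln q)%:E.

Definition lower_exponent : \bar R := limn_einf block_exponent.

Definition upper_exponent : \bar R := limn_esup block_exponent.

End Exponents.

Definition uniformly_bounded (R : realType) (phi : nat -> R -> R[i]) : Prop :=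
  exists M : R, forall n x, Normc.normc (phi n x) <= M.

Definition locally_uniformly_bilipschitz (R : realType)
    (phi : nat -> R -> R[i]) : Prop :=
  exists L delta : R, [/\ 1 <= L, 0 < delta &
    forall n x y, distR x y <= delta ->
      L^-1 * distR x y <= distC (phi n x) (phi n y) <= L * distR x y].

Definition mutually_independent (R : realType) (d : measure_display)
    (Omega : measurableType d) (P : probability Omega R)
    (X : nat -> {RV P >-> R}) : Prop :=
  forall (J : {fset nat}) (B : nat -> set R),
    (forall j, j \in J -> measurable (B j)) ->
    (P (\bigcap_(j in [set` J]) (X j @^-1` B j)) =
     \prod_(j <- J) P (X j @^-1` B j))%E.

Definition uniform01 (R : realType) (d : measure_display)
    (Omega : measurableType d) (P : probability Omega R)
    (X : {RV P >-> R}) : Prop :=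
  forall B : set R, measurable B ->
    distribution P X B = uniform_prob (@ltr01 R) B.

(* The factor expi (2 * pi * theta n w) is the Steinhaus variable X_n. *)
Definition random_series (R : realType) (Omega : Type) (a : nat -> R[i])
    (lambda : nat -> R) (phi : nat -> R -> R[i]) (theta : nat -> Omega -> R)
    (w : Omega) (x : R) : R[i] :=
  complex_series (fun n =>
    a n * expi (2 * pi * theta n w) * phi n (lambda n * x)).

(* Main.v *)
Require Import Defs.
From HB Require Import structures.
From mathcomp Require Import all_boot all_order all_algebra finmap.
From mathcomp Require Import all_classical all_reals all_analysis.
From mathcomp Require Import complex.
From mathcomp Require Import measurable_realfun.
From mathcomp Require Import ring lra zify.
Set Implicit Arguments.
Unset Strict Implicit.
Unset Printing Implicit Defensive.
Import Order.TTheory GRing.Theory Num.Theory.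
Import numFieldNormedType.Exports.
Local Open Scope classical_set_scope.
Local Open Scope ring_scope.

(* The increment S(x) - S(y), tested against a frequency vector xi, is a sum of
   independent terms A_n cos (2 pi theta_n) + B_n sin (2 pi theta_n) of amplitude
   |xi| |a_n| |phi_n (lambda_n x) - phi_n (lambda_n y)|.

   Lower bounds: if tau < t, the blocks with lambda_n ~ 1 / |x - y| show that the
   characteristic function of S(x) - S(y) is at most
   (1 + c |xi|^2 |x - y|^(2 t))^(-m), for any m.  A Borel set of dimension
   larger than s contains a compact set K carrying a Frostman measure mu of
   exponent s; the image of mu under S then has, in the mean, finite energies of
   the orders that give dimension at least b (t b < s), positive area (2 t < s),
   and a continuous density (4 t < s).  Everything is done at finite scale: mu
   is a finite sum of atoms spread at scale 2^-N, the energies are quadratic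
   forms in trigonometric kernels, and Fatou's lemma bounds them along
   infinitely many scales.

   Upper bound: for g < min (sigma, 1) the increments have exponential moments at
   scale |x - y|^g, so dyadic chaining makes S almost surely locally Hoelder of
   every exponent below g. *)

(** * Dyadic content and capacitability of Borel sets *)

(** The mean square Fourier coefficient of the image measure at frequency [k] is at most a constant
    times [|k|^(-b)] once [t b < s], and the thresholds are read off from this decay. A [b]-energy
    in the plane weighs it by [|k|^(b-2)], which asks for [t b < s]. A square integrable density
    needs an exponent above 2, hence the factor 1/2. A continuous density needs summable
    coefficients, and Cauchy-Schwarz gives these from an exponent above 4, hence 1/4. For the upper
    bound, the [phi n] are used as Lipschitz functions, so increments are never estimated better
    than by [|x - y|]: hence [min {sigma, 1}].

    The obstacle is limits of measures, and none is taken. With finitely many atoms at each scale,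
    expectations exchange only with finite sums of cosines, and the measures at different scales
    need not be related. What links the scales is a fixed path [w] and the compactness of the image:
    finite covers, dyadic hulls and separated points each test finitely many frequencies. Dyadic
    content is chosen for the reduction to compact sets because the tree of dyadic intervals makes
    it strongly subadditive. *)

Section DyadicContent.
Context (R : realType).
Implicit Types (x y : R) (n l : nat) (s : R) (E : set R).

Definition dyadic_index n x : int := Num.floor (2 ^+ n * x).

Lemma floor_double x y :
  Num.floor (2 * x) = Num.floor (2 * y) -> Num.floor x = Num.floor y.
Proof.
move=> h.
have hx := floor_itv (2 * x); have hy := floor_itv (2 * y).
have hx' := floor_itv x.
move: hx hy hx'; rewrite -h !intrD => /andP[a1 a2] /andP[b1 b2] /andP[c1 c2].
set f := Num.floor (2 * x) in h a1 a2 b1 b2 *.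
set m := Num.floor x in c1 c2 *.
have d1 : (m * 2 <= f)%R.
  by rewrite /f floor_ge_int intrM mulrC ler_pM2l.
have d2 : (f < (m + 1) * 2)%R.
  rewrite /f floor_lt_int intrM intrD mulrC ltr_pM2r//.
have e1 : (m%:~R * 2 <= f%:~R :> R) by rewrite -[2]/(2%:~R) -intrM ler_int.
have e2 : (f%:~R + 1 <= (m%:~R + 1) * 2 :> R).
  by rewrite -[X in X * 2]/(m%:~R + 1%:~R) -[_ + 1 :> R]/(_ + 1%:~R) -[2]/(2%:~R) -!intrD -intrM ler_int lezD1.
apply/esym/floor_def/andP; rewrite intrD; split; lra.
Qed.

Lemma dyadic_index_nest n l x y : (l <= n)%N ->
  dyadic_index n x = dyadic_index n y -> dyadic_index l x = dyadic_index l y.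
Proof.
move=> /subnK <-; elim: (n - l)%N => [//|d IH] h; apply: IH.
apply: floor_double; move: h.
by rewrite /dyadic_index addSn exprS -!mulrA.
Qed.

Let node := (nat * int)%type.

Definition in_node (I : node) x := dyadic_index I.1 x = I.2.

Definition covers (F : set node) E := forall x, E x -> exists2 I, F I & in_node I x.

Definition node_weight s (I : node) : \bar R := ((2^-1 `^ s) ^+ I.1)%:E.

Definition family_weight s (F : set node) : \bar R := \esum_(I in F) node_weight s I.

(** There is no mesh parameter: when [s > 0] a cover of small total weight consists of short
    intervals anyway, so vanishing content forces vanishing Hausdorff measure. *)
Definition dyadic_content s E : \bar R :=
  ereal_inf [set family_weight s F | F in [set F | covers F E]].

Lemma node_weight_ge0 s I : (0 <= node_weight s I)%E.
Proof. by rewrite lee_fin exprn_ge0// powR_ge0. Qed.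

Lemma family_weight_ge0 s F : (0 <= family_weight s F)%E.
Proof. by apply: esum_ge0 => *; exact: node_weight_ge0. Qed.

Lemma dyadic_content_ge0 s E : (0 <= dyadic_content s E)%E.
Proof. by apply: le_ereal_inf_tmp => _ [F _ <-]; exact: family_weight_ge0. Qed.

Lemma dyadic_content_le s E F : covers F E ->
  (dyadic_content s E <= family_weight s F)%E.
Proof. by move=> h; apply: ereal_inf_lbound; exists F. Qed.

Lemma le_dyadic_content s E E' : E `<=` E' ->
  (dyadic_content s E <= dyadic_content s E')%E.
Proof.
move=> h; apply: le_ereal_inf_tmp => _ [F cF <-]; apply: dyadic_content_le => x /h.
exact: cF.
Qed.

(** [J] is the coarser interval. Dyadic intervals with a common point are nested, so one common
    point stands for inclusion. *)
Definition strict_ancestor (I J : node) :=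
  (J.1 < I.1)%N /\ exists x, in_node I x /\ in_node J x.

Definition maximal_nodes (F : set node) : set node :=
  [set I | F I /\ forall J, F J -> ~ strict_ancestor I J].

(** What is left of [A] and [B], apart from repetitions, after the maximal nodes of the union have
    been taken out once. It plays the part of the intersection in strong subadditivity. *)
Definition merge_rest (A B : set node) : set node :=
  [set I | (A I /\ B I) \/ ((A I \/ B I) /\ ~ maximal_nodes (A `|` B) I)].

Lemma strict_ancestorP I J x : strict_ancestor I J -> in_node I x -> in_node J x.
Proof.
move=> [lt [y [Iy Jy]]] Ix; rewrite /in_node -Jy.
by apply: (dyadic_index_nest (ltnW lt)); rewrite [RHS]Iy.
Qed.

(** Levels are natural numbers, so the passage to strict ancestors stops. The comparison of levels
    is recorded because it makes the replacements in [dyadic_content_bigcup] terminate. *)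
Lemma maximal_nodes_cover (F : set node) I x : F I -> in_node I x ->
  exists J, [/\ maximal_nodes F J, in_node J x & (J.1 <= I.1)%N].
Proof.
have [n] := ubnP I.1; elim: n I => // n IH I In FI Ix.
have [mI|nmI] := pselect (maximal_nodes F I); first by exists I.
have [J FJ IJ] : exists2 J, F J & strict_ancestor I J.
  apply: contrapT => h; apply: nmI; split => // J FJ IJ; apply: h.
  by exists J.
have [||K [mK Kx KJ]] := IH J _ FJ; first by rewrite (leq_trans IJ.1).
  exact: strict_ancestorP IJ Ix.
by exists K; split => //; rewrite (leq_trans KJ)// ltnW// IJ.1.
Qed.

(** Of two nodes through one point the finer is not maximal in the union; at equal levels they
    coincide and so belong to both families. *)
Lemma merge_rest_cover (A B : set node) E E' :
  covers A E -> covers B E' -> covers (merge_rest A B) (E `&` E').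
Proof.
move=> cA cB x [/cA[I AI Ix] /cB[J BJ Jx]].
have [lt|lt|e] := ltngtP I.1 J.1.
- exists J => //; right; split; first by right.
  by move=> [_ /(_ I (or_introl AI))]; apply; split => //; exists x.
- exists I => //; right; split; first by left.
  by move=> [_ /(_ J (or_intror BJ))]; apply; split => //; exists x.
- have eIJ : I = J.
    rewrite [I]surjective_pairing [J]surjective_pairing e -Ix -Jx.
    by rewrite e.
  by exists I => //; left; rewrite {2}eIJ.
Qed.

(** A node by node count. A node of exactly one family is either maximal or in the rest, not both; a
    node of both families is counted at most twice. *)
Lemma merge_weight s (A B : set node) :
  (family_weight s (maximal_nodes (A `|` B)) + family_weight s (merge_rest A B)
   <= family_weight s A + family_weight s B)%E.
Proof.
rewrite /family_weight !(esum_mkcond _ (node_weight s)).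
have p (F : set node) i : (0 <= if i \in F then node_weight s i else 0)%E.
  by case: ifP => // _; exact: node_weight_ge0.
rewrite -!esumD//; try by move=> *; exact: p.
apply: le_esum => I _; have w0 := node_weight_ge0 s I.
have [AI|nAI] := pselect (A I); have [BI|nBI] := pselect (B I).
- rewrite (mem_set AI) (mem_set BI); apply: leeD; case: ifP => //.
- rewrite (mem_set AI) (memNset nBI) adde0.
  have [mI|nmI] := pselect (maximal_nodes (A `|` B) I).
    by rewrite (mem_set mI) memNset ?adde0// => -[[]|[]].
  by rewrite (memNset nmI) add0e; case: ifP.
- rewrite (memNset nAI) (mem_set BI) add0e.
  have [mI|nmI] := pselect (maximal_nodes (A `|` B) I).
    by rewrite (mem_set mI) memNset ?adde0// => -[[]|[]].
  by rewrite (memNset nmI) add0e; case: ifP.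
- by rewrite !memNset//; [move=> [[]|[[]]]|move=> [[]]].
Qed.

(* Strong subadditivity makes the errors of the covers of the [E n] add up
   instead of the covers themselves. *)
Lemma dyadic_content_bigcup s (E : nat -> set R) (c : R) :
  nondecreasing_seq E -> (forall n, dyadic_content s (E n) <= c%:E)%E ->
  (dyadic_content s (\bigcup_n E n) <= c%:E)%E.
Proof.
move=> incE hE.
have finE n : dyadic_content s (E n) \is a fin_num.
  rewrite ge0_fin_numE; last exact: dyadic_content_ge0.
  by rewrite (le_lt_trans (hE n))// ltry.
apply/lee_addgt0Pr => e e0.
pose d n : R := e / 2 * (2 ^- n).
have d0 n : 0 < d n by rewrite mulr_gt0// ?divr_gt0// invr_gt0 exprn_gt0.
have /choice[A hA] : forall n, exists F, covers F (E n) /\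
    (family_weight s F <= dyadic_content s (E n) + (d n)%:E)%E.
  move=> n.
  have /ereal_inf_lt[_ [F cF <-] lt] : (dyadic_content s (E n) < dyadic_content s (E n) + (d n)%:E)%E.
    by rewrite lteDl// lte_fin.
  by exists F; split => //; exact: ltW.
pose U := fix U n := if n is m.+1 then maximal_nodes (U m `|` A m.+1) else A 0%N.
have cU n : covers (U n) (E n).
  case: n => [|n]; first exact: (hA 0%N).1.
  move=> x /(hA n.+1).1[I AI Ix].
  have [J [mJ Jx _]] := @maximal_nodes_cover (U n `|` A n.+1) I x (or_intror AI) Ix.
  by exists J.
(* The error is a partial geometric sum of the [d n]. The rest of each merge covers [E n], so its
   weight pays for [dyadic_content s (E n)] and a new stage adds only its own [d]. *)
have wU n : (family_weight s (U n) <=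
    dyadic_content s (E n) + (e / 2 * (2 - 2 ^- n))%:E)%E.
  elim: n => [|n IH].
    apply: le_trans (hA 0%N).2 _; rewrite leeD2l// lee_fin /d ler_pM2l ?divr_gt0//.
    by rewrite expr0; lra.
  have h := merge_weight s (U n) (A n.+1).
  have cV : (dyadic_content s (E n) <= family_weight s (merge_rest (U n) (A n.+1)))%E.
    apply: dyadic_content_le => x Ex.
    apply: (merge_rest_cover (cU n) (hA n.+1).1); split => //.
    by have /subsetPset := incE _ _ (leqnSn n); apply.
  have := le_trans (leeD2l _ cV) (le_trans h (leeD IH (hA n.+1).2)).
  rewrite -/(U n.+1).
  move: (finE n) (finE n.+1).
  case: (dyadic_content s (E n)) => // a _; case: (dyadic_content s (E n.+1)) => // b _.
  have := family_weight_ge0 s (U n.+1).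
  case: (family_weight s (U n.+1)) => // w _.
  rewrite -!EFinD !lee_fin /d exprS invfM => h1.
  lra.
(* The nodes that survive from some stage on. A dropped node gives way to a strictly coarser one
   through the same point, so each point keeps a survivor in the end; a finite part of [V] lies in a
   single [U N]. *)
pose V : set node := [set I | exists N, forall n, (N <= n)%N -> U n I].
have covV : covers V (\bigcup_n E n).
  move=> x [n0 _ Ex].
  suff key : forall l n I, (I.1 <= l)%N -> U n I -> in_node I x -> exists2 J, V J & in_node J x.
    by have [I UI Ix] := cU _ _ Ex; apply: (key I.1 n0 I).
  elim/ltn_ind => l IH n I Il UI Ix.
  have [h|] := pselect (forall m, (n <= m)%N -> U m I -> U m.+1 I).
    exists I => //; exists n => m /subnK <-; elim: (m - n)%N => [//|k IHk].
    by rewrite addSn; apply: h => //; rewrite leq_addl.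
  move=> /existsNP[m] /not_implyP[nm] /not_implyP[Um nUm].
  have [J [mJ Jx JI]] := @maximal_nodes_cover (U m `|` A m.+1) I x (or_introl Um) Ix.
  move: JI; rewrite leq_eqVlt => /orP[/eqP e1|lt].
    exfalso; apply: nUm.
    rewrite [I]surjective_pairing -[I.2]Ix -e1 [dyadic_index _ _]Jx -surjective_pairing.
    exact: mJ.
  exact: (IH J.1 (leq_trans lt Il) m.+1 J).
apply: le_trans (dyadic_content_le s covV) _.
apply: ge_ereal_sup => _ [F [finF FV] <-].
have [N hN] : exists N, F `<=` U N.
  have : exists N, forall I, I \in fset_set F -> forall n, (N <= n)%N -> U n I.
    have : forall I, I \in fset_set F -> V I.
      by move=> I; rewrite in_fset_set// inE => /FV.
    elim/finSet_rect: (fset_set F) => S IH hS.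
    have [->|[I IS]] := fset_0Vmem S; first by exists 0%N.
    have [||N hN] := IH (S `\ I)%fset; first by rewrite fproperD1.
      by move=> J /fsetD1P[_ /hS].
    have [N' hN'] := hS _ IS.
    exists (maxn N N') => J JS n; rewrite geq_max => /andP[n1 n2].
    have [->|JI] := eqVneq J I; first exact: hN'.
    by apply: hN => //; apply/fsetD1P.
  move=> [N hN]; exists N => I FI; apply: (hN I) => //.
  by rewrite in_fset_set// inE.
rewrite -(esum_fset finF); last by move=> *; exact: node_weight_ge0.
apply: (@le_trans _ _ (family_weight s (U N))).
  rewrite /family_weight !(esum_mkcond _ (node_weight s)).
  apply: le_esum => I _; case: ifPn => [|_]; last by case: ifP => // _; exact: node_weight_ge0.
  by rewrite inE => /hN UI; rewrite mem_set.
apply: le_trans (wU N) _; apply: leeD => //.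
rewrite lee_fin; have : 0 < (2:R) ^- N by rewrite invr_gt0 exprn_gt0.
have := e0; nra.
Qed.

End DyadicContent.

(** * Analytic sets and Choquet's capacitability argument *)

Section Analytic.
Context (R : realType).
Implicit Types (x y : R) (A : set R).

(** Closedness in the product of Baire space and the line, tested on basic neighbourhoods: agreement
    of the first [n] terms and distance below [1 / (n + 1)]. *)
Definition closed_scheme (C : (nat -> nat) -> set R) :=
  forall f x, (forall n, exists g y, [/\ forall i, (i < n)%N -> g i = f i,
    `|y - x| < n.+1%:R^-1 & C g y]) -> C f x.

(* Borel subsets of R are projections of closed subsets of (nat -> nat) * R. *)
Definition analytic A :=
  exists2 C, closed_scheme C & forall x, A x <-> exists f, C f x.

Lemma analytic_closed A : closed A -> analytic A.
Proof.
move=> cA; exists (fun _ => A); last first.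
  by move=> x; split=> [Ax|[]//]; exists (fun=> 0%N).
move=> f x h; apply: cA => B /nbhs_ballP[e /= e0 eB].
have [n ne] : exists n : nat, n.+1%:R^-1 < e.
  have := near_infty_natSinv_lt (PosNum e0) => -[n _ /(_ n (leqnn n))].
  by exists n.
have [g [y [_ yx Ay]]] := h n.
by exists y; split => //; apply: eB; rewrite /ball/= distrC (lt_trans yx).
Qed.

(** The first term of the code names the set and the shifted code is the witness for it. *)
Lemma analytic_bigcup (A : nat -> set R) :
  (forall n, analytic (A n)) -> analytic (\bigcup_n A n).
Proof.
move=> /(_ _)/cid2-/all_sig2[C cC hC].
exists (fun f => C (f 0%N) (f \o succn)).
  move=> f x h; apply: cC => n; have [g [y [gf yx Cgy]]] := h n.+1.
  exists (g \o succn), y; split.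
  - by move=> i il /=; apply: gf.
  - by rewrite (lt_trans yx)// ltf_pV2 ?posrE// ltr_nat.
  - by rewrite -(gf 0%N).
move=> x; split.
  move=> [n _ /hC[f Cf]].
  by exists (fun i => if i is j.+1 then f j else n).
by move=> [f Cf]; exists (f 0%N) => //; apply/hC; exists (f \o succn).
Qed.

(** One code carries a witness for every set, interleaved by the pairing of naturals. *)
Lemma analytic_bigcap (A : nat -> set R) :
  (forall n, analytic (A n)) -> analytic (\bigcap_n A n).
Proof.
move=> /(_ _)/cid2-/all_sig2[C cC hC].
exists (fun (f : nat -> nat) (x : R) => forall i : nat, C i (fun n : nat => f (choice.pickle (i, n))) x).
  move=> f x h i; apply: cC => n.
  (* [N] exceeds the position of every pair [(i, m)] with [m < n], so agreement below [N] gives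
     agreement of strand [i] below [n]. *)
  pose N := (n + \max_(m < n) (choice.pickle (i, val m)).+1)%N.
  have [g [y [gf yx Cgy]]] := h N.
  exists (fun m => g (choice.pickle (i, m))), y; split => //.
  - move=> m mn; apply: gf; rewrite /N; apply: leq_trans (leq_addl _ _).
    exact: (@leq_bigmax _ (fun m : 'I_n => (choice.pickle (i, val m)).+1) (Ordinal mn)).
  - rewrite (lt_le_trans yx)// lef_pV2 ?posrE//.
    by rewrite ler_nat ltnS leq_addr.
move=> x; split.
  move=> h; have /choice[F hF] : forall i, exists f, C i f x.
    by move=> i; apply/hC; exact: h.
  exists (fun k => if choice.unpickle k is Some p then F p.1 p.2 else 0%N) => i.
  have -> // : (fun n : nat => match choice.unpickle (choice.pickle (i, n)) with
    | Some p => F p.1 p.2 | None => 0%N end) = F i.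
  by apply/funext => n; rewrite choice.pickleK.
by move=> [f hf] i _; apply/hC; eexists; exact: hf.
Qed.

Lemma analytic_setU A B : analytic A -> analytic B -> analytic (A `|` B).
Proof.
move=> aA aB; rewrite -bigcup2E; apply: analytic_bigcup => -[//|[//|n]] /=.
exact: (analytic_closed closed0).
Qed.

(** Analytic sets are not closed under complement, so the induction runs over the sets that are
    analytic together with their complement; these form a sigma-algebra that contains the half-open
    intervals. *)
Lemma borel_analytic A : measurable A -> analytic A.
Proof.
move=> mA.
suff : (analytic A /\ analytic (~` A)) by case.
have setCa (B : set R) : analytic B /\ analytic (~` B) ->
    analytic (~` B) /\ analytic (~` ~` B).
  by rewrite setCK => -[].
move: mA; rewrite /measurable /= => mA.
apply: (mA [set B | analytic B /\ analytic (~` B)]); split; last first.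
  move=> _ [[a b] _ <-] /=; split.
    have -> : `]a, b]%classic = \bigcup_n `[a + n.+1%:R^-1, b]%classic.
      apply/seteqP; split => x /=; rewrite ?in_itv/=.
        move=> /andP[ax xb].
        have xa0 : 0 < x - a by rewrite subr_gt0.
        have := near_infty_natSinv_lt (PosNum xa0) => -[n _ /(_ n (leqnn n))]/= h.
        by exists n => //=; rewrite in_itv/= xb andbT -lerBrDl ltW.
      move=> [n _] /=; rewrite in_itv/= => /andP[h ->]; rewrite andbT.
      by rewrite (lt_le_trans _ h)// ltrDl invr_gt0.
    apply: analytic_bigcup => n; apply: analytic_closed; exact: itv_closed.
  have -> : ~` `]a, b]%classic = `]-oo, a]%classic `|` \bigcup_n `[b + n.+1%:R^-1, +oo[%classic.
    apply/seteqP; split => x /=; rewrite !in_itv/= ?andbT.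
      move=> /negP; rewrite negb_and -leNgt -ltNge => /orP[xa|bx]; first by left.
      right; have xa0 : 0 < x - b by rewrite subr_gt0.
      have := near_infty_natSinv_lt (PosNum xa0) => -[n _ /(_ n (leqnn n))]/= h.
      by exists n => //=; rewrite in_itv/= andbT -lerBrDl ltW.
    move=> [xa|[n _]] /=; first by rewrite ltNge xa.
    rewrite in_itv/= andbT => h; apply/negP; rewrite negb_and -leNgt -ltNge.
    by rewrite (lt_le_trans _ h) ?orbT// ltrDl invr_gt0.
  apply: analytic_setU; first by apply: analytic_closed; exact: lray_closed.
  by apply: analytic_bigcup => n; apply: analytic_closed; exact: rray_closed.
split => [|B|B hB] /=.
- rewrite setC0; split; apply: analytic_closed; [exact: closed0|exact: closedT].
- by rewrite setTD; exact: setCa.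
- split; first by apply: analytic_bigcup => n; have [] := hB n.
  by rewrite setC_bigcup; apply: analytic_bigcap => n; have [] := hB n.
Qed.

Lemma ultra_bounded_cst (G : set_system nat) (UG : UltraFilter G) (f : nat -> nat) m :
  G [set k | (f k <= m)%N] -> exists v, (v <= m)%N /\ G [set k | f k = v].
Proof.
elim: m => [|m IH] Gm.
  exists 0%N; split => //; apply: filterS Gm => k /=.
  by rewrite leqn0 => /eqP.
have [/IH[v [vm Gv]]|h] := in_ultra_setVsetC [set k | (f k <= m)%N] UG.
  by exists v; split => //; rewrite (leq_trans vm).
exists m.+1; split => //; apply: filterS (filterI Gm h) => k /= [h1 /negP].
by rewrite -ltnNge => h2; apply/eqP; rewrite eqn_leq h1.
Qed.

(** Compactness of the codes below [nu] times [[a, b]], read along one ultrafilter instead of a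
    diagonal subsequence. The bound [nu] is asked of [f k] only below [k], which is all that the
    successive choices in [analytic_capacitable] provide. *)
Lemma scheme_cluster (C : (nat -> nat) -> set R) (nu : nat -> nat) (a b : R)
    (f : nat -> nat -> nat) (u : nat -> R) : closed_scheme C ->
  (forall k, u k \in `[a, b]) -> (forall k i, (i < k)%N -> (f k i <= nu i)%N) ->
  (forall k, C (f k) (u k)) ->
  exists g x, [/\ x \in `[a, b], forall i, (g i <= nu i)%N, C g x &
    forall e : R, 0 < e -> exists k, `|u k - x| < e /\ e^-1 < k%:R].
Proof.
move=> cC uab fnu Cfu.
have [G [UG FG]] := ultraFilterLemma eventually_filter.
have PG : ProperFilter G by case: UG.
have ev n : G [set k | (n <= k)%N] by apply: FG; exists n.
have /choice[g hg] : forall i, exists v, (v <= nu i)%N /\ G [set k | f k i = v].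
  move=> i; apply: ultra_bounded_cst; apply: filterS (ev i.+1) => k /=.
  exact: fnu.
have Gpre n : G [set k | forall i, (i < n)%N -> f k i = g i].
  elim: n => [|n IH]; first by apply: filterS (ev 0%N).
  apply: filterS (filterI IH (hg n).2) => k /= [h1 h2] i.
  by rewrite ltnS leq_eqVlt => /orP[/eqP ->|/h1].
have [x [xab clx]] : `[a, b]%classic `&` cluster (u @ G) !=set0.
  apply: segment_compact; suff : G (u @^-1` `[a, b]%classic) by [].
  by apply: filterS (ev 0%N) => k _; exact: uab k.
have key W (e : R) : G W -> 0 < e -> exists2 k, W k & `|u k - x| < e.
  move=> GW e0.
  have [] := clx (u @` W) (ball x e).
  - suff : G (u @^-1` (u @` W)) by [].
    by apply: filterS GW => k Wk /=; exists k.
  - exact: nbhsx_ballx.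
  by move=> _ [[k Wk <-]]; rewrite /ball/= distrC => h; exists k.
exists g, x; split => //.
- by move=> i; have [] := hg i.
- apply: cC => n.
  have [|k hk kx] := key _ n.+1%:R^-1 (Gpre n); first by rewrite invr_gt0.
  by exists (f k), (u k); split.
- move=> e e0.
  have [k hk kx] := key _ e (ev (Num.bound e^-1)) e0.
  exists k; split => //.
  have : e^-1 < (Num.bound e^-1)%:R by rewrite archi_boundP// invr_ge0 ltW.
  by move=> /lt_le_trans; apply; rewrite ler_nat.
Qed.

(** Choquet's argument: bounds on the terms of the code are fixed one after the other while the
    content stays above [c], and the codes below all of these bounds yield a compact set. Only open
    neighbourhoods of [K] are controlled here, since a cover of [K] by half-open cells need not
    cover a neighbourhood of [K]. *)
Lemma analytic_capacitable s A (a b c : R) : analytic A ->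
  (c%:E < dyadic_content s (A `&` `[a, b]))%E ->
  exists K, [/\ compact K, K `<=` A `&` `[a, b] &
    forall U, open U -> K `<=` U -> (c%:E < dyadic_content s U)%E].
Proof.
move=> [C cC hC] cA.
(* Points with a code whose first [size l] terms obey the bounds [l]. As the next bound grows these
   sets increase to [B l], so [dyadic_content_bigcup] finds a finite bound that keeps the content
   above [c]. *)
pose B (l : seq nat) : set R := [set x | x \in `[a, b] /\ exists f,
  (forall i, (i < size l)%N -> (f i <= nth 0%N l i)%N) /\ C f x].
have stepB l : (c%:E < dyadic_content s (B l))%E ->
    exists m, (c%:E < dyadic_content s (B (rcons l m)))%E.
  move=> cB; apply: contrapT => /forallNP h.
  have : (dyadic_content s (\bigcup_m B (rcons l m)) <= c%:E)%E.
    apply: dyadic_content_bigcup => [m n mn|m]; last first.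
      by rewrite leNgt; apply/negP/h.
    apply/subsetPset => x [xab [f [fl Cf]]]; split => //; exists f; split => // i.
    move=> il; apply: leq_trans (fl i _) _; first by rewrite !size_rcons in il *.
    by rewrite !nth_rcons; case: ifP => // _; case: ifP.
  apply/negP; rewrite -ltNge (lt_le_trans cB)//; apply: le_dyadic_content.
  move=> x [xab [f [fl Cf]]]; exists (f (size l)) => //; split => //.
  exists f; split => // i; rewrite size_rcons ltnS leq_eqVlt nth_rcons.
  by move=> /orP[/eqP ->|il]; [rewrite ltnn eqxx|rewrite il; exact: fl].
have /choice[nxt hnxt] : forall l, exists m, (c%:E < dyadic_content s (B l))%E ->
    (c%:E < dyadic_content s (B (rcons l m)))%E.
  move=> l; have [/stepB[m hm]|h] := pselect (c%:E < dyadic_content s (B l))%E.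
    by exists m.
  by exists 0%N.
pose L := fix L n := if n is m.+1 then rcons (L m) (nxt (L m)) else [::].
have sL n : size (L n) = n by elim: n => //= n IH; rewrite size_rcons IH.
have cL n : (c%:E < dyadic_content s (B (L n)))%E.
  elim: n => [|n IH]; last exact: hnxt.
  apply: lt_le_trans cA _; apply: le_dyadic_content => x [Ax xab]; split => //.
  by have /hC[f Cf] := Ax; exists f.
pose nu i := nxt (L i).
have nL n i : (i < n)%N -> nth 0%N (L n) i = nu i.
  elim: n => // n IH; rewrite ltnS leq_eqVlt /= nth_rcons sL.
  by move=> /orP[/eqP ->|il]; [rewrite ltnn eqxx|rewrite il; exact: IH].
pose K : set R := [set x | x \in `[a, b] /\ exists f, (forall i, (f i <= nu i)%N) /\ C f x].
exists K; split.
- apply: (@subclosed_compact _ K `[a, b]%classic); last by move=> x [].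
    move=> x clx.
    have /choice[u hu] : forall k, exists y, K y /\ `|y - x| < k.+1%:R^-1.
      move=> k; have [|y [Ky]] := clx (ball x k.+1%:R^-1).
        by apply: nbhsx_ballx; rewrite invr_gt0.
      by rewrite /ball/= distrC => yx; exists y.
    have /choice[f hf] : forall k, exists f, (forall i, (f i <= nu i)%N) /\ C f (u k).
      by move=> k; have [[]] := hu k.
    have [g [y [yab gnu Cgy yx]]] := @scheme_cluster C nu a b f u cC
      (fun k => (hu k).1.1) (fun k i _ => (hf k).1 i) (fun k => (hf k).2).
    suff <- : y = x by split => //; exists g.
    apply/eqP; rewrite -subr_eq0 -normr_le0; apply/ler_addgt0Pr => e e0.
    rewrite add0r.
    have [k [k1 k2]] := yx (e / 2) (divr_gt0 e0 (ltr0Sn _ 1)).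
    have k3 : `|u k - x| < e / 2.
      apply: lt_trans (hu k).2 _; rewrite -[e / 2]invrK ltf_pV2 ?posrE//.
        by rewrite (lt_trans k2)// ltr_nat.
      by rewrite invr_gt0 divr_gt0.
    have -> : y - x = (u k - x) - (u k - y) by lra.
    by rewrite (le_trans (ler_normB _ _))//; lra.
  exact: segment_compact.
- by move=> x [xab [f [_ Cf]]]; split => //; apply/hC; exists f.
(* If [U] had content at most [c], every [B (L k)] would have a point outside [U]; a cluster point
   of these lies in [K], hence in the open set [U], which is absurd. *)
- move=> U oU KU; apply: contrapT => /negP; rewrite -leNgt => cU.
  have /choice[u hu] : forall k, exists x, B (L k) x /\ ~ U x.
    move=> k; apply: contrapT => /forallNP h.
    have : (c%:E < dyadic_content s U)%E.
      apply: (lt_le_trans (cL k)); apply: le_dyadic_content => x Bx.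
      by apply: contrapT => nU; exact: (h x).
    by rewrite ltNge cU.
  have /choice[f hf] : forall k, exists f,
      (forall i, (i < k)%N -> (f i <= nu i)%N) /\ C f (u k).
    move=> k; have [[_ [f [h1 h2]]] _] := hu k; exists f; split => // i ik.
    by rewrite -(nL k)// h1// sL.
  have [g [x [xab gnu Cgx ux]]] := @scheme_cluster C nu a b f u cC
    (fun k => (hu k).1.1) (fun k => (hf k).1) (fun k => (hf k).2).
  have /(open_nbhs_nbhs)/nbhs_ballP[e /= e0 eU] : open_nbhs x U.
    by split => //; apply: KU; split => //; exists g.
  have [k [k1 _]] := ux e e0.
  by apply: (hu k).2; apply: eU; rewrite /ball/= distrC.
Qed.

Lemma family_weightU s (F G : set (nat * int)) :
  (@family_weight R s (F `|` G) <= family_weight s F + family_weight s G)%E.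
Proof.
rewrite /family_weight !(esum_mkcond _ (node_weight s)).
have p (H : set (nat * int)) i : (0 <= if i \in H then @node_weight R s i else 0)%E.
  by case: ifP => // _; exact: node_weight_ge0.
rewrite -esumD//; try by move=> *; exact: p.
apply: le_esum => I _; have w0 := node_weight_ge0 s I.
have [FI|nFI] := pselect (F I); have [GI|nGI] := pselect (G I).
- by rewrite (mem_set FI) (mem_set GI) mem_set; [rewrite leeDl|left].
- by rewrite (mem_set FI) (memNset nGI) mem_set; [rewrite adde0|left].
- by rewrite (memNset nFI) (mem_set GI) mem_set; [rewrite add0e|right].
- by rewrite !memNset ?adde0// => -[].
Qed.

Lemma family_weight_shift s (F : set (nat * int)) (j : int) :
  @family_weight R s ((fun I => (I.1, I.2 + j)) @` F) = family_weight s F.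
Proof.
rewrite /family_weight (reindex_esum F _ (fun I => (I.1, I.2 + j)))//.
  split => //.
  by move=> [n k] [n' k'] _ _ /= [-> h]; congr pair; exact: addIr h.
Qed.

(** Adding to each half-open cell its two neighbours of the same level yields a cover of a
    neighbourhood; this triples the weight at most. *)
Lemma dyadic_content_open_nbhs s (K : set R) (c : R) : 0 < c ->
  (forall U, open U -> K `<=` U -> (c%:E < dyadic_content s U)%E) ->
  ((c / 3)%:E <= dyadic_content s K)%E.
Proof.
move=> c0 hU; apply: le_ereal_inf_tmp => _ [F cF <-].
(* Open intervals with the centres of the cells and twice their length. *)
pose U : set R := \bigcup_(I in F) [set x | `|2 ^+ I.1 * x - (I.2%:~R + 2^-1)| < 1].
have oU : open U.
  apply: bigcup_open => I _.
  have -> : [set x : R | `|2 ^+ I.1 * x - (I.2%:~R + 2^-1)| < 1] =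
     (fun x => `|2 ^+ I.1 * x - (I.2%:~R + 2^-1)|) @^-1` [set y | y < 1] by [].
  apply: open_comp; last exact: open_lt.
  move=> x _; apply: cvg_norm.
  by apply: cvgB; [apply: cvgM; [exact: cvg_cst|exact: cvg_id]|exact: cvg_cst].
pose F3 := F `|` (((fun I => (I.1, I.2 + 1)) @` F) `|` ((fun I => (I.1, I.2 + (- 1))) @` F)).
have KU : K `<=` U.
  move=> x /cF[I FI Ix]; exists I => //=.
  have := floor_itv (2 ^+ I.1 * x); rewrite -[Num.floor _]/(dyadic_index _ _) Ix intrD.
  by move=> /andP[h1 h2]; rewrite ltr_norml; apply/andP; split; lra.
have cU : covers F3 U.
  move=> x [I FI]; rewrite /= ltr_norml => /andP[h1 h2].
  have [h|h] := ltP (2 ^+ I.1 * x) (I.2%:~R).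
    exists (I.1, I.2 + -1); first by right; right; exists I.
    by apply: floor_def; rewrite /= addrNK intrD; apply/andP; split; lra.
  have [h'|h'] := ltP (2 ^+ I.1 * x) (I.2%:~R + 1).
    exists I; first by left.
    by apply: floor_def; rewrite intrD h h'.
  exists (I.1, I.2 + 1); first by right; left; exists I.
  by apply: floor_def; rewrite /= !intrD h'/=; lra.
have := lt_le_trans (hU _ oU KU) (dyadic_content_le s cU).
move=> /lt_le_trans /(_ (family_weightU _ _ _)).
move=> /lt_le_trans /(_ (leeD2l _ (family_weightU _ _ _))).
rewrite !family_weight_shift.
case: (family_weight s F) => //[r|]; last by rewrite leey.
by rewrite -!EFinD lte_fin lee_fin; lra.
Qed.

Lemma analytic_compact_content s A (a b : R) : analytic A ->
  (0 < dyadic_content s (A `&` `[a, b]))%E ->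
  exists K, [/\ compact K, K `<=` A `&` `[a, b] & (0 < dyadic_content s K)%E].
Proof.
move=> aA h.
have [c c0 hc] : exists2 c : R, 0 < c & (c%:E < dyadic_content s (A `&` `[a, b]))%E.
  move: h; case: (dyadic_content _ _) => [r|_|//]; last by exists 1; rewrite ?ltry.
  by rewrite lte_fin => r0; exists (r / 2); rewrite ?lte_fin; lra.
have [K [K1 K2 K3]] := analytic_capacitable aA hc.
exists K; split => //; apply: lt_le_trans (dyadic_content_open_nbhs c0 K3).
by rewrite lte_fin divr_gt0.
Qed.

End Analytic.

(** * Discrete Frostman measures *)

Section Frostman.
Context (R : realType).
Implicit Types (x y : R) (K : set R) (mu : seq (R * R)).

Lemma sum_geometric_le (x : R) n : 0 <= x -> x < 1 ->
  \sum_(l < n) x ^+ l <= (1 - x)^-1.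
Proof.
move=> x0 x1; rewrite -[leRHS]mul1r ler_pdivlMr ?subr_gt0//.
rewrite -opprB mulrN mulrC -subrX1 opprB lerBlDr lerDl exprn_ge0//.
Qed.

Lemma powR_half_expn (s : R) n : (2^-1 `^ s) ^+ n = (2^-1 ^+ n) `^ s.
Proof. by rewrite -powR_mulrn ?powR_ge0// -powRrM mulrC powRrM powR_mulrn. Qed.

Lemma powR_half (s : R) : 2^-1 `^ s = (2 `^ s)^-1.
Proof. by rewrite -powR_inv1// -powRrM mulN1r powRN. Qed.

Lemma powR2_lt1 (s : R) : s < 0 -> 2 `^ s < 1.
Proof.
move=> s0; rewrite /powR pnatr_eq0 /= expR_lt1 nmulr_rlt0// ln_gt0//.
by rewrite ltr1n.
Qed.

Lemma dyadic_index_dist n x y : dyadic_index n x = dyadic_index n y ->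
  `|x - y| < 2^-1 ^+ n.
Proof.
rewrite /dyadic_index => h.
have := floor_itv (2 ^+ n * x); have := floor_itv (2 ^+ n * y).
rewrite h !intrD => /andP[a1 a2] /andP[b1 b2].
have p0 : 0 < (2 : R) ^+ n by rewrite exprn_gt0.
rewrite -(ltr_pM2l p0) exprVn mulfV ?gt_eqF//.
rewrite -{1}[2 ^+ n]gtr0_norm// -normrM mulrBr ltr_norml; apply/andP; split; lra.
Qed.

Lemma dist_dyadic_index n x y : `|x - y| <= 2^-1 ^+ n ->
  [|| dyadic_index n y == dyadic_index n x, dyadic_index n y == dyadic_index n x + 1 |
      dyadic_index n y == dyadic_index n x - 1].
Proof.
move=> h.
have p0 : 0 < (2 : R) ^+ n by rewrite exprn_gt0.
have : `|2 ^+ n * x - 2 ^+ n * y| <= 1.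
  by rewrite -mulrBr normrM gtr0_norm// -ler_pdivlMl// mulr1 -exprVn.
rewrite ler_norml => /andP[h1 h2].
have := floor_itv (2 ^+ n * x); have := floor_itv (2 ^+ n * y).
rewrite -/(dyadic_index n x) -/(dyadic_index n y).
move: (dyadic_index n x) (dyadic_index n y) => i j.
rewrite !intrD => /andP[a1 a2] /andP[b1 b2].
have c1 : (i < j + 1 + 1)%R.
  by rewrite -(ltr_int R) !intrD; lra.
have c2 : (j < i + 1 + 1)%R.
  by rewrite -(ltr_int R) !intrD; lra.
move: c1 c2; clear; lia.
Qed.

Lemma dyadic_content_pos (s : R) (A : set R) : 0 < s ->
  hausdorff_measure (@distR R) s A != 0%E -> (0 < dyadic_content s A)%E.
Proof.
move=> s0; apply: contraNT; rewrite -leNgt => cA0.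
have cA : dyadic_content s A = 0%E.
  by apply/eqP; rewrite eq_le cA0 dyadic_content_ge0.
have dpow_ge0 (U : set R) : (0 <= diameter_pow (@distR R) s U)%E.
  by rewrite /diameter_pow; case: ifP => // _; exact: poweR_ge0.
apply/eqP/le_anti/andP; split; last first.
  apply: ereal_sup_ge; exists (hausdorff_content (@distR R) s 1 A) => //.
    by exists 1 => //=.
  by apply: le_ereal_inf_tmp => _ [U _ <-]; apply: nneseries_ge0.
apply: ge_ereal_sup => _ [d /= d0 <-].
apply/lee_addgt0Pr => e e0; rewrite add0e.
(* A total weight below [d] to the power [s] forces every single node to be shorter than [d], so a
   cheap cover is automatically a fine one. *)
pose eps := Num.min e (d `^ s).
have eps0 : 0 < eps by rewrite lt_min e0 powR_gt0.
have /ereal_inf_lt[_ [F cF <-] wF] : (dyadic_content s A < eps%:E)%E.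
  by rewrite cA lte_fin.
pose cell (I : nat * int) : set R := [set x | in_node I x].
pose U (i : nat) : set R := 
  match (choice.pickle_inv i : option (nat * int)) with
  | Some J => if J \in F then cell J else set0 | None => set0 end.
have diam I : (diameter (@distR R) (cell I) <= (2^-1 ^+ I.1)%:E)%E.
  apply: ge_ereal_sup => _ [x [y [/= Ix Iy ->]]].
  rewrite lee_fin /distR ltW//; apply: dyadic_index_dist.
  by rewrite [LHS]Ix [RHS]Iy.
have dw I : (diameter_pow (@distR R) s (cell I) <= @node_weight R s I)%E.
  rewrite /diameter_pow; case: ifPn => [_|]; first exact: node_weight_ge0.
  move=> /set0P[x Ix]; rewrite /node_weight powR_half_expn -poweR_EFin.
  have d0' : (0 <= diameter (@distR R) (cell I))%E.
    apply: ereal_sup_ge; exists (distR x x)%:E => //.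
      by exists x, x.
    by rewrite lee_fin normr_ge0.
  have := diam I; apply: gt0_ler_poweR; first exact: ltW.
  - by rewrite in_itv/= leey andbT.
  - by rewrite in_itv/= leey andbT lee_fin exprn_ge0.
have wI I : F I -> 2^-1 ^+ I.1 <= d.
  move=> FI; rewrite leNgt; apply/negP => dI.
  have : (@node_weight R s I < eps%:E)%E.
    apply: le_lt_trans wF; apply: esum_ge; exists [set I]; last by rewrite fsbig_set1.
    by split; [exact: finite_set1|move=> _ ->].
  rewrite /node_weight powR_half_expn lte_fin lt_min => /andP[_].
  by apply/negP; rewrite -leNgt ltW// gt0_ltr_powR// ?nnegrE ?ltW// exprn_gt0.
apply: (@le_trans _ _ (\sum_(i <oo) diameter_pow (@distR R) s (U i)))%E.
  apply: ereal_inf_lbound; exists U => //; split.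
    move=> i; rewrite /U; case: choice.pickle_inv => [I|]; last first.
      by apply: ge_ereal_sup => z [x [y [[]]]].
    case: ifPn => [|_]; last by apply: ge_ereal_sup => z [x [y [[]]]].
    by rewrite inE => FI; apply: le_trans (diam I) _; rewrite lee_fin; exact: wI.
  move=> x /cF[I FI Ix]; exists (choice.pickle I) => //.
  by rewrite /U choice.pickleK_inv mem_set.
rewrite nneseries_esumT; last by move=> *; exact: dpow_ge0.
have -> : (\esum_(i in [set: nat]) diameter_pow (@distR R) s (U i) =
    \esum_(i in choice.pickle @` F) diameter_pow (@distR R) s (U i))%E.
  rewrite [RHS]esum_mkcond; apply: eq_esum => i _.
  case: ifPn => //; rewrite notin_setE => nF.
  suff -> : U i = set0 by rewrite /diameter_pow eqxx.
  rewrite /U; case E : (choice.pickle_inv i) => [I|//].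
  case: ifPn => //; rewrite inE => FI; exfalso; apply: nF; exists I => //.
  by move: (@choice.pickle_invK _ i : oapp (@choice.pickle (Datatypes_prod__canonical__choice_Countable nat int)) i (choice.pickle_inv i) = i); rewrite E.
rewrite (reindex_esum F _ choice.pickle); last first.
  split => //; first by move=> I J _ _; exact: (pcan_inj choice.pickleK).
apply: (@le_trans _ _ (family_weight s F)); last first.
  by rewrite ltW// (lt_le_trans wF)// lee_fin /eps ge_min lexx.
apply: le_esum => I FI; rewrite /U choice.pickleK_inv mem_set//; exact: dw.
Qed.

Definition cell_mass mu n (k : int) : R :=
  \sum_(p <- mu | dyadic_index n p.2 == k) p.1.

(* The points receive their weights one by one, each the largest that the
   constraints on the cells allow. *)
Lemma greedy_weights (r : R) N (l : seq R) : 0 < r ->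
  exists mu, [/\ map snd mu = l, forall p, p \in mu -> 0 <= p.1,
    forall n k, (n <= N)%N -> cell_mass mu n k <= r ^+ n &
    forall x, x \in l -> exists2 n, (n <= N)%N & cell_mass mu n (dyadic_index n x) = r ^+ n].
Proof.
move=> r0; elim: l => [|x l [mu [ml mu0 muc mus]]].
  exists [::]; split => // n k _; by rewrite /cell_mass big_nil exprn_ge0// ltW.
(* The least slack over all levels is the weight given to [x]: no constraint breaks, and the cell of
   [x] at the minimising level becomes saturated. *)
pose slack (i : 'I_N.+1) := r ^+ i - cell_mass mu i (dyadic_index i x).
have [i0 _ hi0] := @arg_minP _ _ 'I_N.+1 ord0 xpredT slack isT.
have t0 : 0 <= slack i0 by rewrite subr_ge0 muc// -ltnS.
have cons_mass n k : cell_mass ((slack i0, x) :: mu) n k =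
    (if dyadic_index n x == k then slack i0 else 0) + cell_mass mu n k.
  by rewrite /cell_mass big_cons /=; case: ifP => // _; rewrite add0r.
have hc n k : (n <= N)%N -> cell_mass ((slack i0, x) :: mu) n k <= r ^+ n.
  move=> nN; rewrite cons_mass; case: eqP => [<-|_]; last by rewrite add0r muc.
  by have := hi0 (Ordinal (nN : (n < N.+1)%N)) isT; rewrite {2}/slack /=; lra.
exists ((slack i0, x) :: mu); split => //=.
- by rewrite ml.
- by move=> p; rewrite inE => /orP[/eqP ->//|/mu0].
- move=> y; rewrite inE => /orP[/eqP ->|/mus[n nN hn]].
    exists i0; first by rewrite -ltnS.
    by rewrite cons_mass eqxx /slack addrNK.
  exists n => //; apply/eqP; rewrite eq_le hc//= cons_mass hn.
  by rewrite lerDr; case: ifP.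
Qed.

Lemma sum_unique_le (T : eqType) (X : seq T) (P : pred T) (c : R) : uniq X ->
  0 <= c -> (forall a b, a \in X -> b \in X -> P a -> P b -> a = b) ->
  \sum_(a <- X | P a) c <= c.
Proof.
move=> uX c0 hP; rewrite -big_filter.
have : uniq (seq.filter P X) by rewrite filter_uniq.
have : forall a b, a \in seq.filter P X -> b \in seq.filter P X -> a = b.
  by move=> a b; rewrite !mem_filter => /andP[Pa aX] /andP[Pb bX]; exact: hP.
case: (seq.filter P X) => [|a [|b t]] h u; rewrite ?big_nil ?big_seq1//.
by have := h a b; rewrite !inE !eqxx ?orbT => /(_ isT isT) e; move: u; rewrite e /= inE eqxx.
Qed.

Lemma grid_points K (a b : R) N : K `<=` `[a, b]%classic ->
  exists l : seq R, (forall x, x \in l -> K x) /\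
    forall x, K x -> exists2 y, y \in l & dyadic_index N x = dyadic_index N y.
Proof.
move=> Kab; pose k0 := dyadic_index N a.
have key M : exists l : seq R, (forall x, x \in l -> K x) /\
    forall x, K x -> (dyadic_index N x < k0 + M%:Z)%R ->
      exists2 y, y \in l & dyadic_index N x = dyadic_index N y.
  elim: M => [|M [l [lK hl]]].
    exists [::]; split => // x Kx; rewrite addr0 ltNge.
    have /= := Kab _ Kx; rewrite in_itv/= => /andP[ax _].
    by rewrite /dyadic_index le_floor// ler_pM2l// exprn_gt0.
  have [[z [Kz zM]]|nz] := pselect (exists z, K z /\ dyadic_index N z = k0 + M%:Z).
    exists (z :: l); split; first by move=> x; rewrite inE => /orP[/eqP ->|/lK].
    move=> x Kx xM; have [lt|ge] := ltP (dyadic_index N x) (k0 + M%:Z).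
      by have [y yl e] := hl _ Kx lt; exists y; rewrite ?inE ?yl ?orbT.
    exists z; rewrite ?inE ?eqxx// zM; move: xM ge; clear; lia.
  exists l; split => // x Kx xM; apply: hl => //.
  have : dyadic_index N x <> k0 + M%:Z by move=> e; apply: nz; exists x.
  move: xM; clear; lia.
have [l [lK hl]] := key `|dyadic_index N b - k0|.+1.
exists l; split => // x Kx; apply: hl => //.
have /= := Kab _ Kx; rewrite in_itv/= => /andP[ax xb].
have : dyadic_index N x <= dyadic_index N b.
  by rewrite /dyadic_index le_floor// ler_pM2l// exprn_gt0.
move: (dyadic_index N x) (dyadic_index N b); clear; lia.
Qed.

(** Frostman's lemma at resolution [2^-N]. The maximal saturated cells cover [K], are disjoint, and
    have mass equal to their weight, so the total mass is at least the weight of a cover. *)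
Lemma discrete_frostman K (a b s : R) N : K `<=` `[a, b]%classic ->
  exists mu, [/\ forall p, p \in mu -> K p.2 /\ 0 <= p.1,
    forall n k, (n <= N)%N -> cell_mass mu n k <= (2^-1 `^ s) ^+ n &
    (dyadic_content s K <= (\sum_(p <- mu) p.1)%:E)%E].
Proof.
move=> /(@grid_points _ _ _ N)[l [lK hl]].
have r0 : 0 < (2^-1 : R) `^ s by rewrite powR_gt0.
have [mu [ml mu0 muc mus]] := @greedy_weights (2^-1 `^ s) N l r0.
exists mu; split => //.
  by move=> p pmu; split; [apply: lK; rewrite -ml; apply/mapP; exists p|exact: mu0].
pose F : set (nat * int) := [set I | (I.1 <= N)%N /\ cell_mass mu I.1 I.2 = (2^-1 `^ s) ^+ I.1].
have cF : covers (maximal_nodes R F) K.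
  move=> x /hl[y yl xy].
  have [n nN hn] := mus _ yl.
  have Fn : F (n, dyadic_index n y) by [].
  have [J [mJ Jx _]] := maximal_nodes_cover Fn (dyadic_index_nest nN xy).
  by exists J.
apply: le_trans (dyadic_content_le s cF) _.
apply: ge_ereal_sup => _ [X [finX XF] <-].
rewrite fsbig_finite//=.
have hX I : I \in fset_set X -> maximal_nodes R F I.
  by rewrite in_fset_set// inE => /XF.
rewrite big_seq.
under eq_bigr => I /hX[[_ e] _].
  rewrite /node_weight -e; over.
rewrite sumEFin lee_fin -big_seq /cell_mass.
rewrite (exchange_big_dep xpredT)//= [leRHS]big_seq [leLHS]big_seq; apply: ler_sum => p pmu.
apply: sum_unique_le; [exact: fset_uniq|exact: mu0|].
move=> I J /hX[FI mI] /hX[FJ mJ] /eqP pI /eqP pJ.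
have [lt|lt|e] := ltngtP I.1 J.1.
- by exfalso; apply: (mJ _ FI); split => //; exists p.2.
- by exfalso; apply: (mI _ FJ); split => //; exists p.2.
- by rewrite [I]surjective_pairing [J]surjective_pairing -pI -pJ e.
Qed.

Lemma dyadic_scale (d : R) N : d <= 1 -> exists2 l, (l <= N)%N &
  d <= 2^-1 ^+ l /\ 2^-1 ^+ l.+1 <= Num.max d (2^-1 ^+ N).
Proof.
move=> d1; elim: N => [|N [l lN [h1 h2]]].
  by exists 0%N => //; rewrite expr0 expr1; split=> //; rewrite le_max; apply/orP; right; lra.
case: (boolP (d <= 2^-1 ^+ N.+1)) => [h|]; last rewrite -ltNge => h.
  exists N.+1 => //; split => //; rewrite le_max; apply/orP; right.
  by apply: ler_wiXn2l => //; lra.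
case: (boolP (d <= 2^-1 ^+ N)) => [h'|]; last rewrite -ltNge => h'.
  by exists N => //; split => //; rewrite le_max (ltW h).
exists l; first exact: leqW.
split => //; apply: (le_trans h2).
by rewrite ge_max !le_max lexx/= (ltW h').
Qed.

(** The points within [2^-l] of [x] lie in three cells of level [l], each of mass at most
    [2^(-s l)], against a kernel of size at most [2^(e (l + 1))]. So 3 counts cells, [2^e] is the
    rounding of the distance to a power of 2, and the rest is a geometric sum of ratio
    [2^(e - s)]. *)
Lemma riesz_potential_le (s e : R) N mu x : 0 <= e -> e < s ->
  (forall p, p \in mu -> 0 <= p.1 /\ `|x - p.2| <= 1) ->
  (forall n k, (n <= N)%N -> cell_mass mu n k <= (2^-1 `^ s) ^+ n) ->
  \sum_(p <- mu) p.1 * (Num.max `|x - p.2| (2^-1 ^+ N)) `^ (- e) <=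
    3 * 2 `^ e / (1 - 2 `^ (e - s)).
Proof.
move=> e0 es hmu hc.
set rho : R := 2 `^ e.
have rho0 : 0 < rho by rewrite powR_gt0.
have rhoE n : (2^-1 ^+ n : R) `^ (- e) = rho ^+ n.
  by rewrite powRN -powR_half_expn powR_half -exprVn invrK.
have h1 p : p \in mu -> p.1 * (Num.max `|x - p.2| (2^-1 ^+ N)) `^ (- e) <=
    \sum_(l < N.+1) rho ^+ l.+1 * (if `|x - p.2| <= 2^-1 ^+ l then p.1 else 0).
  move=> pmu; have [p0 xp1] := hmu p pmu.
  have [l lN [l1 l2]] := dyadic_scale N xp1.
  rewrite (bigD1 (Ordinal (lN : (l < N.+1)%N)))//= l1 -[leLHS]addr0 lerD//.
    rewrite mulrC ler_wpM2r// -rhoE !powRN lef_pV2 ?posrE ?powR_gt0//.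
    by apply: ge0_ler_powR => //; rewrite nnegrE ?exprn_ge0 ?invr_ge0// le_max normr_ge0.
  by rewrite sumr_ge0// => i _; rewrite mulr_ge0 ?exprn_ge0 ?(ltW rho0)//; case: ifP.
rewrite big_seq; apply: le_trans (ler_sum _ h1) _; rewrite -big_seq exchange_big /=.
have h2 (l : 'I_N.+1) : \sum_(p <- mu) rho ^+ l.+1 * (if `|x - p.2| <= 2^-1 ^+ l then p.1 else 0)
    <= 3 * rho * (2 `^ (e - s)) ^+ l.
  rewrite -mulr_sumr exprS.
  have -> : 2 `^ (e - s) = rho * 2^-1 `^ s.
    by rewrite powRD ?pnatr_eq0 ?implybT// powRN powR_half.
  rewrite exprMn mulrACA.
  have -> : 3 * rho ^+ l * (rho * (2^-1 `^ s) ^+ l) = rho * rho ^+ l * (3 * (2^-1 `^ s) ^+ l) by ring.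
  rewrite ler_wpM2l ?mulr_ge0 ?exprn_ge0 ?(ltW rho0)//.
  have lN : (l <= N)%N by rewrite -ltnS.
  have := hc l (dyadic_index l x) lN; have := hc l (dyadic_index l x + 1) lN.
  have := hc l (dyadic_index l x - 1) lN; rewrite /cell_mass.
  set S1 := \sum_(_ <- _ | _) _; set S2 := \sum_(_ <- _ | _) _; set S3 := \sum_(_ <- _ | _) _.
  move=> b1 b2 b3.
  suff : \sum_(p <- mu) (if `|x - p.2| <= 2^-1 ^+ l then p.1 else 0) <= S1 + (S2 + S3) by lra.
  rewrite /S1 /S2 /S3 (big_mkcond (fun p => dyadic_index l p.2 == _ - 1)).
  rewrite (big_mkcond (fun p => dyadic_index l p.2 == _ + 1)).
  rewrite (big_mkcond (fun p => dyadic_index l p.2 == _)) -!big_split /=.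
  rewrite big_seq [leRHS]big_seq; apply: ler_sum => p pmu; have [p0 _] := hmu p pmu.
  have q0 (b : bool) : 0 <= (if b then p.1 else 0) by case: b.
  case: ifPn => [/dist_dyadic_index/or3P[]->|_]; last by rewrite !addr_ge0.
  - by rewrite addrA lerDr addr_ge0.
  - by rewrite addrCA lerDl addr_ge0.
  - by rewrite lerDl addr_ge0.
apply: le_trans (ler_sum _ (fun l _ => h2 l)) _.
rewrite -mulr_sumr ler_wpM2l//; first by rewrite mulr_ge0// ltW.
apply: sum_geometric_le; first exact: powR_ge0.
by apply: powR2_lt1; rewrite subr_lt0.
Qed.

End Frostman.

(** * Expectations of bounded random variables *)

Section Expectation.
Context (R : realType) (d : measure_display) (Omega : measurableType d).
Variable P : probability Omega R.
Implicit Types f g : Omega -> R.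

Definition bounded_rv f := measurable_fun setT f /\ exists M : R, forall w, `|f w| <= M.

Definition expect f : R := Rintegral P setT f.

Lemma bounded_rv_integrable f : bounded_rv f -> P.-integrable setT (EFin \o f).
Proof.
move=> [mf [M fM]].
apply: measurable_bounded_integrable => //; first by apply: le_lt_trans (probability_le1 P measurableT) (ltry _).
by exists M; split; [exact: num_real|move=> N MN w _ /=; rewrite (le_trans (fM w))// ltW].
Qed.

Lemma bounded_rv_cst (c : R) : bounded_rv (fun=> c).
Proof. by split; [exact: measurable_cst|exists `|c|]. Qed.

Lemma bounded_rvD f g : bounded_rv f -> bounded_rv g -> bounded_rv (fun w => f w + g w).
Proof.
move=> [mf [M fM]] [mg [N gN]]; split; first exact: measurable_funD.
by exists (M + N) => w; rewrite (le_trans (ler_normD _ _))// lerD.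
Qed.

Lemma bounded_rvM f g : bounded_rv f -> bounded_rv g -> bounded_rv (fun w => f w * g w).
Proof.
move=> [mf [M fM]] [mg [N gN]]; split; first exact: measurable_funM.
by exists (M * N) => w; rewrite normrM ler_pM.
Qed.

Lemma bounded_rvZ (c : R) f : bounded_rv f -> bounded_rv (fun w => c * f w).
Proof. by apply: bounded_rvM; exact: bounded_rv_cst. Qed.

Lemma bounded_rvB f g : bounded_rv f -> bounded_rv g -> bounded_rv (fun w => f w - g w).
Proof.
move=> bf bg; have := bounded_rvD bf (bounded_rvZ (-1) bg).
by congr bounded_rv; apply/funext => w; rewrite mulN1r.
Qed.

Lemma bounded_rv_sum (I : Type) (s : seq I) (Q : pred I) (F : I -> Omega -> R) :
  (forall i, bounded_rv (F i)) -> bounded_rv (fun w => \sum_(i <- s | Q i) F i w).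
Proof.
move=> bF; elim: s => [|i s IH].
  by under eq_fun do rewrite big_nil; exact: bounded_rv_cst.
case Qi : (Q i); under eq_fun do rewrite big_cons Qi; [exact: bounded_rvD|exact: IH].
Qed.

Lemma bounded_rv_prod (I : Type) (s : seq I) (Q : pred I) (F : I -> Omega -> R) :
  (forall i, bounded_rv (F i)) -> bounded_rv (fun w => \prod_(i <- s | Q i) F i w).
Proof.
move=> bF; elim: s => [|i s IH].
  by under eq_fun do rewrite big_nil; exact: bounded_rv_cst.
case Qi : (Q i); under eq_fun do rewrite big_cons Qi; [exact: bounded_rvM|exact: IH].
Qed.

Lemma bounded_rv_continuous f (h : R -> R) (M : R) : measurable_fun setT f ->
  continuous h -> (forall x, `|h x| <= M) -> bounded_rv (fun w => h (f w)).
Proof.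
move=> mf ch hM; split; last by exists M => w.
by apply: (measurableT_comp (f := h)) => //; exact: continuous_measurable_fun.
Qed.

Lemma expect_cst (c : R) : expect (fun=> c) = c.
Proof.
rewrite /expect Rintegral_cst//; transitivity (c * fine (1 : \bar R)%E).
  by congr (_ * fine _); exact: probability_setT.
by rewrite mulr1.
Qed.

Lemma expectD f g : bounded_rv f -> bounded_rv g ->
  expect (fun w => f w + g w) = expect f + expect g.
Proof. by move=> bf bg; rewrite /expect RintegralD//; exact: bounded_rv_integrable. Qed.

Lemma expectB f g : bounded_rv f -> bounded_rv g ->
  expect (fun w => f w - g w) = expect f - expect g.
Proof. by move=> bf bg; rewrite /expect RintegralB//; exact: bounded_rv_integrable. Qed.

Lemma expectZ (c : R) f : bounded_rv f -> expect (fun w => c * f w) = c * expect f.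
Proof. by move=> bf; rewrite /expect RintegralZl//; exact: bounded_rv_integrable. Qed.

Lemma expect_sum (I : Type) (s : seq I) (Q : pred I) (F : I -> Omega -> R) :
  (forall i, bounded_rv (F i)) ->
  expect (fun w => \sum_(i <- s | Q i) F i w) = \sum_(i <- s | Q i) expect (F i).
Proof.
move=> bF; elim: s => [|i s IH].
  by under eq_fun do rewrite big_nil; rewrite big_nil expect_cst.
rewrite big_cons; case Qi : (Q i); under eq_fun do rewrite big_cons Qi; last exact: IH.
by rewrite expectD ?IH//; exact: bounded_rv_sum.
Qed.

Lemma le_expect f g : bounded_rv f -> bounded_rv g -> (forall w, f w <= g w) ->
  expect f <= expect g.
Proof. by move=> bf bg fg; apply: le_Rintegral => //; exact: bounded_rv_integrable. Qed.

Lemma expect_norm_le f (M : R) : bounded_rv f -> (forall w, `|f w| <= M) -> `|expect f| <= M.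
Proof.
move=> bf fM; rewrite ler_norml; apply/andP; split.
  rewrite -(expect_cst (- M)); apply: le_expect => // [|w]; first exact: bounded_rv_cst.
  by have := fM w; rewrite ler_norml => /andP[].
rewrite -[leRHS](expect_cst M); apply: le_expect => // [|w]; first exact: bounded_rv_cst.
by have := fM w; rewrite ler_norml => /andP[].
Qed.

Lemma expect_indic (A : set Omega) : measurable A -> expect \1_A = fine (P A).
Proof. by move=> mA; rewrite /expect /Rintegral integral_indic// setIT. Qed.

Definition bounded_measurable (h : R -> R) :=
  measurable_fun setT h /\ exists M : R, forall x, `|h x| <= M.

Lemma bounded_rv_comp (X : {RV P >-> R}) (h : R -> R) : bounded_measurable h ->
  bounded_rv (fun w => h (X w)).
Proof.
move=> [mh [M hM]]; split; last by exists M.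
by apply: (measurableT_comp (f := h)).
Qed.

Lemma bounded_measurable_indic (B : set R) : measurable B -> bounded_measurable \1_B.
Proof.
move=> mB; split; first exact: measurable_indic.
by exists 1 => w; rewrite indicE; case: (_ \in _); rewrite ?normr0 ?normr1.
Qed.

Lemma bounded_measurable_continuous (h : R -> R) (M : R) : continuous h ->
  (forall x, `|h x| <= M) -> bounded_measurable h.
Proof. by move=> ch hM; split; [exact: continuous_measurable_fun|exists M]. Qed.

(* Both sides are additive in [u] and every bounded [u] is a uniform limit of
   finite combinations of indicators of its level sets. *)
Lemma expect_extend_indic (X : {RV P >-> R}) (G : Omega -> R) (c : R) (u : R -> R) :
  bounded_rv G -> bounded_measurable u ->
  (forall B, measurable B -> expect (fun w => \1_B (X w) * G w) =
                             expect (fun w => \1_B (X w)) * c) ->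
  expect (fun w => u (X w) * G w) = expect (fun w => u (X w)) * c.
Proof.
move=> bG [mu [M uM]] hB.
have [N GN] := bG.2.
have M0 : 0 <= M by rewrite (le_trans _ (uM 0)).
have N0 : 0 <= N + `|c|.
  by rewrite -(addr0 0) lerD// (le_trans _ (GN point)).
apply/eqP; rewrite -subr_eq0 -normr_le0; apply/ler_addgt0Pr => e0 e00; rewrite add0r.
pose e := e0 / (N + `|c| + 1).
have e_gt0 : 0 < e by rewrite divr_gt0// ltr_pwDr.
pose m := (`|Num.floor (M / e)| + 1)%N.
pose lev (k : int) : set R := u @^-1` [set y | e * k%:~R <= y < e * (k + 1)%:~R].
have mlev k : measurable (lev k).
  rewrite -[lev k]setTI; apply: mu => //.
  have -> : [set y : R | e * k%:~R <= y < e * (k + 1)%:~R] = `[e * k%:~R, e * (k + 1)%:~R[%classic.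
    by apply/seteqP; split=> y /=; rewrite in_itv.
  exact: measurable_itv.
pose z (i : 'I_(m + m).+1) : int := (i%:Z - m%:Z)%R.
pose ue (x : R) : R := \sum_(i < (m + m).+1) (e * (z i)%:~R) * \1_(lev (z i)) x.
have ueE x : `|u x - ue x| <= e.
  pose k := Num.floor (u x / e).
  have ku : e * k%:~R <= u x < e * (k + 1)%:~R.
    have := floor_itv (u x / e); rewrite -/k.
    by rewrite ler_pdivlMr// ltr_pdivrMr// ![_ * e]mulrC.
  have kM : `|k| <= m%:Z.
    have ux := uM x; have M1 : `|u x / e| <= M / e.
      by rewrite normrM (gtr0_norm (_ : 0 < e^-1)) ?invr_gt0// ler_pM2r ?invr_gt0.
    have k1 : k <= Num.floor (M / e) by apply: le_floor; rewrite (le_trans (ler_norm _)).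
    have k2 : - Num.floor (M / e) - 1 <= k.
      rewrite /k floor_ge_int intrD intrN mulrN1z.
      have := floor_itv (M / e); rewrite intrD => /andP[_ h].
      by move: M1; rewrite ler_norml => /andP[h1 _]; lra.
    rewrite /m; move: k1 k2; move: (Num.floor (M / e)) k {ku} => a b; clear; lia.
  have im : (absz (k + m%:Z)%R < (m + m).+1)%N by move: kM; clear; lia.
  have zi : z (Ordinal im) = k by rewrite /z /=; move: kM; clear; lia.
  have -> : ue x = e * k%:~R.
    rewrite /ue (bigD1 (Ordinal im))//= zi big1 ?addr0.
      by rewrite indicE mem_set ?mulr1.
    move=> i ik; rewrite indicE memNset ?mulr0// => -[] /andP[h1 h2].
    move: ku => /andP[h3 h4].
    have a1 : (z i < k + 1)%R by rewrite -(ltr_int R) -(ltr_pM2l e_gt0) (le_lt_trans h1).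
    have a2 : (k < z i + 1)%R by rewrite -(ltr_int R) -(ltr_pM2l e_gt0) (le_lt_trans h3).
    move: ik; rewrite -val_eqE /= => /eqP; apply.
    by move: a1 a2 kM; rewrite /z; clear; lia.
  move: ku; rewrite intrD mulrDr mulr1 => /andP[h1 h2].
  by rewrite ger0_norm; lra.
have bu : bounded_rv (fun w => u (X w)) by apply: bounded_rv_comp; split => //; exists M.
have bI i : bounded_rv (fun w => \1_(lev (z i)) (X w)).
  by apply: bounded_rv_comp; exact: bounded_measurable_indic.
have bue : bounded_rv (fun w => ue (X w)).
  by apply: bounded_rv_sum => i; exact: bounded_rvZ.
have hue : expect (fun w => ue (X w) * G w) = expect (fun w => ue (X w)) * c.
  transitivity (\sum_(i < (m + m).+1) (e * (z i)%:~R) * (expect (fun w => \1_(lev (z i)) (X w) * G w))).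
    rewrite -[RHS](eq_bigr _ (fun i _ => expectZ _ (bounded_rvM (bI i) bG))) -expect_sum.
      congr expect; apply/funext => w; rewrite /ue mulr_suml.
      by apply: eq_bigr => i _; rewrite mulrA.
    by move=> i; apply: bounded_rvZ; exact: bounded_rvM.
  rewrite /ue expect_sum; last by move=> i; exact: bounded_rvZ.
  by rewrite mulr_suml; apply: eq_bigr => i _; rewrite hB// expectZ// mulrA.
have -> : expect (fun w => u (X w) * G w) - expect (fun w => u (X w)) * c =
    expect (fun w => (u (X w) - ue (X w)) * G w) - expect (fun w => u (X w) - ue (X w)) * c.
  have -> : (fun w => (u (X w) - ue (X w)) * G w) = (fun w => u (X w) * G w - ue (X w) * G w).
    by apply/funext => w; rewrite mulrBl.
  rewrite (expectB (bounded_rvM bu bG) (bounded_rvM bue bG)).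
  by rewrite expectB// hue mulrBl; lra.
rewrite (le_trans (ler_normB _ _))// normrM.
have bD := bounded_rvB bu bue.
have h1 : `|expect (fun w => (u (X w) - ue (X w)) * G w)| <= e * N.
  apply: expect_norm_le; first exact: bounded_rvM.
  by move=> w; rewrite normrM ler_pM.
have h2 : `|expect (fun w => u (X w) - ue (X w))| <= e by apply: expect_norm_le.
apply: (@le_trans _ _ (e * (N + `|c|))).
  by rewrite mulrDr lerD// ler_wpM2r.
rewrite /e mulrAC ler_pdivrMr ?ltr_pwDr//.
by rewrite ler_pM2l// lerDl.
Qed.

(** Independence is given for events only. The factors are freed from being indicators one at a
    time: those of index below [j] are general, the others are still indicators, and
    [expect_extend_indic] frees the factor [j]. *)
Lemma expect_prod (X : nat -> {RV P >-> R}) (h : nat -> R -> R) N :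
  mutually_independent X -> (forall n, bounded_measurable (h n)) ->
  expect (fun w => \prod_(n < N) h n (X n w)) = \prod_(n < N) expect (fun w => h n (X n w)).
Proof.
move=> indep bh.
suff key j : forall h, (forall n, bounded_measurable (h n)) ->
    (forall n, (j <= n)%N -> exists2 B, measurable B & h n = \1_B) ->
    expect (fun w => \prod_(n < N) h n (X n w)) =
    \prod_(n < N) expect (fun w => h n (X n w)).
  (* Beyond [N] the constant 1, as an indicator, so that the claim with [j = N] covers the general
     case. *)
  pose h' n := if (n < N)%N then h n else \1_[set: R].
  have e1 (w : Omega) : \prod_(n < N) h n (X n w) = \prod_(n < N) h' n (X n w).
    by apply: eq_bigr => i _; rewrite /h' ltn_ord.
  under eq_fun do rewrite e1.
  rewrite (key N h'); first by apply: eq_bigr => i _; rewrite /h' ltn_ord.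
    by move=> n; rewrite /h'; case: ifP => // _; exact: bounded_measurable_indic.
  by move=> n; rewrite leqNgt /h' => /negPf ->; exists setT.
elim: j => [|j IH] {}h {}bh hB.
  have /choice[B mB] : forall n, exists B, measurable B /\ h n = \1_B.
    by move=> n; have [//|B] := hB n; exists B.
  pose J : {fset nat} := seq_fset tt (iota 0 N).
  have permJ : perm_eq J (iota 0 N).
    apply: uniq_perm; [exact: fset_uniq|exact: iota_uniq|].
    by move=> i; rewrite seq_fsetE.
  have mXB n : measurable (X n @^-1` B n).
    by rewrite -[X in measurable X]setTI; apply: measurable_funPT => //; exact: (mB n).1.
  have -> : (fun w => \prod_(n < N) h n (X n w)) = \1_(\bigcap_(j in [set` J]) (X j @^-1` B j)).
    apply/funext => w; rewrite indicE.
    have hE n : h n (X n w) = (X n w \in B n)%:R by rewrite (mB n).2 indicE.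
    under eq_bigr do rewrite hE.
    have [wJ|wJ] := pselect ((\bigcap_(j in [set` J]) (X j @^-1` B j)) w).
      rewrite mem_set// big1// => i _; rewrite mem_set//; apply: (wJ i).
      by rewrite /= seq_fsetE mem_iota add0n ltn_ord.
    rewrite memNset//; have /existsNP[i /not_implyP[iJ nB]] := wJ.
    rewrite /= seq_fsetE mem_iota /= add0n in iJ.
    by rewrite (bigD1 (Ordinal iJ))//= memNset// mul0r.
  rewrite expect_indic; last first.
    by apply: fin_bigcap_measurable => [|i _]; [exact: finite_fset|exact: mXB].
  rewrite indep; last by move=> i _; exact: (mB i).1.
  rewrite (perm_big _ permJ)/=.
  have -> : iota 0 N = index_iota 0 N by rewrite /index_iota subn0.
  rewrite big_mkord.
  have fP n : P (X n @^-1` B n) = (expect (fun w => h n (X n w)))%:E.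
    have -> : (fun w => h n (X n w)) = \1_(X n @^-1` B n).
      by apply/funext => w; rewrite (mB n).2 !indicE.
    by rewrite expect_indic// fineK// fin_num_measure.
  rewrite (eq_bigr (fun i : 'I_N => (expect (fun w => h i (X i w)))%:E)).
    by rewrite prodEFin.
  by move=> i _; exact: fP.
have [jN|Nj] := ltnP j N; last first.
  pose h' n := if (n < N)%N then h n else \1_[set: R].
  have e1 (w : Omega) : \prod_(n < N) h n (X n w) = \prod_(n < N) h' n (X n w).
    by apply: eq_bigr => i _; rewrite /h' ltn_ord.
  under eq_fun do rewrite e1.
  rewrite IH; first by apply: eq_bigr => i _; rewrite /h' ltn_ord.
    by move=> n; rewrite /h'; case: ifP => // _; exact: bounded_measurable_indic.
  move=> n jn; rewrite /h'; case: ifP => nN; last by exists setT.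
  by have := leq_trans Nj jn; rewrite leqNgt nN.
pose o := Ordinal jN.
have bG : bounded_rv (fun w => \prod_(n < N | n != o) h n (X n w)).
  by apply: bounded_rv_prod => i; exact: bounded_rv_comp.
transitivity (expect (fun w => h j (X j w) * \prod_(n < N | n != o) h n (X n w))).
  by congr expect; apply/funext => w; rewrite (bigD1 o).
rewrite (@expect_extend_indic _ _ (\prod_(n < N | n != o) expect (fun w => h n (X n w))))//.
  by rewrite [RHS](bigD1 o).
move=> B mB.
pose h' n := if n == j then \1_B else h n.
have e2 (n : 'I_N) : n != o -> h' n = h n.
  by move=> no; rewrite /h' ifN_eq// -[j]/(nat_of_ord o).
have b1 n : bounded_measurable (h' n).
  by rewrite /h'; case: eqP => // _; exact: bounded_measurable_indic.
have b2 n : (j <= n)%N -> exists2 B, measurable B & h' n = \1_B.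
  move=> jn; rewrite /h'; case: eqP => [_|/eqP nj]; first by exists B.
  by apply: hB; rewrite ltn_neqAle eq_sym nj.
transitivity (expect (fun w => \prod_(n < N) h' n (X n w))).
  congr expect; apply/funext => w; rewrite [RHS](bigD1 o)//= {1}/h' eqxx; congr (_ * _).
  by apply: eq_bigr => i io; rewrite e2.
rewrite (IH _ b1 b2) [LHS](bigD1 o)//= {1}/h' eqxx; congr (_ * _).
by apply: eq_bigr => i io; rewrite e2.
Qed.

(** The derivative is asked only to the right of -1, because the primitive in [expect_sin_wave] is
    an integral that starts there. *)
Lemma expect_uniform_primitive (X : {RV P >-> R}) (f F : R -> R) (M : R) :
  uniform01 X -> continuous f -> (forall x, `|f x| <= M) ->
  (forall x : R, -1 < x -> is_derive x 1 F (f x)) ->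
  expect (fun w => f (X w)) = F 1 - F 0.
Proof.
move=> uX cf fM dF.
(* The shift by [M] makes the integrand nonnegative, as needed to transfer the integral to the law
   of [X]. *)
have cfM : continuous (fun x => f x + M).
  by move=> x; apply: cvgD; [exact: cf|exact: cvg_cst].
have fM0 x : 0 <= f x + M by have := fM x; rewrite ler_norml => /andP[h _]; lra.
have bf : bounded_rv (fun w => f (X w)).
  by apply: bounded_rv_comp; exact: bounded_measurable_continuous fM.
suff : expect (fun w => f (X w) + M) = (F 1 + M) - F 0.
  rewrite expectD ?expect_cst//; last exact: bounded_rv_cst.
  by move=> h; lra.
rewrite /expect /Rintegral.
have mX : measurable_fun setT (X : Omega -> measurableTypeR R) := measurable_funPT X.
pose Y : {mfun Omega >-> measurableTypeR R} :=
  HB.pack (X : Omega -> measurableTypeR R) (isMeasurableFun.Build _ _ _ _ _ mX).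
have mfM : measurable_fun [set: measurableTypeR R] (fun y => (f y + M)%:E).
  by apply/measurable_EFinP; exact: continuous_measurable_fun.
have -> : (\int[P]_w (f (X w) + M)%:E = \int[uniform_prob (@ltr01 R)]_y (f y + M)%:E)%E.
  transitivity (\int[pushforward P Y]_y (f y + M)%:E)%E.
    rewrite (@ge0_integral_pushforward _ _ _ _ _ _ mX)//.
    by move=> y _; rewrite lee_fin.
  by apply: eq_measure_integral => B mB _; exact: uX.
rewrite integral_uniform//.
rewrite subr0 invr1 mul1e.
pose F' x := F x + M * x.
have dF' (x : R) : -1 < x -> is_derive x 1 F' (f x + M).
  move=> /dF dFx.
  have -> : f x + M = f x + (M * 1 + x *: 0) by rewrite scaler0 mulr1 addr0.
  by apply: is_deriveD; apply: is_deriveM.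
have cF' (x : R) : -1 < x -> {for x, continuous F'}.
  by move=> /dF' h; apply/differentiable_continuous/derivable1_diffP; exact: ex_derive.
rewrite (@continuous_FTC2 _ _ F')//.
- by rewrite /F' mulr1 mulr0 addr0 /= addrAC.
- exact: continuous_subspaceT.
- split.
  + move=> x; rewrite in_itv/= => /andP[x0 _].
    by have := dF' x (lt_trans (ltrN10 _) x0) => h; exact: ex_derive.
  + by apply: cvg_at_right_filter; apply: cF'; rewrite ltrN10.
  + by apply: cvg_at_left_filter; apply: cF'; lra.
- move=> x; rewrite in_itv/= => /andP[x0 _].
  by have h := dF' x (lt_trans (ltrN10 _) x0); rewrite derive1E; exact: derive_val.
Qed.

(* Fatou *)
Lemma liminf_bounded_expect (X : nat -> Omega -> R) (C : R) :
  (forall n, bounded_rv (X n)) -> (forall n w, 0 <= X n w) ->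
  (forall n, expect (X n) <= C) ->
  {ae P, forall w, exists B : R, forall N, exists2 n, (N <= n)%N & X n w <= B}.
Proof.
move=> bX X0 XC.
have mX n : measurable_fun setT (fun w => (X n w)%:E).
  by apply/measurable_EFinP; exact: (bX n).1.
have h : (\int[P]_w (limn_einf (fun n => (X n w)%:E)) <= C%:E)%E.
  apply: le_trans (fatou P measurableT mX _) _.
    by move=> n w _; rewrite lee_fin.
  rewrite limn_einf_lim.
  apply: lime_le; first exact: is_cvg_einfs.
  apply: nearW => n; apply: le_trans (_ : \int[P]_w (X n w)%:E <= _)%E.
    by apply: ereal_inf_lbound; exists n => /=.
  rewrite -[leLHS]fineK; first by rewrite lee_fin; exact: XC.
  exact: integrable_fin_num (bounded_rv_integrable (bX n)).
have L0 w : (0 <= limn_einf (fun n => (X n w)%:E))%E.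
  rewrite limn_einf_lim; apply: lime_ge; first exact: is_cvg_einfs.
  by apply: nearW => n; apply: le_ereal_inf_tmp => _ [k _ <-]; rewrite lee_fin.
have mL : measurable_fun setT (fun w => limn_einf (fun n => (X n w)%:E)).
  apply: (measurableT_comp (f := -%E)) => //.
  apply: measurable_fun_limn_esup => n.
  exact: (measurableT_comp (f := -%E)).
have /integrable_ae : P.-integrable setT (fun w => limn_einf (fun n => (X n w)%:E)).
  apply/integrableP; split => //.
  under eq_integral do rewrite gee0_abs//.
  exact: le_lt_trans h (ltry _).
move=> /(_ measurableT); apply: filterS => w /(_ I) fw.
have [B hB] : exists B : R, (limn_einf (fun n => (X n w)%:E) < B%:E)%E.
  exists (fine (limn_einf (fun n => (X n w)%:E)) + 1).
  by rewrite EFinD fineK// lteDl.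
exists B => N.
have : (einfs (fun n => (X n w)%:E) N < B%:E)%E.
  apply: le_lt_trans hB; rewrite limn_einf_lim.
  apply: lime_ge; first exact: is_cvg_einfs.
  by exists N => // n /= Nn; apply: nondecreasing_einfs.
move=> /ereal_inf_lt[_ [n /= Nn <-]]; rewrite lte_fin => /ltW h'.
by exists n.
Qed.

End Expectation.

(** * Characteristic function of one Steinhaus term *)

Section Wave.
Context (R : realType) (d : measure_display) (Omega : measurableType d).
Variables (P : probability Omega R) (X : {RV P >-> R}).
Hypothesis uX : uniform01 X.
Implicit Types (f g h : R -> R) (A B t u x : R).

Lemma is_derive_add f g x (df dg : R) : is_derive x 1 f df -> is_derive x 1 g dg ->
  is_derive x 1 (fun t => f t + g t) (df + dg).
Proof. by move=> hf hg; exact: is_deriveD. Qed.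

Lemma is_derive_mul f g x (df dg : R) : is_derive x 1 f df -> is_derive x 1 g dg ->
  is_derive x 1 (fun t => f t * g t) (df * g x + f x * dg).
Proof.
move=> hf hg; apply: (is_derive_eq (is_deriveM hf hg)).
by rewrite /GRing.scale /=; ring.
Qed.

Lemma is_derive_exp f n x (df : R) : is_derive x 1 f df ->
  is_derive x 1 (fun t => f t ^+ n) (n%:R * f x ^+ n.-1 * df).
Proof.
move=> hf; elim: n => [|n IH]; first by rewrite !mul0r; exact: is_derive_cst.
under eq_fun do rewrite exprS; apply: (is_derive_eq (is_derive_mul hf IH)).
rewrite /= -[n.+1%:R]natr1; case: n {IH} => [|n] /=; first by rewrite expr0; ring.
by rewrite exprS; ring.
Qed.

Lemma is_derive_cos_comp f x (df : R) : is_derive x 1 f df ->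
  is_derive x 1 (fun t => cos (f t)) (- sin (f x) * df).
Proof. by move=> hf; exact: is_derive1_comp. Qed.

Lemma is_derive_sin_comp f x (df : R) : is_derive x 1 f df ->
  is_derive x 1 (fun t => sin (f t)) (cos (f x) * df).
Proof. by move=> hf; exact: is_derive1_comp. Qed.

(** One Steinhaus term tested against a direction; its amplitude [u] is the Euclidean norm of
    [(A, B)]. With [g = wave A B] and [g' = wave B (- A)], its derivative up to [2 pi], the moment
    estimates below rest on [g'^2 = u^2 - g^2] and periodicity. *)
Definition wave A B t : R := A * cos (2 * pi * t) + B * sin (2 * pi * t).

Lemma is_derive_wave A B x : is_derive x 1 (wave A B) (2 * pi * wave B (- A) x).
Proof.
have dl : is_derive x 1 (fun t : R => 2 * pi * t) (2 * pi).
  apply: (is_derive_eq (is_derive_mul (is_derive_cst (2 * pi) x 1) (is_derive_id x 1))).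
  by rewrite mul0r add0r mulr1.
apply: (is_derive_eq (is_derive_add
  (is_derive_mul (is_derive_cst A x 1) (is_derive_cos_comp dl))
  (is_derive_mul (is_derive_cst B x 1) (is_derive_sin_comp dl)))).
by rewrite /wave /cst; ring.
Qed.

Lemma wave_sqr A B t : wave B (- A) t ^+ 2 = (A ^+ 2 + B ^+ 2) - wave A B t ^+ 2.
Proof.
rewrite /wave; have := cos2Dsin2 (2 * pi * t).
move: (cos _) (sin _) => c s cs.
have -> : A ^+ 2 + B ^+ 2 = (A ^+ 2 + B ^+ 2) * (c ^+ 2 + s ^+ 2) by rewrite cs mulr1.
by ring.
Qed.

Lemma wave01 A B : wave A B 1 = wave A B 0.
Proof. by rewrite /wave mulr1 mulr0 mulr_natl cos2pi sin2pi cos0 sin0. Qed.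

Lemma wave_half A B t : wave A B (t + 2^-1) = - wave A B t.
Proof.
rewrite /wave mulrDr -[2 * pi * 2^-1]mulrAC mulfV ?pnatr_eq0// mul1r.
by rewrite cosDpi sinDpi; ring.
Qed.

Lemma wave_scale (c : R) A B t : wave (c * A) (c * B) t = c * wave A B t.
Proof. by rewrite /wave; ring. Qed.

Lemma wave_le A B u t : 0 <= u -> A ^+ 2 + B ^+ 2 = u ^+ 2 -> `|wave A B t| <= u.
Proof.
move=> u0 AB; rewrite -ler_sqr ?nnegrE// -normrX ger0_norm ?sqr_ge0//.
by rewrite -AB -subr_ge0 -wave_sqr sqr_ge0.
Qed.

Definition bounded_continuous h := continuous h /\ exists M : R, forall x, `|h x| <= M.

Let E h : R := expect P (fun w => h (X w)).

Lemma bounded_continuous_rv h : bounded_continuous h -> bounded_rv (fun w => h (X w)).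
Proof.
move=> [ch [M hM]]; apply: bounded_rv_comp; exact: (bounded_measurable_continuous ch hM).
Qed.

Lemma bounded_continuous_cst (c : R) : bounded_continuous (fun=> c).
Proof. by split; [move=> x; exact: cvg_cst|exists `|c|]. Qed.

Lemma bounded_continuousD f g : bounded_continuous f -> bounded_continuous g ->
  bounded_continuous (fun x => f x + g x).
Proof.
move=> [cf [M fM]] [cg [N gN]]; split; first by move=> x; apply: cvgD; [exact: cf|exact: cg].
by exists (M + N) => x; rewrite (le_trans (ler_normD _ _))// lerD.
Qed.

Lemma bounded_continuousM f g : bounded_continuous f -> bounded_continuous g ->
  bounded_continuous (fun x => f x * g x).
Proof.
move=> [cf [M fM]] [cg [N gN]]; split; first by move=> x; apply: cvgM; [exact: cf|exact: cg].
by exists (M * N) => x; rewrite normrM ler_pM.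
Qed.

Lemma bounded_continuous_comb f g (a b : R) : bounded_continuous f ->
  bounded_continuous g -> bounded_continuous (fun x => a * f x + b * g x).
Proof.
move=> bf bg.
exact: (bounded_continuousD (bounded_continuousM (bounded_continuous_cst a) bf)
  (bounded_continuousM (bounded_continuous_cst b) bg)).
Qed.

Lemma bounded_continuousX f n : bounded_continuous f ->
  bounded_continuous (fun x => f x ^+ n).
Proof.
move=> bf; elim: n => [|n IH]; first exact: bounded_continuous_cst.
by under eq_fun do rewrite exprS; exact: bounded_continuousM.
Qed.

Lemma bounded_continuous_wave A B : bounded_continuous (wave A B).
Proof.
split.
  move=> x; apply/differentiable_continuous/derivable1_diffP.
  by have h := is_derive_wave A B x; exact: ex_derive.
exists (Num.sqrt (A ^+ 2 + B ^+ 2)) => x; apply: wave_le; first exact: sqrtr_ge0.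
by rewrite sqr_sqrtr// addr_ge0// sqr_ge0.
Qed.

Lemma bounded_continuous_cos f : continuous f -> bounded_continuous (fun x => cos (f x)).
Proof.
move=> cf; split; last by exists 1 => x; exact: cos_max.
by move=> x; apply: continuous_comp; [exact: cf|exact: continuous_cos].
Qed.

Lemma bounded_continuous_sin f : continuous f -> bounded_continuous (fun x => sin (f x)).
Proof.
move=> cf; split; last by exists 1 => x; exact: sin_max.
by move=> x; apply: continuous_comp; [exact: cf|exact: continuous_sin].
Qed.

Lemma expect_periodic_derivative f F : bounded_continuous f ->
  (forall x, is_derive x 1 F (f x)) -> F 1 = F 0 -> E f = 0.
Proof.
move=> [cf [M fM]] dF F10.
by rewrite /E (expect_uniform_primitive uX cf fM (fun x _ => dF x)) F10 subrr.
Qed.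

Lemma expect_comb f g (a b : R) : bounded_continuous f -> bounded_continuous g ->
  E (fun x => a * f x + b * g x) = a * E f + b * E g.
Proof.
move=> /bounded_continuous_rv bf /bounded_continuous_rv bg.
by rewrite /E expectD ?expectZ//; exact: bounded_rvZ.
Qed.

Section Amplitude.
Variables (A B u : R).
Hypotheses (u0 : 0 < u) (AB : A ^+ 2 + B ^+ 2 = u ^+ 2).
Let g := wave A B.
Let g' := wave B (- A).
Let bg : bounded_continuous g := bounded_continuous_wave A B.
Let bg' : bounded_continuous g' := bounded_continuous_wave B (- A).

Let dg x : is_derive x 1 g (2 * pi * g' x) := is_derive_wave A B x.

Let dg' x : is_derive x 1 g' (- (2 * pi) * g x).
Proof.
apply: (is_derive_eq (is_derive_wave B (- A) x)).
by rewrite /g /wave; ring.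
Qed.

Let g'2 x : g' x ^+ 2 = u ^+ 2 - g x ^+ 2.
Proof. by rewrite /g' wave_sqr AB. Qed.

Let g_le x : `|g x| <= u.
Proof. by apply: wave_le AB; exact: ltW. Qed.

Let pi2_neq0 : 2 * pi != 0 :> R.
Proof. by rewrite mulf_neq0// ?pnatr_eq0// gt_eqF// pi_gt0. Qed.

(** Wallis' recursion: [g^(2l+1) g'] has period 1, so its derivative has mean 0. *)
Lemma expect_wave_even_step l :
  l.*2.+2%:R * E (fun x => g x ^+ l.*2.+2) = l.*2.+1%:R * u ^+ 2 * E (fun x => g x ^+ l.*2).
Proof.
have key : E (fun x => (l.*2.+1%:R * u ^+ 2) * g x ^+ l.*2 + (- l.*2.+2%:R) * g x ^+ l.*2.+2) = 0.
  pose F x := (2 * pi)^-1 * (g x ^+ l.*2.+1 * g' x).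
  refine (@expect_periodic_derivative (fun x => (l.*2.+1%:R * u ^+ 2) * g x ^+ l.*2 +
    (- l.*2.+2%:R) * g x ^+ l.*2.+2) F _ _ _).
  - exact: (bounded_continuous_comb _ _ (bounded_continuousX _ bg) (bounded_continuousX _ bg)).
  - move=> x; apply: (is_derive_eq (is_derive_mul (is_derive_cst (2 * pi)^-1 x 1)
      (is_derive_mul (is_derive_exp l.*2.+1 (dg x)) (dg' x)))).
    rewrite /cst /= mul0r add0r.
    have -> : l.*2.+1%:R * g x ^+ l.*2 * (2 * pi * g' x) * g' x + g x ^+ l.*2.+1 * (- (2 * pi) * g x) =
       (2 * pi) * (l.*2.+1%:R * g x ^+ l.*2 * g' x ^+ 2 - g x ^+ l.*2.+2).
      by rewrite !exprS expr0; ring.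
    rewrite mulKf// g'2 -[l.*2.+2%:R]natr1 !exprS; ring.
  - by rewrite /F /g /g' !wave01.
move: key; rewrite expect_comb; [|exact: bounded_continuousX..].
by move=> key; lra.
Qed.

(** Induction along Wallis' recursion; the step comes down to [k (k + 2) <= (k + 1)^2] with
    [k = 2 l + 1]. *)
Lemma expect_wave_even_le l :
  (l.*2.+1)%:R * (E (fun x => g x ^+ l.*2)) ^+ 2 <= u ^+ l.*2 ^+ 2.
Proof.
elim: l => [|l IH].
  rewrite /E; under eq_fun do rewrite expr0; rewrite expect_cst.
  by rewrite !expr0 !expr1n mulr1.
have := expect_wave_even_step l.
rewrite doubleS; set m := E _; set m' := E _ in IH * => e.
have a0 : (0 : R) < l.*2.+2%:R by rewrite ltr0n.
have -> : m = l.*2.+1%:R / l.*2.+2%:R * u ^+ 2 * m'.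
  by rewrite -[LHS](mulKf (lt0r_neq0 a0)) e; ring.
have b0 : (0 : R) < l.*2.+1%:R by rewrite ltr0n.
rewrite -[l.*2.+3%:R]natr1 -[l.*2.+2%:R]natr1.
move: (l.*2.+1%:R : R) b0 IH => k k0 IH {e a0}.
have k1 : 0 < k + 1 by lra.
have -> : (k + 1 + 1) * (k / (k + 1) * u ^+ 2 * m') ^+ 2 =
   (k * m' ^+ 2) * u ^+ 2 ^+ 2 * ((k + 1 + 1) * k / (k + 1) ^+ 2).
  by field; rewrite gt_eqF.
have h1 : (k + 1 + 1) * k / (k + 1) ^+ 2 <= 1.
  by rewrite ler_pdivrMr ?exprn_gt0// mul1r; nra.
apply: (@le_trans _ _ (u ^+ l.*2 ^+ 2 * u ^+ 2 ^+ 2 * 1)).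
  apply: ler_pM => //.
  - by apply: mulr_ge0; [apply: mulr_ge0; [exact: ltW|exact: sqr_ge0]|exact: sqr_ge0].
  - by rewrite divr_ge0 ?sqr_ge0// mulr_ge0; lra.
  - by apply: ler_wpM2r => //; rewrite sqr_ge0.
by rewrite mulr1 -!exprM -exprD -mulnDl addn2.
Qed.

Lemma expect_norm_le_wave h (M : R) : bounded_continuous h -> (forall x, `|h x| <= M) ->
  `|E h| <= M.
Proof. by move=> /bounded_continuous_rv bh hM; apply: expect_norm_le. Qed.

(* [sin g * g' * g ^ (2 l)] is periodic, so its derivative has mean 0. *)
Lemma expect_cos_wave_step l :
  `|u ^+ 2 * E (fun x => cos (g x) * g x ^+ l.*2) - E (fun x => cos (g x) * g x ^+ l.*2.+2)|
    <= l.*2.+1%:R * u ^+ l.*2.+1.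
Proof.
have bcos n : bounded_continuous (fun x => cos (g x) * g x ^+ n).
  exact: (bounded_continuousM (bounded_continuous_cos bg.1) (bounded_continuousX _ bg)).
have bsin n : bounded_continuous (fun x => sin (g x) * g x ^+ n).
  exact: (bounded_continuousM (bounded_continuous_sin bg.1) (bounded_continuousX _ bg)).
pose r x := l.*2%:R * (sin (g x) * g x ^+ l.*2.-1 * g' x ^+ 2) + (- 1) * (sin (g x) * g x ^+ l.*2.+1).
pose r0 x := l.*2%:R * (sin (g x) * g x ^+ l.*2.-1 * g' x ^+ 2).
have br0 : bounded_continuous (fun x => sin (g x) * g x ^+ l.*2.-1 * g' x ^+ 2).
  exact: (bounded_continuousM (bounded_continuousM (bounded_continuous_sin bg.1) (bounded_continuousX _ bg)) (bounded_continuousX _ bg')).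
have br : bounded_continuous r.
  exact: (bounded_continuous_comb _ _ br0 (bsin _)).
pose q x := u ^+ 2 * (cos (g x) * g x ^+ l.*2) + (- 1) * (cos (g x) * g x ^+ l.*2.+2).
have bq : bounded_continuous q.
  exact: (bounded_continuous_comb _ _ (bcos _) (bcos _)).
have key : E (fun x => 1 * q x + 1 * r x) = 0.
  pose F x := (2 * pi)^-1 * (sin (g x) * g x ^+ l.*2 * g' x).
  refine (@expect_periodic_derivative (fun x => 1 * q x + 1 * r x) F _ _ _).
  - exact: (bounded_continuous_comb _ _ bq br).
  - move=> x; apply: (is_derive_eq (is_derive_mul (is_derive_cst (2 * pi)^-1 x 1)
      (is_derive_mul (is_derive_mul (is_derive_sin_comp (dg x)) (is_derive_exp l.*2 (dg x))) (dg' x)))).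
    rewrite /cst /= mul0r add0r.
    have -> : (cos (g x) * (2 * pi * g' x) * g x ^+ l.*2 +
        sin (g x) * (l.*2%:R * g x ^+ l.*2.-1 * (2 * pi * g' x))) * g' x +
        sin (g x) * g x ^+ l.*2 * (- (2 * pi) * g x) =
      (2 * pi) * (cos (g x) * g x ^+ l.*2 * g' x ^+ 2 +
        l.*2%:R * (sin (g x) * g x ^+ l.*2.-1 * g' x ^+ 2) - sin (g x) * g x ^+ l.*2.+1).
      by rewrite [g x ^+ l.*2.+1]exprS; ring.
    rewrite mulKf// /q /r [X in cos (g x) * _ * X + _]g'2 !exprS; ring.
  - by rewrite /F /g /g' !wave01.
rewrite expect_comb// !mul1r in key.
have -> : u ^+ 2 * E (fun x => cos (g x) * g x ^+ l.*2) - E (fun x => cos (g x) * g x ^+ l.*2.+2) = E q.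
  by rewrite /q expect_comb// mulN1r.
have -> : E q = - E r by lra.
rewrite normrN; apply: expect_norm_le_wave => // x.
rewrite /r (le_trans (ler_normD _ _))// -[l.*2.+1%:R]natr1 mulrDl mul1r.
have su := ltW u0.
apply: lerD.
  rewrite normrM ger0_norm// ; case: l {r r0 br0 br q bq key} => [|l].
    by rewrite !mul0r.
  rewrite ler_wpM2l// (normrM (_ * _)) (normrM (sin _)) doubleS /=.
  have -> : u ^+ l.*2.+3 = 1 * u ^+ l.*2.+1 * u ^+ 2 by rewrite mul1r -exprD addn2.
  apply: ler_pM; [by rewrite mulr_ge0|exact: normr_ge0| |].
    apply: ler_pM => //; first exact: sin_max.
    by rewrite normrX lerXn2r ?nnegrE.
  rewrite normrX ler_sqr ?nnegrE//.
  apply: wave_le su _; rewrite sqrrN addrC; exact: AB.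
rewrite mulN1r normrN normrM -[leRHS]mul1r; apply: ler_pM => //; first exact: sin_max.
by rewrite normrX lerXn2r ?nnegrE.
Qed.

(** [M] uses of the previous step replace [u^(2M) E cos g] by [E (cos g g^(2M))], with error
    [1 + 3 + ... + (2M - 1) = M^2] times [u^(2M-1)]. What remains is at most an even moment, smaller
    than [u^(2M)] by the factor of [expect_wave_even_le]. *)
Lemma expect_cos_wave_decay M :
  `|E (fun x => cos (g x))| <= Num.sqrt (M.*2.+1%:R)^-1 + M%:R ^+ 2 / u.
Proof.
have h1 : `|u ^+ M.*2 * E (fun x => cos (g x)) - E (fun x => cos (g x) * g x ^+ M.*2)|
    <= M%:R ^+ 2 * u ^+ M.*2 / u.
  elim: M => [|M IH].
    rewrite double0 expr0 mul1r expr0n /= !mul0r.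
    by under [in X in _ - X]eq_fun do rewrite expr0 mulr1; rewrite subrr normr0.
  have := expect_cos_wave_step M.
  rewrite doubleS; set a := E _ in IH *; set b := E _ in IH *; set c := E _ => h2.
  have -> : u ^+ M.*2.+2 * a - c = u ^+ 2 * (u ^+ M.*2 * a - b) + (u ^+ 2 * b - c).
    by rewrite !exprS; ring.
  rewrite (le_trans (ler_normD _ _))// normrM (ger0_norm (sqr_ge0 u)).
  apply: le_trans (lerD (ler_wpM2l (sqr_ge0 u) IH) h2) _.
  have -> : u ^+ M.*2.+1 = u ^+ M.*2.+2 / u by rewrite [in RHS]exprSr mulfK// gt_eqF.
  have -> : u ^+ M.*2.+2 = u ^+ 2 * u ^+ M.*2 by rewrite !exprS mulrA mulr1.
  have -> : M.+1%:R = M%:R + 1 :> R by rewrite natr1.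
  have -> : M.*2.+1%:R = M%:R * 2 + 1 :> R by rewrite -natr1 -muln2 natrM.
  by rewrite le_eqVlt; apply/orP; left; apply/eqP; field; rewrite gt_eqF.
have bcos n : bounded_continuous (fun x => cos (g x) * g x ^+ n).
  exact: (bounded_continuousM (bounded_continuous_cos bg.1) (bounded_continuousX _ bg)).
have h2 : `|E (fun x => cos (g x) * g x ^+ M.*2)| <= E (fun x => g x ^+ M.*2).
  have be : bounded_continuous (fun x => g x ^+ M.*2) by exact: bounded_continuousX.
  have g0 x : 0 <= g x ^+ M.*2 by rewrite exprn_even_ge0// odd_double.
  have hx x : `|cos (g x) * g x ^+ M.*2| <= g x ^+ M.*2.
    by rewrite normrM (ger0_norm (g0 x)) ler_piMl// cos_max.
  rewrite ler_norml; apply/andP; split.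
    have -> : - E (fun x => g x ^+ M.*2) = E (fun x => (-1) * g x ^+ M.*2).
      by rewrite /E (expectZ P (-1) (bounded_continuous_rv be)) mulN1r.
    apply: (le_expect P (bounded_rvZ (-1) (bounded_continuous_rv be)) (bounded_continuous_rv (bcos _))).
    by move=> w; have := hx (X w); rewrite ler_norml mulN1r => /andP[].
  apply: (le_expect P (bounded_continuous_rv (bcos _)) (bounded_continuous_rv be)).
  by move=> w; have := hx (X w); rewrite ler_norml => /andP[].
have h3 : E (fun x => g x ^+ M.*2) <= Num.sqrt (M.*2.+1%:R)^-1 * u ^+ M.*2.
  have := expect_wave_even_le M; set m := E _ => h.
  have k0 : (0 : R) < M.*2.+1%:R by rewrite ltr0n.
  rewrite (le_trans (ler_norm _))// -ler_sqr ?nnegrE ?mulr_ge0 ?sqrtr_ge0 ?exprn_ge0 ?(ltW u0)//.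
  rewrite exprMn sqr_sqrtr ?invr_ge0 ?(ltW k0)// ler_pdivlMl//.
  by rewrite -normrX ger0_norm ?sqr_ge0.
have uM : 0 < u ^+ M.*2 by rewrite exprn_gt0.
rewrite -(ler_pM2l uM) -{1}[u ^+ M.*2]gtr0_norm// -normrM.
set a := _ * _ in h1 *; set b := E _ in h1 h2.
have -> : a = (a - b) + b by rewrite subrK.
rewrite (le_trans (ler_normD _ _))// mulrDr.
have -> : u ^+ M.*2 * (M%:R ^+ 2 / u) = M%:R ^+ 2 * u ^+ M.*2 / u by ring.
by move: (le_trans h2 h3) h1; rewrite [Num.sqrt _ * _]mulrC; lra.
Qed.

End Amplitude.

(** Pointwise, [cos 2y = 2 cos^2 y - 1] lies above both [4 cos y - 3] and [- 4 cos y - 3]. *)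
Lemma expect_cos_wave_double A B :
  1 - `|E (fun x => cos (wave (2 * A) (2 * B) x))| <= 4 * (1 - `|E (fun x => cos (wave A B x))|).
Proof.
have bc A' B' : bounded_continuous (fun x => cos (wave A' B' x)).
  by apply: bounded_continuous_cos; exact: (bounded_continuous_wave _ _).1.
have E1 : E (fun=> 1) = 1 by exact: expect_cst.
set e2 := E _; set e1 := E (fun x => cos (wave A B x)).
have c2 x : cos (wave (2 * A) (2 * B) x) = cos (wave A B x) ^+ 2 * 2 - 1.
  by rewrite wave_scale mulr_natl cos_mulr2n mulr_natr.
have h1 : 4 * e1 - 3 <= e2.
  have -> : 4 * e1 - 3 = E (fun x => 4 * cos (wave A B x) + (- 3) * 1).
    by rewrite (expect_comb _ _ (bc _ _) (bounded_continuous_cst 1)) E1 mulr1.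
  apply: (le_expect P (bounded_continuous_rv (bounded_continuous_comb _ _ (bc _ _)
    (bounded_continuous_cst 1))) (bounded_continuous_rv (bc _ _))).
  move=> w; rewrite c2.
  have := cos_le1 (wave A B (X w)); have := cos_geN1 (wave A B (X w)).
  move: (cos _) => c; nra.
have h2 : - 4 * e1 - 3 <= e2.
  have -> : - 4 * e1 - 3 = E (fun x => (- 4) * cos (wave A B x) + (- 3) * 1).
    by rewrite (expect_comb _ _ (bc _ _) (bounded_continuous_cst 1)) E1 mulr1.
  apply: (le_expect P (bounded_continuous_rv (bounded_continuous_comb _ _ (bc _ _)
    (bounded_continuous_cst 1))) (bounded_continuous_rv (bc _ _))).
  move=> w; rewrite c2.
  have := cos_le1 (wave A B (X w)); have := cos_geN1 (wave A B (X w)).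
  move: (cos _) => c; nra.
have h3 := ler_norm e2.
by case: (ger0P e1) => _; lra.
Qed.

(** A shift by half a period changes the sign of the wave. The change of variables is made on a
    primitive [F]: the sum [F (t + 1/2) + F t] has derivative 0, and its values at 0 and 1/2 give
    [F 1 = F 0]. *)
Lemma expect_sin_wave A B : E (fun x => sin (wave A B x)) = 0.
Proof.
have bs : bounded_continuous (fun x => sin (wave A B x)).
  by apply: bounded_continuous_sin; exact: (bounded_continuous_wave _ _).1.
pose f x := sin (wave A B x).
pose F (x : R) : R := Rintegral lebesgue_measure `[-1, x] f.
have dF x : -1 < x -> is_derive x 1 F (f x).
  move=> x1; have xx : x < x + 1 by rewrite ltrDl.
  have intf : lebesgue_measure.-integrable `[-1, x + 1] (EFin \o f).
    apply: continuous_compact_integrable; first exact: segment_compact.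
    by apply: continuous_subspaceT; exact: bs.1.
  have [dv dE] := continuous_FTC1_closed xx intf x1 (bs.1 x).
  by have := derivableP dv; rewrite -derive1E dE.
have [M fM] := bs.2.
rewrite /E (expect_uniform_primitive uX bs.1 fM dF).
pose G t := F (t + 2^-1) + F t.
have dG x : -1 < x -> is_derive x 1 G 0.
  move=> x1; have dsh : is_derive x 1 (fun t : R => t + 2^-1) 1.
    have := is_derive_add (is_derive_id x 1) (is_derive_cst (2^-1 : R) x 1).
    by rewrite addr0.
  have x2 : -1 < x + 2^-1 by lra.
  have d1 : is_derive x 1 (fun t => F (t + 2^-1)) (f (x + 2^-1) * 1).
    exact: (@is_derive1_comp R F (fun t => t + 2^-1) x _ _ (dF _ x2) dsh).
  apply: (is_derive_eq (is_derive_add d1 (dF _ x1))).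
  by rewrite /f wave_half sinN mulr1 addNr.
have : exists2 c : R, c \in `[(0 : R), 2^-1]%R & G 2^-1 - G 0 = 0 * (2^-1 - 0).
  apply: (@MVT_segment R G (fun=> 0)).
  - by rewrite invr_ge0.
  - by move=> x; rewrite in_itv/= => /andP[x0 _]; apply: dG; lra.
  - apply: continuous_in_subspaceT => x; rewrite inE/= in_itv/= => /andP[x0 _].
    apply/differentiable_continuous/derivable1_diffP.
    have x1 : -1 < x by lra.
    by have h := dG x x1; exact: ex_derive.
move=> [c _]; rewrite mul0r /G add0r.
have -> : 2^-1 + 2^-1 = 1 :> R by lra.
by lra.
Qed.

(* The sharp order of decay of [J_0] is 1/2 rather than 1/6: any order will do,
   since the factors of a whole block of coefficients are multiplied. *)
Definition wave_rate : R := (192 * 6 ^+ 6)^-1.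

Lemma wave_rate_gt0 : 0 < wave_rate.
Proof.
by rewrite /wave_rate invr_gt0; apply: mulr_gt0; [rewrite ltr0n|apply: exprn_gt0; rewrite ltr0n].
Qed.

(** With [M] near [u^(1/3)] the remainder [M^2 / u] is at most [1 / M], and the whole bound is of
    order [M^(-1/2)], that is [u^(-1/6)]; its twelfth power is of order [u^(-2)]. In [6^6], the
    factor [3^6] comes from the squared bound [3 / M] and [2^6] from [M + 1 <= 2 M]. *)
Lemma expect_cos_wave_power_decay A B u : 1 <= u -> A ^+ 2 + B ^+ 2 = u ^+ 2 ->
  `|E (fun x => cos (wave A B x))| ^+ 12 <= 6 ^+ 6 / u ^+ 2.
Proof.
move=> u1 AB; have u0 : 0 < u by lra.
have [M Mu uM] : exists2 M : nat, (M%:R : R) ^+ 3 <= u & u < (M.+1%:R : R) ^+ 3.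
  have ex : exists n : nat, (n%:R : R) ^+ 3 <= u by exists 0%N; rewrite expr0n ltW.
  have bd n : (n%:R : R) ^+ 3 <= u -> (n <= Num.bound u)%N.
    move=> nu; rewrite -(ler_nat R).
    have := archi_boundP (ltW u0); case: n nu => [//|n] nu ub.
    have n1 : 1 <= n.+1%:R :> R by rewrite ler1n.
    apply: ltW; apply: le_lt_trans ub; apply: le_trans nu.
    by rewrite -[leLHS]expr1 ler_weXn2l.
  case: (ex_maxnP ex bd) => M hM hmax; exists M => //.
  by rewrite ltNge; apply/negP => /hmax; rewrite ltnn.
have M1 : (1 <= M)%N.
  rewrite lt0n; apply/negP => /eqP M0; move: uM; rewrite M0 expr1n => h; lra.
set m : R := M%:R in Mu; have m1 : 1 <= m by rewrite ler1n.
have m0 : 0 < m by lra.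
have mS : M.+1%:R = m + 1 :> R by rewrite natr1.
rewrite mS in uM.
have := expect_cos_wave_decay u0 AB M.
set e := `|_|; rewrite -/m => he.
have e0 : 0 <= e by exact: normr_ge0.
set s := Num.sqrt _ in he.
have s0 : 0 <= s by exact: sqrtr_ge0.
have s2 : s ^+ 2 = (2 * m + 1)^-1.
  by rewrite sqr_sqrtr ?invr_ge0// -natr1 -muln2 natrM mulrC.
have hu : m ^+ 2 / u <= m^-1.
  rewrite ler_pdivrMr// mulrC ler_pdivlMr// -exprSr.
  exact: Mu.
have e2 : e ^+ 2 <= 3 / m.
  have h : e ^+ 2 <= 2 * s ^+ 2 + 2 * m^-1 ^+ 2.
    have : e <= s + m^-1 by lra.
    have : 0 < m^-1 by rewrite invr_gt0.
    move: (m^-1) => k k0 ek.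
    have : e ^+ 2 <= (s + k) ^+ 2 by rewrite ler_sqr ?nnegrE// addr_ge0// ltW.
    have := sqr_ge0 (s - k); rewrite !expr2; lra.
  apply: (le_trans h); rewrite s2.
  have k1 : m^-1 <= 1 by rewrite invf_le1.
  have k0 : 0 < m^-1 by rewrite invr_gt0.
  have h2 : 2 * (2 * m + 1)^-1 <= m^-1.
    by rewrite ler_pdivrMr ?lerDr//; [rewrite mulrC ler_pdivlMr//; lra|lra].
  move: h2 k0 k1; move: (m^-1) => k; rewrite expr2; nra.
have e12 : e ^+ 12 <= 3 ^+ 6 / m ^+ 6.
  have -> : e ^+ 12 = (e ^+ 2) ^+ 6 by rewrite -exprM.
  by rewrite -expr_div_n lerXn2r// nnegrE ?sqr_ge0// divr_ge0// ltW.
apply: (le_trans e12).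
rewrite ler_pdivlMr ?exprn_gt0// mulrAC ler_pdivrMr ?exprn_gt0//.
have -> : 6 ^+ 6 * m ^+ 6 = 3 ^+ 6 * (2 * m) ^+ 6.
  by rewrite -!exprMn; congr (_ ^+ _); ring.
apply: ler_wpM2l; first exact: exprn_ge0.
apply: (@le_trans _ _ (((m + 1) ^+ 3) ^+ 2)).
  by rewrite lerXn2r ?nnegrE ?exprn_ge0//; lra.
by rewrite -exprM lerXn2r ?nnegrE//; lra.
Qed.

(** Large amplitudes fall under the power decay. A small amplitude is doubled until the decay
    applies; a doubling multiplies the defect [1 - |E cos|] by at most 4, and the squared amplitude
    by exactly 4, so the initial defect is at least proportional to [A^2 + B^2]. *)
Lemma expect_cos_wave_bound A B :
  `|E (fun x => cos (wave A B x))| ^+ 12 <= (1 + wave_rate * (A ^+ 2 + B ^+ 2))^-1.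
Proof.
have k0 := wave_rate_gt0.
pose K : R := 6 ^+ 6.
have K1 : 1 <= K by rewrite exprn_ege1//; lra.
(* [192 = 8 * 24]: doubling stops with the squared amplitude below [8 K], and the defect reached
   there is at least [1 / 24]. *)
have kK : wave_rate * (192 * K) = 1 by rewrite mulVf// mulf_neq0 ?pnatr_eq0// expf_neq0// pnatr_eq0.
have le1 A' B' : `|E (fun x => cos (wave A' B' x))| <= 1.
  apply: expect_norm_le; last by move=> w; exact: cos_max.
  exact: (bounded_continuous_rv (bounded_continuous_cos (bounded_continuous_wave A' B').1)).
set u2 := A ^+ 2 + B ^+ 2.
have u20 : 0 <= u2 by rewrite addr_ge0 ?sqr_ge0.
have large A' B' : 2 * K <= A' ^+ 2 + B' ^+ 2 ->
    `|E (fun x => cos (wave A' B' x))| ^+ 12 <= K / (A' ^+ 2 + B' ^+ 2).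
  move=> h; set v2 := A' ^+ 2 + B' ^+ 2 in h *.
  have v0 : 0 <= v2 by lra.
  rewrite -[v2]sqr_sqrtr//; apply: expect_cos_wave_power_decay; last by rewrite sqr_sqrtr.
  by rewrite -(ler_pXn2r (_ : (0 < 2)%N)) ?nnegrE ?sqrtr_ge0// expr1n sqr_sqrtr//; lra.
have [big|small] := leP (2 * K) u2.
  apply: (le_trans (large _ _ big)); rewrite -/u2.
  have u2p : 0 < u2 by lra.
  rewrite ler_pdivrMr// mulrC ler_pdivlMr; last by rewrite ltr_pwDl// mulr_ge0// ltW.
  have : wave_rate * K <= 192^-1 by lra.
  nra.
have [u2p|] := ltP 0 u2; last first.
  move=> u2n; have -> : u2 = 0 by lra.
  by rewrite mulr0 addr0 invr1 exprn_ile1.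
have iter m : (1 - `|E (fun x => cos (wave (2 ^+ m * A) (2 ^+ m * B) x))|) <=
    4 ^+ m * (1 - `|E (fun x => cos (wave A B x))|).
  elim: m => [|m IH]; first by rewrite !expr0 !mul1r.
  rewrite [2 ^+ m.+1]exprS -!mulrA (le_trans (expect_cos_wave_double _ _))//.
  by rewrite exprS -mulrA ler_pM2l.
have [m m1 m2] : exists2 m, 2 * K <= 4 ^+ m * u2 & 4 ^+ m * u2 < 8 * K.
  have ex : exists n, 2 * K <= 4 ^+ n * u2.
    exists (Num.bound (2 * K / u2)).
    have := archi_boundP (_ : 0 <= 2 * K / u2); rewrite divr_ge0 ?(ltW u2p)//; last by lra.
    move=> /(_ isT); set n := Num.bound _ => h.
    rewrite -ler_pdivrMr//; apply: le_trans (ltW h) _.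
    by rewrite -natrX ler_nat ltnW// ltn_expl.
  case: (ex_minnP ex) => m hm hmin; exists m => //.
  case: m hm hmin => [|m] hm hmin; first by rewrite expr0 mul1r; lra.
  rewrite ltNge; apply/negP => h.
  have /hmin : 2 * K <= 4 ^+ m * u2.
    by move: h; rewrite exprS; move: (4 ^+ m) => z; nra.
  by rewrite ltnn.
have hm : 4 ^+ m * u2 = (2 ^+ m * A) ^+ 2 + (2 ^+ m * B) ^+ 2.
  rewrite !exprMn -mulrDr -/u2 -exprM mulnC exprM; congr (_ ^+ _ * _); lra.
have := iter m; set z := `|E (fun x => cos (wave (2 ^+ m * A) (2 ^+ m * B) x))|.
set y := `|E (fun x => cos (wave A B x))| => hy.
have y0 : 0 <= y by exact: normr_ge0.
have z0 : 0 <= z by exact: normr_ge0.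
have y1 : y <= 1 by exact: le1.
have z12 : z ^+ 12 <= 2^-1.
  rewrite hm in m1; apply: (le_trans (large _ _ m1)).
  rewrite ler_pdivrMr; last by lra.
  by lra.
(* Bernoulli: [(1 - 1/24)^12 >= 1 - 12/24 = 1/2]. *)
have hz : z <= 1 - 24^-1.
  rewrite leNgt; apply/negP => h.
  have bern n : (1 - 24^-1 : R) ^+ n >= 1 - n%:R * 24^-1.
    elim: n => [|n IH]; first by rewrite expr0 mul0r subr0.
    rewrite exprS -natr1; have : (0 : R) <= n%:R by rewrite ler0n.
    by move: IH; move: (_ ^+ n) => p; nra.
  have : (1 - 24^-1 : R) ^+ 12 < z ^+ 12 by rewrite ltr_pXn2r ?nnegrE//; lra.
  by have := bern 12%N; lra.
have hyu : y <= 1 - wave_rate * u2.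
  have p4 : 0 < 4 ^+ m :> R by rewrite exprn_gt0.
  have : 24^-1 <= 4 ^+ m * (1 - y) by lra.
  have : wave_rate * (4 ^+ m * u2) <= 24^-1.
    by rewrite (le_trans (ler_wpM2l (ltW k0) (ltW m2)))//; lra.
  move=> h1 h2; have := le_trans h1 h2.
  by rewrite mulrCA ler_pM2l//; lra.
apply: (@le_trans _ _ y); first by rewrite -[leRHS]expr1 ler_wiXn2l.
have q0 : 0 <= wave_rate * u2 by rewrite mulr_ge0// ltW.
rewrite -[leRHS]mul1r ler_pdivlMr ?ltr_pwDl//.
apply: (@le_trans _ _ ((1 - wave_rate * u2) * (1 + wave_rate * u2))).
  by rewrite ler_wpM2r// addr_ge0.
by move: (wave_rate * u2) => k; nra.
Qed.

End Wave.

(** * Series of independent waves *)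

Section WaveSeries.
Context (R : realType) (d : measure_display) (Omega : measurableType d).
Variables (P : probability Omega R) (theta : nat -> {RV P >-> R}) (b : nat -> R).
Hypothesis theta_indep : mutually_independent theta.
Hypothesis theta_unif : forall n, uniform01 (theta n).
Hypothesis cvg_b : cvgn (series b).
Implicit Types (A B : nat -> R) (w : Omega).

Definition wave_partial A B N w : R := \sum_(0 <= n < N) wave (A n) (B n) (theta n w).

Definition wave_series A B w : R := limn (fun N => wave_partial A B N w).

Definition dominated A B := forall n, `|A n| + `|B n| <= b n.

Lemma wave_norm_le (x y t : R) : `|wave x y t| <= `|x| + `|y|.
Proof.
rewrite /wave (le_trans (ler_normD _ _))// !normrM lerD//.
  by rewrite ler_piMr// cos_max.
by rewrite ler_piMr// sin_max.
Qed.

Lemma dominated_bound A B : dominated A B -> forall n t, `|wave (A n) (B n) t| <= b n.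
Proof. by move=> h n t; exact: le_trans (wave_norm_le _ _ _) (h n). Qed.

Lemma cvg_wave_partial A B w : dominated A B ->
  wave_partial A B N w @[N --> \oo] --> wave_series A B w.
Proof.
move=> dAB; have : cvgn (series (fun n => wave (A n) (B n) (theta n w))).
  apply: normed_cvg; apply: (series_le_cvg _ _ _ cvg_b) => [n|n|n] /=; first exact: normr_ge0.
    by rewrite (le_trans _ (dAB n))// addr_ge0.
  exact: dominated_bound.
by [].
Qed.

(** [N0] depends on the majorant [b] alone, so estimates for partial sums pass to the series
    uniformly in [w]. *)
Lemma wave_tail (e : R) : 0 < e -> exists N0, forall N A B w, (N0 <= N)%N ->
  dominated A B -> `|wave_series A B w - wave_partial A B N w| <= e.
Proof.
move=> e0; have [N0 hN0] : exists N0, forall N, (N0 <= N)%N -> `|limn (series b) - series b N| <= e / 2.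
  have /cvgrPdist_le/(_ (e / 2)) := cvg_b; rewrite divr_gt0// => /(_ isT)[N0 _ h].
  by exists N0 => N /h.
exists N0 => N A B w NN dAB.
have cv := cvg_wave_partial (w := w) dAB.
have cvN : wave_partial A B M w - wave_partial A B N w @[M --> \oo] -->
    wave_series A B w - wave_partial A B N w by apply: cvgB => //; exact: cvg_cst.
have -> : wave_series A B w - wave_partial A B N w =
    limn (fun M => wave_partial A B M w - wave_partial A B N w) by apply/esym/cvg_lim.
rewrite -lim_norm; last by apply/cvg_ex; eexists; exact: cvN.
apply: limr_le; first by apply: is_cvg_norm; apply/cvg_ex; eexists; exact: cvN.
exists N => // M /= NM.
have -> : wave_partial A B M w - wave_partial A B N w =
    \sum_(N <= n < M) wave (A n) (B n) (theta n w).
  by rewrite /wave_partial (big_cat_nat (n := N))//= addrAC subrr add0r.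
apply: (@le_trans _ _ (series b M - series b N)).
  have -> : series b M - series b N = \sum_(N <= n < M) b n.
    by rewrite /series /= (big_cat_nat (n := N))//= addrAC subrr add0r.
  apply: le_trans (ler_norm_sum _ _ _) _; apply: ler_sum => n _.
  exact: dominated_bound.
have h1 := hN0 _ (leq_trans NN NM); have h2 := hN0 _ NN.
move: h1 h2; rewrite !ler_norml => /andP[h1 h2] /andP[h3 h4]; lra.
Qed.

Lemma wave_series_bounded : exists M : R, forall A B w, dominated A B ->
  `|wave_series A B w| <= M.
Proof.
have [N h] := wave_tail ltr01.
exists (1 + series b N) => A B w dAB.
have -> : wave_series A B w = (wave_series A B w - wave_partial A B N w) + wave_partial A B N w.
  by rewrite subrK.
rewrite (le_trans (ler_normD _ _))// lerD ?h//.
apply: le_trans (ler_norm_sum _ _ _) _; apply: ler_sum => n _.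
exact: dominated_bound.
Qed.

Lemma wave_seriesD A B A' B' (x y : R) w : dominated A B -> dominated A' B' ->
  wave_series (fun n => x * A n + y * A' n) (fun n => x * B n + y * B' n) w =
  x * wave_series A B w + y * wave_series A' B' w.
Proof.
move=> h h'; apply: cvg_lim => //.
have -> : wave_partial (fun n => x * A n + y * A' n) (fun n => x * B n + y * B' n) ^~ w =
    (fun N => x * wave_partial A B N w + y * wave_partial A' B' N w).
  apply/funext => N; rewrite /wave_partial !mulr_sumr -big_split /=.
  by apply: eq_bigr => n _; rewrite /wave; ring.
by apply: cvgD; apply: cvgM; (exact: cvg_cst || exact: cvg_wave_partial).
Qed.

Lemma measurable_wave_partial A B N : measurable_fun setT (wave_partial A B N).
Proof.
apply: measurable_sum => n.
apply: (measurableT_comp (f := wave (A n) (B n))) => //.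
exact: continuous_measurable_fun (bounded_continuous_wave _ _).1.
Qed.

Lemma measurable_wave_series A B : dominated A B -> measurable_fun setT (wave_series A B).
Proof.
move=> h; apply: (measurable_fun_cvg (h := fun N => wave_partial A B N)).
  by move=> N; exact: measurable_wave_partial.
by move=> w _; exact: cvg_wave_partial.
Qed.

Lemma bounded_rv_wave_series A B : dominated A B -> bounded_rv (wave_series A B).
Proof.
move=> h; split; first exact: measurable_wave_series.
by have [M hM] := wave_series_bounded; exists M => w; exact: hM.
Qed.

(** Multiplicativity of the characteristic function in real terms, so cosine and sine go through one
    induction. The addition formulas move the last wave of the partial sum into the product of the
    [h n], and the sine means vanish by [expect_sin_wave]. *)
Lemma expect_trig_partial A B N (h : nat -> R -> R) j : (j <= N)%N ->
  (forall n, bounded_measurable (h n)) ->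
  expect P (fun w => cos (wave_partial A B j w) * \prod_(j <= n < N) h n (theta n w)) =
    \prod_(0 <= n < j) expect P (fun w => cos (wave (A n) (B n) (theta n w))) *
    \prod_(j <= n < N) expect P (fun w => h n (theta n w)) /\
  expect P (fun w => sin (wave_partial A B j w) * \prod_(j <= n < N) h n (theta n w)) = 0.
Proof.
elim: j h => [|j IH] h jN bh.
  split.
    rewrite big_nil mul1r big_mkord -(@expect_prod _ _ _ _ theta h N theta_indep bh); congr expect; apply/funext => w.
    by rewrite /wave_partial big_nil cos0 mul1r big_mkord.
  rewrite -[RHS](expect_cst P); congr expect; apply/funext => w.
  by rewrite /wave_partial big_nil sin0 mul0r.
pose g := wave (A j) (B j).
have cg : continuous g := (bounded_continuous_wave _ _).1.
pose hc n := if n == j then (fun x => cos (g x)) else h n.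
pose hs n := if n == j then (fun x => sin (g x)) else h n.
have bc : bounded_measurable (fun x => cos (g x)).
  have [c1 [M c2]] := bounded_continuous_cos cg; exact: bounded_measurable_continuous c1 c2.
have bs : bounded_measurable (fun x => sin (g x)).
  have [c1 [M c2]] := bounded_continuous_sin cg; exact: bounded_measurable_continuous c1 c2.
have bhc n : bounded_measurable (hc n) by rewrite /hc; case: eqP.
have bhs n : bounded_measurable (hs n) by rewrite /hs; case: eqP.
have [c1 s1] := IH hc (ltnW jN) bhc.
have [c2 s2] := IH hs (ltnW jN) bhs.
have ehc (K : (R -> R) -> nat -> R) :
    \prod_(j <= n < N) K (hc n) n = K (fun x => cos (g x)) j * \prod_(j.+1 <= n < N) K (h n) n.
  rewrite big_ltn// {1}/hc eqxx; congr (_ * _).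
  by apply: eq_big_nat => n /andP[jn _]; rewrite /hc gtn_eqF.
have ehs (K : (R -> R) -> nat -> R) :
    \prod_(j <= n < N) K (hs n) n = K (fun x => sin (g x)) j * \prod_(j.+1 <= n < N) K (h n) n.
  rewrite big_ltn// {1}/hs eqxx; congr (_ * _).
  by apply: eq_big_nat => n /andP[jn _]; rewrite /hs gtn_eqF.
rewrite (ehc (fun f n => expect P (fun w => f (theta n w)))) in c1.
rewrite (ehs (fun f n => expect P (fun w => f (theta n w)))) in c2.
rewrite (expect_sin_wave (theta_unif j)) mul0r mulr0 in c2.
have bprod (k : nat -> R -> R) m : (forall n, bounded_measurable (k n)) ->
    bounded_rv (fun w => \prod_(m <= n < N) k n (theta n w)).
  by move=> bk; apply: bounded_rv_prod => n; exact: bounded_rv_comp.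
have bcos k m : (forall n, bounded_measurable (k n)) ->
    bounded_rv (fun w => cos (wave_partial A B j w) * \prod_(m <= n < N) k n (theta n w)).
  move=> bk; apply: bounded_rvM; last exact: bprod.
  apply: (bounded_rv_continuous (M := 1)); first exact: measurable_wave_partial.
    exact: continuous_cos.
  exact: cos_max.
have bsin k m : (forall n, bounded_measurable (k n)) ->
    bounded_rv (fun w => sin (wave_partial A B j w) * \prod_(m <= n < N) k n (theta n w)).
  move=> bk; apply: bounded_rvM; last exact: bprod.
  apply: (bounded_rv_continuous (M := 1)); first exact: measurable_wave_partial.
    exact: continuous_sin.
  exact: sin_max.
have partS w : wave_partial A B j.+1 w = wave_partial A B j w + g (theta j w).
  by rewrite /wave_partial big_nat_recr.
split.
  transitivity (expect P (fun w => cos (wave_partial A B j w) * \prod_(j <= n < N) hc n (theta n w)) -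
    expect P (fun w => sin (wave_partial A B j w) * \prod_(j <= n < N) hs n (theta n w))).
    rewrite -expectB; [|exact: bcos|exact: bsin].
    congr expect; apply/funext => w.
    rewrite partS cosD (ehc (fun f n => f (theta n w))) (ehs (fun f n => f (theta n w))).
    by rewrite mulrBl !mulrA.
  by rewrite s2 subr0 c1 big_nat_recr//= mulrA.
transitivity (expect P (fun w => sin (wave_partial A B j w) * \prod_(j <= n < N) hc n (theta n w)) +
  expect P (fun w => cos (wave_partial A B j w) * \prod_(j <= n < N) hs n (theta n w))).
  rewrite -expectD; [|exact: bsin|exact: bcos].
  congr expect; apply/funext => w.
  rewrite partS sinD (ehc (fun f n => f (theta n w))) (ehs (fun f n => f (theta n w))).
  by rewrite mulrDl !mulrA.
by rewrite s1 c2 addr0.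
Qed.

Lemma expect_cos_wave_partial A B N :
  expect P (fun w => cos (wave_partial A B N w)) =
  \prod_(0 <= n < N) expect P (fun w => cos (wave (A n) (B n) (theta n w))).
Proof.
have b1 : bounded_measurable (fun=> 1 : R).
  by split; [exact: measurable_cst|exists 1 => x; rewrite normr1].
have [h _] := @expect_trig_partial A B N (fun _ _ => 1) N (leqnn N) (fun=> b1).
move: h; rewrite [X in _ * X]big_geq// mulr1 => <-.
by congr expect; apply/funext => w; rewrite big_geq// mulr1.
Qed.

Lemma expect_exp_wave_partial A B N :
  expect P (fun w => expR (wave_partial A B N w)) =
  \prod_(0 <= n < N) expect P (fun w => expR (wave (A n) (B n) (theta n w))).
Proof.
rewrite big_mkord -(@expect_prod _ _ _ _ _ (fun n t => expR (wave (A n) (B n) t)))//.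
  congr expect; apply/funext => w.
  by rewrite /wave_partial expR_sum big_mkord.
move=> n; apply: (@bounded_measurable_continuous _ _ (expR (`|A n| + `|B n|))).
  move=> x; apply: continuous_comp; last exact: continuous_expR.
  exact: (bounded_continuous_wave _ _).1.
by move=> x; rewrite ger0_norm ?expR_ge0// ler_expR (le_trans (ler_norm _))// wave_norm_le.
Qed.

Lemma cos_lipschitz (x y : R) : `|cos x - cos y| <= `|x - y|.
Proof.
wlog xy : x y / x <= y.
  by move=> h; have [/h//|/ltW/h] := leP x y; rewrite distrC (distrC x).
have [c _ e] := @MVT_segment R (@cos R) (fun x => - sin x) x y xy
  (fun t _ => is_derive_cos t) (continuous_subspaceT (@continuous_cos R)).
rewrite distrC e normrM normrN (distrC x) ler_piMl// sin_max//.
Qed.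

Lemma exprn_perturb (y z e : R) n : 0 <= y -> y <= 1 -> 0 <= z -> z <= 1 -> 0 <= e ->
  y <= z + e -> y ^+ n <= z ^+ n + n%:R * e.
Proof.
move=> y0 y1 z0 z1 e0 yz; elim: n => [|n IH]; first by rewrite !expr0 mul0r addr0.
rewrite !exprS -natr1; have zn1 : z ^+ n <= 1 by rewrite exprn_ile1.
have zn0 : 0 <= z ^+ n by rewrite exprn_ge0.
have n0 : 0 <= n%:R * e by rewrite mulr_ge0.
have h1 := ler_wpM2l y0 IH; move: h1; rewrite mulrDr.
have h2 : y * z ^+ n <= (z + e) * z ^+ n by rewrite ler_wpM2r.
have h3 : y * (n%:R * e) <= n%:R * e by rewrite ler_piMl.
have h4 : e * z ^+ n <= e by rewrite ler_piMr.
by rewrite mulrDl in h2; rewrite mulrDl mul1r; lra.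
Qed.

(** Factors beyond [N] are at most 1 and may be dropped, so any finite number of terms can be
    exploited. Replacing the series by a partial sum costs [e / 12], which the twelfth power turns
    into at most [e]. *)
Lemma expect_cos_wave_series A B N : dominated A B ->
  `|expect P (fun w => cos (wave_series A B w))| ^+ 12 <=
  \prod_(0 <= n < N) (1 + wave_rate R * (A n ^+ 2 + B n ^+ 2))^-1.
Proof.
move=> dAB; set p := \prod_(_ <= _ < _) _; set y := `|_|.
have k0 := wave_rate_gt0 R.
have q0 n : 1 <= 1 + wave_rate R * (A n ^+ 2 + B n ^+ 2).
  by rewrite lerDl; apply: mulr_ge0; [exact: ltW|apply: addr_ge0; exact: sqr_ge0].
have f0 n : 0 <= (1 + wave_rate R * (A n ^+ 2 + B n ^+ 2))^-1.
  by rewrite invr_ge0 (le_trans _ (q0 n)).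
have f1 n : (1 + wave_rate R * (A n ^+ 2 + B n ^+ 2))^-1 <= 1.
  by rewrite invf_le1 ?q0// (lt_le_trans _ (q0 n)).
have p0 : 0 <= p by apply: prodr_ge0.
have bw : bounded_rv (fun w => cos (wave_series A B w)).
  apply: (bounded_rv_continuous (M := 1)); first exact: measurable_wave_series.
    exact: continuous_cos.
  exact: cos_max.
have bp M : bounded_rv (fun w => cos (wave_partial A B M w)).
  apply: (bounded_rv_continuous (M := 1)); first exact: measurable_wave_partial.
    exact: continuous_cos.
  exact: cos_max.
have hp M : (N <= M)%N -> `|expect P (fun w => cos (wave_partial A B M w))| ^+ 12 <= p.
  move=> NM; rewrite expect_cos_wave_partial normr_prod -prodrXl.
  apply: (@le_trans _ _ (\prod_(0 <= n < M) (1 + wave_rate R * (A n ^+ 2 + B n ^+ 2))^-1)).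
    apply: ler_prod => n _; rewrite exprn_ge0//=.
    exact: expect_cos_wave_bound (theta_unif n) _ _.
  rewrite (big_cat_nat (n := N))//= -[leRHS]mulr1 ler_wpM2l//.
  suff /andP[] : 0 <= \prod_(N <= n < M) (1 + wave_rate R * (A n ^+ 2 + B n ^+ 2))^-1 <= 1 by [].
  elim/big_ind: _ => [|u v /andP[u0 u1] /andP[v0 v1]|n _]; first by rewrite ler01 lexx.
    by rewrite mulr_ge0//= mulr_ile1.
  by rewrite f0 f1.
apply/ler_addgt0Pr => e e0.
have e12 : 0 < e / 12 by rewrite divr_gt0.
have [N0 hN0] := wave_tail e12.
have hM := hp (maxn N N0) (leq_maxl _ _); apply: le_trans (_ : _ <= _ + e) _; last first.
  by rewrite lerD2r; exact: hM.
have -> : e = 12%:R * (e / 12) by rewrite mulrCA mulfV ?mulr1// pnatr_eq0.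
apply: exprn_perturb; rewrite ?normr_ge0//.
- by apply: expect_norm_le => // w; exact: cos_max.
- by apply: expect_norm_le => // w; exact: cos_max.
- exact: ltW.
rewrite -lerBlDl (le_trans (lerB_dist _ _))// -expectB//.
apply: expect_norm_le => [|w]; first exact: bounded_rvB.
by rewrite (le_trans (cos_lipschitz _ _))// hN0// leq_maxr.
Qed.

(** The linear term stands apart so that it disappears in the mean of a centred variable. Up to 1/2
    the exponential is compared with a quadratic by means of [expR (- v) >= 1 - v]; beyond 1/2,
    [v <= 2 v^2]. *)
Lemma expR_le_add (v : R) : expR v <= v + expR (2 * v ^+ 2).
Proof.
have h := expR_ge1Dx (2 * v ^+ 2).
have [v0|v0] := leP v 0.
  have : expR v <= 1 + v + v ^+ 2.
    have h1 : 1 - v <= expR (- v) by exact: expR_ge1Dx.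
    rewrite -[v in leLHS]opprK expRN -[leLHS]mul1r ler_pdivrMr ?expR_gt0//.
    apply: (@le_trans _ _ ((1 + v + v ^+ 2) * (1 - v))).
      have -> : (1 + v + v ^+ 2) * (1 - v) = 1 - v ^+ 3 by ring.
      by rewrite lerBrDl gerDr exprn_odd_le0.
    by rewrite ler_wpM2l// expr2; nra.
  by have := sqr_ge0 v; lra.
have [v1|v1] := leP v 2^-1; last first.
  have : expR v <= expR (2 * v ^+ 2) by rewrite ler_expR expr2; nra.
  by lra.
have : expR v <= 1 + v + 2 * v ^+ 2.
  have h1 : 1 - v <= expR (- v) by exact: expR_ge1Dx.
  rewrite -[v in leLHS]opprK expRN -[leLHS]mul1r ler_pdivrMr ?expR_gt0//.
  apply: (@le_trans _ _ ((1 + v + 2 * v ^+ 2) * (1 - v))).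
    have -> : (1 + v + 2 * v ^+ 2) * (1 - v) = 1 + v ^+ 2 * (1 - 2 * v) by ring.
    by rewrite lerDl mulr_ge0 ?sqr_ge0//; lra.
  by rewrite ler_wpM2l// expr2; nra.
by lra.
Qed.

Lemma expect_exp_wave (n : nat) (x y : R) :
  expect P (fun w => expR (wave x y (theta n w))) <= expR (2 * (x ^+ 2 + y ^+ 2)).
Proof.
have bw := bounded_continuous_wave x y.
have bex : bounded_rv (fun w => expR (wave x y (theta n w))).
  apply: (bounded_rv_comp (theta n) (h := fun t => expR (wave x y t))).
  apply: (@bounded_measurable_continuous _ _ (expR (`|x| + `|y|))).
    by move=> t; apply: continuous_comp; [exact: bw.1|exact: continuous_expR].
  by move=> t; rewrite ger0_norm ?expR_ge0// ler_expR (le_trans (ler_norm _))// wave_norm_le.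
have E0 : expect P (fun w => wave x y (theta n w)) = 0.
  apply: (@expect_periodic_derivative _ _ _ _ _ (theta_unif n) (wave x y)
    (fun t => (2 * pi)^-1 * wave (- y) x t)).
  - exact: bw.
  - move=> t; apply: (is_derive_eq (is_derive_mul (is_derive_cst (2 * pi)^-1 t 1) (is_derive_wave (- y) x t))).
    rewrite /cst mul0r add0r mulKf ?opprK//.
    by rewrite mulf_neq0// ?pnatr_eq0// gt_eqF// pi_gt0.
  - by rewrite wave01.
apply: (@le_trans _ _ (expect P (fun w => wave x y (theta n w) + expR (2 * (x ^+ 2 + y ^+ 2))))).
  apply: le_expect => //.
    by apply: bounded_rvD; [exact: bounded_continuous_rv|exact: bounded_rv_cst].
  move=> w; rewrite (le_trans (expR_le_add _))// lerD2l ler_expR ler_pM2l//.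
  by rewrite -subr_ge0 -wave_sqr sqr_ge0.
rewrite expectD; [|exact: bounded_continuous_rv|exact: bounded_rv_cst].
by rewrite E0 expect_cst add0r.
Qed.

Lemma bounded_rv_exp (f : Omega -> R) : bounded_rv f -> bounded_rv (fun w : Omega => expR (f w)).
Proof.
move=> [mf [M fM]]; split.
  apply: (measurableT_comp (f := @expR R)) => //.
exists (expR M) => w; rewrite ger0_norm ?expR_ge0// ler_expR.
exact: le_trans (ler_norm _) (fM w).
Qed.

Lemma dominated_partial A B : dominated A B -> forall (N : nat) w, `|wave_partial A B N w| <= series b N.
Proof.
move=> dAB N w; apply: le_trans (ler_norm_sum _ _ _) _; apply: ler_sum => n _.
exact: dominated_bound.
Qed.

(** In [3 = 1 + 2] the 1 bounds the tail of the series and the 2 is the constant of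
    [expect_exp_wave], the squared amplitudes having sum at most 1. *)
Lemma expect_exp_wave_series A B : dominated A B ->
  (forall N, \sum_(0 <= n < N) (A n ^+ 2 + B n ^+ 2) <= 1) ->
  expect P (fun w => expR (wave_series A B w)) <= expR 3.
Proof.
move=> dAB sAB.
have [N hN] := wave_tail ltr01.
have bp : bounded_rv (wave_partial A B N).
  split; first exact: measurable_wave_partial.
  by exists (series b N) => w; exact: dominated_partial.
apply: (@le_trans _ _ (expect P (fun w => expR 1 * expR (wave_partial A B N w)))).
  apply: le_expect.
  - by apply: bounded_rv_exp; exact: bounded_rv_wave_series.
  - by apply: bounded_rvZ; exact: bounded_rv_exp.
  move=> w; rewrite -expRD ler_expR.
  have := hN N A B w (leqnn N) dAB; rewrite ler_norml => /andP[_]; lra.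
rewrite expectZ; last exact: bounded_rv_exp.
have -> : 3 = 1 + 2 :> R by lra.
rewrite expRD ler_wpM2l ?expR_ge0// expect_exp_wave_partial.
apply: (@le_trans _ _ (\prod_(0 <= n < N) expR (2 * (A n ^+ 2 + B n ^+ 2)))).
  apply: ler_prod => n _; rewrite expect_exp_wave andbT.
  apply: Rintegral_ge0 => w _; exact: expR_ge0.
rewrite -expR_sum ler_expR -mulr_sumr.
by have := sAB N; lra.
Qed.

End WaveSeries.

(** * Block exponents and decorrelation of the random series *)

Section Exponents.
Context (R : realType).
Variables (q : R) (lambda : nat -> R) (a : nat -> R[i]).
Hypothesis q_gt1 : 1 < q.
Implicit Types (k n N : nat).

Let v n : R := Normc.normc (a n) ^+ 2.

Definition in_block k n := q ^+ k <= lambda n < q ^+ k.+1.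

Definition block_sum N k : R := \sum_(0 <= n < N | in_block k n) v n.

Let v0 n : 0 <= v n.
Proof. exact: sqr_ge0. Qed.

Let total k : \bar R := (\sum_(0 <= n <oo | (q ^+ k <= lambda n < q ^+ k.+1)%R) (v n)%:E)%E.

Let total_ge0 k : (0 <= total k)%E.
Proof. by apply: nneseries_ge0 => n _ _; rewrite lee_fin. Qed.

Let block_sum_le_total N k : ((block_sum N k)%:E <= total k)%E.
Proof.
rewrite /block_sum -sumEFin /total.
apply: (@nneseries_lim_ge R (fun n => (v n)%:E) (fun n => in_block k n) 0%N N) => n _ _.
by rewrite lee_fin.
Qed.

Let total_le_block_sum k (c : R) : (forall N, block_sum N k <= c) -> (total k <= c%:E)%E.
Proof.
move=> h; apply: lime_le; first by apply: is_cvg_nneseries => n _ _; rewrite lee_fin.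
by apply: nearW => N; rewrite sumEFin lee_fin; exact: h.
Qed.

Let lnq : 0 < ln q. Proof. by rewrite ln_gt0. Qed.

Let qk_gt0 k : 0 < q ^+ k. Proof. by rewrite exprn_gt0// (lt_trans ltr01). Qed.

Let ln_powR_qk k (s : R) : ln ((q ^+ k) `^ s) = s * (k%:R * ln q).
Proof. by rewrite ln_powR lnXn ?(lt_trans ltr01)// mulr_natl. Qed.

Let block_exponentE k : (0 < k)%N ->
  block_exponent q lambda a k = (- lne (sqrte (total k)) * ((k%:R * ln q)^-1)%:E)%E.
Proof.
by move=> k0; rewrite /block_exponent /block_norm inver gt_eqF// mulr_gt0// ltr0n.
Qed.

Let kln k : (0 < k)%N -> 0 < (k%:R * ln q)^-1.
Proof. by move=> k0; rewrite invr_gt0 mulr_gt0// ltr0n. Qed.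

Let sqrt_qk k (s : R) : Num.sqrt ((q ^+ k) `^ (- (2 * s))) = (q ^+ k) `^ (- s).
Proof.
rewrite -powR12_sqrt ?powR_ge0// -powRrM; congr (_ `^ _).
by rewrite mulNr mulrAC mulfV ?mul1r// pnatr_eq0.
Qed.

(** The exponent [2 t] undoes the square root in [block_norm]. The block sum is truncated at [N]
    because only finitely many terms enter a product of decay factors. *)
Lemma upper_exponent_block (t : R) : (upper_exponent q lambda a < t%:E)%E ->
  exists k0, forall k, (k0 <= k)%N ->
    exists N, (q ^+ k) `^ (- (2 * t)) < block_sum N k.
Proof.
move=> /ereal_inf_lt[_ [V [k1 _ k1V] <-] sV].
exists (maxn k1 1) => k; rewrite geq_max => /andP[k1k k0].
have : (block_exponent q lambda a k < t%:E)%E.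
  by apply: le_lt_trans sV; apply: ereal_sup_ubound; exists k => //; exact: k1V.
rewrite block_exponentE// => h; apply: contrapT => /forallNP hN.
have : (total k <= ((q ^+ k) `^ (- (2 * t)))%:E)%E.
  by apply: total_le_block_sum => N; rewrite leNgt; exact/negP/hN.
move: h (total_ge0 k); case: (total k) => [r| |]//=.
case: ifPn => [_ h|rpos]; first by move: h; rewrite /= gt0_mulye ?lte_fin ?kln// ltNge leey.
rewrite -EFinN -EFinM lte_fin !lee_fin -ltNge in rpos *.
rewrite ltr_pdivrMr ?mulr_gt0 ?ltr0n// => h1 r0 rle.
have : Num.sqrt r <= (q ^+ k) `^ (- t) by rewrite -sqrt_qk ler_wsqrtr.
rewrite -ler_ln ?posrE// ?powR_gt0//.
by rewrite ln_powR_qk; lra.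
Qed.

Lemma lower_exponent_block (t : R) : (t%:E < lower_exponent q lambda a)%E ->
  exists k0, forall k, (k0 <= k)%N -> forall N, block_sum N k <= (q ^+ k) `^ (- (2 * t)).
Proof.
rewrite /lower_exponent /limn_einf lteNr -EFinN.
move=> /ereal_inf_lt[_ [V [k1 _ k1V] <-] sV].
exists (maxn k1 1) => k; rewrite geq_max => /andP[k1k k0] N.
have : (t%:E < block_exponent q lambda a k)%E.
  rewrite -lteN2 -EFinN.
  by apply: le_lt_trans sV; apply: ereal_sup_ubound; exists k => //; exact: k1V.
rewrite block_exponentE// => h; rewrite leNgt; apply/negP => hN.
move: h; apply/negP; rewrite -leNgt.
have := block_sum_le_total N k; case: (total k) => [r| |]//=; last first.
  by move=> _; rewrite gt0_mulNye ?lte_fin ?kln// leNye.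
rewrite lee_fin => Nr.
have rp : 0 < r by apply: lt_le_trans Nr; apply: lt_trans hN; rewrite powR_gt0.
rewrite ifN; last by rewrite -ltNge sqrtr_gt0.
rewrite -EFinN -EFinM lee_fin ler_pdivrMr ?mulr_gt0 ?ltr0n//.
have : (q ^+ k) `^ (- t) <= Num.sqrt r by rewrite -sqrt_qk ler_wsqrtr// (le_trans (ltW hN)).
rewrite -ler_ln ?posrE// ?powR_gt0// ?sqrtr_gt0//.
by rewrite ln_powR_qk; lra.
Qed.

Lemma between_powers (x : R) : 1 <= x -> exists k, q ^+ k <= x < q ^+ k.+1.
Proof.
move=> x1; have ex : exists k, q ^+ k <= x by exists 0%N; rewrite expr0.
have [m hm] : exists m : nat, x < q ^+ m.
  have q1 : 0 < q - 1 by rewrite subr_gt0.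
  exists (Num.bound (x / (q - 1))).
  have := archi_boundP (_ : 0 <= x / (q - 1)); rewrite divr_ge0 ?(ltW q1)//; last by lra.
  move=> /(_ isT); rewrite ltr_pdivrMr//; set n := Num.bound _ => h.
  apply: (lt_le_trans h).
  have bern k : 1 + k%:R * (q - 1) <= q ^+ k.
    elim: k => [|k IH]; first by rewrite mul0r addr0 expr0.
    rewrite exprS -natr1; have k0 : (0 : R) <= k%:R by rewrite ler0n.
    have := ler_wpM2l (ltW (lt_trans ltr01 q_gt1)) IH.
    by have := mulr_ge0 k0 (sqr_ge0 (q - 1)); rewrite expr2; lra.
  by have := bern n; lra.
have bd k : q ^+ k <= x -> (k <= m)%N.
  move=> h; rewrite leqNgt; apply/negP => mk.
  have : q ^+ m <= q ^+ k by rewrite ler_weXn2l ?(ltW q_gt1)// ltnW.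
  by lra.
case: (ex_maxnP ex bd) => k hk kmax; exists k; rewrite hk /=.
by rewrite ltNge; apply/negP => /kmax; rewrite ltnn.
Qed.

(** For [t] strictly between [g] and the lower exponent, block [k] contributes at most
    [q^(2g) q^(2 (g - t) k)], a geometric series. The early blocks, for which the exponent says
    nothing, are charged to [V]. *)
Lemma weighted_sum_bounded (g V : R) : 0 <= g -> (g%:E < lower_exponent q lambda a)%E ->
  (forall n, 1 <= lambda n) -> (forall N, \sum_(0 <= n < N) v n <= V) ->
  exists B, forall N, \sum_(0 <= n < N) v n * lambda n `^ (2 * g) <= B.
Proof.
move=> g0 gl l1 hV.
have [t gt tl] : exists2 t : R, g < t & (t%:E < lower_exponent q lambda a)%E.
  move: gl; case: (lower_exponent _ _ _) => [s|_|//]; last first.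
    by exists (g + 1); [lra|exact: ltry].
  by rewrite lte_fin => gs; exists ((g + s) / 2); rewrite ?lte_fin; lra.
have [k0 hk0] := lower_exponent_block tl.
pose r := q `^ (2 * (g - t)).
have q0 : 0 < q := lt_trans ltr01 q_gt1.
have r1 : r < 1.
  by rewrite /r /powR gt_eqF//= expR_lt1 nmulr_rlt0// pmulr_rlt0// subr_lt0.
exists (V * (q ^+ k0) `^ (2 * g) + q `^ (2 * g) * (1 - r)^-1) => N.
have /choice[kk hkk] : forall n, exists k, in_block k n by move=> n; exact: between_powers.
pose K := (\max_(n < N) kk n).+1.
have h1 n : (n < N)%N -> v n * lambda n `^ (2 * g) <= v n * (q ^+ k0) `^ (2 * g) +
    \sum_(k < K) (if (k0 <= k)%N && in_block k n then v n * (q ^+ k.+1) `^ (2 * g) else 0).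
  move=> nN; have [kn|kn] := ltnP (kk n) k0.
    rewrite -[leLHS]addr0 lerD//; last first.
      by apply: sumr_ge0 => k _; case: ifP => // _; apply: mulr_ge0; [exact: v0|exact: powR_ge0].
    rewrite ler_wpM2l// ge0_ler_powR ?nnegrE ?mulr_ge0 ?(ltW (qk_gt0 _))//.
      by rewrite (le_trans _ (l1 n)).
    have /andP[_ h] := hkk n; rewrite (le_trans (ltW h))//.
    by rewrite ler_weXn2l ?ltW.
  rewrite -[leLHS]add0r; apply: lerD.
    by apply: mulr_ge0; [exact: v0|exact: powR_ge0].
  have kK : (kk n < K)%N by rewrite ltnS (@leq_bigmax _ (fun n : 'I_N => kk n) (Ordinal nN)).
  rewrite (bigD1 (Ordinal kK))//= kn hkk /= -[leLHS]addr0 lerD//; last first.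
    by apply: sumr_ge0 => k _; case: ifP => // _; apply: mulr_ge0; [exact: v0|exact: powR_ge0].
  rewrite ler_wpM2l// ge0_ler_powR ?nnegrE ?mulr_ge0 ?(ltW (qk_gt0 _))//.
    by rewrite (le_trans _ (l1 n)).
  by have /andP[_ h] := hkk n; exact: ltW.
rewrite big_mkord; apply: le_trans (ler_sum _ (fun (n : 'I_N) _ => h1 n (ltn_ord n))) _.
rewrite big_split /= -mulr_suml lerD//.
  by have := hV N; rewrite big_mkord => h; apply: ler_wpM2r => //; exact: powR_ge0.
rewrite exchange_big /=.
apply: (@le_trans _ _ (\sum_(k < K) q `^ (2 * g) * r ^+ k)); last first.
  rewrite -mulr_sumr ler_wpM2l ?powR_ge0//; apply: sum_geometric_le => //.
  exact: powR_ge0.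
apply: ler_sum => k _; have [kk0|kk0] := leqP k0 k; last first.
  by rewrite big1// mulr_ge0 ?exprn_ge0 ?powR_ge0.
rewrite -big_mkcond /= -mulr_suml.
have := hk0 _ kk0 N; rewrite /block_sum big_mkord => h.
apply: (le_trans (ler_wpM2r (powR_ge0 _ _) h)).
have e1 : (q ^+ k.+1) `^ (2 * g) = q `^ (2 * g) * (q ^+ k) `^ (2 * g).
  by rewrite exprS powRM// ?(ltW q0)// (ltW (qk_gt0 k)).
rewrite e1 mulrCA ler_wpM2l ?powR_ge0// -powRD; last first.
  by rewrite (gt_eqF (qk_gt0 k)) implybT.
have -> : r ^+ k = q `^ (2 * (g - t) * k%:R) by rewrite powRrM powR_mulrn ?powR_ge0.
have -> : q ^+ k = q `^ k%:R by rewrite powR_mulrn// ltW.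
rewrite -powRrM le_eqVlt; apply/orP; left; apply/eqP; congr (_ `^ _); ring.
Qed.

End Exponents.

Section ComplexNorm.
Context (R : realType).
Implicit Types z : R[i].

Lemma normc_sqr z : Normc.normc z ^+ 2 = complex.Re z ^+ 2 + complex.Im z ^+ 2.
Proof. by case: z => x y /=; rewrite sqr_sqrtr// addr_ge0 ?sqr_ge0. Qed.

Lemma normc_ge0 z : 0 <= Normc.normc z.
Proof. by case: z => x y /=; exact: sqrtr_ge0. Qed.

Lemma Re_le_normc z : `|complex.Re z| <= Normc.normc z.
Proof.
rewrite -ler_sqr ?nnegrE ?normc_ge0// normc_sqr -normrX ger0_norm ?sqr_ge0//.
by rewrite lerDl sqr_ge0.
Qed.

Lemma Im_le_normc z : `|complex.Im z| <= Normc.normc z.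
Proof.
rewrite -ler_sqr ?nnegrE ?normc_ge0// normc_sqr -normrX ger0_norm ?sqr_ge0//.
by rewrite lerDr sqr_ge0.
Qed.

Lemma normc_le_ReIm z : Normc.normc z <= `|complex.Re z| + `|complex.Im z|.
Proof.
rewrite -ler_sqr ?nnegrE ?normc_ge0 ?addr_ge0// normc_sqr sqrrD !real_normK ?num_real//.
by rewrite -addrA [_ *+ 2 + _]addrC addrA lerDl mulrn_wge0// mulr_ge0.
Qed.

End ComplexNorm.

Section ProductBounds.
Context (R : realType).

Lemma prod_unique_le (T : eqType) (X : seq T) (Q : pred T) (c : R) : uniq X ->
  1 <= c -> (forall a b, a \in X -> b \in X -> Q a -> Q b -> a = b) ->
  \prod_(a <- X | Q a) c <= c.
Proof.
move=> uX c0 hP; rewrite -big_filter.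
have : uniq (seq.filter Q X) by rewrite filter_uniq.
have : forall a b, a \in seq.filter Q X -> b \in seq.filter Q X -> a = b.
  by move=> a b; rewrite !mem_filter => /andP[Pa aX] /andP[Pb bX]; exact: hP.
case: (seq.filter Q X) => [|a [|b t]] h u; rewrite ?big_nil ?big_seq1//.
by have := h a b; rewrite !inE !eqxx ?orbT => /(_ isT isT) e; move: u; rewrite e /= inE eqxx.
Qed.

Lemma prod_disjoint_le (N m : nat) (Q : nat -> pred nat) (F : nat -> R) :
  (forall n, 1 <= F n) ->
  (forall n i j, (i < m)%N -> (j < m)%N -> Q i n -> Q j n -> i = j) ->
  \prod_(0 <= j < m) \prod_(0 <= n < N | Q j n) F n <= \prod_(0 <= n < N) F n.
Proof.
move=> F1 hQ; rewrite (exchange_big_dep xpredT)//=.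
apply: ler_prod => n _; apply/andP; split.
  by apply: prodr_ge0 => j _; rewrite (le_trans _ (F1 n)).
apply: prod_unique_le => //; first exact: iota_uniq.
by move=> i j; rewrite !mem_index_iota => /= im jm; exact: hQ.
Qed.

Lemma prod_add1_ge (I : Type) (s : seq I) (Q : pred I) (x : I -> R) :
  (forall i, 0 <= x i) -> 1 + \sum_(i <- s | Q i) x i <= \prod_(i <- s | Q i) (1 + x i).
Proof.
move=> x0; elim: s => [|i s IH]; first by rewrite !big_nil addr0.
rewrite !big_cons; case: ifP => // _.
have s0 : 0 <= \sum_(i <- s | Q i) x i by apply: sumr_ge0.
have := mulr_ge0 (x0 i) s0.
have h1 : 0 <= 1 + x i by rewrite addr_ge0.
by have := ler_wpM2l h1 IH; rewrite mulrDr mulr1 mulrDl mul1r; lra.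
Qed.

End ProductBounds.

Lemma cvg_series_scale (R : realType) (c : R) (b : nat -> R) : cvgn (series b) ->
  cvgn (series (fun n => c * b n)).
Proof. by move=> h; exact: (@is_cvg_seriesZ R b c h). Qed.

(** * Increments of the random series *)

Section RandomSeries.
Context (R : realType) (d : measure_display) (Omega : measurableType d).
Variables (P : probability Omega R) (theta : nat -> {RV P >-> R}).
Variables (phi : nat -> R -> R[i]) (a : nat -> R[i]) (lambda : nat -> R) (q : R).
Hypothesis theta_indep : mutually_independent theta.
Hypothesis theta_unif : forall n, uniform01 (theta n).
Hypothesis phi_bounded : uniformly_bounded phi.
Hypothesis phi_bilip : locally_uniformly_bilipschitz phi.
Hypothesis a_summable : cvgn (series (fun n => Normc.normc (a n))).
Hypothesis lambda_ge1 : forall n, 1 <= lambda n.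
Hypothesis q_gt1 : 1 < q.
Implicit Types (x y : R) (n N k : nat) (w : Omega).

Definition coef n x : R[i] := a n * phi n (lambda n * x).

Definition coef_re n x : R := complex.Re (coef n x).
Definition coef_im n x : R := complex.Im (coef n x).

Definition series_re w x := wave_series theta (coef_re ^~ x) (fun n => - coef_im n x) w.
Definition series_im w x := wave_series theta (coef_im ^~ x) (coef_re ^~ x) w.

Lemma random_seriesE w x :
  random_series a lambda phi theta w x = Complex (series_re w x) (series_im w x).
Proof.
have mulE n : a n * expi (2 * pi * theta n w) * phi n (lambda n * x) =
    Complex (wave (coef_re n x) (- coef_im n x) (theta n w))
            (wave (coef_im n x) (coef_re n x) (theta n w)).
  rewrite mulrAC -/(coef n x) /coef_re /coef_im /expi; case: (coef n x) => r s.
  by apply/eqP; rewrite eq_complex /= /wave; apply/andP; split; apply/eqP; ring.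
rewrite /random_series /complex_series; congr Complex; congr (limn _);
  apply/funext => N; rewrite /series /wave_partial /=;
  by apply: eq_bigr => n _; rewrite mulE.
Qed.

Lemma coef_diff n x y :
  (coef_re n x - coef_re n y) ^+ 2 + (coef_im n x - coef_im n y) ^+ 2 =
  (Normc.normc (a n) * distC (phi n (lambda n * x)) (phi n (lambda n * y))) ^+ 2.
Proof.
rewrite /distC -Normc.normcM normc_sqr mulrBr -/(coef n x) -/(coef n y) /coef_re /coef_im.
by case: (coef n x) => r s; case: (coef n y).
Qed.

Lemma coef_dominated : exists2 b : nat -> R, cvgn (series b) &
  forall n x, `|coef_re n x| + `|coef_im n x| <= b n.
Proof.
have [M hM] := phi_bounded.
exists (fun n => (2 * M) * Normc.normc (a n)).
  exact: cvg_series_scale.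
move=> n x; apply: le_trans (lerD (Re_le_normc _) (Im_le_normc _)) _.
rewrite /coef Normc.normcM.
by have := ler_wpM2l (normc_ge0 (a n)) (hM n (lambda n * x)); lra.
Qed.

Definition coef_dom := sval (cid2 coef_dominated).

Lemma cvg_coef_dom : cvgn (series coef_dom).
Proof. by rewrite /coef_dom; case: cid2. Qed.

Lemma coef_le_dom n x : `|coef_re n x| + `|coef_im n x| <= coef_dom n.
Proof. by rewrite /coef_dom; case: cid2. Qed.

Lemma dominated_re x : dominated coef_dom (coef_re ^~ x) (fun n => - coef_im n x).
Proof. by move=> n; rewrite normrN; exact: coef_le_dom. Qed.

Lemma dominated_im x : dominated coef_dom (coef_im ^~ x) (coef_re ^~ x).
Proof. by move=> n; rewrite addrC; exact: coef_le_dom. Qed.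

(** With [diff_im], the coefficients of the wave obtained by testing the increment against [(u, v)].
    By [diff_sqr] the amplitude depends on [(u, v)] only through its norm: a Steinhaus term is
    isotropic. *)
Definition diff_re (u v x y : R) n :=
  u * (coef_re n x - coef_re n y) + v * (coef_im n x - coef_im n y).
Definition diff_im (u v x y : R) n :=
  v * (coef_re n x - coef_re n y) - u * (coef_im n x - coef_im n y).

Lemma dominated_diff (u v x y : R) :
  dominated (fun n => (2 * (`|u| + `|v|)) * coef_dom n) (diff_re u v x y) (diff_im u v x y).
Proof.
move=> n; have hx := coef_le_dom n x; have hy := coef_le_dom n y.
rewrite /diff_re /diff_im.
set r := coef_re n x - _; set s := coef_im n x - _.
have hr : `|r| <= `|coef_re n x| + `|coef_re n y| by exact: ler_normB.
have hs : `|s| <= `|coef_im n x| + `|coef_im n y| by exact: ler_normB.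
have h : `|r| + `|s| <= 2 * coef_dom n by lra.
apply: (@le_trans _ _ ((`|u| + `|v|) * (`|r| + `|s|))).
  apply: le_trans (lerD (ler_normD _ _) (ler_normB _ _)) _.
  by rewrite !normrM; lra.
apply: le_trans (ler_wpM2l (addr_ge0 (normr_ge0 u) (normr_ge0 v)) h) _.
by rewrite mulrCA mulrA.
Qed.

Lemma series_diff (u v x y : R) w :
  u * (series_re w x - series_re w y) + v * (series_im w x - series_im w y) =
  wave_series theta (diff_re u v x y) (diff_im u v x y) w.
Proof.
have b2 (z z' : R) (A B A' B' : nat -> R) : `|z| = 1 -> `|z'| = 1 ->
    dominated coef_dom A B -> dominated coef_dom A' B' ->
    dominated (fun n => 2 * coef_dom n) (fun n => z * A n + z' * A' n) (fun n => z * B n + z' * B' n).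
  move=> z1 z1' h h' n; have := h n; have := h' n.
  have := ler_normD (z * A n) (z' * A' n); have := ler_normD (z * B n) (z' * B' n).
  by rewrite !normrM z1 z1' !mul1r; lra.
have n1 : `|1 : R| = 1 by rewrite normr1.
have nN1 : `|-1 : R| = 1 by rewrite normrN normr1.
have cv := cvg_coef_dom; have cv2 : cvgn (series (fun n => 2 * coef_dom n)) by exact: cvg_series_scale.
have -> : series_re w x - series_re w y = 1 * series_re w x + (-1) * series_re w y by ring.
have -> : series_im w x - series_im w y = 1 * series_im w x + (-1) * series_im w y by ring.
rewrite /series_re /series_im.
rewrite -(wave_seriesD theta cv 1 (-1) w (dominated_re x) (dominated_re y)).
rewrite -(wave_seriesD theta cv 1 (-1) w (dominated_im x) (dominated_im y)).
rewrite -(wave_seriesD theta cv2 u v w (b2 _ _ _ _ _ _ n1 nN1 (dominated_re x) (dominated_re y))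
   (b2 _ _ _ _ _ _ n1 nN1 (dominated_im x) (dominated_im y))).
by congr wave_series; apply/funext => n; rewrite /diff_re /diff_im; ring.
Qed.

Lemma diff_sqr (u v x y : R) n : diff_re u v x y n ^+ 2 + diff_im u v x y n ^+ 2 =
  (u ^+ 2 + v ^+ 2) *
  (Normc.normc (a n) * distC (phi n (lambda n * x)) (phi n (lambda n * y))) ^+ 2.
Proof. by rewrite -coef_diff /diff_re /diff_im; ring. Qed.

Lemma block_sumS N k : block_sum q lambda a N k <= block_sum q lambda a N.+1 k.
Proof.
rewrite /block_sum [leRHS]big_mkcond big_nat_recr//= -big_mkcond lerDl.
by case: ifP => // _; exact: sqr_ge0.
Qed.

Lemma le_block_sum N N' k : (N <= N')%N ->
  block_sum q lambda a N k <= block_sum q lambda a N' k.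
Proof.
move=> /subnK <-; elim: (N' - N)%N => [//|m IH].
by rewrite addSn (le_trans IH)// block_sumS.
Qed.

(* For x close to y, each of finitely many consecutive blocks of frequencies
   comparable to 1 / |x - y| contributes one factor of decay. *)
Lemma decorrelation (t : R) (m : nat) : 0 < t -> (upper_exponent q lambda a < t%:E)%E ->
  exists c d0 : R, [/\ 0 < c, 0 < d0, d0 <= 1 &
    forall x y, x != y -> `|x - y| <= d0 -> forall u v : R,
    `|expect P (fun w => cos (u * (series_re w x - series_re w y) +
                              v * (series_im w x - series_im w y)))|
    <= (1 + c * (u ^+ 2 + v ^+ 2) * `|x - y| `^ (2 * t))^-1 ^+ m].
Proof.
move=> t0 ht; have [k0 hk0] := upper_exponent_block q_gt1 ht.
have [L [dl [L1 dl0 bil]]] := phi_bilip.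
have q0 : 0 < q := lt_trans ltr01 q_gt1.
have L0 : 0 < L := lt_le_trans ltr01 L1.
have kap0 := wave_rate_gt0 R.
(* One factor of decay per block, and [expect_cos_wave_series] bounds only a twelfth power. *)
pose p := (12 * m)%N.
pose c1 := L^-1 * (dl / q ^+ p.+1).
have c10 : 0 < c1 by rewrite mulr_gt0 ?invr_gt0// divr_gt0// exprn_gt0.
pose c := wave_rate R * c1 ^+ 2 * dl `^ (- (2 * t)).
have c0 : 0 < c by exact: mulr_gt0 (mulr_gt0 kap0 (exprn_gt0 _ c10)) (powR_gt0 _ dl0).
pose d0 := Num.min 1 (dl / q ^+ (k0 + p.+1)).
exists c, d0; split => //.
- by rewrite lt_min ltr01 divr_gt0// exprn_gt0.
- by rewrite ge_min lexx.
move=> x y xy xyd0 u v.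
set D := `|x - y|; have D0 : 0 < D by rewrite normr_gt0 subr_eq0.
(* Frequencies near [q^k1] stretch [|x - y|] to about [dl], the largest distance at which the
   bi-Lipschitz bounds hold. *)
have [k1 /andP[hk1 hk2]] : exists k, q ^+ k <= dl / D < q ^+ k.+1.
  apply: between_powers => //; rewrite ler_pdivlMr// mul1r.
  apply: le_trans xyd0 _; rewrite /d0 ge_min; apply/orP; right.
  by rewrite ler_pdivrMr ?exprn_gt0// ler_peMr ?exprn_ege1// ltW.
have k1k : (k0 + p.+1 <= k1)%N.
  rewrite leqNgt; apply/negP => h.
  have h1 : q ^+ k1.+1 <= q ^+ (k0 + p.+1) by rewrite ler_weXn2l// ltW.
  have h2 : q ^+ (k0 + p.+1) <= dl / D.
    rewrite ler_pdivlMr// mulrC -ler_pdivlMr ?exprn_gt0//.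
    by apply: le_trans xyd0 _; rewrite /d0 ge_min lexx orbT.
  by have := lt_le_trans hk2 (le_trans h1 h2); rewrite ltxx.
have /choice[Nf hNf] : forall k, exists N, (k0 <= k)%N ->
    (q ^+ k) `^ (- (2 * t)) < block_sum q lambda a N k.
  by move=> k; have [/hk0[N hN]|_] := leqP k0 k; [exists N|exists 0%N].
pose N := \max_(j < p) Nf (k1 - j.+1)%N.
(* In the [p] blocks just below [k1] the stretched distance stays under [dl] and above
   [dl / q^(p+1)], which is the origin of [c1]. *)
pose kj j := (k1 - j.+1)%N.
have kjk0 j : (j < p)%N -> (k0 <= kj j)%N by rewrite /kj => jp; move: k1k; clear -jp; lia.
have bs j : (j < p)%N -> (dl / D) `^ (- (2 * t)) <= block_sum q lambda a N (kj j).
  move=> jp; apply: (@le_trans _ _ ((q ^+ kj j) `^ (- (2 * t)))).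
    rewrite !powRN lef_pV2 ?posrE ?powR_gt0 ?divr_gt0 ?exprn_gt0//.
    apply: ge0_ler_powR; rewrite ?nnegrE ?divr_ge0 ?exprn_ge0 ?(ltW q0) ?(ltW dl0) ?(ltW D0) ?mulr_ge0 ?(ltW t0)//.
    by apply: le_trans hk1; apply: ler_weXn2l; [exact: ltW|exact: leq_subr].
  apply: le_trans (ltW (hNf _ (kjk0 _ jp))) _; apply: le_block_sum.
  exact: (@leq_bigmax _ (fun j : 'I_p => Nf (k1 - j.+1)%N) (Ordinal jp)).
have far j n : (j < p)%N -> in_block q lambda (kj j) n ->
    c1 <= distC (phi n (lambda n * x)) (phi n (lambda n * y)).
  move=> jp /andP[l1 l2].
  have lD : distR (lambda n * x) (lambda n * y) = lambda n * D.
    by rewrite /distR -mulrBr normrM ger0_norm// (le_trans _ (lambda_ge1 n)).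
  have lDd : lambda n * D <= dl.
    rewrite -ler_pdivlMr//; apply: le_trans hk1; apply: le_trans (ltW l2) _.
    by rewrite ler_weXn2l ?(ltW q_gt1)// /kj; move: k1k; clear -jp; lia.
  have lDd' : distR (lambda n * x) (lambda n * y) <= dl by rewrite lD.
  have /andP[h _] := bil n (lambda n * x) (lambda n * y) lDd'.
  rewrite lD in h; apply: le_trans h.
  rewrite /c1 ler_pM2l ?invr_gt0//.
  rewrite ler_pdivrMr ?exprn_gt0//.
  have h1 : q ^+ k1.+1 <= q ^+ kj j * q ^+ p.+1.
    rewrite -exprD ler_weXn2l ?(ltW q_gt1)// /kj; move: k1k; clear -jp; lia.
  rewrite ltr_pdivrMr// in hk2.
  apply: (le_trans (ltW hk2)).
  rewrite mulrAC ler_pM2r//; apply: (le_trans h1).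
  by rewrite ler_pM2r ?exprn_gt0.
pose xi := u ^+ 2 + v ^+ 2.
have xi0 : 0 <= xi by rewrite addr_ge0 ?sqr_ge0.
pose un n := (Normc.normc (a n) * distC (phi n (lambda n * x)) (phi n (lambda n * y))) ^+ 2.
have un0 n : 0 <= un n by exact: sqr_ge0.
have kxu n : 0 <= wave_rate R * (xi * un n).
  exact: mulr_ge0 (ltW kap0) (mulr_ge0 xi0 (un0 n)).
have cxi0 : 0 <= c * xi * D `^ (2 * t).
  exact: mulr_ge0 (mulr_ge0 (ltW c0) xi0) (powR_ge0 _ _).
have F1 n : 1 <= 1 + wave_rate R * (xi * un n) by rewrite lerDl.
have big : (1 + c * xi * D `^ (2 * t)) ^+ p <= \prod_(0 <= n < N) (1 + wave_rate R * (xi * un n)).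
  apply: le_trans (@prod_disjoint_le R N p (fun j n => in_block q lambda (kj j) n) _ F1 _); last first.
    move=> n i j ip jp /andP[a1 a2] /andP[b1 b2].
    have e1 : (kj i < (kj j).+1)%N.
      by have := le_lt_trans a1 b2; rewrite ltr_eXn2l.
    have e2 : (kj j < (kj i).+1)%N.
      by have := le_lt_trans b1 a2; rewrite ltr_eXn2l.
    by move: e1 e2 k1k; rewrite /kj; clear -ip jp; lia.
  have -> : (1 + c * xi * D `^ (2 * t)) ^+ p = \prod_(0 <= j < p) (1 + c * xi * D `^ (2 * t)).
    by rewrite prodr_const_nat subn0.
  rewrite big_nat [leRHS]big_nat; apply: ler_prod => j /= jp.
  apply/andP; split; first by rewrite addr_ge0.
  apply: le_trans (prod_add1_ge _ _ _); last exact: kxu.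
  rewrite lerD2l.
  have dd : (dl / D) `^ (- (2 * t)) = dl `^ (- (2 * t)) * D `^ (2 * t).
    rewrite powRM ?invr_ge0 ?(ltW dl0) ?(ltW D0)//; congr (_ * _).
    by rewrite -powR_inv1 ?(ltW D0)// -powRrM mulN1r opprK.
  have : c1 ^+ 2 * block_sum q lambda a N (kj j) <= \sum_(0 <= n < N | in_block q lambda (kj j) n) un n.
    rewrite /block_sum mulr_sumr; apply: ler_sum => n nb.
    rewrite /un [leRHS]exprMn [leRHS]mulrC; apply: ler_wpM2r; first exact: sqr_ge0.
    by rewrite ler_sqr ?nnegrE ?(ltW c10) ?normc_ge0//; exact: far jp nb.
  move=> h; have := ler_wpM2l (ltW (exprn_gt0 2 c10)) (bs _ jp).
  move=> /le_trans /(_ h); rewrite dd => h2.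
  rewrite -mulr_sumr -mulr_sumr /c.
  have -> : wave_rate R * c1 ^+ 2 * dl `^ (- (2 * t)) * xi * D `^ (2 * t) =
    wave_rate R * (xi * (c1 ^+ 2 * (dl `^ (- (2 * t)) * D `^ (2 * t)))) by ring.
  by rewrite ler_pM2l// ler_wpM2l.
have -> : (fun w => cos (u * (series_re w x - series_re w y) + v * (series_im w x - series_im w y)))
   = (fun w => cos (wave_series theta (diff_re u v x y) (diff_im u v x y) w)).
  by apply/funext => w; rewrite series_diff.
have := expect_cos_wave_series theta_indep theta_unif
   (@cvg_series_scale R (2 * (`|u| + `|v|)) _ cvg_coef_dom) N (dominated_diff u v x y).
set z := `|_| => hz.
have base0 : 0 < 1 + c * xi * D `^ (2 * t).
  by rewrite ltr_pwDl.
have : z ^+ 12 <= (1 + c * xi * D `^ (2 * t))^-1 ^+ m ^+ 12.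
  apply: (le_trans hz); rewrite -exprM mulnC -/p exprVn.
  under eq_bigr do rewrite diff_sqr -/xi -/(un _).
  rewrite prodfV lef_pV2 ?posrE//.
  - by apply: prodr_gt0 => n _; rewrite (lt_le_trans ltr01).
  - by rewrite exprn_gt0.
by rewrite ler_pXn2r ?nnegrE ?exprn_ge0 ?invr_ge0 ?(ltW base0) ?normr_ge0.
Qed.

(** Boundedness and the Lipschitz bound interpolate to a Hoelder bound of order [g] at all
    distances, which needs [g <= 1]. The squared amplitudes of the increment then add up to at most
    [|x - y|^(2g)] times the sum in [weighted_sum_bounded]. *)
Lemma subgaussian_increment (g : R) : 0 <= g -> g <= 1 -> (g%:E < lower_exponent q lambda a)%E ->
  exists V : R, 0 < V /\ forall x y, x != y -> forall u v : R, u ^+ 2 + v ^+ 2 <= 1 ->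
    expect P (fun w => expR ((u * (series_re w x - series_re w y) +
       v * (series_im w x - series_im w y)) / (V * `|x - y| `^ g))) <= expR 3.
Proof.
move=> g0 g1 hg.
have [L [dl [L1 dl0 bil]]] := phi_bilip.
have [M hM] := phi_bounded.
have M0 : 0 <= M by rewrite (le_trans _ (hM 0%N 0))// normc_ge0.
have [W hW] : exists W, forall N, \sum_(0 <= n < N) Normc.normc (a n) ^+ 2 <= W.
  pose s := limn (series (fun n => Normc.normc (a n))).
  have le_s N : series (fun n => Normc.normc (a n)) N <= s.
    apply: nondecreasing_cvgn_le => //.
    by apply: nondecreasing_series => n _ _; exact: normc_ge0.
  have an n : Normc.normc (a n) <= s.
    apply: le_trans (le_s n.+1); rewrite /series /= big_nat_recr//= lerDr.
    by apply: sumr_ge0 => i _; exact: normc_ge0.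
  have s0 : 0 <= s by rewrite (le_trans _ (an 0%N))// normc_ge0.
  exists (s * s) => N.
  apply: (@le_trans _ _ (s * series (fun n => Normc.normc (a n)) N)); last by rewrite ler_wpM2l.
  rewrite /series /= mulr_sumr; apply: ler_sum => n _.
  by rewrite expr2 ler_wpM2r ?normc_ge0.
have [B hB] := weighted_sum_bounded q_gt1 g0 hg lambda_ge1 hW.
have B0 : 0 <= B by rewrite (le_trans _ (hB 0%N))// big_nil.
pose d1 := Num.min dl 1.
have d10 : 0 < d1 by rewrite lt_min dl0 ltr01.
have d1l : d1 <= dl by rewrite ge_min lexx.
have d11 : d1 <= 1 by rewrite ge_min lexx orbT.
(* [L] serves up to the distance [d1 <= 1]; beyond it the sup bound [2 M] is at most
   [(2 M / d1) z^g]. *)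
pose C := L + 2 * M / d1.
have M2 : 0 <= 2 * M / d1 by rewrite divr_ge0 ?mulr_ge0// ltW.
have C0 : 0 < C by rewrite /C; lra.
have hoe n x y : distC (phi n (lambda n * x)) (phi n (lambda n * y)) <= C * (lambda n * `|x - y|) `^ g.
  have l0 : 0 <= lambda n by rewrite (le_trans _ (lambda_ge1 n)).
  have lD : distR (lambda n * x) (lambda n * y) = lambda n * `|x - y|.
    by rewrite /distR -mulrBr normrM ger0_norm.
  set z := lambda n * `|x - y| in lD *.
  have z0 : 0 <= z by rewrite mulr_ge0.
  have [zd|zd] := leP z d1.
    have zl : distR (lambda n * x) (lambda n * y) <= dl by rewrite lD (le_trans zd).
    have /andP[_ h] := bil n _ _ zl; rewrite lD in h; apply: (le_trans h).
    apply: (@le_trans _ _ (L * z `^ g)); last by rewrite ler_wpM2r ?powR_ge0// lerDl.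
    rewrite ler_wpM2l//; first by lra.
    have [->|zn0] := eqVneq z 0; first exact: powR_ge0.
    by rewrite ger1_powR// lt0r zn0 z0 (le_trans zd).
  have h2M : distC (phi n (lambda n * x)) (phi n (lambda n * y)) <= 2 * M.
    rewrite /distC; apply: le_trans (le_normcD _ _) _; rewrite normcN.
    by have := hM n (lambda n * x); have := hM n (lambda n * y); lra.
  apply: (le_trans h2M).
  apply: (@le_trans _ _ (2 * M / d1 * z `^ g)); last by rewrite ler_wpM2r ?powR_ge0// lerDr; lra.
  apply: (@le_trans _ _ (2 * M / d1 * d1)); first by rewrite divfK ?gt_eqF.
  rewrite ler_wpM2l//; apply: (@le_trans _ _ (d1 `^ g)).
    by rewrite ger1_powR// d10.
  by apply: ge0_ler_powR; rewrite ?nnegrE// ltW.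
pose V := C * Num.sqrt B + 1.
have V0 : 0 < V by rewrite /V ltr_wpDl// mulr_ge0 ?sqrtr_ge0 ?ltW.
have VB : C ^+ 2 * B <= V ^+ 2.
  rewrite -[B in leLHS]sqr_sqrtr// -exprMn ler_sqr ?nnegrE ?mulr_ge0 ?sqrtr_ge0 ?(ltW C0) ?(ltW V0)//.
  by rewrite /V lerDl.
exists V; split => // x y xy u v uv1.
set D := `|x - y|; have D0 : 0 < D by rewrite normr_gt0 subr_eq0.
set r := V * D `^ g.
have r0 : 0 < r by rewrite mulr_gt0// powR_gt0.
have -> : (fun w => expR ((u * (series_re w x - series_re w y) + v * (series_im w x - series_im w y)) / r)) =
   (fun w => expR (wave_series theta (diff_re (u / r) (v / r) x y) (diff_im (u / r) (v / r) x y) w)).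
  by apply/funext => w; rewrite -series_diff; congr expR; ring.
have cv := @cvg_series_scale R (2 * (`|u / r| + `|v / r|)) _ cvg_coef_dom.
refine (expect_exp_wave_series theta_indep theta_unif cv (dominated_diff (u / r) (v / r) x y) _).
move=> N; under eq_bigr do rewrite diff_sqr.
rewrite -mulr_sumr.
have -> : (u / r) ^+ 2 + (v / r) ^+ 2 = (u ^+ 2 + v ^+ 2) / r ^+ 2 by rewrite !expr_div_n mulrDl.
rewrite mulrAC ler_pdivrMr ?exprn_gt0// mul1r.
set S := \sum_(_ <= _ < _) _.
have S0 : 0 <= S by apply: sumr_ge0 => n _; exact: sqr_ge0.
apply: (@le_trans _ _ S); first by rewrite ler_piMl.
have DE : (D `^ g) ^+ 2 = D `^ (2 * g) by rewrite -powR_mulrn ?powR_ge0// -powRrM mulrC.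
apply: (@le_trans _ _ (C ^+ 2 * D `^ (2 * g) * B)).
  apply: le_trans (ler_wpM2l _ (hB N)); last by rewrite mulr_ge0 ?sqr_ge0 ?powR_ge0.
  rewrite /S mulr_sumr; apply: ler_sum => n _.
  have l0 : 0 <= lambda n by rewrite (le_trans _ (lambda_ge1 n)).
  have -> : C ^+ 2 * D `^ (2 * g) * (Normc.normc (a n) ^+ 2 * lambda n `^ (2 * g)) =
     (Normc.normc (a n) * (C * (lambda n * D) `^ g)) ^+ 2.
    rewrite powRM ?(ltW D0)// !exprMn DE -[lambda n `^ g ^+ 2]powR_mulrn ?powR_ge0// -powRrM.
    by rewrite [g * 2]mulrC; ring.
  rewrite ler_sqr ?nnegrE ?mulr_ge0 ?normc_ge0 ?powR_ge0 ?(ltW C0)//.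
  by rewrite ler_wpM2l ?normc_ge0.
rewrite /r exprMn DE mulrAC ler_wpM2r ?powR_ge0//.
Qed.

End RandomSeries.

(** * Energies of the image *)

Section FrostmanFamily.
Context (R : realType).
Implicit Types (s x y h : R) (A K E : set R).

Lemma dyadic_content0U s E E' : dyadic_content s E = 0%E -> dyadic_content s E' = 0%E ->
  dyadic_content s (E `|` E') = 0%E.
Proof.
move=> hE hE'; apply/eqP; rewrite eq_le dyadic_content_ge0 andbT.
apply/lee_addgt0Pr => e e0; rewrite add0e.
have e2 : (0 < (e / 2)%:E)%E by rewrite lte_fin divr_gt0.
have cov (X : set R) : dyadic_content s X = 0%E ->
    exists2 F, covers F X & (family_weight s F < (e / 2)%:E)%E.
  move=> hX; have : (dyadic_content s X < (e / 2)%:E)%E by rewrite hX.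
  by move=> /ereal_inf_lt[_ [F cF <-] h]; exists F.
have [F cF wF] := cov _ hE; have [G cG wG] := cov _ hE'.
apply: (@le_trans _ _ (family_weight s (F `|` G))).
  apply: dyadic_content_le => x [/cF[J FJ Jx]|/cG[J GJ Jx]]; exists J => //; [by left|by right].
apply: le_trans (family_weightU _ _ _) _.
by apply: le_trans (leeD (ltW wF) (ltW wG)) _; rewrite -EFinD -splitr.
Qed.

Lemma dyadic_content_gt0P s E : (0 < dyadic_content s E)%E <-> dyadic_content s E <> 0%E.
Proof. by rewrite lt0e dyadic_content_ge0 andbT; split => [/eqP|/eqP]. Qed.

(** The decay of the characteristic function is known only for nearby points, so the set is cut into
    short pieces; a finite union of pieces of content 0 has content 0. *)
Lemma dyadic_content_gt0_piece s E (a h : R) M : 0 < h ->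
  (0 < dyadic_content s (E `&` `[a, (a + M%:R * h)%R]))%E ->
  exists b, (0 < dyadic_content s (E `&` `[b, (b + h)%R]))%E.
Proof.
move=> h0; elim: M => [|M IH] hM.
  exists a; apply: lt_le_trans hM _; apply: le_dyadic_content => x [Ex].
  rewrite mul0r addr0 /= !in_itv/= => /andP[ax xa]; split => //=.
  by rewrite ax/= (le_trans xa)// lerDl ltW.
have [h1|/dyadic_content_gt0P] := pselect ((0 < dyadic_content s (E `&` `[a, (a + M%:R * h)%R]))%E).
  exact: IH.
move=> h1; exists (a + M%:R * h); apply/dyadic_content_gt0P => h2.
have h3 : dyadic_content s (E `&` `[a, a + M%:R * h]) = 0%E.
  exact: contrapT.
have := dyadic_content0U h3 h2; apply/dyadic_content_gt0P.
apply: lt_le_trans hM _; apply: le_dyadic_content => x [Ex].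
rewrite /= !in_itv/= => /andP[ax xa]; case: (leP x (a + M%:R * h)) => hx; [left|right];
  split => //; first by rewrite ax.
by rewrite (ltW hx)/= (le_trans xa)// -addrA -natr1 mulrDl mul1r.
Qed.

(* A set of dimension larger than s carries, at arbitrarily small diameter, a
   compact set of positive s-dimensional content. *)
Lemma compact_content_subset A s h : measurable A -> 0 < s -> 0 < h ->
  (s%:E < hausdorff_dim (@distR R) A)%E ->
  exists K b, [/\ compact K, K `<=` A, K `<=` `[b, b + h]%classic &
    (0 < dyadic_content s K)%E].
Proof.
move=> mA s0 h0 sA.
have cA : (0 < dyadic_content s A)%E.
  apply: dyadic_content_pos => //; apply/negP => /eqP H0.
  have : (hausdorff_dim (@distR R) A <= s%:E)%E.
    by apply: ereal_inf_lbound; exists s => //; split => //; exact: ltW.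
  by rewrite leNgt sA.
have [T hT] : exists T : nat, (0 < dyadic_content s (A `&` `[(- T%:R)%R, T%:R%R]))%E.
  apply: contrapT => /forallNP hn; move: cA; apply/negP; rewrite -leNgt.
  have -> : A = \bigcup_n (A `&` `[- n%:R, n%:R]).
    apply/seteqP; split => [x Ax|x [n _ []]]//.
    exists (Num.bound `|x|) => //; split => //=; rewrite in_itv/= -ler_norml ltW//.
    exact: archi_boundP.
  apply: dyadic_content_bigcup.
    move=> m n mn; apply/subsetPset => x [Ax]; rewrite /= !in_itv/= -!ler_norml => hx.
    by split => //; rewrite (le_trans hx)// ler_nat.
  by move=> n; rewrite leNgt; exact/negP/hn.
pose M := Num.bound (2 * T%:R / h).
have hM : 2 * T%:R <= M%:R * h.
  rewrite -ler_pdivrMr// ltW// /M; apply: archi_boundP.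
  by rewrite divr_ge0 ?mulr_ge0 ?ler0n// ltW.
have : (0 < dyadic_content s (A `&` `[(- T%:R)%R, (- T%:R + M%:R * h)%R]))%E.
  apply: lt_le_trans hT _; apply: le_dyadic_content => x [Ax]; rewrite /= !in_itv/=.
  move=> /andP[x1 x2]; split => //; rewrite x1/=; lra.
move=> /(dyadic_content_gt0_piece h0)[b hb].
have [K [cK KA K0]] := analytic_compact_content (borel_analytic mA) hb.
by exists K, b; split => // x /KA[].
Qed.

Definition frostman_const s e : R := 3 * 2 `^ e / (1 - 2 `^ (e - s)).

(* A measure is a list of (weight, atom) pairs; its Riesz potentials are cut off
   at distance 2^-N. *)
Definition frostman_at K s (c : R) N (mu : seq (R * R)) :=
  [/\ forall p, p \in mu -> K p.2 /\ 0 <= p.1,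
      c <= \sum_(p <- mu) p.1 &
      forall e x, 0 <= e -> e < s -> K x ->
        \sum_(p <- mu) p.1 * (Num.max `|x - p.2| (2^-1 ^+ N)) `^ (- e) <= frostman_const s e].

Lemma frostman_measures K s (b h : R) : 0 < s -> h <= 1 -> K `<=` `[b, b + h]%classic ->
  (0 < dyadic_content s K)%E ->
  exists2 c : R, 0 < c & forall N, exists mu, frostman_at K s c N mu.
Proof.
move=> s0 h1 Kb K0.
have [c c0 hc] : exists2 c : R, 0 < c & (c%:E <= dyadic_content s K)%E.
  case: (dyadic_content s K) K0 => [r|_|//]; last by exists 1 => //; exact: leey.
  by rewrite lte_fin => r0; exists r.
exists c => // N; have [mu [h2 h3 h4]] := discrete_frostman s N Kb.
exists mu; split => //; first by rewrite -lee_fin (le_trans hc).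
move=> e x e0 es Kx; apply: riesz_potential_le => // p pmu.
have [/Kb/= + p0] := h2 p pmu; move: Kx => /Kb/=; rewrite !in_itv/= => /andP[x1 x2] /andP[p1 p2].
by split => //; rewrite ler_norml; apply/andP; split; lra.
Qed.

End FrostmanFamily.

(** * Sums over plane frequencies *)

Section FrequencySums.
Context (R : realType).
Implicit Types (N M : nat) (e : R).

Lemma sum_diff_le N a (g : int -> R) : (forall k, 0 <= g k) -> (a < N)%N ->
  \sum_(0 <= b < N) g (a%:Z - b%:Z) <= \sum_(0 <= i < N + N) g (i%:Z - N%:Z).
Proof.
move=> g0 aN; rewrite big_nat_rev /= add0n.
have -> : \sum_(0 <= i < N) g (a%:Z - (N - i.+1)%:Z) =
    \sum_(0 + a.+1 <= i < N + a.+1) g (i%:Z - N%:Z).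
  rewrite big_addn addnK; apply: eq_big_nat => i /andP[_ iN]; congr g; lia.
rewrite add0n (@big_cat_nat _ _ _ a.+1 0%N (N + N)%N)//=; last by lia.
rewrite (@big_cat_nat _ _ _ (N + a.+1) a.+1 (N + N)%N)//=; [|lia|lia].
by rewrite addrCA lerDl addr_ge0// sumr_ge0.
Qed.

Lemma sum_diffC_le N b (g : int -> R) : (forall k, 0 <= g k) -> (b < N)%N ->
  \sum_(0 <= a < N) g (a%:Z - b%:Z) <= \sum_(0 <= i < N + N) g (i%:Z - N%:Z).
Proof.
move=> g0 bN.
have -> : \sum_(0 <= i < N) g (i%:Z - b%:Z) =
    \sum_(0 + (N - b) <= i < N + (N - b)) g (i%:Z - N%:Z).
  rewrite big_addn addnK; apply: eq_big_nat => i /andP[_ iN]; congr g; lia.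
rewrite add0n (@big_cat_nat _ _ _ (N - b) 0%N (N + N)%N)//=; last by lia.
rewrite (@big_cat_nat _ _ _ (N + (N - b)) (N - b) (N + N)%N)//=; [|lia|lia].
by rewrite addrCA lerDl addr_ge0// sumr_ge0.
Qed.

Definition freq_sum N (G : int -> int -> R) : R :=
  \sum_(0 <= i < N + N) \sum_(0 <= j < N + N) G (i%:Z - N%:Z) (j%:Z - N%:Z).

(* The index sums run over pairs of frequencies, whose differences cover
   [-N, N)^2; the quadratic weights are removed by 2 b b' <= b^2 + b'^2. *)
Lemma freq_sum_le N (b : nat -> R) (G : int -> int -> R) :
  (forall i j, 0 <= G i j) ->
  \sum_(0 <= i < N) \sum_(0 <= j < N) \sum_(0 <= i' < N) \sum_(0 <= j' < N)
     (b i * b j) * (b i' * b j') * G (i%:Z - i'%:Z) (j%:Z - j'%:Z) <=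
  (\sum_(0 <= i < N) b i ^+ 2) ^+ 2 * freq_sum N G.
Proof.
move=> G0; set B := \sum_(_ <= _ < _) b _ ^+ 2; set F := freq_sum N G.
have B2 : B ^+ 2 = \sum_(0 <= i < N) \sum_(0 <= j < N) (b i * b j) ^+ 2.
  rewrite expr2 /B mulr_suml; apply: eq_bigr => i _; rewrite mulr_sumr.
  by apply: eq_bigr => j _; rewrite exprMn.
have h1 i j : (i < N)%N -> (j < N)%N ->
    \sum_(0 <= i' < N) \sum_(0 <= j' < N) G (i%:Z - i'%:Z) (j%:Z - j'%:Z) <= F.
  move=> iN jN; apply: (@le_trans _ _ (\sum_(0 <= i' < N)
     \sum_(0 <= l < N + N) G (i%:Z - i'%:Z) (l%:Z - N%:Z))).
    by apply: ler_sum => i' _; apply: (@sum_diff_le N j (fun k => G (i%:Z - i'%:Z) k)).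
  apply: (@sum_diff_le N i (fun k => \sum_(0 <= l < N + N) G k (l%:Z - N%:Z))) => // k.
  by apply: sumr_ge0.
have h2 i' j' : (i' < N)%N -> (j' < N)%N ->
    \sum_(0 <= i < N) \sum_(0 <= j < N) G (i%:Z - i'%:Z) (j%:Z - j'%:Z) <= F.
  move=> iN jN; apply: (@le_trans _ _ (\sum_(0 <= i < N)
     \sum_(0 <= l < N + N) G (i%:Z - i'%:Z) (l%:Z - N%:Z))).
    by apply: ler_sum => i _; apply: (@sum_diffC_le N j' (fun k => G (i%:Z - i'%:Z) k)).
  apply: (@sum_diffC_le N i' (fun k => \sum_(0 <= l < N + N) G k (l%:Z - N%:Z))) => // k.
  by apply: sumr_ge0.
apply: (@le_trans _ _ (\sum_(0 <= i < N) \sum_(0 <= j < N) \sum_(0 <= i' < N) \sum_(0 <= j' < N)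
     (2^-1 * ((b i * b j) ^+ 2 * G (i%:Z - i'%:Z) (j%:Z - j'%:Z)) +
      2^-1 * ((b i' * b j') ^+ 2 * G (i%:Z - i'%:Z) (j%:Z - j'%:Z))))).
  apply: ler_sum => i _; apply: ler_sum => j _; apply: ler_sum => i' _; apply: ler_sum => j' _.
  set x := b i * b j; set y := b i' * b j'; set g := G _ _.
  have : 0 <= g * (x - y) ^+ 2 by rewrite mulr_ge0 ?sqr_ge0// /g G0.
  lra.
have -> : B ^+ 2 * F = 2^-1 * (B ^+ 2 * F) + 2^-1 * (B ^+ 2 * F) by lra.
under eq_bigr do under eq_bigr do under eq_bigr do rewrite big_split /=.
under eq_bigr do under eq_bigr do rewrite big_split /=.
under eq_bigr do rewrite big_split /=.
rewrite big_split /=; apply: lerD.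
  rewrite B2 mulr_suml mulr_sumr; apply: ler_sum_nat => i /andP[_ iN].
  rewrite mulr_suml mulr_sumr; apply: ler_sum_nat => j /andP[_ jN].
  under eq_bigr do rewrite -mulr_sumr -mulr_sumr.
  rewrite -mulr_sumr -mulr_sumr ler_pM2l ?invr_gt0//.
  by apply: ler_wpM2l; [exact: sqr_ge0|exact: h1].
rewrite B2.
under eq_bigr do rewrite exchange_big /=.
rewrite exchange_big /= mulr_suml mulr_sumr; apply: ler_sum_nat => i' /andP[_ iN].
under eq_bigr do rewrite exchange_big /=.
rewrite exchange_big /= mulr_suml mulr_sumr; apply: ler_sum_nat => j' /andP[_ jN].
under eq_bigr do rewrite -mulr_sumr -mulr_sumr.
rewrite -mulr_sumr -mulr_sumr ler_pM2l ?invr_gt0//.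
by apply: ler_wpM2l; [exact: sqr_ge0|exact: h2].
Qed.

(** Cauchy condensation: the terms with [n + 1] between [2^m] and [2^(m+1)] contribute at most
    [2^(- e m)]. *)
Lemma sum_power_bounded e : 0 < e ->
  exists2 V : R, 0 < V & forall M, \sum_(0 <= n < M) (n.+1%:R : R) `^ (- 1 - e) <= V.
Proof.
move=> e0; pose r := (2 : R) `^ (- e).
have r0 : 0 <= r by exact: powR_ge0.
have r1 : r < 1 by apply: powR2_lt1; rewrite oppr_lt0.
exists ((1 - r)^-1); first by rewrite invr_gt0 subr_gt0.
have block m : \sum_(0 <= n < (2 ^ m).-1) (n.+1%:R : R) `^ (- 1 - e) <= \sum_(j < m) r ^+ j.
  elim: m => [|m IH]; first by rewrite big_ord0 big_geq.
  have p0 : (0 < 2 ^ m)%N by rewrite expn_gt0.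
  rewrite (@big_cat_nat _ _ _ (2 ^ m).-1)//=; last by rewrite expnS; lia.
  rewrite big_ord_recr /= lerD//.
  apply: (@le_trans _ _ (\sum_((2 ^ m).-1 <= n < (2 ^ m.+1).-1) ((2 ^+ m : R) `^ (- 1 - e)))).
    apply: ler_sum_nat => n /andP[n1 _].
    have -> : - 1 - e = - (1 + e) by rewrite opprD.
    rewrite !powRN lef_pV2 ?posrE ?powR_gt0 ?exprn_gt0 ?ltr0n//.
    apply: ge0_ler_powR; rewrite ?nnegrE ?exprn_ge0 ?ler0n ?addr_ge0 ?(ltW e0)//.
    by rewrite -natrX ler_nat; lia.
  rewrite sumr_const_nat.
  have -> : ((2 ^ m.+1).-1 - (2 ^ m).-1 = 2 ^ m)%N by rewrite expnS; lia.
  rewrite -[leLHS]mulr_natl (_ : (2 ^ m)%:R = 2 ^+ m :> R); last by rewrite natrX.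
  have -> : (2 ^+ m : R) = 2 `^ m%:R by rewrite powR_mulrn.
  rewrite -powRrM -powRD; last by rewrite pnatr_eq0 implybT.
  rewrite /r -powR_mulrn ?powR_ge0// -powRrM.
  by rewrite le_eqVlt; apply/orP; left; apply/eqP; congr (_ `^ _); ring.
move=> M; apply: le_trans (sum_geometric_le M r0 r1); apply: le_trans (block M).
have MM : (M <= (2 ^ M).-1)%N by have := ltn_expl M (isT : (1 < 2)%N); lia.
rewrite [leRHS](@big_cat_nat _ _ _ M)//= lerDl sumr_ge0// => i _; exact: powR_ge0.
Qed.

Definition freq_size (i j : int) : R := 1 + `|i|%:~R + `|j|%:~R.

Lemma freq_size_ge1 i j : 1 <= freq_size i j.
Proof. by rewrite /freq_size -addrA lerDl addr_ge0// ler0z. Qed.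

Lemma sum_int_power_le e V M : 0 < e ->
  (forall M, \sum_(0 <= n < M) (n.+1%:R : R) `^ (- 1 - e) <= V) ->
  \sum_(0 <= i < M + M) (1 + `|i%:Z - M%:Z|%:~R : R) `^ (- 1 - e) <= 2 * V.
Proof.
move=> e0 hV; rewrite (@big_cat_nat _ _ _ M)//=; last by lia.
rewrite mulr2n mulrDl mul1r lerD//.
  rewrite big_nat_rev /= add0n; apply: (@le_trans _ _ (\sum_(0 <= n < M.+1) (n.+1%:R : R) `^ (- 1 - e))) => //.
  rewrite big_nat_recl//= -[leLHS]add0r lerD ?powR_ge0//.
  apply: ler_sum_nat => n /andP[_ nM]; rewrite le_eqVlt; apply/orP; left; apply/eqP; congr (_ `^ _).
  have -> : `|(M - n.+1)%:Z - M%:Z| = n.+1%:Z by lia.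
  by rewrite addrC natr1.
rewrite -[X in \sum_(X <= _ < _) _]add0n big_addn addnK.
apply: le_trans (hV M); apply: ler_sum_nat => n /andP[_ nM].
rewrite le_eqVlt; apply/orP; left; apply/eqP; congr (_ `^ _).
have -> : `|(n + M)%:Z - M%:Z| = n%:Z by lia.
by rewrite addrC natr1.
Qed.

(** [freq_size] dominates the size of either coordinate, so half of the exponent goes to each and
    the double sum splits into a product. *)
Lemma freq_sum_power_bounded e : 0 < e ->
  exists2 V : R, 0 < V & forall N, freq_sum N (fun i j => freq_size i j `^ (- 2 - 2 * e)) <= V.
Proof.
move=> e0; have [V V0 hV] := sum_power_bounded e0.
exists ((2 * V) ^+ 2) => [|N]; first by rewrite exprn_gt0 ?mulr_gt0.
have h := sum_int_power_le N e0 hV.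
pose v (k : int) : R := (1 + `|k|%:~R) `^ (- 1 - e).
have hv i j : freq_size i j `^ (- 2 - 2 * e) <= v i * v j.
  have -> : - 2 - 2 * e = (- 1 - e) + (- 1 - e) by ring.
  have f1 := freq_size_ge1 i j; have f0 := lt_le_trans ltr01 f1.
  rewrite powRD; last by rewrite (gt_eqF f0) implybT.
  have i0 : (0 : R) <= `|i|%:~R by rewrite ler0z.
  have j0 : (0 : R) <= `|j|%:~R by rewrite ler0z.
  have -> : - 1 - e = - (1 + e) by rewrite opprD.
  have mono (x y : R) : 0 < x -> x <= y -> y `^ (- (1 + e)) <= x `^ (- (1 + e)).
    move=> x0 xy; have y0 := lt_le_trans x0 xy.
    rewrite !powRN lef_pV2 ?posrE ?powR_gt0//.
    by apply: ge0_ler_powR; rewrite ?nnegrE; lra.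
  have vE k : v k = (1 + `|k|%:~R) `^ (- (1 + e)) by rewrite /v opprD.
  rewrite !vE; apply: ler_pM; rewrite ?powR_ge0//; apply: mono; rewrite /freq_size; lra.
apply: (@le_trans _ _ (freq_sum N (fun i j => v i * v j))).
  by apply: ler_sum => i _; apply: ler_sum => j _; exact: hv.
rewrite /freq_sum; under eq_bigr do rewrite -mulr_sumr.
rewrite -mulr_suml expr2.
by apply: ler_pM => //; apply: sumr_ge0 => i _; exact: powR_ge0.
Qed.

End FrequencySums.

(** * Trigonometric kernels *)

Section TrigonometricKernels.
Context (R : realType).
Implicit Types (N : nat) (b : nat -> R) (z : R).

Lemma sum_cos_diff (I : Type) (s : seq I) (c u : I -> R) :
  \sum_(p <- s) \sum_(p' <- s) c p * c p' * cos (u p - u p') =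
  (\sum_(p <- s) c p * cos (u p)) ^+ 2 + (\sum_(p <- s) c p * sin (u p)) ^+ 2.
Proof.
rewrite !expr2 !mulr_suml -big_split /=; apply: eq_bigr => p _.
rewrite !mulr_sumr -big_split /=; apply: eq_bigr => p' _.
by rewrite cosB; ring.
Qed.

(* [`| \sum_(i, j < N) b_i b_j exp (I (i z1 + j z2)) |^2], expanded. *)
Definition trig_kernel N b z1 z2 : R :=
  \sum_(0 <= i < N) \sum_(0 <= j < N) \sum_(0 <= i' < N) \sum_(0 <= j' < N)
     (b i * b j) * (b i' * b j') *
     cos ((i%:Z - i'%:Z)%:~R * z1 + (j%:Z - j'%:Z)%:~R * z2).

Lemma trig_kernelE N b z1 z2 : trig_kernel N b z1 z2 =
  (\sum_(0 <= i < N) \sum_(0 <= j < N) b i * b j * cos (i%:R * z1 + j%:R * z2)) ^+ 2 +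
  (\sum_(0 <= i < N) \sum_(0 <= j < N) b i * b j * sin (i%:R * z1 + j%:R * z2)) ^+ 2.
Proof.
pose s := [seq (i, j) | i <- index_iota 0 N, j <- index_iota 0 N].
have big_s (F : nat -> nat -> R) : \sum_(0 <= i < N) \sum_(0 <= j < N) F i j = \sum_(p <- s) F p.1 p.2.
  by rewrite /s big_allpairs.
rewrite !(big_s (fun i j => _ * _ * _)) -sum_cos_diff /trig_kernel.
rewrite (big_s (fun i j => \sum_(0 <= i' < N) \sum_(0 <= j' < N) (b i * b j) * (b i' * b j') *
     cos ((i%:Z - i'%:Z)%:~R * z1 + (j%:Z - j'%:Z)%:~R * z2))).
apply: eq_bigr => -[i j] _ /=.
rewrite (big_s (fun i' j' => (b i * b j) * (b i' * b j') *
     cos ((i%:Z - i'%:Z)%:~R * z1 + (j%:Z - j'%:Z)%:~R * z2))).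
by apply: eq_bigr => -[i' j'] _ /=; congr (_ * cos _); rewrite !intrB !mulrBl; ring.
Qed.

Lemma trig_kernel_ge0 N b z1 z2 : 0 <= trig_kernel N b z1 z2.
Proof. by rewrite trig_kernelE addr_ge0 ?sqr_ge0. Qed.

Lemma cos_ge_cos1 z : `|z| <= 1 -> cos 1 <= cos z.
Proof.
move=> z1; rewrite -(cos_norm z) leNgt ltr_cos -?leNgt// in_itv/= ?normr_ge0 ?ler01/=.
  by have := pi_ge2 R; lra.
by have := pi_ge2 R; lra.
Qed.

(** All phases [i z1 + j z2] are at most 1 in absolute value, so the [N^2] unit vectors have real
    part at least [cos 1]. In this way an energy detects pairs of points at distance about
    [1 / N]. *)
Lemma trig_kernel_near N z1 z2 : `|z1| <= (2 * N%:R)^-1 -> `|z2| <= (2 * N%:R)^-1 ->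
  cos 1 ^+ 2 * N%:R ^+ 4 <= trig_kernel N (fun=> 1) z1 z2.
Proof.
move=> h1 h2; rewrite trig_kernelE.
set A := \sum_(_ <= _ < _) _; have A2 : cos 1 * N%:R ^+ 2 <= A.
  rewrite /A.
  apply: (@le_trans _ _ (\sum_(0 <= i < N) \sum_(0 <= j < N) (cos 1 : R))).
    by rewrite !sumr_const_nat subn0 -[leRHS]mulr_natr -(mulr_natr (cos 1) N) expr2 mulrA.
  apply: ler_sum_nat => i /andP[_ iN]; apply: ler_sum_nat => j /andP[_ jN].
  rewrite !mul1r; apply: cos_ge_cos1; apply: (le_trans (ler_normD _ _)).
  have N0 : (0 : R) < N%:R by rewrite ltr0n; case: N iN {jN h1 h2 A}.
  have half (k : nat) (z : R) : (k < N)%N -> `|z| <= (2 * N%:R)^-1 -> `|k%:R * z| <= 2^-1.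
    move=> kN hz; rewrite normrM ger0_norm ?ler0n//.
    apply: (@le_trans _ _ (N%:R * (2 * N%:R)^-1)).
      by apply: ler_pM; rewrite ?ler0n// ler_nat ltnW.
    by rewrite invfM mulrCA mulfV ?gt_eqF// mulr1.
  by have := half _ _ iN h1; have := half _ _ jN h2; lra.
have A0 : 0 <= cos 1 * N%:R ^+ 2 :> R by rewrite mulr_ge0 ?exprn_ge0// ltW// cos1_gt0.
rewrite -[leLHS]addr0; apply: lerD; last exact: sqr_ge0.
apply: (@le_trans _ _ ((cos 1 * N%:R ^+ 2) ^+ 2)); last by rewrite ler_sqr ?nnegrE// (le_trans A0).
by rewrite exprMn -exprM.
Qed.

End TrigonometricKernels.

Lemma centered_le (l N : nat) : (l < N + N)%N -> `|l%:Z - N%:Z| <= N%:Z.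
Proof. by move=> h; lia. Qed.

Section PowRMonotone.
Context (R : realType).

Lemma ler_powR_ge_le1 (a x y : R) : 0 < a -> a <= 1 -> y <= x -> a `^ x <= a `^ y.
Proof.
move=> a0 a1 xy; rewrite -[leLHS]invrK -[leRHS]invrK lef_pV2 ?posrE ?invr_gt0 ?powR_gt0//.
have e z : (a `^ z)^-1 = a^-1 `^ z by rewrite -powR_inv1 ?powR_ge0// -powRrM mulrC powRrM powR_inv1 ?(ltW a0).
by rewrite !e; apply: ler_powR => //; rewrite invf_ge1.
Qed.

End PowRMonotone.

(** * Mean Fourier coefficients and energies of the image *)

Section DecorrelatedField.
Context (R : realType) (d : measure_display) (Omega : measurableType d).
Variables (P : probability Omega R) (X Y : Omega -> R -> R).
Implicit Types (x y t e c : R) (N : nat) (w : Omega) (mu : seq (R * R)).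

(* The power 3 makes the decay in (u, v) of order 6; a continuous density in
   the plane needs a little more than 4. *)
Definition decorrelated t c d0 := forall x y, x != y -> `|x - y| <= d0 -> forall u v : R,
  `|expect P (fun w => cos (u * (X w x - X w y) + v * (Y w x - Y w y)))|
  <= (1 + c * (u ^+ 2 + v ^+ 2) * `|x - y| `^ (2 * t))^-1 ^+ 3.

Hypothesis bX : forall x, bounded_rv (fun w => X w x).
Hypothesis bY : forall x, bounded_rv (fun w => Y w x).

Lemma bounded_rv_cos (f : Omega -> R) : bounded_rv f -> bounded_rv (fun w => cos (f w)).
Proof.
move=> [mf _]; apply: (@bounded_rv_continuous R d Omega f cos 1) => //.
  by move=> x; exact: continuous_cos.
by move=> x; exact: cos_max.
Qed.

Let Z x y u v w := u * (X w x - X w y) + v * (Y w x - Y w y).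

Lemma bounded_rv_diff x y (u v : R) : bounded_rv (fun w => cos (Z x y u v w)).
Proof.
by apply: bounded_rv_cos; apply: bounded_rvD; apply: bounded_rvZ; exact: bounded_rvB.
Qed.

Lemma expect_cos_le1 (f : Omega -> R) : bounded_rv f -> `|expect P (fun w => cos (f w))| <= 1.
Proof.
by move=> bf; apply: expect_norm_le; [exact: bounded_rv_cos|move=> w; exact: cos_max].
Qed.

(** The decay of order 6 is weakened to any order [b <= 6]. Points closer than [2^-N] get the
    trivial bound 1, and the restriction on [freq_size] makes this compatible with a distance cut
    off at [2^-N], the form in which the Frostman potentials are known. *)
Lemma fourier_decay t c d0 : 0 < t -> 0 < c -> d0 <= 1 -> decorrelated t c d0 ->
  exists2 C : R, 0 < C & forall x y N (i j : int) (b : R), `|x - y| <= d0 -> 0 <= b -> b <= 6 ->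
    freq_size R i j <= (2 ^+ N) `^ t ->
    `|expect P (fun w => cos (Z x y i%:~R j%:~R w))| <=
      C * freq_size R i j `^ (- b) * (Num.max `|x - y| (2^-1 ^+ N)) `^ (- (t * b)).
Proof.
move=> t0 c0 d01 dec.
(* The 3 comes from [(1 + |i| + |j|)^2 <= 3 (1 + i^2 + j^2)]; the minimum with 1 lets the 1 in
   [base] absorb the term free of [i] and [j]. *)
pose c' := Num.min c 1 / 3.
have c'0 : 0 < c' by rewrite divr_gt0// lt_min c0 ltr01.
have c'1 : c' <= 1 by rewrite ler_pdivrMr// mul1r ge_min; apply/orP; right; lra.
have C1 : 1 <= c' `^ (- 3).
  rewrite powRN invf_ge1 ?powR_gt0// powR_mulrn ?(ltW c'0)//.
  by apply: exprn_ile1 => //; exact: ltW.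
exists (c' `^ (- 3)) => [|x y N i j b xy b0 b6 kN]; first by rewrite (lt_le_trans ltr01).
set k := freq_size R i j in kN *.
have k1 : 1 <= k by exact: freq_size_ge1.
have k0 : 0 < k := lt_le_trans ltr01 k1.
have le1 := expect_cos_le1 (_ : bounded_rv (Z x y i%:~R j%:~R)).
have {}le1 : `|expect P (fun w => cos (Z x y i%:~R j%:~R w))| <= 1.
  by apply: le1; apply: bounded_rvD; apply: bounded_rvZ; exact: bounded_rvB.
have [close|far] := boolP (`|x - y| <= 2^-1 ^+ N).
  rewrite (max_idPr close); apply: (le_trans le1).
  have -> : (2^-1 ^+ N : R) `^ (- (t * b)) = ((2 ^+ N) `^ t) `^ b.
    have p2 : (0 : R) <= 2 ^+ N by exact: exprn_ge0.
    by rewrite exprVn -(powR_inv1 p2) -[RHS]powRrM -[LHS]powRrM; congr (_ `^ _); ring.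
  have kb0 : 0 < k `^ b by rewrite powR_gt0.
  rewrite powRN -mulrA; apply: (@le_trans _ _ ((k `^ b)^-1 * ((2 ^+ N) `^ t) `^ b)).
    rewrite mulrC ler_pdivlMr// mul1r.
    by apply: ge0_ler_powR; rewrite ?nnegrE ?powR_ge0 ?(ltW k0).
  by rewrite ler_peMl// mulr_ge0 ?invr_ge0 ?powR_ge0// ltW.
rewrite -ltNge in far; have D0 : 0 < `|x - y| by rewrite (lt_trans _ far)// exprn_gt0// invr_gt0.
rewrite (max_idPl (ltW far)).
have xny : x != y by rewrite -subr_eq0 -normr_gt0.
have := dec x y xny xy i%:~R j%:~R.
set D := `|x - y| in xy far D0 *; set E := `|expect _ _| => hE.
set base := 1 + _ in hE.
have D1 : D `^ t <= 1 by apply: le_trans (ge0_ler_powR _ _ _ (le_trans xy d01)) _; rewrite ?nnegrE ?powR1 ?(ltW t0) ?(ltW D0).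
have Dt0 : 0 < D `^ t by rewrite powR_gt0.
have DE : D `^ (2 * t) = (D `^ t) ^+ 2 by rewrite mulrC powRrM powR_mulrn// ltW.
have sq (l : int) : (`|l|%:~R : R) ^+ 2 = l%:~R ^+ 2 by rewrite intr_norm real_normK ?num_real.
have k3 : k ^+ 2 <= 3 * (1 + (i%:~R ^+ 2 + j%:~R ^+ 2)).
  rewrite /k /freq_size -(sq i) -(sq j); set p : R := `|i|%:~R; set r : R := `|j|%:~R.
  have := sqr_ge0 (1 - p); have := sqr_ge0 (1 - r); have := sqr_ge0 (p - r); lra.
have b1 : (c' * (k * D `^ t) ^+ 2) <= base.
  rewrite /base DE exprMn /c'; set m := Num.min c 1; set n : R := i%:~R ^+ 2 + j%:~R ^+ 2 in k3 *.
  set D2 := (D `^ t) ^+ 2.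
  have n0 : 0 <= n by rewrite addr_ge0 ?sqr_ge0.
  have D20 : 0 <= D2 by exact: sqr_ge0.
  have D21 : D2 <= 1 by rewrite /D2 expr_le1// ltW.
  have m0 : 0 <= m by rewrite le_min (ltW c0) ler01.
  have m1 : m <= 1 by rewrite ge_min lexx orbT.
  have mc : m <= c by rewrite ge_min lexx.
  apply: (@le_trans _ _ (m * (1 + n) * D2)).
    have h : k ^+ 2 / 3 <= 1 + n by rewrite ler_pdivrMr// mulrC.
    have := ler_wpM2r D20 (ler_wpM2l m0 h); lra.
  have : m * D2 <= 1 by apply: mulr_ile1.
  have := ler_wpM2r D20 (ler_wpM2r n0 mc); lra.
have base1 : 1 <= base by rewrite /base lerDl !mulr_ge0 ?powR_ge0 ?addr_ge0 ?sqr_ge0// ltW.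
have base0 : 0 < base := lt_le_trans ltr01 base1.
apply: (le_trans hE).
have -> : base^-1 ^+ 3 = base `^ (- 3) by rewrite exprVn powRN powR_mulrn// ltW.
apply: (@le_trans _ _ (base `^ (- (b / 2)))).
  by apply: ler_powR => //; lra.
have kD0 : 0 < k * D `^ t by rewrite mulr_gt0.
apply: (@le_trans _ _ ((c' * (k * D `^ t) ^+ 2) `^ (- (b / 2)))).
  have cb0 : 0 < c' * (k * D `^ t) ^+ 2 by exact: mulr_gt0 c'0 (exprn_gt0 _ kD0).
  rewrite !powRN lef_pV2 ?posrE ?powR_gt0//.
  apply: ge0_ler_powR => //; first by rewrite divr_ge0.
    by rewrite nnegrE ltW.
  by rewrite nnegrE ltW.
rewrite powRM ?sqr_ge0 ?(ltW c'0)//.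
have -> : ((k * D `^ t) ^+ 2) `^ (- (b / 2)) = k `^ (- b) * D `^ (- (t * b)).
  rewrite -powR_mulrn ?(ltW kD0)// -powRrM powRM ?(ltW k0) ?powR_ge0// -powRrM.
  by congr (_ `^ _ * _ `^ _); lra.
rewrite -[leRHS]mulrA; apply: ler_wpM2r; first by rewrite mulr_ge0 ?powR_ge0.
by apply: ler_powR_ge_le1; lra.
Qed.

(** The squared modulus of the Fourier coefficient at [(i, j)] of the image of [mu]. The double sum
    is the form in which expectations are taken. *)
Definition fourier_energy mu (i j : int) w : R := \sum_(p <- mu) \sum_(p' <- mu)
  p.1 * p'.1 * cos (i%:~R * (X w p.2 - X w p'.2) + j%:~R * (Y w p.2 - Y w p'.2)).

Lemma fourier_energyE mu (i j : int) w : fourier_energy mu i j w =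
  (\sum_(p <- mu) p.1 * cos (i%:~R * X w p.2 + j%:~R * Y w p.2)) ^+ 2 +
  (\sum_(p <- mu) p.1 * sin (i%:~R * X w p.2 + j%:~R * Y w p.2)) ^+ 2.
Proof.
rewrite -sum_cos_diff; apply: eq_bigr => p _; apply: eq_bigr => p' _.
by congr (_ * cos _); ring.
Qed.

Lemma fourier_energy_ge0 mu (i j : int) w : 0 <= fourier_energy mu i j w.
Proof. by rewrite fourier_energyE addr_ge0 ?sqr_ge0. Qed.

Lemma bounded_rv_fourier_energy mu (i j : int) : bounded_rv (fourier_energy mu i j).
Proof.
apply: bounded_rv_sum => p; apply: bounded_rv_sum => p'; apply: bounded_rvZ.
exact: bounded_rv_diff.
Qed.

Lemma expect_ge0 (f : Omega -> R) : bounded_rv f -> (forall w, 0 <= f w) -> 0 <= expect P f.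
Proof.
move=> bf f0; rewrite -(expect_cst P 0); apply: le_expect => //; exact: bounded_rv_cst.
Qed.

(** Summing [fourier_decay] over pairs of atoms leaves a Riesz potential of order [t b], bounded
    because [t b < s]. The total mass is bounded by the potential of order 0. *)
Lemma expect_fourier_energy t c d0 s (K : set R) :
  0 < t -> 0 < c -> d0 <= 1 -> decorrelated t c d0 -> 0 < s ->
  (forall x y, K x -> K y -> `|x - y| <= d0) ->
  exists2 C : R, 0 < C & forall c' N mu (i j : int) (b : R), frostman_at K s c' N mu ->
    0 <= b -> b <= 6 -> t * b < s -> freq_size R i j <= (2 ^+ N) `^ t ->
    expect P (fourier_energy mu i j) <=
      C * frostman_const s (t * b) * freq_size R i j `^ (- b).
Proof.
move=> t0 c0 d01 dec s0 Kd.
have [C C0 hC] := fourier_decay t0 c0 d01 dec.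
have F0 e : e < s -> 0 < frostman_const s e.
  move=> es; rewrite /frostman_const divr_gt0// ?mulr_gt0 ?powR_gt0// subr_gt0.
  by apply: powR2_lt1; rewrite subr_lt0.
exists (C * frostman_const s 0) => [|c' N mu i j b [hmu _ pot] b0 b6 tbs kN].
  by rewrite mulr_gt0 ?F0.
have tb0 : 0 <= t * b by rewrite mulr_ge0// ltW.
set k := freq_size R i j in kN *.
have mass : \sum_(p <- mu) p.1 <= frostman_const s 0.
  have [e|[p pmu]] : mu = [::] \/ exists p, p \in mu.
    by case: (mu) => [|p l]; [left|right; exists p; rewrite inE eqxx].
    by rewrite e big_nil ltW// F0.
  have [Kp _] := hmu p pmu; apply: le_trans (pot 0 p.2 (lexx 0) s0 Kp).
  rewrite big_seq [leRHS]big_seq; apply: ler_sum => p' p'mu.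
  by rewrite oppr0 powRr0 mulr1.
rewrite /fourier_energy expect_sum; last first.
  move=> p; apply: bounded_rv_sum => p'; apply: bounded_rvZ; exact: bounded_rv_diff.
apply: (@le_trans _ _ (\sum_(p <- mu) p.1 * (C * k `^ (- b) * frostman_const s (t * b)))); last first.
  rewrite -mulr_suml; apply: (@le_trans _ _ (frostman_const s 0 * (C * k `^ (- b) * frostman_const s (t * b)))).
    by apply: ler_wpM2r mass; exact: mulr_ge0 (mulr_ge0 (ltW C0) (powR_ge0 _ _)) (ltW (F0 _ tbs)).
  by rewrite le_eqVlt; apply/orP; left; apply/eqP; ring.
rewrite big_seq [leRHS]big_seq; apply: ler_sum => p pmu.
have [Kp p0] := hmu p pmu.
rewrite expect_sum; last by move=> p'; apply: bounded_rvZ; exact: bounded_rv_diff.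
apply: (@le_trans _ _ (p.1 * (C * k `^ (- b) *
    \sum_(p' <- mu) p'.1 * (Num.max `|p.2 - p'.2| (2^-1 ^+ N)) `^ (- (t * b))))); last first.
  by rewrite ler_wpM2l// ler_wpM2l ?mulr_ge0 ?powR_ge0 ?(ltW C0)//; exact: pot.
rewrite mulrA mulr_sumr big_seq [leRHS]big_seq; apply: ler_sum => p' p'mu.
have [Kp' p'0] := hmu p' p'mu.
rewrite (expectZ P _ (bounded_rv_diff p.2 p'.2 i%:~R j%:~R)).
have := hC p.2 p'.2 N i j b (Kd _ _ Kp Kp') b0 b6 kN => /(le_trans (ler_norm _)).
move=> /(ler_wpM2l (mulr_ge0 p0 p'0)) /le_trans; apply.
by rewrite le_eqVlt; apply/orP; left; apply/eqP; rewrite -/k; ring.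
Qed.

Definition kernel_energy N (b : nat -> R) mu w : R := \sum_(p <- mu) \sum_(p' <- mu)
  p.1 * p'.1 * trig_kernel N b (X w p.2 - X w p'.2) (Y w p.2 - Y w p'.2).

Lemma kernel_energyE N (b : nat -> R) mu w : kernel_energy N b mu w =
  \sum_(0 <= i < N) \sum_(0 <= j < N) \sum_(0 <= i' < N) \sum_(0 <= j' < N)
     (b i * b j) * (b i' * b j') * fourier_energy mu (i%:Z - i'%:Z) (j%:Z - j'%:Z) w.
Proof.
rewrite /kernel_energy /trig_kernel.
under eq_bigr => p _ do under eq_bigr => p' _ do rewrite mulr_sumr.
under eq_bigr => p _ do rewrite exchange_big /=.
rewrite exchange_big /=; apply: eq_bigr => i _.
under eq_bigr => p _ do under eq_bigr => p' _ do rewrite mulr_sumr.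
under eq_bigr => p _ do rewrite exchange_big /=.
rewrite exchange_big /=; apply: eq_bigr => j _.
under eq_bigr => p _ do under eq_bigr => p' _ do rewrite mulr_sumr.
under eq_bigr => p _ do rewrite exchange_big /=.
rewrite exchange_big /=; apply: eq_bigr => i' _.
under eq_bigr => p _ do under eq_bigr => p' _ do rewrite mulr_sumr.
under eq_bigr => p _ do rewrite exchange_big /=.
rewrite exchange_big /=; apply: eq_bigr => j' _.
rewrite /fourier_energy mulr_sumr; apply: eq_bigr => p _.
rewrite mulr_sumr; apply: eq_bigr => p' _; ring.
Qed.

Lemma kernel_energy_ge0 N (b : nat -> R) mu w : (forall p, p \in mu -> 0 <= p.1) ->
  0 <= kernel_energy N b mu w.
Proof.
move=> mu0; rewrite /kernel_energy big_seq; apply: sumr_ge0 => p pmu.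
rewrite big_seq; apply: sumr_ge0 => p' p'mu.
by apply: mulr_ge0 (trig_kernel_ge0 _ _ _ _); apply: mulr_ge0; exact: mu0.
Qed.

Lemma bounded_rv_kernel_energy N (b : nat -> R) mu : bounded_rv (kernel_energy N b mu).
Proof.
rewrite (_ : kernel_energy N b mu = fun w => \sum_(0 <= i < N) \sum_(0 <= j < N)
    \sum_(0 <= i' < N) \sum_(0 <= j' < N) (b i * b j) * (b i' * b j') *
    fourier_energy mu (i%:Z - i'%:Z) (j%:Z - j'%:Z) w).
  do 4 (apply: bounded_rv_sum => ?); apply: bounded_rvZ; exact: bounded_rv_fourier_energy.
by apply/funext => w; exact: kernel_energyE.
Qed.

Lemma expect_kernel_energy N (b : nat -> R) mu : expect P (kernel_energy N b mu) <=
  (\sum_(0 <= i < N) b i ^+ 2) ^+ 2 *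
  freq_sum N (fun i j => expect P (fourier_energy mu i j)).
Proof.
apply: le_trans (freq_sum_le _ _ _); last first.
  move=> i j; apply: expect_ge0; [exact: bounded_rv_fourier_energy|exact: fourier_energy_ge0].
rewrite le_eqVlt; apply/orP; left; apply/eqP.
rewrite (_ : kernel_energy N b mu = fun w => \sum_(0 <= i < N) \sum_(0 <= j < N)
    \sum_(0 <= i' < N) \sum_(0 <= j' < N) (b i * b j) * (b i' * b j') *
    fourier_energy mu (i%:Z - i'%:Z) (j%:Z - j'%:Z) w); last first.
  by apply/funext => w; exact: kernel_energyE.
have bf i j := bounded_rv_fourier_energy mu i j.
have bfz i j c := bounded_rvZ c (bf i j).
rewrite expect_sum; last by move=> i; do 3 (apply: bounded_rv_sum => ?); exact: bfz.
apply: eq_bigr => i _.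
rewrite expect_sum; last by move=> j; do 2 (apply: bounded_rv_sum => ?); exact: bfz.
apply: eq_bigr => j _.
rewrite expect_sum; last by move=> i'; apply: bounded_rv_sum => ?; exact: bfz.
apply: eq_bigr => i' _.
rewrite expect_sum; last by move=> j'; exact: bfz.
by apply: eq_bigr => j' _; rewrite expectZ.
Qed.

(** [k^(-b)] need not be summable over the plane lattice. Since frequencies stay below
    [1 + 2 N <= 3 N], it is at most [(3 N)^(2 + 2 e - b)] times the summable [k^(-2 - 2 e)]. *)
Lemma expect_kernel_energy_le t c d0 s (K : set R) (e b : R) :
  0 < t -> 0 < c -> d0 <= 1 -> decorrelated t c d0 -> 0 < s ->
  (forall x y, K x -> K y -> `|x - y| <= d0) ->
  0 < e -> 0 <= b -> b <= 6 -> b <= 2 + 2 * e -> t * b < s ->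
  exists2 C : R, 0 < C & forall c' M N mu, (0 < N)%N -> frostman_at K s c' M mu ->
    1 + 2 * N%:R <= ((2 : R) ^+ M) `^ t ->
    expect P (kernel_energy N (fun=> 1) mu) <= C * N%:R ^+ 4 * N%:R `^ (2 * e - b).
Proof.
move=> t0 c0 d01 dec s0 Kd e0 b0 b6 be tbs.
have [C C0 hC] := expect_fourier_energy t0 c0 d01 dec s0 Kd.
have [V V0 hV] := freq_sum_power_bounded e0.
set F := frostman_const s (t * b).
have F0 : 0 < F.
  rewrite /F /frostman_const divr_gt0// ?mulr_gt0 ?powR_gt0// subr_gt0.
  by apply: powR2_lt1; rewrite subr_lt0.
pose g := 2 + 2 * e - b.
have g0 : 0 <= g by rewrite /g; lra.
exists (C * frostman_const s (t * b) * 3 `^ g * V) => [|c' M N mu N0 hmu NM].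
  exact: mulr_gt0 (mulr_gt0 (mulr_gt0 C0 F0) (powR_gt0 _ _)) V0.
have N1 : (1 : R) <= N%:R by rewrite ler1n.
have N0' : (0 : R) < N%:R := lt_le_trans ltr01 N1.
apply: (le_trans (expect_kernel_energy _ _ _)).
have -> : \sum_(0 <= i < N) (1 : R) ^+ 2 = N%:R.
  by under eq_bigr do rewrite expr1n; rewrite sumr_const_nat subn0.
rewrite -/F.
apply: (@le_trans _ _ (N%:R ^+ 2 * (C * F * (3 * N%:R) `^ g * V))).
  rewrite ler_wpM2l ?exprn_ge0//.
  apply: (@le_trans _ _ (C * F * (3 * N%:R) `^ g *
     freq_sum N (fun i j => freq_size R i j `^ (- 2 - 2 * e)))); last first.
    by apply: ler_wpM2l (hV N); exact: mulr_ge0 (mulr_ge0 (ltW C0) (ltW F0)) (powR_ge0 _ _).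
  rewrite /freq_sum mulr_sumr; apply: ler_sum_nat => i /andP[_ iN].
  rewrite mulr_sumr; apply: ler_sum_nat => j /andP[_ jN].
  set k := freq_size R _ _.
  have k1 : 1 <= k by exact: freq_size_ge1.
  have k0 : 0 < k := lt_le_trans ltr01 k1.
  have kN : k <= 1 + 2 * N%:R.
    have h (l : nat) : (l < N + N)%N -> `|l%:Z - N%:Z|%:~R <= N%:R :> R.
      by move=> lN; rewrite pmulrn ler_int centered_le.
    by have := h i iN; have := h j jN; rewrite /k /freq_size; lra.
  have := hC c' M mu (i%:Z - N%:Z) (j%:Z - N%:Z) b hmu b0 b6 tbs (le_trans kN NM).
  rewrite -/k -/F => /le_trans; apply.
  rewrite -[leRHS]mulrA; apply: ler_wpM2l; first exact: mulr_ge0 (ltW C0) (ltW F0).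
  have -> : k `^ (- b) = k `^ g * k `^ (- 2 - 2 * e).
    rewrite -powRD; first by congr (_ `^ _); rewrite /g; lra.
    by rewrite (gt_eqF k0) implybT.
  rewrite ler_wpM2r ?powR_ge0//; apply: ge0_ler_powR => //; rewrite ?nnegrE ?(ltW k0)//.
  by lra.
rewrite powRM// ?(ltW N0')// -[leRHS]mulrA.
have -> : N%:R ^+ 4 * N%:R `^ (2 * e - b) = N%:R ^+ 2 * N%:R `^ g :> R.
  have -> : g = 2%:R + (2 * e - b) by rewrite /g; lra.
  rewrite [in RHS]powRD; last by rewrite (gt_eqF N0') implybT.
  by rewrite [N%:R `^ 2%:R]powR_mulrn ?(ltW N0')//; ring.
by rewrite le_eqVlt; apply/orP; left; apply/eqP; ring.
Qed.

Lemma powR2_unbounded t (B : R) : 0 < t -> exists M, B <= ((2 : R) ^+ M) `^ t.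
Proof.
move=> t0; have [B0|B0] := leP B 0; first by exists 0%N; rewrite (le_trans B0)// powR_ge0.
exists (Num.bound (B `^ t^-1)).
have h := archi_boundP (powR_ge0 B t^-1); set M := Num.bound _ in h *.
have -> : B = (B `^ t^-1) `^ t by rewrite -powRrM mulVf ?powRr1 ?(ltW B0)// gt_eqF.
apply: ge0_ler_powR; rewrite ?nnegrE ?powR_ge0 ?exprn_ge0 ?(ltW t0)//.
by apply: le_trans (ltW h) _; rewrite -natrX ler_nat ltnW// ltn_expl.
Qed.

End DecorrelatedField.

(** * Energies bounded along infinitely many scales *)

Section EnergyBounds.
Context (R : realType) (d : measure_display) (Omega : measurableType d).
Variables (P : probability Omega R) (X Y : Omega -> R -> R).
Hypothesis bX : forall x, bounded_rv (fun w => X w x).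
Hypothesis bY : forall x, bounded_rv (fun w => Y w x).
Variables (t c d0 s c' : R) (K : set R).
Hypotheses (t0 : 0 < t) (c0 : 0 < c) (d01 : d0 <= 1).
Hypothesis dec : decorrelated P X Y t c d0.
Hypothesis s0 : 0 < s.
Hypothesis Kd : forall x y, K x -> K y -> `|x - y| <= d0.
Hypothesis frostman : forall N, exists mu, frostman_at K s c' N mu.
Implicit Types (b e r : R) (N n J : nat) (w : Omega).

Let unit_weight : nat -> R := fun=> 1.

(** A discrete [b]-energy: the kernel of level [n] divided by [2^(4 n)] is of order 1 for points
    closer than about [2^-n], and it receives the weight [2^(n b)]. *)
Lemma dyadic_energy_often b : 0 < b -> b < 2 -> t * b < s ->
  exists mu : nat -> seq (R * R), (forall J, exists M, frostman_at K s c' M (mu J)) /\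
  {ae P, forall w, exists B : R, forall N, exists2 J, (N <= J)%N &
    \sum_(0 <= n < J) ((2 ^ n)%:R `^ b / (2 ^ n)%:R ^+ 4) *
       kernel_energy X Y (2 ^ n) unit_weight (mu J) w <= B}.
Proof.
move=> b0 b2 tbs.
(* The gap [b' - b] makes the levels summable: with [e = (b' - b) / 4], level [n] contributes at
   most a constant times [2^(- n (b' - b) / 2)]. *)
have [b' [bb' b'2 tb's]] : exists b', [/\ b < b', b' < 2 & t * b' < s].
  have bs : b < s / t by rewrite ltr_pdivlMr// mulrC.
  pose m := Num.min 2 (s / t).
  have bm : b < m by rewrite lt_min b2.
  have m2 : m <= 2 by rewrite ge_min lexx.
  have ms : m <= s / t by rewrite ge_min lexx orbT.
  exists ((b + m) / 2); split; [lra|lra|].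
  by rewrite mulrC -ltr_pdivlMr//; lra.
pose e := (b' - b) / 4.
have e0 : 0 < e by rewrite divr_gt0// subr_gt0.
have [C C0 hC] := @expect_kernel_energy_le _ _ _ P X Y bX bY t c d0 s K e b' t0 c0 d01 dec s0 Kd e0
  ltac:(lra) ltac:(lra) ltac:(rewrite /e; lra) tb's.
(* The measure must be finer than the levels it is tested on: [M] is taken so large that all
   frequencies up to [2^J] are admissible in [fourier_decay]. *)
have /choice[mu hmu] : forall J, exists mu, exists M,
    frostman_at K s c' M mu /\ 1 + 2 * (2 ^ J)%:R <= ((2 : R) ^+ M) `^ t.
  move=> J; have [M hM] := powR2_unbounded (1 + 2 * (2 ^ J)%:R) t0.
  by have [mu hmu] := frostman M; exists mu, M.
exists mu; split; first by move=> J; have [M [hM _]] := hmu J; exists M.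
have mu0 J p : p \in mu J -> 0 <= p.1.
  by have [M [[h _ _] _]] := hmu J; move=> /h[].
pose r := (2 : R) `^ (- (b' - b) / 2).
have r0 : 0 <= r by exact: powR_ge0.
have r1 : r < 1 by apply: powR2_lt1; lra.
apply: (@liminf_bounded_expect _ _ _ P _ (C * (1 - r)^-1)).
- move=> J; apply: bounded_rv_sum => n; apply: bounded_rvZ; exact: bounded_rv_kernel_energy.
- move=> J w; apply: sumr_ge0 => n _; apply: mulr_ge0.
    by rewrite divr_ge0 ?powR_ge0 ?exprn_ge0.
  by apply: kernel_energy_ge0; exact: mu0.
move=> J; rewrite expect_sum; last first.
  by move=> n; apply: bounded_rvZ; exact: bounded_rv_kernel_energy.
apply: (@le_trans _ _ (\sum_(n < J) C * r ^+ n)); last first.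
  by rewrite -mulr_sumr ler_wpM2l ?(ltW C0)// sum_geometric_le.
rewrite big_mkord; apply: ler_sum => -[n nJ] _ /=.
rewrite expectZ; last exact: bounded_rv_kernel_energy.
have p0 : (0 : R) < (2 ^ n)%:R by rewrite ltr0n expn_gt0.
have [M [hM hJ]] := hmu J.
have h : 1 + 2 * (2 ^ n)%:R <= ((2 : R) ^+ M) `^ t.
  by apply: le_trans hJ; rewrite lerD2l ler_wpM2l// ler_nat leq_exp2l// ltnW.
have := hC c' M (2 ^ n)%N (mu J); rewrite expn_gt0 => /(_ isT hM h) hE.
have w0 : 0 <= (2 ^ n)%:R `^ b / (2 ^ n)%:R ^+ 4 :> R by rewrite divr_ge0 ?powR_ge0 ?exprn_ge0// ltW.
apply: (le_trans (ler_wpM2l w0 hE)).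
have -> : (2 ^ n)%:R `^ b / (2 ^ n)%:R ^+ 4 * (C * (2 ^ n)%:R ^+ 4 * (2 ^ n)%:R `^ (2 * e - b')) =
    C * ((2 ^ n)%:R `^ b * (2 ^ n)%:R `^ (2 * e - b')).
  by field; rewrite gt_eqF.
rewrite ler_wpM2l ?(ltW C0)// -powRD; last by rewrite (gt_eqF p0) implybT.
rewrite natrX -powR_mulrn// -powRrM -powR_mulrn// /r -powRrM.
by rewrite le_eqVlt; apply/orP; left; apply/eqP; congr (_ `^ _); rewrite /e; lra.
Qed.

(** There is now room for the decay exponent [2 + 2 e], for which [N^(2 e - b)] is [N^(-2)]: the
    growth expected of a square integrable image density. *)
Lemma top_energy_often : 2 * t < s ->
  exists mu : nat -> seq (R * R), (forall J, exists M, frostman_at K s c' M (mu J)) /\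
  {ae P, forall w, exists B : R, forall N, exists2 J, (N <= J)%N &
    kernel_energy X Y (2 ^ J) unit_weight (mu J) w <= B * (2 ^ J)%:R ^+ 2}.
Proof.
move=> ts.
have [e [e0 e1 tes]] : exists e, [/\ 0 < e, e <= 1 & t * (2 + 2 * e) < s].
  exists (Num.min 1 ((s - 2 * t) / (4 * t))).
  have h : 0 < (s - 2 * t) / (4 * t) by rewrite divr_gt0 ?mulr_gt0// subr_gt0.
  split; [by rewrite lt_min ltr01|by rewrite ge_min lexx|].
  set e := Num.min _ _; have : e <= (s - 2 * t) / (4 * t) by rewrite ge_min lexx orbT.
  rewrite ler_pdivlMr ?mulr_gt0//; lra.
have [C C0 hC] := @expect_kernel_energy_le _ _ _ P X Y bX bY t c d0 s K e (2 + 2 * e) t0 c0 d01 dec s0 Kd e0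
  ltac:(lra) ltac:(lra) (lexx _) tes.
have /choice[mu hmu] : forall J, exists mu, exists M,
    frostman_at K s c' M mu /\ 1 + 2 * (2 ^ J)%:R <= ((2 : R) ^+ M) `^ t.
  move=> J; have [M hM] := powR2_unbounded (1 + 2 * (2 ^ J)%:R) t0.
  by have [mu hmu] := frostman M; exists mu, M.
exists mu; split; first by move=> J; have [M [hM _]] := hmu J; exists M.
have mu0 J p : p \in mu J -> 0 <= p.1.
  by have [M [[h _ _] _]] := hmu J; move=> /h[].
have : {ae P, forall w, exists B : R, forall N, exists2 J, (N <= J)%N &
    ((2 ^ J)%:R ^+ 2)^-1 * kernel_energy X Y (2 ^ J) unit_weight (mu J) w <= B}.
  apply: (@liminf_bounded_expect _ _ _ P _ C).
  - by move=> J; apply: bounded_rvZ; exact: bounded_rv_kernel_energy.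
  - move=> J w; apply: mulr_ge0; first by rewrite invr_ge0 exprn_ge0.
    by apply: kernel_energy_ge0; exact: mu0.
  move=> J; rewrite expectZ; last exact: bounded_rv_kernel_energy.
  have p0 : (0 : R) < (2 ^ J)%:R by rewrite ltr0n expn_gt0.
  have [M [hM hJ]] := hmu J.
  have := hC c' M (2 ^ J)%N (mu J); rewrite expn_gt0 => /(_ isT hM hJ) hE.
  rewrite mulrC ler_pdivrMr ?exprn_gt0//; apply: (le_trans hE).
  have -> : 2 * e - (2 + 2 * e) = - 2 :> R by lra.
  rewrite powRN powR_mulrn ?(ltW p0)//.
  by rewrite le_eqVlt; apply/orP; left; apply/eqP; field; rewrite gt_eqF.
apply: filterS => w [B hB]; exists B => N; have [J NJ h] := hB N; exists J => //.
by rewrite -ler_pdivrMr ?exprn_gt0 ?ltr0n ?expn_gt0// mulrC.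
Qed.

End EnergyBounds.

(** * From energies to dimension, area and interior *)

Section ImageDimension.
Context (R : realType) (d : measure_display) (Omega : measurableType d).
Variables (X Y : Omega -> R -> R) (w : Omega).
Implicit Types (b c s B : R) (mu : seq (R * R)) (K : set R).

Let unit_weight : nat -> R := fun=> 1.

(* Two points of a set whose image has diameter about 2^-n contribute to the
   energy of level n, hence Cauchy-Schwarz over the sets of the cover. *)
Lemma finite_cover_energy mu b c B J M (V : nat -> set R) (n : nat -> nat) :
  0 < c -> 0 < B -> c <= \sum_(p <- mu) p.1 -> (forall p, p \in mu -> 0 <= p.1) ->
  \sum_(0 <= l < J) ((2 ^ l)%:R `^ b / (2 ^ l)%:R ^+ 4) *
       kernel_energy X Y (2 ^ l) unit_weight mu w <= B ->
  (forall p, p \in mu -> exists2 i, (i < M)%N & V i p.2) ->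
  (forall i, (i < M)%N -> (n i < J)%N) ->
  (forall i x y, V i x -> V i y -> `|X w x - X w y| <= (2 * (2 ^ n i)%:R)^-1 /\
                                  `|Y w x - Y w y| <= (2 * (2 ^ n i)%:R)^-1) ->
  c ^+ 2 * cos 1 ^+ 2 / (4 * B) <= \sum_(0 <= i < M) (2 ^ n i)%:R `^ (- b).
Proof.
move=> c0 B0 cmu mu0 hB cov nJ Vd.
pose T l (p p' : R * R) := trig_kernel (2 ^ l) unit_weight (X w p.2 - X w p'.2) (Y w p.2 - Y w p'.2).
pose W l : R := (2 ^ l)%:R `^ b / (2 ^ l)%:R ^+ 4.
have W0 l : 0 < W l by rewrite /W divr_gt0 ?powR_gt0 ?exprn_gt0// ltr0n expn_gt0.
have T0 l p p' : 0 <= T l p p' by exact: trig_kernel_ge0.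
pose pot p := \sum_(0 <= l < J) W l * \sum_(p' <- mu) p'.1 * T l p p'.
have pot_ge0 p : 0 <= pot p.
  apply: sumr_ge0 => l _; apply: mulr_ge0; first exact: ltW.
  by rewrite big_seq; apply: sumr_ge0 => p' /mu0 h; exact: mulr_ge0.
have hpot : \sum_(p <- mu) p.1 * pot p <= B.
  apply: le_trans hB; rewrite le_eqVlt; apply/orP; left; apply/eqP.
  under eq_bigr do rewrite mulr_sumr.
  rewrite exchange_big /=; apply: eq_bigr => l _; rewrite /kernel_energy mulr_sumr.
  apply: eq_bigr => p _; rewrite [LHS]mulrCA; congr GRing.mul; rewrite mulr_sumr.
  by apply: eq_bigr => p' _; rewrite mulrA.
(* Markov's inequality: the atoms of larger potential carry mass at most [c / 2]. *)
pose good p := pot p <= 2 * B / c.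
have lam0 : 0 < 2 * B / c by rewrite divr_gt0// mulr_gt0.
have good_mass : c / 2 <= \sum_(p <- mu | good p) p.1.
  have bad : \sum_(p <- mu | ~~ good p) p.1 <= c / 2.
    rewrite -(ler_pM2r lam0) (_ : c / 2 * _ = B); last by field; rewrite gt_eqF.
    apply: le_trans hpot; rewrite mulr_suml [leRHS](bigID good) /=.
    rewrite -[leLHS]add0r; apply: lerD.
      by rewrite big_seq_cond; apply: sumr_ge0 => p /andP[/mu0 h _]; exact: mulr_ge0.
    rewrite big_seq_cond [leRHS]big_seq_cond; apply: ler_sum => p /andP[/mu0 h].
    by rewrite /good -ltNge => /ltW; exact: ler_wpM2l.
  by move: cmu; rewrite (bigID good)/=; lra.
have k0 : 0 < cos 1 ^+ 2 :> R by rewrite exprn_gt0// cos1_gt0.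
(* The potential at one good atom of [V i] bounds the mass of all good atoms there, since the images
   of all these are close enough for [trig_kernel_near] at level [n i]. *)
have piece i : (i < M)%N ->
    \sum_(p <- mu | good p && `[< V i p.2 >]) p.1 <= 2 * B / c / cos 1 ^+ 2 * (2 ^ n i)%:R `^ (- b).
  move=> iM.
  have rhs0 : 0 <= 2 * B / c / cos 1 ^+ 2 * (2 ^ n i)%:R `^ (- b).
    by apply: mulr_ge0 (powR_ge0 _ _); rewrite divr_ge0 ?(ltW lam0) ?(ltW k0).
  have [/hasP[p0 p0mu /andP[gp0 /asboolP Vp0]]|/hasPn nh] :=
      boolP (has (fun p => good p && `[< V i p.2 >]) mu); last first.
    rewrite big_seq_cond big1// => p /andP[pmu h]; by have := nh p pmu; rewrite h.
  set N := (2 ^ n i)%:R; have N0 : (0 : R) < N by rewrite ltr0n expn_gt0.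
  have h1 : W (n i) * \sum_(p <- mu) p.1 * T (n i) p0 p <= 2 * B / c.
    apply: le_trans gp0; rewrite /pot (bigD1_seq (n i)) ?iota_uniq ?mem_index_iota ?nJ//=.
    rewrite lerDl; apply: sumr_ge0 => l _; apply: mulr_ge0; first exact: ltW.
    by rewrite big_seq; apply: sumr_ge0 => p' /mu0 h; exact: mulr_ge0.
  have h2 : (cos 1 ^+ 2 * N ^+ 4) * \sum_(p <- mu | good p && `[< V i p.2 >]) p.1 <=
       \sum_(p <- mu) p.1 * T (n i) p0 p.
    rewrite [leRHS](bigID (fun p => good p && `[< V i p.2 >]))/= -[leLHS]addr0.
    apply: lerD; last by rewrite big_seq_cond; apply: sumr_ge0 => p /andP[/mu0 h _]; exact: mulr_ge0.
    rewrite mulr_sumr big_seq_cond [leRHS]big_seq_cond.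
    apply: ler_sum => p /andP[pmu /andP[_ /asboolP Vp]].
    rewrite mulrC ler_wpM2l ?mu0//.
    by have [dx dy] := Vd i _ _ Vp0 Vp; exact: trig_kernel_near.
  have h3 := le_trans (ler_wpM2l (ltW (W0 (n i))) h2) h1.
  have eW : W (n i) * (cos 1 ^+ 2 * N ^+ 4) = cos 1 ^+ 2 * N `^ b.
    by rewrite /W -/N; field; rewrite gt_eqF.
  rewrite mulrA eW in h3.
  rewrite powRN ler_pdivlMr; last exact: powR_gt0.
  rewrite ler_pdivlMr//; apply: le_trans h3.
  by rewrite le_eqVlt; apply/orP; left; apply/eqP; ring.
have tot : c / 2 <= \sum_(0 <= i < M) 2 * B / c / cos 1 ^+ 2 * (2 ^ n i)%:R `^ (- b).
  apply: (le_trans good_mass).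
  apply: (@le_trans _ _ (\sum_(0 <= i < M) \sum_(p <- mu | good p && `[< V i p.2 >]) p.1)); last first.
    by apply: ler_sum_nat => i /andP[_]; exact: piece.
  rewrite (exchange_big_dep good) /=; last by move=> i p _ /andP[].
  rewrite big_seq_cond [leRHS]big_seq_cond; apply: ler_sum => p /andP[pmu gp].
  have [i iM Vi] := cov p pmu.
  rewrite big_mkcond (bigD1_seq i) ?iota_uniq ?mem_index_iota//= gp /=.
  have -> : `[< V i p.2 >] = true by exact/asboolP.
  by rewrite lerDl; apply: sumr_ge0 => j _; case: ifP => // _; exact: mu0.
rewrite -mulr_sumr in tot.
rewrite ler_pdivrMr ?mulr_gt0//.
have : c / 2 * (2 * c * cos 1 ^+ 2) <= 2 * B / c / cos 1 ^+ 2 * (\sum_(0 <= i < M) (2 ^ n i)%:R `^ (- b)) * (2 * c * cos 1 ^+ 2).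
  by apply: ler_wpM2r tot; rewrite mulr_ge0 ?(ltW k0)// mulr_ge0// ltW.
set S := \sum_(_ <= _ < _) _.
have -> : 2 * B / c / cos 1 ^+ 2 * S * (2 * c * cos 1 ^+ 2) = S * (4 * B).
  by field; rewrite !gt_eqF ?cos1_gt0.
by apply: le_trans; rewrite le_eqVlt; apply/orP; left; apply/eqP; field.
Qed.

Lemma compact_nat_cover K (V : nat -> set R) : compact K -> (forall i, open (V i)) ->
  (forall x, K x -> exists i, V i x) ->
  exists M, forall x, K x -> exists2 i, (i < M)%N & V i x.
Proof.
move=> cK oV KV.
have : cover_compact K by rewrite -compact_cover.
move=> /(_ nat setT V (fun i _ => oV i)) [|D _ hD].
  by move=> x /KV[i Vi]; exists i.
exists (\max_(i <- D) i.+1) => x /hD[i /= iD Vi]; exists i => //.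
by rewrite (big_rem i)//= leq_max leqnn.
Qed.

Hypothesis cX : continuous (X w).
Hypothesis cY : continuous (Y w).

(** The sets of a cover are enlarged to open squares of comparable dyadic size. Compactness keeps
    finitely many of them, and a single measure [mu J], with [J] beyond all their levels, bounds the
    cover from below. A positive content at one mesh for every [s <= b] is enough. *)
Lemma image_dimension_ge K (mu : nat -> seq (R * R)) b c B (E : set R[i]) :
  compact K -> 0 < c -> 0 < b -> b <= 2 ->
  (forall J p, p \in mu J -> K p.2 /\ 0 <= p.1) ->
  (forall J, c <= \sum_(p <- mu J) p.1) ->
  (forall N, exists2 J, (N <= J)%N &
    \sum_(0 <= n < J) ((2 ^ n)%:R `^ b / (2 ^ n)%:R ^+ 4) *
       kernel_energy X Y (2 ^ n) unit_weight (mu J) w <= B) ->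
  (fun x => Complex (X w x) (Y w x)) @` K `<=` E ->
  (b%:E <= hausdorff_dim (@distC R) E)%E.
Proof.
move=> cK c0 b0 b2 hmu cmu energy KE.
pose B' := Num.max B 1.
have B'0 : 0 < B' by rewrite lt_max ltr01 orbT.
(* A set of diameter [D > 0] receives a level [m] with [2^-m < 16 D], and the exponent [b] is at
   most 2. *)
pose k : R := 16 `^ 2; have k_gt0 : 0 < k by rewrite powR_gt0.
(* One [k] is for the cover itself, the other for the errors [eta * k / 2^(i+1)] allowed to its
   members. *)
pose eta := c ^+ 2 * cos 1 ^+ 2 / (4 * B') / (k + k).
have eta0 : 0 < eta.
  apply: divr_gt0; last exact: addr_gt0.
  apply: divr_gt0; last by apply: mulr_gt0 => //; rewrite ltr0n.
  by apply: mulr_gt0; apply: exprn_gt0 => //; exact: cos1_gt0.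
suff content s : 0 <= s -> s <= b -> (eta%:E <= hausdorff_content (@distC R) s 8^-1 E)%E.
  apply: le_ereal_inf_tmp => _ [s [s0 Hs0] <-]; rewrite lee_fin leNgt; apply/negP => sb.
  have := content s s0 (ltW sb); apply/negP; rewrite -ltNge.
  apply: le_lt_trans (_ : (0 < _)%E); last by rewrite lte_fin.
  by rewrite -Hs0; apply: ereal_sup_ubound; exists 8^-1 => //=; rewrite invr_gt0.
move=> s0 sb; apply: le_ereal_inf_tmp => _ [U [dU EU] <-].
have dp0 i : (0 <= diameter_pow (@distC R) s (U i))%E.
  by rewrite /diameter_pow; case: ifP => // _; exact: poweR_ge0.
have /choice[sc hsc] : forall i, exists zn : R[i] * nat,
    (forall z, U i z -> `|complex.Re z - complex.Re zn.1| < (4 * (2 ^ zn.2)%:R)^-1 /\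
                        `|complex.Im z - complex.Im zn.1| < (4 * (2 ^ zn.2)%:R)^-1) /\
    (((2 ^ zn.2)%:R `^ (- b))%:E <= k%:E * diameter_pow (@distC R) s (U i) +
       (eta * k * 2^-1 ^+ i.+1)%:E)%E.
  move=> i; set eps := eta * k * 2^-1 ^+ i.+1.
  have eps0 : 0 < eps.
    apply: mulr_gt0; first exact: mulr_gt0.
    by apply: exprn_gt0; rewrite invr_gt0 ltr0n.
  (* Empty sets and single points have no scale of their own; a level this deep makes their term
     smaller than the allowed error. *)
  have [n0 hn0] : exists n : nat, (2 ^ n)%:R `^ (- b) <= eps.
    have [n hn] := powR2_unbounded eps^-1 b0; exists n.
    by rewrite natrX powRN -[leRHS]invrK lef_pV2 ?posrE ?invr_gt0 ?powR_gt0 ?exprn_gt0.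
  have rp n : 0 < (4 * (2 ^ n)%:R)^-1 :> R by rewrite invr_gt0 mulr_gt0// ltr0n expn_gt0.
  have small : (((2 ^ n0)%:R `^ (- b))%:E <= k%:E * diameter_pow (@distC R) s (U i) + eps%:E)%E.
    rewrite -[leLHS]add0e; apply: leeD; last by rewrite lee_fin.
    by apply: mule_ge0; [rewrite lee_fin ltW|exact: dp0].
  have [[z0 Uz0]|nU] := pselect (exists z, U i z); last first.
    by exists (0, n0); split => // z Uz; case: nU; exists z.
  have Ud z : U i z -> ((Normc.normc (z - z0))%:E <= diameter (@distC R) (U i))%E.
    by move=> Uz; apply: ereal_sup_ubound; exists z, z0.
  have := Ud z0 Uz0; rewrite subrr Normc.normc0.
  have Ui0 : U i == set0 = false by apply/eqP => e; move: Uz0; rewrite e.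
  move: Ud (dU i) small; rewrite /diameter_pow Ui0.
  case: (diameter _ _) => [D| |]//= Ud; rewrite !lee_fin => D8 small D0.
  have close z n : U i z -> D < (4 * (2 ^ n)%:R)^-1 ->
      `|complex.Re z - complex.Re z0| < (4 * (2 ^ n)%:R)^-1 /\
      `|complex.Im z - complex.Im z0| < (4 * (2 ^ n)%:R)^-1.
    move=> /Ud; rewrite lee_fin => zD Dn.
    have := Re_le_normc (z - z0); have := Im_le_normc (z - z0).
    have -> : complex.Re (z - z0) = complex.Re z - complex.Re z0 by case: (z) => ? ?; case: (z0).
    have -> : complex.Im (z - z0) = complex.Im z - complex.Im z0 by case: (z) => ? ?; case: (z0).
    by move=> h1 h2; split; [apply: le_lt_trans h2 _|apply: le_lt_trans h1 _]; apply: le_lt_trans zD Dn.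
  have [D00|Dn0] := eqVneq D 0.
    by exists (z0, n0); split => [z Uz|//=]; apply: close => //; rewrite D00.
  have Dp : 0 < D by rewrite lt0r Dn0.
  have [m /andP[k1 k2]] : exists m, (2 : R) ^+ m <= (8 * D)^-1 < 2 ^+ m.+1.
    apply: between_powers; first by lra.
    rewrite -[leLHS]invrK lef_pV2 ?posrE ?invr_gt0 ?mulr_gt0// invr1.
    by rewrite mulrC -ler_pdivlMr// mul1r.
  have pk : 0 < 2 ^+ m :> R by exact: exprn_gt0.
  exists (z0, m); split => [z Uz|/=].
    apply: close => //; rewrite natrX -[ltLHS]invrK ltf_pV2 ?posrE ?invr_gt0 ?mulr_gt0//.
    move: k1; rewrite invfM -ler_pdivrMl ?invr_gt0// invrK => k1.
    by apply: lt_le_trans k1; rewrite ltr_pM2r// ltr_nat.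
  rewrite -[leLHS]adde0; apply: leeD; last by rewrite lee_fin ltW.
  rewrite natrX -EFinM lee_fin.
  apply: (@le_trans _ _ ((16 * D) `^ b)).
    rewrite powRN -powR_inv1 ?powR_ge0// -powRrM mulrC powRrM powR_inv1 ?(ltW pk)//.
    apply: ge0_ler_powR; rewrite ?nnegrE ?invr_ge0 ?(ltW pk) ?(ltW b0) ?mulr_ge0//.
    rewrite -[leRHS]invrK lef_pV2 ?posrE ?invr_gt0 ?mulr_gt0//.
    move: k2; rewrite exprS -ltr_pdivrMl// => /ltW; apply: le_trans.
    by rewrite -invfM le_eqVlt; apply/orP; left; apply/eqP; congr (_^-1); ring.
  rewrite powRM ?(ltW Dp)//; apply: ler_pM; rewrite ?powR_ge0//.
    by apply: ler_powR => //; rewrite ler1n.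
  by apply: ler_powR_ge_le1 => //; apply: (le_trans D8); rewrite invf_le1// ler1n.
pose r i : R := (4 * (2 ^ (sc i).2)%:R)^-1.
have r0 i : 0 < r i by rewrite invr_gt0 mulr_gt0// ltr0n expn_gt0.
pose V i : set R := X w @^-1` (ball (complex.Re (sc i).1) (r i)) `&`
                    Y w @^-1` (ball (complex.Im (sc i).1) (r i)).
have oV i : open (V i).
  apply: openI; apply: open_comp; [by move=> x _; exact: cX| |by move=> x _; exact: cY|];
    exact: ball_open.
have KV x : K x -> exists i, V i x.
  move=> Kx; have [i _ Ui] := EU _ (KE _ (imageP _ Kx)).
  have [/(_ _ Ui)/= [h1 h2] _] := hsc i; exists i; split; rewrite /= /ball/= distrC.
    exact: h1.
  exact: h2.
have [M hM] := compact_nat_cover cK oV KV.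
pose N := (\max_(i < M) (sc i).2).+1.
have [J NJ hJ] := energy N.
have := @finite_cover_energy (mu J) b c B' J M V (fun i => (sc i).2) c0 B'0 (cmu J)
   (fun p h => proj2 (hmu J p h)).
move=> /(_ (le_trans hJ _)) => /(_ ltac:(by rewrite le_max lexx)).
move=> /(_ (fun p h => hM _ (proj1 (hmu J p h)))) h.
have {h} : c ^+ 2 * cos 1 ^+ 2 / (4 * B') <= \sum_(0 <= i < M) (2 ^ (sc i).2)%:R `^ (- b).
  apply: h => [i iM|i x y [/= x1 x2] [/= y1 y2]].
    apply: leq_trans NJ; rewrite ltnS.
    exact: (@leq_bigmax _ (fun i : 'I_M => (sc i).2) (Ordinal iM)).
  have rr : (2 * (2 ^ (sc i).2)%:R)^-1 = r i + r i.
    by rewrite /r; field; rewrite gt_eqF// ltr0n expn_gt0.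
  move: x1 x2 y1 y2; rewrite rr /ball/= => x1 x2 y1 y2.
  split; rewrite ltW//.
    have -> : X w x - X w y = (complex.Re (sc i).1 - X w y) - (complex.Re (sc i).1 - X w x) by ring.
    by apply: le_lt_trans (ler_normB _ _) _; rewrite ltrD.
  have -> : Y w x - Y w y = (complex.Im (sc i).1 - Y w y) - (complex.Im (sc i).1 - Y w x) by ring.
  by apply: le_lt_trans (ler_normB _ _) _; rewrite ltrD.
rewrite -lee_fin -sumEFin => h.
have {}h : ((c ^+ 2 * cos 1 ^+ 2 / (4 * B'))%:E <= \sum_(0 <= i < M)
    (k%:E * diameter_pow (@distC R) s (U i) + (eta * k * 2^-1 ^+ i.+1)%:E))%E.
  by apply: le_trans h _; apply: lee_sum => i _; exact: (proj2 (hsc i)).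
set T := (\sum_(0 <= i <oo) _)%E.
have T0 : (0 <= T)%E by apply: nneseries_ge0.
have h2 : (((k + k) * eta)%:E <= k%:E * T + (k * eta)%:E)%E.
  have -> : (k + k) * eta = c ^+ 2 * cos 1 ^+ 2 / (4 * B') by rewrite /eta mulrC divfK// gt_eqF// addr_gt0.
  apply: (le_trans h); rewrite big_split /=; apply: leeD.
    rewrite -ge0_sume_distrr; last by move=> i _; exact: dp0.
    apply: lee_wpmul2l; first by rewrite lee_fin ltW.
    by apply: nneseries_lim_ge => i _ _; exact: dp0.
  rewrite sumEFin lee_fin -mulr_sumr mulrC [leRHS]mulrC mulrA -[leRHS]mul1r mulrAC mulrA -[leLHS]mulrA.
  rewrite (_ : 1 * eta * k = 1 * (k * eta)); last by ring.
  apply: ler_wpM2r; first by rewrite mulr_ge0// ltW.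
  rewrite big_mkord; under eq_bigr do rewrite exprS.
  rewrite -mulr_sumr; have := @sum_geometric_le R 2^-1 M ltac:(lra) ltac:(lra).
  rewrite (_ : 1 - 2^-1 = 2^-1 :> R); last by lra.
  by rewrite invrK; lra.
move: T T0 h2 => [T| |]//= T0; last by rewrite leey.
by rewrite -EFinM -EFinD !lee_fin mulrDl lerD2r ler_pM2l.
Qed.

End ImageDimension.

(** * Dyadic squares and hulls in the plane *)

Section DyadicSquares.
Context (R : realType).
Implicit Types (n : nat) (k : int) (x y z : R).

Lemma dyadic_cellE n k : [set x : R | dyadic_index n x = k] =
  `[k%:~R * 2^-1 ^+ n, (k%:~R + 1) * 2^-1 ^+ n[%classic.
Proof.
have p0 : (0 : R) < 2 ^+ n by exact: exprn_gt0.
apply/seteqP; split => x /=; rewrite in_itv/= exprVn ler_pdivrMr// ltr_pdivlMr// [x * _]mulrC.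
  by move=> <-; rewrite /dyadic_index floor_le/= -intrD1 floorD1_gt.
by move=> h; apply: floor_def; rewrite intrD.
Qed.

Definition dyadic_square n (I : int * int) : set (R * R) :=
  [set z | dyadic_index n z.1 = I.1 /\ dyadic_index n z.2 = I.2].

Let area := (@lebesgue_measure R \x @lebesgue_measure R)%E.

Lemma dyadic_squareE n I : dyadic_square n I =
  [set x | dyadic_index n x = I.1] `*` [set x | dyadic_index n x = I.2].
Proof. by []. Qed.

Lemma measurable_dyadic_square n I : measurable (dyadic_square n I).
Proof. by rewrite dyadic_squareE; apply: measurableX; rewrite dyadic_cellE; exact: measurable_itv. Qed.

Lemma dyadic_square_area n I : area (dyadic_square n I) = ((2^-1 ^+ n) ^+ 2)%:E.
Proof.
rewrite dyadic_squareE /area product_measure1E; [|by rewrite dyadic_cellE; exact: measurable_itv..].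
have len k : (@lebesgue_measure R) [set x | dyadic_index n x = k] = (2^-1 ^+ n)%:E.
  rewrite dyadic_cellE lebesgue_measure_itv /= lte_fin ifT.
    by rewrite -EFinD; congr _%:E; ring.
  by rewrite ltr_pM2r ?exprn_gt0 ?invr_gt0// ltrDl.
by rewrite expr2 EFinM; congr (_ * _)%E; exact: len.
Qed.

(** The union of the squares of level [n] that meet [G], measurable for arbitrary [G]; its area is
    bounded below by counting squares. *)
Definition square_hull n (G : set (R * R)) : set (R * R) := [set z | exists2 g, G g &
  dyadic_index n z.1 = dyadic_index n g.1 /\ dyadic_index n z.2 = dyadic_index n g.2].

Lemma measurable_square_hull n G : measurable (square_hull n G).
Proof.
have -> : square_hull n G = \bigcup_I (if `[< exists2 g, G g & dyadic_square n I g >]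
    then dyadic_square n I else set0).
  apply/seteqP; split => [z [g Gg [h1 h2]]|z [I _]].
    exists (dyadic_index n g.1, dyadic_index n g.2) => //.
    by rewrite ifT//; apply/asboolP; exists g.
  by case: ifPn => // /asboolP[g Gg [h1 h2]] [h3 h4]; exists g => //; rewrite h1 h2.
apply: countable_bigcupT_measurable => [|I]; first exact: countableP.
by case: ifP => _; [exact: measurable_dyadic_square|exact: measurable0].
Qed.

Lemma square_hull_nest m n G : (m <= n)%N -> square_hull n G `<=` square_hull m G.
Proof.
move=> mn z [g Gg [h1 h2]]; exists g => //.
by split; [move: h1|move: h2]; exact: dyadic_index_nest.
Qed.

Lemma square_hull_area_ge n G (L : seq (int * int)) : uniq L ->
  (forall I, I \in L -> exists2 g, G g & dyadic_square n I g) ->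
  (((size L)%:R * (2^-1 ^+ n) ^+ 2)%:E <= area (square_hull n G))%E.
Proof.
move=> uL LG; pose F (i : 'I_(size L)) := dyadic_square n (nth (0, 0) L i).
have mF i : measurable (F i) by exact: measurable_dyadic_square.
have tF : trivIset setT F.
  move=> i j _ _ [z [[h1 h2] [h3 h4]]]; apply: val_inj => /=.
  apply/eqP; rewrite -(nth_uniq (0, 0) (ltn_ord i) (ltn_ord j) uL); apply/eqP.
  by rewrite (surjective_pairing (nth _ _ i)) (surjective_pairing (nth _ _ j)) -h1 -h2 h3 h4.
apply: (@le_trans _ _ (area (\big[setU/set0]_(i < size L) F i))).
  rewrite /area measure_bigsetU_ord// (eq_bigr (fun=> ((2^-1 ^+ n) ^+ 2)%:E)).
    by rewrite sumEFin sumr_const card_ord mulr_natl.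
  by move=> i _; rewrite -(dyadic_square_area n (nth (0, 0) L i)).
apply: le_measure; rewrite ?inE; [by apply: bigsetU_measurable => i _; exact: mF|exact: measurable_square_hull|].
apply: (big_ind (fun S => S `<=` square_hull n G)) => [//|S T hS hT z [/hS|/hT]//|i _ z [h1 h2]].
have [g Gg [h3 h4]] := LG _ (mem_nth (0, 0) (ltn_ord i)).
by exists g => //; rewrite h1 h2.
Qed.

Lemma open_far z (r : R) : open [set u : R | r < `|u - z|].
Proof.
rewrite (_ : [set u | _] = [set u | z + r < u] `|` [set u | u < z - r] `|` [set u | r < 0]); last first.
  apply/seteqP; split => u /=.
    move=> h; have [r0|r0] := ltP r 0; [by right|left].
    by have [u0|u0] := leP 0 (u - z); [left|right]; move: h; [rewrite ger0_norm//; lra|rewrite ltr0_norm//; lra].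
  move=> [[h|h]|h].
  - by apply: lt_le_trans (ler_norm _); lra.
  - by rewrite -normrN; apply: lt_le_trans (ler_norm _); lra.
  - by apply: lt_le_trans h (normr_ge0 _).
apply: openU; first by apply: openU; [exact: open_gt|exact: open_lt].
have [r0|r0] := ltP r 0.
  by rewrite (_ : [set u | _] = setT); [exact: openT|apply/seteqP].
rewrite (_ : [set u | _] = set0); first exact: open0.
by apply/seteqP; split => // u /=; rewrite ltNge r0.
Qed.

End DyadicSquares.

(** * Positive area of the image *)

Section ImageArea.
Context (R : realType) (d : measure_display) (Omega : measurableType d).
Variables (X Y : Omega -> R -> R) (w : Omega).
Implicit Types (c B : R) (mu : seq (R * R)) (K : set R).
Hypothesis cX : continuous (X w).
Hypothesis cY : continuous (Y w).

Let unit_weight : nat -> R := fun=> 1.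
Let area := (@lebesgue_measure R \x @lebesgue_measure R)%E.

Definition image K : set (R * R) := (fun x => (X w x, Y w x)) @` K.

Lemma half_expn_lt (r : R) : 0 < r -> exists i, 2^-1 ^+ i < r.
Proof.
move=> r0; exists (Num.bound r^-1); set m := Num.bound _.
have h : r^-1 < m%:R by apply: archi_boundP; rewrite invr_ge0 ltW.
rewrite exprVn -[ltRHS]invrK ltf_pV2 ?posrE ?invr_gt0 ?exprn_gt0//.
by apply: lt_le_trans h _; rewrite -natrX ler_nat ltnW// ltn_expl.
Qed.

(** Compactness again. It serves twice: the hulls shrink to the image, and the smoothed densities
    die out off the image. *)
Lemma image_separated K z : compact K -> ~ image K z ->
  exists i, forall x, K x -> 2^-1 ^+ i < `|X w x - z.1| \/ 2^-1 ^+ i < `|Y w x - z.2|.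
Proof.
move=> cK nz.
pose V i : set R := X w @^-1` [set u | 2^-1 ^+ i < `|u - z.1|] `|`
                    Y w @^-1` [set u | 2^-1 ^+ i < `|u - z.2|].
have oV i : open (V i).
  by apply: openU; apply: open_comp; [move=> x _; exact: cX|exact: open_far|
     move=> x _; exact: cY|exact: open_far].
have KV x : K x -> exists i, V i x.
  move=> Kx; have [e1|n1] := eqVneq (X w x) z.1; last first.
    have /half_expn_lt[i hi] : 0 < `|X w x - z.1| by rewrite normr_gt0 subr_eq0.
    by exists i; left.
  have [e2|n2] := eqVneq (Y w x) z.2; last first.
    have /half_expn_lt[i hi] : 0 < `|Y w x - z.2| by rewrite normr_gt0 subr_eq0.
    by exists i; right.
  by case: nz; exists x => //; rewrite e1 e2 -surjective_pairing.
have [M hM] := compact_nat_cover cK oV KV.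
exists M => x /hM[i iM].
have le : (2^-1 : R) ^+ M <= 2^-1 ^+ i.
  by apply: ler_wiXn2l; rewrite ?invr_ge0// ?invf_le1// ?ler1n// ltnW.
by move=> [/= v|/= v]; [left|right]; exact: le_lt_trans le v.
Qed.

Lemma square_hull_image K z : compact K ->
  (forall n, square_hull n (image K) z) -> image K z.
Proof.
move=> cK hz; apply: contrapT => /(image_separated cK)[i hi].
have [_ [x Kx <-] /= [h1 h2]] := hz i.
have d1 := dyadic_index_dist h1; have d2 := dyadic_index_dist h2.
rewrite distrC in d1; rewrite distrC in d2.
by have [h|h] := hi x Kx; [move: d1|move: d2]; rewrite ltNge (ltW h).
Qed.

(* By Cauchy-Schwarz the energy bounds from below the number of dyadic squares
   that meet the image, and the hulls decrease to the compact image. *)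
Lemma image_area_gt0 K (mu : nat -> seq (R * R)) c B M (E : set R[i]) :
  compact K -> 0 < c ->
  (forall x, K x -> `|X w x| <= M /\ `|Y w x| <= M) ->
  (forall J p, p \in mu J -> K p.2 /\ 0 <= p.1) ->
  (forall J, c <= \sum_(p <- mu J) p.1) ->
  (forall N, exists2 J, (N <= J)%N &
    kernel_energy X Y (2 ^ J) unit_weight (mu J) w <= B * (2 ^ J)%:R ^+ 2) ->
  (fun x => Complex (X w x) (Y w x)) @` K `<=` E ->
  (0 < lebesgue2 E)%E.
Proof.
move=> cK c0 hM hmu cmu energy KE.
pose B' := Num.max B 1 / cos 1 ^+ 2.
have k0 : 0 < cos 1 ^+ 2 :> R by rewrite exprn_gt0// cos1_gt0.
have B'0 : 0 < B' by rewrite divr_gt0// lt_max ltr01 orbT.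
pose eta := c ^+ 2 / B' / 4.
have eta0 : 0 < eta by rewrite divr_gt0// divr_gt0// exprn_gt0.
pose U n := square_hull n (image K).
have mU n : measurable (U n) by exact: measurable_square_hull.
have big n : (eta%:E <= area (U n))%E.
  have [J nJ hJ] := energy n.
  apply: (@le_trans _ _ (area (U J.+1))); last first.
    apply: le_measure; [rewrite inE; exact: mU|rewrite inE; exact: mU|].
    by apply: square_hull_nest; exact: leqW.
  (* Level [J + 1], not [J]: coordinates within one square then differ by less than [1 / (2 * 2^J)],
     the range of [trig_kernel_near]. *)
  pose idx (p : R * R) := (dyadic_index J.+1 (X w p.2), dyadic_index J.+1 (Y w p.2)).
  pose L := undup (map idx (mu J)).
  have uL : uniq L by exact: undup_uniq.
  apply: le_trans (square_hull_area_ge uL _); last first.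
    move=> I; rewrite mem_undup => /mapP[p pmu ->].
    exists (X w p.2, Y w p.2); last by [].
    by exists p.2 => //; have [] := hmu J p pmu.
  rewrite lee_fin.
  pose m I := \sum_(p <- mu J | idx p == I) p.1.
  have m0 I : 0 <= m I by rewrite /m big_seq_cond; apply: sumr_ge0 => p /andP[/hmu[]].
  set N : R := (2 ^ J)%:R in hJ; have N0 : (0 : R) < N by rewrite ltr0n expn_gt0.
  have total : c <= \sum_(I <- L) m I.
    apply: le_trans (cmu J) _; rewrite /m (exchange_big_dep xpredT)//=.
    rewrite big_seq [leRHS]big_seq; apply: ler_sum => p pmu.
    rewrite big_mkcond (bigD1_seq (idx p)) ?uL ?mem_undup ?map_f//= eqxx lerDl.
    by apply: sumr_ge0 => I _; case: ifP => // _; have [] := hmu J p pmu.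
  have quad : \sum_(I <- L) m I ^+ 2 <= B' / N ^+ 2.
    apply: (@le_trans _ _ (\sum_(p <- mu J) p.1 * m (idx p))).
      apply: (@le_trans _ _ (\sum_(I <- L) \sum_(p <- mu J | idx p == I) p.1 * m (idx p))).
        apply: ler_sum => I _; rewrite expr2 {1}/m mulr_suml.
        by rewrite le_eqVlt; apply/orP; left; apply/eqP; apply: eq_bigr => p /eqP ->.
      rewrite (exchange_big_dep xpredT)//= big_seq [leRHS]big_seq; apply: ler_sum => p pmu.
      apply: sum_unique_le => //; first by apply: mulr_ge0 (m0 _); have [] := hmu J p pmu.
      by move=> a b _ _ /eqP <- /eqP <-.
    rewrite ler_pdivlMr ?exprn_gt0// ler_pdivlMr//.
    have h : (\sum_(p <- mu J) p.1 * m (idx p)) * (cos 1 ^+ 2 * N ^+ 4) <=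
        kernel_energy X Y (2 ^ J) unit_weight (mu J) w.
      rewrite mulr_suml /kernel_energy big_seq [leRHS]big_seq; apply: ler_sum => p pmu.
      have [_ p0] := hmu J p pmu.
      rewrite -mulrA /m mulr_suml mulr_sumr [leRHS](bigID (fun p' => idx p' == idx p))/=.
      rewrite -[leLHS]addr0; apply: lerD; last first.
        rewrite big_seq_cond; apply: sumr_ge0 => p' /andP[/hmu[_ p'0] _].
        by apply: mulr_ge0 (trig_kernel_ge0 _ _ _ _); exact: mulr_ge0.
      rewrite big_seq_cond [leRHS]big_seq_cond; apply: ler_sum => p' /andP[/hmu[_ p'0] /eqP[e1 e2]].
      rewrite mulrA ler_wpM2l ?mulr_ge0//.
      have half : (2^-1 : R) ^+ J.+1 = (2 * (2 ^ J)%:R)^-1 by rewrite exprVn exprS natrX.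
      by apply: trig_kernel_near; rewrite -half ltW// dyadic_index_dist.
    have BB : B * N ^+ 2 <= Num.max B 1 * N ^+ 2 by rewrite ler_wpM2r ?exprn_ge0 ?(ltW N0)// le_max lexx.
    have := le_trans h (le_trans hJ BB).
    rewrite (_ : cos 1 ^+ 2 * N ^+ 4 = N ^+ 2 * cos 1 ^+ 2 * N ^+ 2); last by ring.
    by rewrite mulrA ler_pM2r ?exprn_gt0// mulrA.
  (* Cauchy-Schwarz as [2 lam m <= m^2 + lam^2] summed over the occupied squares; this [lam] equates
     [lam * c] with the bound [B' / N^2] and yields at least [c^2 N^2 / B'] squares. *)
  pose lam := B' / (c * N ^+ 2).
  have lam0 : 0 < lam by rewrite divr_gt0// mulr_gt0// exprn_gt0.
  have h1 : 2 * lam * c <= B' / N ^+ 2 + (size L)%:R * lam ^+ 2.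
    apply: (@le_trans _ _ (\sum_(I <- L) (m I ^+ 2 + lam ^+ 2))).
      apply: (@le_trans _ _ (2 * lam * \sum_(I <- L) m I)).
        by rewrite ler_wpM2l// mulr_ge0// ltW.
      rewrite mulr_sumr; apply: ler_sum => I _.
      by have := sqr_ge0 (m I - lam); rewrite sqrrB; lra.
    by rewrite big_split /= lerD// big_const_seq count_predT iter_addr addr0 mulr_natl.
  have lamc : lam * c = B' / N ^+ 2 by rewrite /lam; field; rewrite !gt_eqF.
  have h2 : B' / N ^+ 2 <= (size L)%:R * lam ^+ 2 by move: h1; rewrite -mulrA lamc; lra.
  have -> : (2^-1 : R) ^+ J.+1 ^+ 2 = (4 * N ^+ 2)^-1.
    by rewrite /N natrX -exprM exprVn exprM (exprS _ J) exprMn (_ : (2 : R) ^+ 2 = 4)// -natrX.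
  rewrite /eta ler_pdivlMr ?mulr_gt0 ?exprn_gt0//.
  have -> : c ^+ 2 / B' / 4 * (4 * N ^+ 2) = (B' / N ^+ 2) / lam ^+ 2.
    by rewrite /lam; field; rewrite !gt_eqF.
  by rewrite ler_pdivrMr ?exprn_gt0.
have hull : \bigcap_n U n `<=` image K.
  by move=> z hz; apply: square_hull_image => // n; exact: hz.
have fin : (area (U 0%N) < +oo)%E.
  pose b : set (R * R) := `[- (M + 1), M + 1]%classic `*` `[- (M + 1), M + 1]%classic.
  have mb : measurable b by apply: measurableX; exact: measurable_itv.
  apply: (@le_lt_trans _ _ (area b)).
    apply: le_measure; [rewrite inE; exact: mU|by rewrite inE|].
    move=> z [_ [x Kx <-] /= [h1 h2]].
    have d1 := dyadic_index_dist h1; have d2 := dyadic_index_dist h2.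
    have [m1 m2] := hM x Kx.
    rewrite expr0 in d1 d2; move: m1 m2 d1 d2.
    rewrite !ler_norml !ltr_norml => /andP[? ?] /andP[? ?] /andP[? ?] /andP[? ?].
    by split => /=; rewrite in_itv/=; apply/andP; split; lra.
  rewrite /area product_measure1E; [|exact: measurable_itv..].
  have len : (@lebesgue_measure R) `[- (M + 1), M + 1]%classic \is a fin_num.
    by rewrite lebesgue_measure_itv /=; case: ifP.
  by rewrite -ge0_fin_numE; [rewrite fin_numM|exact: mule_ge0].
have mcap : measurable (\bigcap_n U n) by exact: bigcap_measurableType.
have cvg : area (U n) @[n --> \oo] --> area (\bigcap_n U n).
  apply: (nonincreasing_cvg_mu fin mU mcap) => m n mn; apply/subsetPset.
  exact: square_hull_nest.
have area_ge : (eta%:E <= area (\bigcap_n U n))%E.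
  rewrite -(cvg_lim (@ereal_hausdorff R) cvg); apply: lime_ge; last exact: nearW.
  by apply/cvg_ex; exists (area (\bigcap_n U n)).
rewrite /lebesgue2; apply: (@lt_le_trans _ _ eta%:E); first by rewrite lte_fin.
apply: le_trans area_ge _.
have e : area (\bigcap_n U n) =
    ((@lebesgue_measure R \x @lebesgue_measure R)^*%mu)%E (\bigcap_n U n).
  by rewrite (measurable_mu_extE (@lebesgue_measure R \x @lebesgue_measure R)%E mcap).
rewrite e.
apply: le_mu_ext => z /hull[x Kx <-].
by exists (Complex (X w x) (Y w x)) => //; apply: KE; exists x.
Qed.

End ImageArea.

Section FourierEnergyOften.
Context (R : realType) (d : measure_display) (Omega : measurableType d).
Variables (P : probability Omega R) (X Y : Omega -> R -> R).
Hypothesis bX : forall x, bounded_rv (fun w => X w x).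
Hypothesis bY : forall x, bounded_rv (fun w => Y w x).

(** From the decay exponent [4 + 6 e] the weight [2 + 4 e] leaves the summable [- 2 - 2 e]; this
    weight is what [smoothed_density_modulus] needs. The choice [e <= 1/3] keeps the exponent within
    the order 6 of [decorrelated]. *)
Lemma fourier_energy_often (t c d0 s c' : R) (K : set R) :
  0 < t -> 0 < c -> d0 <= 1 -> decorrelated P X Y t c d0 -> 4 * t < s ->
  (forall x y, K x -> K y -> `|x - y| <= d0) ->
  (forall N, exists mu, frostman_at K s c' N mu) ->
  exists e : R, [/\ 0 < e, e <= 1 & exists mu : nat -> seq (R * R),
    (forall J, exists M, frostman_at K s c' M (mu J)) /\
    {ae P, forall w, exists B : R, forall N, exists2 J, (N <= J)%N &
      freq_sum J (fun i j => freq_size R i j `^ (2 + 4 * e) *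
        fourier_energy X Y (mu J) i j w) <= B}].
Proof.
move=> t0 c0 d01 dec ts Kd frostman.
have s0 : 0 < s by apply: lt_trans ts; rewrite mulr_gt0.
have [e [e0 e1 tes]] : exists e, [/\ 0 < e, e <= 3^-1 & t * (4 + 6 * e) < s].
  exists (Num.min 3^-1 ((s - 4 * t) / (12 * t))).
  have h : 0 < (s - 4 * t) / (12 * t) by rewrite divr_gt0 ?mulr_gt0// subr_gt0.
  split; [by rewrite lt_min h invr_gt0 ltr0n|by rewrite ge_min lexx|].
  set e := Num.min _ _; have : e <= (s - 4 * t) / (12 * t) by rewrite ge_min lexx orbT.
  rewrite ler_pdivlMr ?mulr_gt0//; lra.
exists e; split => //; first by lra.
have [C C0 hC] := expect_fourier_energy bX bY t0 c0 d01 dec s0 Kd.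
have [V V0 hV] := freq_sum_power_bounded e0.
set F := frostman_const s (t * (4 + 6 * e)).
have F0 : 0 < F.
  rewrite /F /frostman_const divr_gt0// ?mulr_gt0 ?powR_gt0// subr_gt0.
  by apply: powR2_lt1; rewrite subr_lt0.
have /choice[mu hmu] : forall J, exists mu, exists M,
    frostman_at K s c' M mu /\ 1 + 2 * J%:R <= ((2 : R) ^+ M) `^ t.
  move=> J; have [M hM] := powR2_unbounded (1 + 2 * J%:R) t0.
  by have [mu hmu] := frostman M; exists mu, M.
exists mu; split; first by move=> J; have [M [hM _]] := hmu J; exists M.
have bf J i j := bounded_rv_fourier_energy bX bY (mu J) i j.
apply: (@liminf_bounded_expect _ _ _ P _ (C * F * V)).
- by move=> J; do 2 (apply: bounded_rv_sum => ?); apply: bounded_rvZ; exact: bf.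
- move=> J w; apply: sumr_ge0 => i _; apply: sumr_ge0 => j _.
  exact: mulr_ge0 (powR_ge0 _ _) (fourier_energy_ge0 _ _ _ _ _ _).
move=> J; rewrite /freq_sum expect_sum; last first.
  by move=> i; apply: bounded_rv_sum => ?; apply: bounded_rvZ; exact: bf.
apply: (@le_trans _ _ (C * F * freq_sum J (fun i j => freq_size R i j `^ (- 2 - 2 * e)))); last first.
  by apply: ler_wpM2l (hV J); exact: mulr_ge0 (ltW C0) (ltW F0).
rewrite /freq_sum mulr_sumr; apply: ler_sum_nat => i /andP[_ iJ].
rewrite expect_sum; last by move=> j; apply: bounded_rvZ; exact: bf.
rewrite mulr_sumr; apply: ler_sum_nat => j /andP[_ jJ].
rewrite expectZ; last exact: bf.
have [M [hM hJ]] := hmu J.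
set k := freq_size R _ _.
have k1 : 1 <= k by exact: freq_size_ge1.
have k0 : 0 < k := lt_le_trans ltr01 k1.
have kJ : k <= 1 + 2 * J%:R.
  have h (l : nat) : (l < J + J)%N -> `|l%:Z - J%:Z|%:~R <= J%:R :> R.
    by move=> lJ; rewrite pmulrn ler_int centered_le.
  by have := h i iJ; have := h j jJ; rewrite /k /freq_size; lra.
have b0 : 0 <= 4 + 6 * e by lra.
have b6 : 4 + 6 * e <= 6 by lra.
have h := hC c' M (mu J) (i%:Z - J%:Z) (j%:Z - J%:Z) (4 + 6 * e) hM b0 b6 tes (le_trans kJ hJ).
rewrite -/F -/k in h.
apply: (le_trans (ler_wpM2l (powR_ge0 _ _) h)).
rewrite mulrCA -powRD; last by rewrite (gt_eqF k0) implybT.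
by rewrite le_eqVlt; apply/orP; left; apply/eqP; congr (_ * _ `^ _); lra.
Qed.

End FourierEnergyOften.

(** * The binomial kernel *)

Section BinomialKernel.
Context (R : realType).
Implicit Types (N n : nat) (z : R).

(** The coefficients of [((1 + z) / 2)^(N-1)], for which the kernel decays geometrically as soon as
    one coordinate is away from 0. The equal weights of the energies give a Fejer kernel, which
    after normalisation does not tend to 0 where only one coordinate is away from 0. *)
Definition binomial_weight N (j : nat) : R := 'C(N.-1, j)%:R / 2 ^+ N.-1.

Lemma expi_expn z n : expi z ^+ n = Complex (cos (n%:R * z)) (sin (n%:R * z)).
Proof.
elim: n => [|n IH]; first by rewrite mul0r cos0 sin0.
rewrite exprS IH /expi -natr1 mulrDl mul1r cosD sinD; apply/eqP; rewrite eq_complex /=.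
by apply/andP; split; apply/eqP; ring.
Qed.

Lemma sum_Complex (I : Type) (s : seq I) (f g : I -> R) :
  \sum_(i <- s) Complex (f i) (g i) = Complex (\sum_(i <- s) f i) (\sum_(i <- s) g i).
Proof.
elim: s => [|i s IH]; first by rewrite !big_nil.
by rewrite !big_cons IH.
Qed.

Lemma binomial_weight_modulus N z : (0 < N)%N ->
  (\sum_(0 <= j < N) binomial_weight N j * cos (j%:R * z)) ^+ 2 +
  (\sum_(0 <= j < N) binomial_weight N j * sin (j%:R * z)) ^+ 2 = ((1 + cos z) / 2) ^+ N.-1.
Proof.
case: N => // n _; rewrite /= /binomial_weight /=.
pose Cs := \sum_(0 <= j < n.+1) 'C(n, j)%:R * cos (j%:R * z).
pose Sn := \sum_(0 <= j < n.+1) 'C(n, j)%:R * sin (j%:R * z).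
have e1 : \sum_(0 <= j < n.+1) 'C(n, j)%:R / 2 ^+ n * cos (j%:R * z) = Cs / 2 ^+ n.
  by rewrite /Cs mulr_suml; apply: eq_bigr => j _; rewrite mulrAC.
have e2 : \sum_(0 <= j < n.+1) 'C(n, j)%:R / 2 ^+ n * sin (j%:R * z) = Sn / 2 ^+ n.
  by rewrite /Sn mulr_suml; apply: eq_bigr => j _; rewrite mulrAC.
have h : Complex Cs Sn = (1 + expi z) ^+ n.
  rewrite exprDn /Cs /Sn -sum_Complex big_mkord; apply: eq_bigr => j _.
  have cm m (x y : R) : Complex x y *+ m = Complex (m%:R * x) (m%:R * y).
    elim: m => [|m IH]; first by rewrite mulr0n !mul0r.
    by rewrite mulrS IH -natr1; apply/eqP; rewrite eq_complex /=; apply/andP; split; apply/eqP; ring.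
  by rewrite expr1n mul1r expi_expn cm.
have nX (u : R[i]) m : Normc.normc (u ^+ m) = Normc.normc u ^+ m.
  by elim: m => [|m IH]; rewrite ?Normc.normc1// !exprS Normc.normcM IH.
have : Cs ^+ 2 + Sn ^+ 2 = (2 * (1 + cos z)) ^+ n.
  have -> : Cs ^+ 2 + Sn ^+ 2 = Normc.normc (Complex Cs Sn) ^+ 2.
    by rewrite /= sqr_sqrtr// addr_ge0 ?sqr_ge0.
  rewrite h nX -exprM mulnC exprM; congr (_ ^+ n).
  rewrite /= sqr_sqrtr ?addr_ge0 ?sqr_ge0// add0r.
  by have := cos2Dsin2 z; lra.
rewrite e1 e2 !expr_div_n -mulrDl => ->.
by rewrite exprMn; field; rewrite expf_neq0.
Qed.

Lemma trig_kernel_binomial N z1 z2 : (0 < N)%N ->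
  trig_kernel N (binomial_weight N) z1 z2 = (((1 + cos z1) / 2) * ((1 + cos z2) / 2)) ^+ N.-1.
Proof.
move=> N0; rewrite exprMn -(binomial_weight_modulus z1 N0) -(binomial_weight_modulus z2 N0).
rewrite trig_kernelE; set b := binomial_weight N.
set C1 := \sum_(_ <= _ < _) b _ * cos (_ * z1); set S1 := \sum_(_ <= _ < _) b _ * sin (_ * z1).
set C2 := \sum_(_ <= _ < _) b _ * cos (_ * z2); set S2 := \sum_(_ <= _ < _) b _ * sin (_ * z2).
have -> : \sum_(0 <= i < N) \sum_(0 <= j < N) b i * b j * cos (i%:R * z1 + j%:R * z2) = C1 * C2 - S1 * S2.
  rewrite /C1 /S1 !mulr_suml -sumrB; apply: eq_bigr => i _; rewrite /C2 /S2 !mulr_sumr -sumrB.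
  by apply: eq_bigr => j _; rewrite cosD; ring.
have -> : \sum_(0 <= i < N) \sum_(0 <= j < N) b i * b j * sin (i%:R * z1 + j%:R * z2) = S1 * C2 + C1 * S2.
  rewrite /C1 /S1 !mulr_suml -big_split /=; apply: eq_bigr => i _; rewrite /C2 /S2 !mulr_sumr -big_split /=.
  by apply: eq_bigr => j _; rewrite sinD; ring.
ring.
Qed.

Lemma binomial_weight_sum N : (0 < N)%N -> \sum_(0 <= j < N) binomial_weight N j = 1.
Proof.
case: N => // n _; rewrite /binomial_weight /= -mulr_suml.
have := exprDn (1 : R) 1 n; rewrite big_mkord -natr1 => e.
have -> : \sum_(i < n.+1) ('C(n, i)%:R : R) = 2 ^+ n.
  rewrite [RHS](_ : _ = (1 + 1) ^+ n)// e; apply: eq_bigr => i _.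
  by rewrite !expr1n mulr1.
by rewrite mulfV// expf_neq0.
Qed.

Lemma binomial_weight_sqr_sum N : (0 < N)%N ->
  N%:R^-1 <= \sum_(0 <= j < N) binomial_weight N j ^+ 2.
Proof.
move=> N0; have N0' : (0 : R) < N%:R by rewrite ltr0n.
have : 0 <= \sum_(0 <= j < N) (binomial_weight N j - N%:R^-1) ^+ 2.
  by apply: sumr_ge0 => j _; exact: sqr_ge0.
have -> : \sum_(0 <= j < N) (binomial_weight N j - N%:R^-1) ^+ 2 =
   \sum_(0 <= j < N) binomial_weight N j ^+ 2 - N%:R^-1.
  rewrite (eq_bigr (fun j => binomial_weight N j ^+ 2 - 2 * N%:R^-1 * binomial_weight N j + N%:R^-1 ^+ 2)).
    rewrite big_split /= sumrB -mulr_sumr binomial_weight_sum// sumr_const_nat subn0 -mulr_natr.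
    by field; rewrite gt_eqF.
  by move=> j _; ring.
by rewrite subr_ge0.
Qed.

(** The cube of [expR u >= u] at [u = l N / 3] beats [N^2] by one power of [N]; hence [27 = 3^3]. *)
Lemma sqr_geometric_small (r e : R) : 0 < r -> r < 1 -> 0 < e ->
  exists N0, forall N, (N0 <= N)%N -> N%:R ^+ 2 * r ^+ N < e.
Proof.
move=> r0 r1 e0; pose l := - ln r.
have l0 : 0 < l by rewrite oppr_gt0 ln_lt0// r0.
exists (Num.bound (27 / (l ^+ 3 * e))).+1 => N hN.
have N0 : (0 : R) < N%:R by rewrite ltr0n (leq_trans _ hN).
have lN : 27 / (l ^+ 3 * e) < N%:R.
  apply: lt_le_trans (archi_boundP _) _.
    by rewrite divr_ge0 ?mulr_ge0 ?exprn_ge0// ltW.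
  by rewrite ler_nat ltnW.
have h : (l * N%:R / 3) ^+ 3 <= (r ^+ N)^-1.
  have -> : (r ^+ N)^-1 = expR (l * N%:R / 3) ^+ 3.
    rewrite -expRM_natl -[r in LHS]lnK ?posrE// -expRM_natl -expRN; congr expR.
    by rewrite /l; field.
  have u0 : 0 <= l * N%:R / 3 by rewrite divr_ge0 ?mulr_ge0// ltW.
  rewrite ler_pXn2r ?nnegrE ?expR_ge0//.
  by apply: le_trans (expR_ge1Dx _); rewrite lerDr.
have rN : 0 < r ^+ N by rewrite exprn_gt0.
have {}h : r ^+ N * (l * N%:R / 3) ^+ 3 <= 1.
  by rewrite mulrC -ler_pdivlMr// mul1r.
have h2 : N%:R ^+ 2 * r ^+ N * (l ^+ 3 * N%:R) <= 27.
  have : r ^+ N * (l * N%:R / 3) ^+ 3 * 27 <= 1 * 27 by rewrite ler_wpM2r.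
  by rewrite mul1r; apply: le_trans; rewrite le_eqVlt; apply/orP; left; apply/eqP; field.
have l3 : 0 < l ^+ 3 by rewrite exprn_gt0.
have lN' : 27 < N%:R * (l ^+ 3 * e) by rewrite -ltr_pdivrMr// mulr_gt0.
have h3 := le_lt_trans h2 lN'.
rewrite -(ltr_pM2r (mulr_gt0 l3 N0)); apply: (lt_le_trans h3).
by rewrite le_eqVlt; apply/orP; left; apply/eqP; ring.
Qed.

End BinomialKernel.

Section CosineBound.
Context (R : realType).
Implicit Types x y z : R.

Lemma cos_lt1 x : 0 < x -> x <= 1 -> cos x < 1.
Proof.
have pi2 := pi_ge2 R; move=> x0 x1.
by rewrite -[X in _ < X]cos0 ltr_cos// in_itv/=; apply/andP; split; lra.
Qed.

Lemma dist_le1 x y z (r : R) : `|x - y| < r / 2 -> r <= 1 -> `|y| <= 4^-1 -> `|z| <= 4^-1 ->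
  `|x - z| <= 1.
Proof. by rewrite ltr_norml !ler_norml; lra. Qed.

Lemma dist_lt_halves x y z (r : R) : `|x - y| < r / 2 -> `|z - x| < r / 2 -> `|y - z| <= r.
Proof. by rewrite !ltr_norml ler_norml; lra. Qed.

End CosineBound.

(** * Smoothed densities and interior points *)

Section ImageInterior.
Context (R : realType) (d : measure_display) (Omega : measurableType d).
Variables (X Y : Omega -> R -> R) (w : Omega).
Implicit Types (c B e r : R) (mu : seq (R * R)) (K : set R) (N : nat).
Hypothesis cX : continuous (X w).
Hypothesis cY : continuous (Y w).

Let Q N : R := (\sum_(0 <= j < N) binomial_weight R N j ^+ 2) ^+ 2.

Let Q_ge N : (0 < N)%N -> (N%:R ^+ 2)^-1 <= Q N.
Proof.
move=> N0; rewrite -exprVn ler_sqr ?nnegrE ?invr_ge0 ?ler0n//; first exact: binomial_weight_sqr_sum.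
by apply: sumr_ge0 => j _; exact: sqr_ge0.
Qed.

Let Q_gt0 N : (0 < N)%N -> 0 < Q N.
Proof. by move=> N0; apply: lt_le_trans (Q_ge N0); rewrite invr_gt0 exprn_gt0// ltr0n. Qed.

(* The image of [mu] convolved with [(((1 + cos z1) / 2) ((1 + cos z2) / 2)) ^+ (N - 1)],
   normalised by the mean [Q N] of that kernel. *)
Definition smoothed_density N mu (y1 y2 : R) : R :=
  (Q N)^-1 * \sum_(p <- mu) p.1 * trig_kernel N (binomial_weight R N) (y1 - X w p.2) (y2 - Y w p.2).

(** Only the diagonal terms [i = i'], [j = j'] of the kernel energy are kept: they have frequency 0,
    hence the squared mass as Fourier energy, and their weights add up to [Q N]. The other terms are
    nonnegative. *)
Lemma smoothed_density_mass N mu : (0 < N)%N -> (forall p, p \in mu -> 0 <= p.1) ->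
  (\sum_(p <- mu) p.1) ^+ 2 <=
  \sum_(p <- mu) p.1 * smoothed_density N mu (X w p.2) (Y w p.2).
Proof.
move=> N0 mu0; set b := binomial_weight R N.
have -> : \sum_(p <- mu) p.1 * smoothed_density N mu (X w p.2) (Y w p.2) =
    (Q N)^-1 * kernel_energy X Y N b mu w.
  rewrite /kernel_energy mulr_sumr; apply: eq_bigr => p _.
  rewrite /smoothed_density mulrCA mulr_sumr; congr (_ * _).
  by apply: eq_bigr => p' _; rewrite mulrA.
rewrite mulrC ler_pdivlMr ?Q_gt0// kernel_energyE.
have e00 : fourier_energy X Y mu 0 0 w = (\sum_(p <- mu) p.1) ^+ 2.
  rewrite fourier_energyE -[RHS]addr0; congr (_ + _).
    by congr (_ ^+ 2); apply: eq_bigr => p _; rewrite !mul0r addr0 cos0 mulr1.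
  by rewrite big1 ?expr0n// => p _; rewrite !mul0r addr0 sin0 mulr0.
have b0 j : 0 <= b j by rewrite /b /binomial_weight divr_ge0 ?ler0n ?exprn_ge0.
have g0 i j : 0 <= fourier_energy X Y mu i j w by exact: fourier_energy_ge0.
move: (\sum_(p <- mu) p.1) e00 => m e00.
rewrite /Q [X in _ * X <= _]expr2 big_distrlr /= mulr_sumr; apply: ler_sum_nat => i /andP[_ iN].
rewrite mulr_sumr; apply: ler_sum_nat => j /andP[_ jN].
rewrite (bigD1_seq i) ?iota_uniq ?mem_index_iota//= (bigD1_seq j) ?iota_uniq ?mem_index_iota//=.
rewrite !subrr e00 -[leLHS]addr0; apply: lerD.
  rewrite -[leLHS]addr0; apply: lerD.
    by rewrite le_eqVlt; apply/orP; left; apply/eqP; rewrite -/b; ring.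
  apply: sumr_ge0 => j' _; apply: mulr_ge0 => //.
  by apply: mulr_ge0; apply: mulr_ge0.
apply: sumr_ge0 => i' _; apply: sumr_ge0 => j' _; apply: mulr_ge0 => //.
by apply: mulr_ge0; apply: mulr_ge0.
Qed.

Lemma cosB_le_powR (u v z e : R) : 0 < e -> e <= 1 -> `|u - v| <= z ->
  `|cos u - cos v| <= 2 * z `^ e.
Proof.
move=> e0 e1 uvz; have z0 : 0 <= z by rewrite (le_trans _ uvz).
have [zz|z1] := leP z 1.
  apply: (le_trans (cos_lipschitz u v)); apply: (le_trans uvz).
  have [->|zn0] := eqVneq z 0; first by rewrite mulr_ge0 ?powR_ge0.
  have h : z <= z `^ e by rewrite ger1_powR// lt0r zn0 z0.
  by have := powR_ge0 z e; lra.
have h : 1 <= z `^ e.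
  by have := ler_powR (ltW z1) (ltW e0); rewrite powRr0.
apply: (le_trans (ler_normB _ _)).
by have := cos_max u; have := cos_max v; lra.
Qed.

Lemma sinB_le_powR (u v z e : R) : 0 < e -> e <= 1 -> `|u - v| <= z ->
  `|sin u - sin v| <= 2 * z `^ e.
Proof.
move=> e0 e1 uvz; rewrite -!cosBpihalf; apply: cosB_le_powR => //.
by have -> : u - pi / 2 - (v - pi / 2) = u - v by ring.
Qed.

(** A shift by [r] changes the term of frequency size [k] by at most [2 (k r)^e] times its
    coefficients. Each product of [k^e] with a coefficient is split into [k^(2 + 4 e)] times the
    squared coefficient and [k^(- 2 - 2 e)]. The bound is free of [N]: this is the
    equicontinuity. *)
Lemma smoothed_density_modulus N mu e B V (r y1 y2 y1' y2' : R) : (0 < N)%N -> 0 < e -> e <= 1 ->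
  0 <= r -> `|y1 - y1'| <= r -> `|y2 - y2'| <= r ->
  freq_sum N (fun i j => freq_size R i j `^ (2 + 4 * e) * fourier_energy X Y mu i j w) <= B ->
  freq_sum N (fun i j => freq_size R i j `^ (- 2 - 2 * e)) <= V ->
  `|smoothed_density N mu y1 y2 - smoothed_density N mu y1' y2'| <= 2 * r `^ e * (B + V).
Proof.
move=> N0 e0 e1 r0 h1 h2 hB hV; set b := binomial_weight R N.
have b0 j : 0 <= b j by rewrite /b /binomial_weight divr_ge0 ?ler0n ?exprn_ge0.
pose C i j := \sum_(p <- mu) p.1 * cos (i%:~R * X w p.2 + j%:~R * Y w p.2).
pose S i j := \sum_(p <- mu) p.1 * sin (i%:~R * X w p.2 + j%:~R * Y w p.2).
pose Phi (i j : int) z1 z2 := \sum_(p <- mu) p.1 *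
  cos (i%:~R * (z1 - X w p.2) + j%:~R * (z2 - Y w p.2)).
have PhiE i j z1 z2 : Phi i j z1 z2 =
    cos (i%:~R * z1 + j%:~R * z2) * C i j + sin (i%:~R * z1 + j%:~R * z2) * S i j.
  rewrite /Phi /C /S !mulr_sumr -big_split /=; apply: eq_bigr => p _.
  rewrite (_ : i%:~R * _ + _ = (i%:~R * z1 + j%:~R * z2) - (i%:~R * X w p.2 + j%:~R * Y w p.2)); last by ring.
  by rewrite cosB; ring.
have densE z1 z2 : smoothed_density N mu z1 z2 = (Q N)^-1 *
    \sum_(0 <= i < N) \sum_(0 <= j < N) \sum_(0 <= i' < N) \sum_(0 <= j' < N)
     (b i * b j) * (b i' * b j') * Phi (i%:Z - i'%:Z) (j%:Z - j'%:Z) z1 z2.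
  congr (_ * _); rewrite /trig_kernel.
  under eq_bigr => p _ do rewrite mulr_sumr.
  rewrite exchange_big /=; apply: eq_bigr => i _.
  under eq_bigr => p _ do rewrite mulr_sumr.
  rewrite exchange_big /=; apply: eq_bigr => j _.
  under eq_bigr => p _ do rewrite mulr_sumr.
  rewrite exchange_big /=; apply: eq_bigr => i' _.
  under eq_bigr => p _ do rewrite mulr_sumr.
  rewrite exchange_big /=; apply: eq_bigr => j' _.
  by rewrite /Phi mulr_sumr; apply: eq_bigr => p _; rewrite mulrCA.
pose G (i j : int) := 2 * (r `^ e * (freq_size R i j `^ e * (`|C i j| + `|S i j|))).
have G0 i j : 0 <= G i j by rewrite /G !mulr_ge0 ?powR_ge0 ?addr_ge0.
have dPhi i j : `|Phi i j y1 y2 - Phi i j y1' y2'| <= G i j.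
  have hz : `|(i%:~R * y1 + j%:~R * y2) - (i%:~R * y1' + j%:~R * y2')| <= freq_size R i j * r.
    rewrite (_ : _ - _ = i%:~R * (y1 - y1') + j%:~R * (y2 - y2')); last by ring.
    apply: (le_trans (ler_normD _ _)); rewrite !normrM /freq_size !intr_norm.
    have := ler_wpM2l (normr_ge0 (i%:~R : R)) h1; have := ler_wpM2l (normr_ge0 (j%:~R : R)) h2.
    lra.
  have k0 : 0 <= freq_size R i j by rewrite (le_trans ler01)// freq_size_ge1.
  have hc := cosB_le_powR e0 e1 hz; have hs := sinB_le_powR e0 e1 hz.
  rewrite powRM// in hc; rewrite powRM// in hs.
  rewrite !PhiE; set a := i%:~R * y1 + j%:~R * y2 in hc hs *.
  set a' := i%:~R * y1' + j%:~R * y2' in hc hs *.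
  rewrite (_ : cos a * C i j + sin a * S i j - (cos a' * C i j + sin a' * S i j) = (cos a - cos a') * C i j + (sin a - sin a') * S i j); last by ring.
  apply: (le_trans (ler_normD _ _)); rewrite !normrM /G.
  by have := ler_wpM2r (normr_ge0 (C i j)) hc; have := ler_wpM2r (normr_ge0 (S i j)) hs; lra.
have GB i j : G i j <= r `^ e * (freq_size R i j `^ (2 + 4 * e) * fourier_energy X Y mu i j w +
    2 * freq_size R i j `^ (- 2 - 2 * e)).
  rewrite /G mulrCA; apply: ler_wpM2l; first exact: powR_ge0.
  rewrite fourier_energyE -/(C i j) -/(S i j).
  have k1 := freq_size_ge1 R i j; have k0 := lt_le_trans ltr01 k1.
  set k := freq_size R i j in k0 k1 *.
  pose al := k `^ (1 + 2 * e); pose be := k `^ (- 1 - e).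
  have -> : k `^ (2 + 4 * e) = al ^+ 2.
    by rewrite /al -powR_mulrn ?powR_ge0// -powRrM; congr (_ `^ _); ring.
  have -> : k `^ (- 2 - 2 * e) = be ^+ 2.
    by rewrite /be -powR_mulrn ?powR_ge0// -powRrM; congr (_ `^ _); ring.
  have -> : k `^ e = al * be.
    rewrite /al /be -powRD; last by rewrite (gt_eqF k0) implybT.
    by congr (_ `^ _); ring.
  rewrite -(real_normK (num_real (C i j))) -(real_normK (num_real (S i j))).
  by have := sqr_ge0 (al * `|C i j| - be); have := sqr_ge0 (al * `|S i j| - be); lra.
rewrite !densE -mulrBr normrM ger0_norm ?invr_ge0 ?(ltW (Q_gt0 N0))//.
rewrite mulrC ler_pdivrMr ?Q_gt0//.
apply: (@le_trans _ _ (\sum_(0 <= i < N) \sum_(0 <= j < N) \sum_(0 <= i' < N) \sum_(0 <= j' < N)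
     (b i * b j) * (b i' * b j') * G (i%:Z - i'%:Z) (j%:Z - j'%:Z))).
  rewrite -sumrB; apply: le_trans (ler_norm_sum _ _ _) _; apply: ler_sum => i _.
  rewrite -sumrB; apply: le_trans (ler_norm_sum _ _ _) _; apply: ler_sum => j _.
  rewrite -sumrB; apply: le_trans (ler_norm_sum _ _ _) _; apply: ler_sum => i' _.
  rewrite -sumrB; apply: le_trans (ler_norm_sum _ _ _) _; apply: ler_sum => j' _.
  have bb : 0 <= b i * b j * (b i' * b j') by apply: mulr_ge0; apply: mulr_ge0.
  by rewrite -mulrBr normrM ger0_norm//; apply: ler_wpM2l.
apply: le_trans (freq_sum_le _ _ G0) _; rewrite -/(Q N) mulrC; apply: ler_wpM2r; first exact: ltW (Q_gt0 N0).
have B0 : 0 <= B.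
  apply: le_trans hB; apply: sumr_ge0 => i _; apply: sumr_ge0 => j _.
  exact: mulr_ge0 (powR_ge0 _ _) (fourier_energy_ge0 _ _ _ _ _ _).
apply: (@le_trans _ _ (r `^ e * (B + 2 * V))); last first.
  by have := mulr_ge0 (powR_ge0 r e) B0; lra.
apply: (@le_trans _ _ (r `^ e * (freq_sum N (fun i j => freq_size R i j `^ (2 + 4 * e) *
    fourier_energy X Y mu i j w) + 2 * freq_sum N (fun i j => freq_size R i j `^ (- 2 - 2 * e))))).
  rewrite /freq_sum mulr_sumr -big_split /= mulr_sumr; apply: ler_sum => i _.
  rewrite mulr_sumr -big_split /= mulr_sumr; apply: ler_sum => j _.
  exact: GB.
apply: ler_wpM2l; first exact: powR_ge0.
by apply: lerD => //; apply: ler_wpM2l.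
Qed.

(** Distances at most 1, below [pi], keep the cosine monotone, so the periodicity of the kernel does
    no harm. The factor [N^2] is the price of the normalisation [Q N >= N^(-2)]. *)
Lemma smoothed_density_far N mu (rho F y1 y2 : R) : (0 < N)%N -> 0 <= rho -> rho <= 1 ->
  (forall p, p \in mu -> [/\ 0 <= p.1, `|y1 - X w p.2| <= 1, `|y2 - Y w p.2| <= 1 &
      rho <= `|y1 - X w p.2| \/ rho <= `|y2 - Y w p.2|]) ->
  \sum_(p <- mu) p.1 <= F ->
  smoothed_density N mu y1 y2 <= F * (N%:R ^+ 2 * ((1 + cos rho) / 2) ^+ N.-1).
Proof.
move=> N0 rho0 rho1 hmu hF.
have pi2 := pi_ge2 R.
have cmono (u : R) : rho <= `|u| -> `|u| <= 1 -> cos u <= cos rho.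
  move=> h1 h2; rewrite -(cos_norm u) leNgt ltr_cos -?leNgt// in_itv/=.
    by rewrite normr_ge0; lra.
  by rewrite rho0; lra.
have cpos (u : R) : 0 <= (1 + cos u) / 2 by have := cos_geN1 u; lra.
have c1 (u : R) : (1 + cos u) / 2 <= 1 by have := cos_le1 u; lra.
have ker p : p \in mu -> trig_kernel N (binomial_weight R N) (y1 - X w p.2) (y2 - Y w p.2)
    <= ((1 + cos rho) / 2) ^+ N.-1.
  move=> /hmu[p0 h1 h2 far]; rewrite trig_kernel_binomial//.
  have [N1|N1] := posnP N.-1; first by rewrite N1 !expr0.
  rewrite ler_pXn2r ?nnegrE ?mulr_ge0//.
  case: far => h.
    apply: (@le_trans _ _ ((1 + cos (y1 - X w p.2)) / 2)); first by rewrite ler_piMr.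
    by have := cmono _ h h1; lra.
  apply: (@le_trans _ _ ((1 + cos (y2 - Y w p.2)) / 2)); first by rewrite ler_piMl.
  by have := cmono _ h h2; lra.
rewrite /smoothed_density mulrA [F * _]mulrC -mulrA.
have N0' : (0 : R) < N%:R by rewrite ltr0n.
apply: ler_pM; rewrite ?invr_ge0 ?(ltW (Q_gt0 N0))//.
- rewrite big_seq; apply: sumr_ge0 => p /hmu[p0 _ _ _].
  exact: mulr_ge0 p0 (trig_kernel_ge0 _ _ _ _).
- rewrite -[leRHS]invrK lef_pV2 ?posrE; [exact: Q_ge|exact: Q_gt0|].
  by rewrite invr_gt0 exprn_gt0.
apply: (@le_trans _ _ ((\sum_(p <- mu) p.1) * ((1 + cos rho) / 2) ^+ N.-1)); last first.
  by rewrite ler_wpM2r// exprn_ge0.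
rewrite mulr_suml big_seq [leRHS]big_seq; apply: ler_sum => p pmu.
by have [p0 _ _ _] := hmu p pmu; rewrite ler_wpM2l// ker.
Qed.

(* The smoothed densities are equicontinuous, tend to 0 off the image, and each
   is bounded below at some point of the image: by compactness some point of the
   image has no point of the complement nearby. *)
Lemma image_contains_box K (mu : nat -> seq (R * R)) c e B F :
  compact K -> 0 < c -> 0 < e -> e <= 1 ->
  (forall x, K x -> `|X w x| <= 4^-1 /\ `|Y w x| <= 4^-1) ->
  (forall J p, p \in mu J -> K p.2 /\ 0 <= p.1) ->
  (forall J, c <= \sum_(p <- mu J) p.1 <= F) ->
  (forall N, exists2 J, (N <= J)%N &
    freq_sum J (fun i j => freq_size R i j `^ (2 + 4 * e) * fourier_energy X Y (mu J) i j w) <= B) ->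
  exists2 x, K x & exists2 r : R, 0 < r & forall z : R * R,
    `|z.1 - X w x| < r -> `|z.2 - Y w x| < r -> image X Y w K z.
Proof.
move=> cK c0 e0 e1 small hmu cmu energy.
have F0 : 0 < F by have /andP[h1 h2] := cmu 0%N; rewrite (lt_le_trans c0)// (le_trans h1).
have [V V0 hV] := @freq_sum_power_bounded R e e0.
(* Density at most [eta] at all atoms would give [c^2 <= F * eta = c^2 / 2] by
   [smoothed_density_mass]. *)
pose eta := c ^+ 2 / (2 * F).
have eta0 : 0 < eta by rewrite divr_gt0 ?exprn_gt0 ?mulr_gt0.
pose B' := Num.max B 1.
have B'0 : 0 < B' by rewrite lt_max ltr01 orbT.
(* Within [r] the densities vary by at most [eta / 2]; the other half of [eta] is left for their
   values off the image. *)
pose r := Num.min 1 ((eta / (4 * (B' + V))) `^ e^-1).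
have BV0 : 0 < 4 * (B' + V) by rewrite mulr_gt0// addr_gt0.
have r0 : 0 < r by rewrite lt_min ltr01 powR_gt0// divr_gt0.
have r1 : r <= 1 by rewrite ge_min lexx.
have re : 2 * r `^ e * (B' + V) <= eta / 2.
  have : r `^ e <= eta / (4 * (B' + V)).
    have q0 : 0 <= eta / (4 * (B' + V)) by rewrite divr_ge0// ltW.
    have -> : eta / (4 * (B' + V)) = ((eta / (4 * (B' + V))) `^ e^-1) `^ e.
      by rewrite -powRrM mulVf ?powRr1 ?gt_eqF.
    apply: ge0_ler_powR; rewrite ?nnegrE ?powR_ge0 ?(ltW e0) ?(ltW r0)//.
    by rewrite ge_min lexx orbT.
  rewrite ler_pdivlMr//; lra.
apply: contrapT => none.
have /choice[y hy] : forall x, exists z : R * R, K x ->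
    [/\ `|z.1 - X w x| < r / 2, `|z.2 - Y w x| < r / 2 & ~ image X Y w K z].
  move=> x; have [Kx|nKx] := pselect (K x); last by exists (0, 0).
  apply: contrapT => nz; apply: none; exists x => //; exists (r / 2); first by rewrite divr_gt0.
  by move=> z z1 z2; apply: contrapT => nim; apply: nz; exists z.
pose W x : set R := X w @^-1` (ball (X w x) (r / 2)) `&` Y w @^-1` (ball (Y w x) (r / 2)).
have r2 : 0 < r / 2 by rewrite divr_gt0.
have oW x : open (W x).
  by apply: openI; apply: open_comp; [move=> z _; exact: cX|exact: ball_open|
    move=> z _; exact: cY|exact: ball_open].
have avoid x : K x -> exists N0, forall J, (N0 <= J)%N ->
    freq_sum J (fun i j => freq_size R i j `^ (2 + 4 * e) * fourier_energy X Y (mu J) i j w) <= B ->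
    forall p, p \in mu J -> W x p.2 -> smoothed_density J (mu J) (X w p.2) (Y w p.2) < eta.
  move=> Kx; have [y1 y2 nim] := hy x Kx.
  have [i hi] := image_separated cX cY cK nim.
  set rho := 2^-1 ^+ i in hi.
  have rho0 : 0 < rho by rewrite exprn_gt0 ?invr_gt0.
  have rho1 : rho <= 1 by rewrite exprn_ile1 ?invr_ge0 ?invf_le1 ?ler1n.
  have cr1 := cos_lt1 rho0 rho1.
  have cr0 : 0 < cos rho.
    by apply: lt_le_trans (cos1_gt0 R) _; apply: cos_ge_cos1; rewrite ger0_norm// ltW.
  set q := (1 + cos rho) / 2.
  have q0 : 0 < q by rewrite /q; lra.
  have q1 : q < 1 by rewrite /q; lra.
  (* The factor [q] on the right turns [q^N] into the [q^(N-1)] of [smoothed_density_far]. *)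
  have [N0 hN0] : exists N0, forall N, (N0 <= N)%N -> N%:R ^+ 2 * q ^+ N < eta / 2 * q / F.
    by apply: sqr_geometric_small => //; rewrite divr_gt0// mulr_gt0// divr_gt0.
  exists N0.+1 => J NJ hJ p pmu [/= w1 w2].
  have J0 : (0 < J)%N by rewrite (leq_trans _ NJ).
  have /andP[_ mF] := cmu J.
  have hfar : smoothed_density J (mu J) (y x).1 (y x).2 <= F * (J%:R ^+ 2 * q ^+ J.-1).
    apply: smoothed_density_far => //; first exact: ltW.
    move=> p' p'mu; have [Kp' p'0] := hmu J p' p'mu.
    have [sx1 sx2] := small x Kx; have [sp1 sp2] := small _ Kp'.
    split => //.
    - exact: dist_le1 y1 r1 sx1 sp1.
    - exact: dist_le1 y2 r1 sx2 sp2.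
    - by have [h|h] := hi _ Kp'; [left|right]; rewrite distrC ltW.
  have hsmall : F * (J%:R ^+ 2 * q ^+ J.-1) < eta / 2.
    have := hN0 J (ltnW NJ); rewrite ltr_pdivlMr//.
    have -> : q ^+ J = q ^+ J.-1 * q by rewrite -exprSr prednK.
    move=> h.
    by rewrite -(ltr_pM2r q0); apply: le_lt_trans h; rewrite le_eqVlt; apply/orP; left; apply/eqP; ring.
  have BB' : B <= B' by rewrite le_max lexx.
  have := @smoothed_density_modulus J (mu J) e B' V r (X w p.2) (Y w p.2) (y x).1 (y x).2 J0 e0 e1
    (ltW r0) (dist_lt_halves w1 y1) (dist_lt_halves w2 y2) (le_trans hJ BB') (hV J).
  rewrite ler_norml => /andP[_]; lra.
have : cover_compact K by rewrite -compact_cover.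
move=> /(_ R K W (fun i _ => oW i)) [x Kx|D DK hD].
  by exists x => //; split; exact: ballxx.
have /choice[Nx hNx] : forall x, exists N0, K x -> forall J, (N0 <= J)%N ->
    freq_sum J (fun i j => freq_size R i j `^ (2 + 4 * e) * fourier_energy X Y (mu J) i j w) <= B ->
    forall p, p \in mu J -> W x p.2 -> smoothed_density J (mu J) (X w p.2) (Y w p.2) < eta.
  by move=> x; have [/avoid[N0 h]|] := pselect (K x); [exists N0|exists 0%N].
have [J NJ hJ] := energy (\max_(x <- D) Nx x).+1.
have J0 : (0 < J)%N by rewrite (leq_trans _ NJ).
have mu0 p : p \in mu J -> 0 <= p.1 by move=> /hmu[].
have lt_eta p : p \in mu J -> smoothed_density J (mu J) (X w p.2) (Y w p.2) <= eta.
  move=> pmu; have [Kp _] := hmu J p pmu; have [x /= xD Wx] := hD _ Kp.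
  apply: ltW; apply: (hNx x) => //; first by have := DK _ xD; rewrite inE.
  apply: leq_trans (ltnW NJ); rewrite (big_rem x)//=; exact: leq_maxl.
have := smoothed_density_mass J0 mu0.
have /andP[cm mF] := cmu J.
have h1 : \sum_(p <- mu J) p.1 * smoothed_density J (mu J) (X w p.2) (Y w p.2) <= F * eta.
  apply: (@le_trans _ _ ((\sum_(p <- mu J) p.1) * eta)); last by rewrite ler_wpM2r// ltW.
  rewrite mulr_suml big_seq [leRHS]big_seq; apply: ler_sum => p pmu.
  by apply: ler_wpM2l; [exact: mu0|exact: lt_eta].
have h2 : c ^+ 2 <= (\sum_(p <- mu J) p.1) ^+ 2.
  by rewrite ler_sqr ?nnegrE ?(ltW c0)// (le_trans (ltW c0)).
move=> h3; have := le_trans (le_trans h2 h3) h1.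
have -> : F * eta = c ^+ 2 / 2 by rewrite /eta; field; rewrite gt_eqF.
have h4 : 0 < c ^+ 2 by rewrite exprn_gt0.
by move=> h5; lra.
Qed.

End ImageInterior.

Lemma int_bound_double (a b : nat) (k : int) : (a < b)%N -> - a%:Z <= k -> k <= a%:Z ->
  - (2 * b)%:Z <= 2 * k /\ 2 * k < (2 * b)%:Z.
Proof. by move=> h1 h2 h3; lia. Qed.

Lemma int_bound_strict (a b : nat) (k : int) : (a < b)%N -> - a%:Z <= k -> k <= a%:Z ->
  - b%:Z <= k /\ k < b%:Z.
Proof. by move=> h1 h2 h3; lia. Qed.

(** * Hoelder continuity and the upper bound *)

Section DyadicIncrements.
Context (R : realType) (d : measure_display) (Omega : measurableType d).
Variables (P : probability Omega R) (X Y : Omega -> R -> R).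
Hypothesis bX : forall x, bounded_rv (fun w => X w x).
Hypothesis bY : forall x, bounded_rv (fun w => Y w x).
Variables (V g : R).
Hypothesis V0 : 0 < V.
Hypothesis subgaussian : forall x y, x != y -> forall u v : R, u ^+ 2 + v ^+ 2 <= 1 ->
  expect P (fun w => expR ((u * (X w x - X w y) + v * (Y w x - Y w y)) /
    (V * `|x - y| `^ g))) <= expR 3.

Let pt n (k : int) : R := k%:~R * 2^-1 ^+ n.

Let scale n : R := V * (2^-1 ^+ n) `^ g.

Let incr (u v : R) n k w : R :=
  expR ((u * (X w (pt n (k + 1)) - X w (pt n k)) + v * (Y w (pt n (k + 1)) - Y w (pt n k))) / scale n).

Let half_gt0 n : (0 : R) < 2^-1 ^+ n.
Proof. by rewrite exprn_gt0// invr_gt0. Qed.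

Let scale_gt0 n : 0 < scale n.
Proof. by rewrite mulr_gt0// powR_gt0. Qed.

Let bounded_rv_incr u v n k : bounded_rv (incr u v n k).
Proof.
have h : bounded_rv (fun w => (scale n)^-1 * (u * (X w (pt n (k + 1)) - X w (pt n k)) +
    v * (Y w (pt n (k + 1)) - Y w (pt n k)))).
  by apply: bounded_rvZ; apply: bounded_rvD; apply: bounded_rvZ; apply: bounded_rvB.
rewrite (_ : incr u v n k = fun w => expR ((scale n)^-1 * (u * (X w (pt n (k + 1)) - X w (pt n k)) +
    v * (Y w (pt n (k + 1)) - Y w (pt n k))))); first exact: bounded_rv_exp h.
by apply/funext => w; rewrite /incr mulrC.
Qed.

Let expect_incr u v n k : u ^+ 2 + v ^+ 2 <= 1 -> expect P (incr u v n k) <= expR 3.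
Proof.
move=> uv.
have dist : pt n (k + 1) - pt n k = 2^-1 ^+ n by rewrite /pt intrD; ring.
have ne : pt n (k + 1) != pt n k by rewrite -subr_eq0 dist gt_eqF.
have h := subgaussian ne uv; rewrite dist ger0_norm in h; last exact: ltW.
exact: h.
Qed.

(** The exponential moments of the [2 T 2^n] increments of level [n] are summed with weight [4^-n],
    which makes the means summable. A bounded total puts each exponential below [B 4^n], and the
    logarithm of this gives the factor [n + 1]. *)
Lemma dyadic_increments T : {ae P, forall w, exists2 C : R, 0 <= C & forall n (k : int),
  - (T * 2 ^ n)%:Z <= k -> k < (T * 2 ^ n)%:Z ->
  `|X w (pt n (k + 1)) - X w (pt n k)| <= C * n.+1%:R * (2^-1 ^+ n) `^ g /\
  `|Y w (pt n (k + 1)) - Y w (pt n k)| <= C * n.+1%:R * (2^-1 ^+ n) `^ g}.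
Proof.
(* Both signs in both coordinates, so that one bound controls two absolute values. *)
pose F n k w := incr 1 0 n k w + incr (-1) 0 n k w + (incr 0 1 n k w + incr 0 (-1) n k w).
have bF n k : bounded_rv (F n k).
  by apply: bounded_rvD; apply: bounded_rvD; exact: bounded_rv_incr.
have F0 n k w : 0 <= F n k w by rewrite !addr_ge0// expR_ge0.
have eF n k : expect P (F n k) <= 4 * expR 3.
  rewrite expectD; [|by apply: bounded_rvD; exact: bounded_rv_incr..].
  rewrite expectD; [|exact: bounded_rv_incr..].
  rewrite expectD; [|exact: bounded_rv_incr..].
  have h1 := @expect_incr 1 0 n k; have h2 := @expect_incr (-1) 0 n k.
  have h3 := @expect_incr 0 1 n k; have h4 := @expect_incr 0 (-1) n k.
  rewrite (_ : 4 * expR 3 = expR 3 + expR 3 + (expR 3 + expR 3)); last by ring.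
  apply: lerD; apply: lerD.
  - by apply: h1; rewrite expr1n expr0n addr0.
  - by apply: h2; rewrite sqrrN expr1n expr0n addr0.
  - by apply: h3; rewrite expr1n expr0n add0r.
  - by apply: h4; rewrite sqrrN expr1n expr0n add0r.
pose m n := (T * 2 ^ n)%N.
pose tot J w := \sum_(0 <= n < J) (4^-1) ^+ n * \sum_(0 <= i < m n + m n) F n (i%:Z - (m n)%:Z) w.
have : {ae P, forall w, exists B : R, forall N, exists2 J, (N <= J)%N & tot J w <= B}.
  apply: (@liminf_bounded_expect _ _ _ P _ (2 * T%:R * (4 * expR 3) * (1 - 2^-1)^-1)).
  - move=> J; apply: bounded_rv_sum => n; apply: bounded_rvZ; apply: bounded_rv_sum => i; exact: bF.
  - move=> J w; apply: sumr_ge0 => n _; apply: mulr_ge0; first by rewrite exprn_ge0 ?invr_ge0.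
    by apply: sumr_ge0 => i _; exact: F0.
  move=> J; rewrite /tot expect_sum; last first.
    by move=> n; apply: bounded_rvZ; apply: bounded_rv_sum => i; exact: bF.
  have h0 : 0 <= 2 * T%:R * (4 * expR 3) :> R by rewrite !mulr_ge0 ?ler0n ?expR_ge0.
  apply: (@le_trans _ _ (\sum_(n < J) (2 * T%:R * (4 * expR 3)) * 2^-1 ^+ n)); last first.
    by rewrite -mulr_sumr ler_wpM2l// sum_geometric_le ?invr_ge0// invf_lt1// ltr1n.
  rewrite big_mkord; apply: ler_sum => -[n nJ] _ /=.
  rewrite expectZ; last by apply: bounded_rv_sum => i; exact: bF.
  rewrite expect_sum; last by move=> i; exact: bF.
  apply: (@le_trans _ _ (4^-1 ^+ n * \sum_(0 <= i < m n + m n) (4 * expR 3))).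
    by apply: ler_wpM2l; [rewrite exprn_ge0 ?invr_ge0|apply: ler_sum => i _; exact: eF].
  rewrite sumr_const_nat subn0 -[(4 * expR 3) *+ _]mulr_natl natrD /m natrM natrX.
  rewrite (_ : (4^-1 : R) = 2^-1 * 2^-1); last by rewrite -invfM -natrM.
  rewrite exprMn le_eqVlt; apply/orP; left; apply/eqP.
  have e : (2^-1 : R) ^+ n * 2 ^+ n = 1 by rewrite -exprMn mulVf ?expr1n// pnatr_eq0.
  have -> : 2^-1 ^+ n * 2^-1 ^+ n * ((T%:R * 2 ^+ n + T%:R * 2 ^+ n) * (4 * expR 3)) =
    2 * T%:R * (4 * expR 3) * 2^-1 ^+ n * (2^-1 ^+ n * 2 ^+ n) :> R by ring.
  by rewrite e mulr1.
apply: filterS => w [B0 hB0]; pose B := Num.max B0 1.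
have B1 : 1 <= B by rewrite le_max lexx orbT.
(* Level [n] occurs in [tot J] once [J > n], and a bounded total occurs for arbitrarily large
   [J]. *)
have hB n (k : int) : - (m n)%:Z <= k -> k < (m n)%:Z -> F n k w <= B * 4 ^+ n.
  move=> k1 k2; have [J nJ hJ] := hB0 n.+1.
  have [i iE] : exists i : nat, k = i%:Z - (m n)%:Z.
    exists `|(k + (m n)%:Z)%R|%N; rewrite gez0_abs; lia.
  have im : (i < m n + m n)%N by move: k2; rewrite iE; lia.
  have h : 4^-1 ^+ n * F n k w <= B.
    apply: (@le_trans _ _ B0); last by rewrite le_max lexx.
    apply: le_trans hJ; rewrite /tot (bigD1_seq n) ?iota_uniq ?mem_index_iota//=.
    rewrite -[leLHS]addr0; apply: lerD.
      apply: ler_wpM2l; first by rewrite exprn_ge0 ?invr_ge0.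
      rewrite (bigD1_seq i) ?iota_uniq ?mem_index_iota//= -iE lerDl.
      by apply: sumr_ge0 => l _; exact: F0.
    apply: sumr_ge0 => l _; apply: mulr_ge0; first by rewrite exprn_ge0 ?invr_ge0.
    by apply: sumr_ge0 => l' _; exact: F0.
  by move: h; rewrite exprVn mulrC ler_pdivrMr// exprn_gt0.
pose C := V * (ln B + ln 4).
have lB : 0 <= ln B by rewrite ln_ge0.
have l4 : 0 <= ln 4 :> R by rewrite ln_ge0// ler1n.
exists C => [|n k k1 k2]; first by rewrite mulr_ge0 ?addr_ge0// ltW.
have {hB} hF := hB n k k1 k2.
have key (z : R) : expR (z / scale n) <= F n k w -> z <= C * n.+1%:R * (2^-1 ^+ n) `^ g.
  move=> hz; have {hz} hz := le_trans hz hF.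
  have : z / scale n <= ln B + n%:R * ln 4.
    rewrite -ler_expR (le_trans hz)// expRD lnK ?posrE ?(lt_le_trans ltr01)//.
    by rewrite expRM_natl lnK// posrE.
  rewrite ler_pdivrMr// => /le_trans; apply; rewrite /C /scale.
  have -> : V * (ln B + ln 4) * n.+1%:R * (2^-1 ^+ n) `^ g = (ln B + ln 4) * n.+1%:R * (V * (2^-1 ^+ n) `^ g) by ring.
  apply: ler_wpM2r; first exact: ltW (scale_gt0 n).
  rewrite -[n.+1%:R]natr1; have xl := mulr_ge0 (ler0n R n) lB.
  rewrite (_ : (_ + _) * (_ + 1) = ln B + n%:R * ln 4 + (n%:R * ln B + ln 4)); last by ring.
  by rewrite lerDl addr_ge0.
have i0 u v := expR_ge0 ((u * (X w (pt n (k + 1)) - X w (pt n k)) + v * (Y w (pt n (k + 1)) - Y w (pt n k))) / scale n).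
split; rewrite ler_norml lerNl; apply/andP; split; apply: key; rewrite /F /incr.
- have := i0 1 0; have := i0 0 1; have := i0 0 (-1).
  by rewrite !mul0r !addr0 !mulN1r; lra.
- have := i0 (-1) 0; have := i0 0 1; have := i0 0 (-1).
  by rewrite !mul0r !addr0 !mul1r; lra.
- have := i0 1 0; have := i0 0 1; have := i0 (-1) 0.
  by rewrite !mul0r !add0r !mulN1r; lra.
- have := i0 1 0; have := i0 0 (-1); have := i0 (-1) 0.
  by rewrite !mul0r !add0r !mul1r; lra.
Qed.

End DyadicIncrements.

(** * Chaining along dyadic points *)

Section Chaining.
Context (R : realType).
Implicit Types (f : R -> R) (x y g h : R) (n T : nat).

Let pt n (k : int) : R := k%:~R * 2^-1 ^+ n.

(** Bernoulli's inequality for [r^-1]. It absorbs the factor [n + 1] of the dyadic increments into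
    the loss from [g] to [h]. *)
Lemma linear_geometric_bounded (r : R) : 0 < r -> r < 1 ->
  exists2 A : R, 0 < A & forall n, n.+1%:R * r ^+ n <= A.
Proof.
move=> r0 r1; pose y := Num.min 1 (r^-1 - 1).
have ri : 1 < r^-1 by rewrite invf_gt1.
have y0 : 0 < y by rewrite lt_min ltr01 subr_gt0.
have y1 : y <= 1 by rewrite ge_min lexx.
have yr : 1 + y <= r^-1.
  have : y <= r^-1 - 1 by rewrite ge_min lexx orbT.
  lra.
exists y^-1 => [|n]; first by rewrite invr_gt0.
have bern : 1 + n%:R * y <= r^-1 ^+ n.
  elim: n => [|n IH]; first by rewrite mul0r addr0 expr0.
  rewrite exprS -natr1; have n0 : (0 : R) <= n%:R by rewrite ler0n.
  have h1 : 0 <= 1 + n%:R * y by rewrite addr_ge0// mulr_ge0// ltW.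
  have h2 : 0 <= 1 + y by rewrite addr_ge0// ltW.
  have := ler_pM h2 h1 yr IH; have := mulr_ge0 n0 (sqr_ge0 y); rewrite expr2; lra.
have rn : 0 < r ^+ n by rewrite exprn_gt0.
rewrite -ler_pdivlMr// -exprVn; apply: le_trans (ler_wpM2l _ bern); last by rewrite invr_ge0 ltW.
rewrite ler_pdivlMl// -natr1 mulrDr mulr1 mulrC; lra.
Qed.

Lemma dyadic_index_succ n x :
  dyadic_index n.+1 x = 2 * dyadic_index n x \/ dyadic_index n.+1 x = 2 * dyadic_index n x + 1.
Proof.
rewrite /dyadic_index exprS -mulrA; set z := 2 ^+ n * x.
have := floor_le z; have := floorD1_gt z; rewrite intrD => h1 h2.
have [h|h] := ltP z ((Num.floor z)%:~R + 2^-1); [left|right]; apply: floor_def.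
  by rewrite intrD intrM; apply/andP; split; lra.
by rewrite !intrD intrM; apply/andP; split; lra.
Qed.

(** At the level [n] with [2^-n] comparable to [|x - y|] the dyadic approximations of [x] and [y]
    coincide or are neighbours, and each point is reached from its own by increments in geometric
    progression of ratio [2^-h]. Increments are assumed on a window larger by 1 so that neighbours
    of extreme cells stay inside. *)
Lemma holder_of_dyadic f (C g h : R) T : continuous f -> 0 <= C -> 0 < h -> h < g -> h <= 1 ->
  (forall n (k : int), - (T.+1 * 2 ^ n)%:Z <= k -> k < (T.+1 * 2 ^ n)%:Z ->
     `|f (pt n (k + 1)) - f (pt n k)| <= C * n.+1%:R * (2^-1 ^+ n) `^ g) ->
  exists2 C', 0 < C' & forall x y, `|x| <= T%:R -> `|y| <= T%:R -> `|x - y| <= 1 ->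
    `|f x - f y| <= C' * `|x - y| `^ h.
Proof.
move=> cf C0 h0 hg h1 inc.
pose r := (2 : R) `^ (- h).
have r0 : 0 < r by rewrite powR_gt0.
have r1 : r < 1 by apply: powR2_lt1; rewrite oppr_lt0.
have rE n : (2^-1 ^+ n : R) `^ h = r ^+ n.
  by rewrite -powR_half_expn powR_half /r powRN.
have hg0 : h - g < 0 by rewrite subr_lt0.
have [A A0 hA] := @linear_geometric_bounded (2 `^ (h - g)) (powR_gt0 _ (ltr0Sn R 1))
  (powR2_lt1 hg0).
pose D := C * A + 1.
have D0 : 0 < D by rewrite ltr_wpDl// mulr_ge0// ltW.
have {}inc n (k : int) : - (T.+1 * 2 ^ n)%:Z <= k -> k < (T.+1 * 2 ^ n)%:Z ->
    `|f (pt n (k + 1)) - f (pt n k)| <= D * r ^+ n.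
  move=> k1 k2; apply: le_trans (inc n k k1 k2) _.
  have -> : (2^-1 ^+ n : R) `^ g = (2 `^ (h - g)) ^+ n * r ^+ n.
    rewrite -rE -powR_half_expn -powR_half_expn -exprMn; congr (_ ^+ n).
    rewrite !powR_half -!powRN -powRD ?pnatr_eq0 ?implybT//; congr (_ `^ _); ring.
  rewrite mulrA; apply: ler_wpM2r; first by rewrite exprn_ge0// ltW.
  rewrite -mulrA; apply: le_trans (ler_wpM2l C0 (hA n)) _; rewrite /D; lra.
have rng x n : `|x| <= T%:R -> - (T * 2 ^ n)%:Z <= dyadic_index n x /\ dyadic_index n x <= (T * 2 ^ n)%:Z.
  rewrite ler_norml => /andP[x1 x2]; have p0 : (0 : R) <= 2 ^+ n by exact: exprn_ge0.
  have e : ((T * 2 ^ n)%:Z)%:~R = 2 ^+ n * T%:R :> R by rewrite -pmulrn natrM natrX mulrC.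
  split; rewrite /dyadic_index.
    by rewrite floor_ge_int intrN e -mulrN ler_wpM2l.
  by rewrite -(ler_int R) e; apply: le_trans (floor_le _) _; rewrite ler_wpM2l.
have T2 n : (T * 2 ^ n < T.+1 * 2 ^ n)%N by rewrite ltn_pmul2r ?expn_gt0.
have step x n : `|x| <= T%:R ->
    `|f (pt n.+1 (dyadic_index n.+1 x)) - f (pt n (dyadic_index n x))| <= D * r ^+ n.+1.
  move=> xT; have [k1 k2] := rng x n xT; set k := dyadic_index n x in k1 k2 *.
  have ek : pt n k = pt n.+1 (2 * k).
    by rewrite /pt exprS intrM; field.
  have rn : 0 <= D * r ^+ n.+1 by rewrite mulr_ge0 ?exprn_ge0// ltW.
  rewrite ek; have [->|->] := dyadic_index_succ n x; first by rewrite subrr normr0.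
  have [b1 b2] := int_bound_double (T2 n) k1 k2.
  by apply: inc; rewrite -/k expnS mulnCA.
have chain x n m : `|x| <= T%:R ->
    `|f (pt (n + m) (dyadic_index (n + m) x)) - f (pt n (dyadic_index n x))| <=
    D * r ^+ n * \sum_(i < m) r ^+ i.+1.
  move=> xT; elim: m => [|m IH]; first by rewrite addn0 subrr normr0 big_ord0 mulr0.
  rewrite big_ord_recr /= mulrDr addnS.
  set u := f (pt (n + m).+1 _); set v := f (pt (n + m) _) in IH *; set z := f _ in IH *.
  rewrite (_ : u - z = (v - z) + (u - v)); last by ring.
  apply: (le_trans (ler_normD _ _)); apply: lerD => //.
  apply: le_trans (step x (n + m)%N xT) _.
  by rewrite le_eqVlt; apply/orP; left; apply/eqP; rewrite -addnS exprD; ring.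
pose E := D / (1 - r).
have E0 : 0 < E by rewrite divr_gt0// subr_gt0.
have approx x n : `|x| <= T%:R -> `|f x - f (pt n (dyadic_index n x))| <= E * r ^+ n.
  move=> xT; apply/ler_addgt0Pr => e e0.
  have /cvgrPdist_lt/(_ e e0)/nbhs_ballP[dl /= dl0 hdl] := cf x.
  have [m hm] := half_expn_lt dl0.
  pose M := (n + m)%N.
  have close : `|x - pt M (dyadic_index M x)| < dl.
    have p0 : (0 : R) < 2 ^+ M by exact: exprn_gt0.
    apply: le_lt_trans hm; apply: (@le_trans _ _ (2^-1 ^+ M)); last first.
      by apply: ler_wiXn2l; rewrite ?invr_ge0// ?invf_le1// ?ler1n// leq_addl.
    rewrite /pt /dyadic_index exprVn -(ler_pM2r p0) mulVf ?gt_eqF//.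
    rewrite -[X in _ * X](gtr0_norm p0) -normrM mulrBl mulfVK ?gt_eqF// mulrC.
    have := floor_le (2 ^+ M * x); have := floorD1_gt (2 ^+ M * x); rewrite intrD => h2 h3.
    by rewrite ler_norml; apply/andP; split; lra.
  have := hdl _ close; set v := f (pt M _) => hv.
  set z := f (pt n _).
  rewrite (_ : f x - z = (v - z) + (f x - v)); last by ring.
  apply: (le_trans (ler_normD _ _)); apply: lerD; last exact: ltW.
  apply: le_trans (chain x n m xT) _; rewrite /E [leRHS]mulrAC; apply: ler_wpM2l.
    by rewrite mulr_ge0 ?exprn_ge0// ltW.
  apply: le_trans (sum_geometric_le m.+1 (ltW r0) r1).
  by rewrite big_ord_recl /= expr0 lerDr.
have close x y n : `|x| <= T%:R -> `|y| <= T%:R -> `|x - y| <= 2^-1 ^+ n ->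
    `|f x - f y| <= (2 * E + D) * r ^+ n.
  move=> xT yT xy.
  have ax := approx x n xT; have ay := approx y n yT.
  have [kx1 kx2] := rng x n xT; have [ky1 ky2] := rng y n yT.
  have mid : `|f (pt n (dyadic_index n x)) - f (pt n (dyadic_index n y))| <= D * r ^+ n.
    have D1 : 0 <= D * r ^+ n by rewrite mulr_ge0 ?exprn_ge0// ltW.
    have /or3P[/eqP ->|/eqP e|/eqP e] := dist_dyadic_index xy; first by rewrite subrr normr0.
      by rewrite e distrC; have [b1 b2] := int_bound_strict (T2 n) kx1 kx2; exact: inc.
    have -> : dyadic_index n x = dyadic_index n y + 1 by rewrite e subrK.
    by have [b1 b2] := int_bound_strict (T2 n) ky1 ky2; exact: inc.
  set u := f (pt n (dyadic_index n x)) in ax mid; set v := f (pt n (dyadic_index n y)) in ay mid.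
  rewrite (_ : f x - f y = (f x - u) + (u - v) - (f y - v)); last by ring.
  apply: (le_trans (ler_normB _ _)); have := ler_normD (f x - u) (u - v); lra.
have G0 : 0 < 2 * E + D by rewrite addr_gt0// mulr_gt0.
exists (2 * (2 * E + D)) => [|x y xT yT xy]; first by rewrite mulr_gt0.
have [->|xny] := eqVneq x y.
  by rewrite !subrr !normr0 mulr_ge0 ?powR_ge0// mulr_ge0// ltW.
have xy0 : 0 < `|x - y| by rewrite normr_gt0 subr_eq0.
have [n /andP[n1 n2]] : exists n, (2 : R) ^+ n <= `|x - y|^-1 < 2 ^+ n.+1.
  by apply: between_powers; [lra|rewrite invf_ge1].
have pn : 0 < 2 ^+ n :> R by exact: exprn_gt0.
have le1 : `|x - y| <= 2^-1 ^+ n by rewrite exprVn -[leLHS]invrK lef_pV2 ?posrE ?invr_gt0.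
have le2 : 2^-1 ^+ n <= 2 * `|x - y|.
  rewrite exprVn -[leRHS]invrK lef_pV2 ?posrE ?invr_gt0 ?mulr_gt0//.
  by rewrite invfM ler_pdivrMl// -exprS ltW.
apply: (le_trans (close x y n xT yT le1)).
rewrite [2 * (2 * E + D)]mulrC -mulrA; apply: ler_wpM2l; first exact: ltW.
rewrite -rE; apply: (@le_trans _ _ ((2 * `|x - y|) `^ h)).
  by apply: ge0_ler_powR; rewrite ?nnegrE ?(ltW h0) ?mulr_ge0// exprn_ge0 ?invr_ge0.
rewrite powRM//; apply: ler_wpM2r; first exact: powR_ge0.
by apply: ler1_powR => //; rewrite ler1n.
Qed.

End Chaining.

Lemma shift_absz (a : nat) (k : int) : - a%:Z <= k -> `|(k + a%:Z)%R|%N%:Z - a%:Z = k.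
Proof. by move=> h; lia. Qed.

(** * Sets of Hausdorff measure zero *)

Section HausdorffNull.
Context (R : realType) (T : Type) (dist : T -> T -> R).
Hypothesis dist_ge0 : forall x y, 0 <= dist x y.
Implicit Types (s r : R) (U A E : set T).

Lemma diameter_le U r : (forall x y, U x -> U y -> dist x y <= r) -> (diameter dist U <= r%:E)%E.
Proof. by move=> h; apply: ge_ereal_sup => _ [x [y [Ux Uy ->]]]; rewrite lee_fin h. Qed.

Lemma dist_le_diameter U x y : U x -> U y -> ((dist x y)%:E <= diameter dist U)%E.
Proof. by move=> Ux Uy; apply: ereal_sup_ubound; exists x, y. Qed.

Lemma diameter_pow_ge0 s U : (0 <= diameter_pow dist s U)%E.
Proof. by rewrite /diameter_pow; case: ifP => // _; exact: poweR_ge0. Qed.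

Lemma diameter_pow_le s r U : 0 <= s -> 0 <= r ->
  (forall x y, U x -> U y -> dist x y <= r) -> (diameter_pow dist s U <= (r `^ s)%:E)%E.
Proof.
move=> s0 r0 h; rewrite /diameter_pow; case: ifPn => [_|/set0P[x Ux]].
  by rewrite lee_fin powR_ge0.
have := dist_le_diameter Ux Ux; have := diameter_le h.
case: (diameter dist U) => [t| |]//=; rewrite !lee_fin => tr xt.
have t0 : 0 <= t by rewrite (le_trans _ xt).
by apply: ge0_ler_powR.
Qed.

Lemma hausdorff_null_cover s A (delta e : R) : hausdorff_measure dist s A = 0%E ->
  0 < delta -> 0 < e -> exists U : nat -> set T,
    [/\ forall i, (diameter dist (U i) <= delta%:E)%E, A `<=` \bigcup_i U i &
        (\sum_(i <oo) diameter_pow dist s (U i) < e%:E)%E].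
Proof.
move=> H0 d0 e0; have : (hausdorff_content dist s delta A < e%:E)%E.
  apply: (@le_lt_trans _ _ (hausdorff_measure dist s A)); last by rewrite H0 lte_fin.
  by apply: ereal_sup_ubound; exists delta.
by move=> /ereal_inf_lt[_ [U [dU AU] <-] h]; exists U.
Qed.

Lemma cover_hausdorff_null s A : (forall delta e : R, 0 < delta -> 0 < e -> exists U : nat -> set T,
    [/\ forall i, (diameter dist (U i) <= delta%:E)%E, A `<=` \bigcup_i U i &
        (\sum_(i <oo) diameter_pow dist s (U i) <= e%:E)%E]) ->
  hausdorff_measure dist s A = 0%E.
Proof.
move=> h; have c0 delta : 0 < delta -> hausdorff_content dist s delta A = 0%E.
  move=> d0; apply/eqP; rewrite eq_le; apply/andP; split.
    apply/lee_addgt0Pr => e e0; rewrite add0e; have [U [dU AU hU]] := h _ _ d0 e0.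
    by apply: le_trans hU; apply: ereal_inf_lbound; exists U.
  apply: le_ereal_inf_tmp => _ [U _ <-]; apply: nneseries_ge0 => i _ _.
  exact: diameter_pow_ge0.
apply/eqP; rewrite eq_le; apply/andP; split.
  by apply: ge_ereal_sup => _ [delta /= d0 <-]; rewrite c0.
apply: (@le_trans _ _ (hausdorff_content dist s 1 A)); first by rewrite c0.
by apply: ereal_sup_ubound; exists 1 => //=.
Qed.

(** The Hoelder constant of a path depends on the bounded window, so the image is treated as a
    countable union over windows. *)
Lemma hausdorff_null_bigcup s (E : nat -> set T) :
  (forall n, hausdorff_measure dist s (E n) = 0%E) ->
  hausdorff_measure dist s (\bigcup_n E n) = 0%E.
Proof.
move=> H0; apply: cover_hausdorff_null => delta e d0 e0.
have /choice[U hU] : forall n, exists U : nat -> set T,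
    [/\ forall i, (diameter dist (U i) <= delta%:E)%E, E n `<=` \bigcup_i U i &
        (\sum_(i <oo) diameter_pow dist s (U i) < (e / (2 ^ n.+1)%:R)%:E)%E].
  by move=> n; apply: hausdorff_null_cover => //; rewrite divr_gt0// ltr0n expn_gt0.
have /card_esym/ppcard_eqP[g] := card_nat2.
have gbij : set_bij [set: nat] [set: nat * nat] g by exact: bij.
exists (fun i => U (g i).1 (g i).2); split.
- by move=> i; have [h _ _] := hU (g i).1.
- move=> x [n _ Enx]; have [_ h _] := hU n; have [j _ Uj] := h x Enx.
  have [_ _ /(_ (n, j) I)[i _ gi]] := gbij.
  by exists i => //; rewrite gi.
rewrite nneseries_esumT; last by move=> i; exact: diameter_pow_ge0.
rewrite -(@reindex_esum R nat (nat * nat)%type setT setT g (fun p => diameter_pow dist s (U p.1 p.2)))//.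
have -> : [set: nat * nat] = setT `*`` (fun=> setT) by apply/seteqP; split.
rewrite -(@esum_esum R nat nat setT (fun=> setT) (fun n j => diameter_pow dist s (U n j)))//; last first.
  by move=> i j _ _; exact: diameter_pow_ge0.
rewrite -nneseries_esumT; last by move=> n; apply: esum_ge0 => j _; exact: diameter_pow_ge0.
apply: le_trans (epsilon_trick0 xpredT (ltW e0)).
apply: lee_nneseries => n *; first by apply: esum_ge0 => j _; exact: diameter_pow_ge0.
rewrite -nneseries_esumT; last by move=> j; exact: diameter_pow_ge0.
by have [_ _ /ltW] := hU n.
Qed.

Lemma hausdorff_dim_le s A : 0 <= s -> hausdorff_measure dist s A = 0%E ->
  (hausdorff_dim dist A <= s%:E)%E.
Proof. by move=> s0 H0; apply: ereal_inf_lbound; exists s. Qed.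

Lemma hausdorff_dim_ge0 A : (0 <= hausdorff_dim dist A)%E.
Proof. by apply: le_ereal_inf_tmp => _ [s [s0 _] <-]; rewrite lee_fin. Qed.

End HausdorffNull.

Section HausdorffComplex.
Context (R : realType).
Implicit Types (s h C : R).

Lemma distC_ge0 (z z' : R[i]) : 0 <= distC z z'.
Proof. exact: normc_ge0. Qed.

Lemma distR_ge0 (x y : R) : 0 <= distR x y.
Proof. exact: normr_ge0. Qed.

Lemma distC_le_ReIm (z z' : R[i]) :
  distC z z' <= `|complex.Re z - complex.Re z'| + `|complex.Im z - complex.Im z'|.
Proof.
by apply: le_trans (normc_le_ReIm _) _; case: z => a b; case: z' => a' b'.
Qed.

Lemma hausdorff_null_image (S : R -> R[i]) (A : set R) s h C : 0 <= s -> 0 < h -> 0 < C ->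
  (forall x y, A x -> A y -> `|x - y| <= 1 -> distC (S x) (S y) <= C * `|x - y| `^ h) ->
  hausdorff_measure (@distR R) s A = 0%E ->
  hausdorff_measure (@distC R) (s / h) (S @` A) = 0%E.
Proof.
move=> s0 h0 C0 hol H0; apply: cover_hausdorff_null => delta e d0 e0.
(* The second entry solves [C * x^h = delta]; the first keeps all pairs within the range of the
   Hoelder hypothesis. *)
pose delta' := Num.min 1 ((delta / C) `^ h^-1).
have d'0 : 0 < delta' by rewrite lt_min ltr01 powR_gt0// divr_gt0.
have d'1 : delta' <= 1 by rewrite ge_min lexx.
have Csh : 0 < C `^ (s / h) by rewrite powR_gt0.
have e'0 : 0 < e / C `^ (s / h) by rewrite divr_gt0.
have [U [dU AU hU]] := hausdorff_null_cover H0 d'0 e'0.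
exists (fun i => S @` (U i `&` A)).
have sh0 : 0 <= s / h by rewrite divr_ge0// ltW.
have close i x y : U i x -> U i y -> `|x - y| <= delta'.
  by move=> Ux Uy; rewrite -lee_fin; apply: le_trans (dU i); exact: dist_le_diameter.
have Cd : C * delta' `^ h <= delta.
  rewrite mulrC -ler_pdivlMr//; apply: (@le_trans _ _ (((delta / C) `^ h^-1) `^ h)).
    by apply: ge0_ler_powR; rewrite ?nnegrE ?powR_ge0 ?(ltW h0) ?(ltW d'0)// ge_min lexx orbT.
  by rewrite -powRrM mulVf ?gt_eqF// powRr1// divr_ge0// ltW.
split.
- move=> i; apply: diameter_le => _ _ [x [Ux Ax] <-] [y [Uy Ay] <-].
  have xy := close i x y Ux Uy.
  apply: le_trans (hol x y Ax Ay (le_trans xy d'1)) _; apply: le_trans Cd.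
  apply: ler_wpM2l; first exact: ltW.
  by apply: ge0_ler_powR; rewrite ?nnegrE ?(ltW h0) ?(ltW d'0).
- by move=> _ [x Ax <-]; have [i _ Ux] := AU x Ax; exists i => //; exists x.
apply: (@le_trans _ _ (\sum_(i <oo) (C `^ (s / h))%:E * diameter_pow (@distR R) s (U i))%E).
  apply: lee_nneseries => i *; first by apply: diameter_pow_ge0.
  rewrite [in leRHS]/diameter_pow; case: ifPn => [/eqP Ui0|/set0P[x0 Ux0]].
    by rewrite Ui0 set0I image_set0 /diameter_pow eqxx mule0.
  have h1 := dist_le_diameter (@distR R) Ux0 Ux0; have h2 := dU i.
  have hd x y := @dist_le_diameter R R (@distR R) (U i) x y.
  move: h1 h2 hd; case: (diameter _ _) => [t| |]//=; rewrite !lee_fin => h1 h2 hd.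
  have t0 : 0 <= t by apply: le_trans h1; exact: distR_ge0.
  rewrite -EFinM; have -> : C `^ (s / h) * t `^ s = (C * t `^ h) `^ (s / h).
    rewrite powRM ?(ltW C0) ?powR_ge0// -powRrM; congr (_ * _ `^ _).
    by field; rewrite gt_eqF.
  apply: diameter_pow_le => //; first exact: distC_ge0.
    by rewrite mulr_ge0 ?powR_ge0// ltW.
  move=> _ _ [x [Ux Ax] <-] [y [Uy Ay] <-].
  have xy := close i x y Ux Uy.
  apply: le_trans (hol x y Ax Ay (le_trans xy d'1)) _.
  apply: ler_wpM2l; first exact: ltW.
  apply: ge0_ler_powR; rewrite ?nnegrE ?(ltW h0)//.
  by have := hd x y Ux Uy; rewrite lee_fin.
rewrite nneseriesZl; last by move=> i _; exact: diameter_pow_ge0.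
apply: (@le_trans _ _ ((C `^ (s / h))%:E * (e / C `^ (s / h))%:E)%E).
  by apply: lee_wpmul2l; [rewrite lee_fin ltW|exact: ltW].
by rewrite -EFinM lee_fin mulrC divfK// gt_eqF.
Qed.

(** A grid of mesh [2^-n] needs of order [2^(2 n)] squares, each costing of order [2^(- s n)]. This
    is the source of the bound 2 on the dimension. *)
Lemma hausdorff_null_bounded (E : set R[i]) s M : 2 < s ->
  (forall z, E z -> `|complex.Re z| <= M%:R /\ `|complex.Im z| <= M%:R) ->
  hausdorff_measure (@distC R) s E = 0%E.
Proof.
move=> s2 EM; apply: cover_hausdorff_null => delta e d0 e0.
pose c : R := (2 * M).+1%:R ^+ 2 * 2 `^ s.
have c0 : 0 < c by rewrite mulr_gt0 ?exprn_gt0 ?powR_gt0.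
pose r : R := 2 `^ (2 - s).
have r0 : 0 < r by rewrite powR_gt0.
have r1 : r < 1 by apply: powR2_lt1; rewrite subr_lt0.
have [n1 hn1] : exists n1, forall n, (n1 <= n)%N -> r ^+ n < e / c.
  have /cvgrPdist_lt/(_ (e / c) (divr_gt0 e0 c0))[n1 _ hn1] := @cvg_expr R r ltac:(by rewrite ger0_norm// ltW).
  by exists n1 => m /hn1/=; rewrite sub0r normrN ger0_norm// exprn_ge0// ltW.
have [n2 hn2] := half_expn_lt (divr_gt0 d0 (ltr0Sn R 1)).
pose n := maxn n1 n2.
have small : 2 * 2^-1 ^+ n <= delta.
  rewrite mulrC -ler_pdivlMr//; apply: le_trans (ltW hn2).
  by apply: ler_wiXn2l; rewrite ?invr_ge0// ?invf_le1// ?ler1n// leq_maxr.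
(* [2 M + 1] unit intervals rather than [2 M]: cells are half-open and the end point [M] must be
   covered. *)
pose N := ((2 * M).+1 * 2 ^ n)%N.
have N0 : (0 < N)%N by rewrite muln_gt0 expn_gt0.
pose cell (k : nat) : set R := [set x | dyadic_index n x = k%:Z - (M * 2 ^ n)%:Z].
pose U (i : nat) : set R[i] := if (i < N * N)%N then
  [set z | cell (i %/ N)%N (complex.Re z) /\ cell (i %% N)%N (complex.Im z)] else set0.
have dist i z z' : U i z -> U i z' -> distC z z' <= 2 * 2^-1 ^+ n.
  rewrite /U; case: ifP => // _ [h1 h2] [h3 h4].
  apply: (le_trans (distC_le_ReIm z z')); rewrite mulr_natl mulr2n.
  by apply: lerD; rewrite ltW//; apply: dyadic_index_dist; [rewrite h1 h3|rewrite h2 h4].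
have inrange x : `|x| <= M%:R -> exists2 k, (k < N)%N & cell k x.
  rewrite ler_norml => /andP[x1 x2]; have p0 : (0 : R) <= 2 ^+ n by exact: exprn_ge0.
  have e1 : ((M * 2 ^ n)%:Z)%:~R = 2 ^+ n * M%:R :> R by rewrite -pmulrn natrM natrX mulrC.
  have k1 : - (M * 2 ^ n)%:Z <= dyadic_index n x.
    by rewrite /dyadic_index floor_ge_int intrN e1 -mulrN ler_wpM2l.
  have k2 : dyadic_index n x <= (M * 2 ^ n)%:Z.
    by rewrite /dyadic_index -(ler_int R) e1; apply: le_trans (floor_le _) _; rewrite ler_wpM2l.
  exists `|(dyadic_index n x + (M * 2 ^ n)%:Z)%R|%N; last first.
    by rewrite /cell /= shift_absz.
  have : (0 < 2 ^ n)%N by rewrite expn_gt0.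
  rewrite /N mulSn -mulnA; move: k1 k2; set k := dyadic_index n x; set a := (M * 2 ^ n)%N; set b := (2 ^ n)%N.
  by clear; lia.
exists U; split.
- by move=> i; apply: diameter_le => z z' Uz Uz'; exact: le_trans (dist i z z' Uz Uz') small.
- move=> z /EM[/inrange[k kN hk] /inrange[l lN hl]].
  exists (k * N + l)%N => //; rewrite /U.
  have -> : (k * N + l < N * N)%N.
    by apply: (@leq_trans (k.+1 * N)%N); [rewrite mulSn addnC ltn_add2r|rewrite leq_mul2r kN orbT].
  by rewrite /= divnMDl// divn_small// addn0 modnMDl modn_small.
rewrite (nneseries_split 0 (N * N)); last by move=> k _; exact: diameter_pow_ge0.
rewrite eseries0 ?adde0; last first.
  by move=> i; rewrite add0n => iN _; rewrite /U ltnNge iN /= /diameter_pow eqxx.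
have h0 : (0 : R) <= 2^-1 ^+ n by rewrite exprn_ge0 ?invr_ge0.
apply: (@le_trans _ _ (\sum_(0 <= i < 0 + N * N) (((2 * 2^-1 ^+ n) `^ s)%:E))%E).
  apply: lee_sum => i _; apply: diameter_pow_le; [exact: distC_ge0|lra|by rewrite mulr_ge0|].
  exact: dist.
rewrite sumEFin lee_fin sumr_const_nat add0n subn0 -[_ *+ (N * N)]mulr_natl.
apply: (@le_trans _ _ (c * r ^+ n)); last first.
  by rewrite mulrC -ler_pdivlMr// ltW// hn1// leq_maxl.
rewrite /N powRM// -powR_half_expn powR_half -powRN natrM natrM natrX.
have -> : r ^+ n = 2 ^+ n * 2 ^+ n * (2 `^ (- s)) ^+ n.
  rewrite -exprMn -exprMn; congr (_ ^+ n); rewrite /r powRD ?pnatr_eq0 ?implybT//.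
  by rewrite powR_mulrn// expr2.
by rewrite le_eqVlt; apply/orP; left; apply/eqP; rewrite /c; ring.
Qed.

End HausdorffComplex.

(** * The image of the random series *)

Section ImageOfSeries.
Context (R : realType) (d : measure_display) (Omega : measurableType d).
Variables (P : probability Omega R) (theta : nat -> {RV P >-> R}).
Variables (phi : nat -> R -> R[i]) (a : nat -> R[i]) (lambda : nat -> R) (q : R).
Hypothesis theta_indep : mutually_independent theta.
Hypothesis theta_unif : forall n, uniform01 (theta n).
Hypothesis phi_bounded : uniformly_bounded phi.
Hypothesis phi_bilip : locally_uniformly_bilipschitz phi.
Hypothesis a_summable : cvgn (series (fun n => Normc.normc (a n))).
Hypothesis lambda_ge1 : forall n, 1 <= lambda n.
Hypothesis q_gt1 : 1 < q.
Implicit Types (x y t s b h : R) (w : Omega).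

Let X := series_re theta phi a lambda.
Let Y := series_im theta phi a lambda.
Let S := random_series a lambda phi theta.

Let dom := coef_dom lambda phi_bounded a_summable.

Let cvg_dom : cvgn (series dom).
Proof. exact: cvg_coef_dom. Qed.

Let SE w : S w = fun x => Complex (X w x) (Y w x).
Proof. by apply/funext => x; exact: random_seriesE. Qed.

Lemma bounded_rv_series_re x : bounded_rv (fun w => X w x).
Proof. exact: (bounded_rv_wave_series theta cvg_dom (dominated_re lambda phi_bounded a_summable x)). Qed.

Lemma bounded_rv_series_im x : bounded_rv (fun w => Y w x).
Proof. exact: (bounded_rv_wave_series theta cvg_dom (dominated_im lambda phi_bounded a_summable x)). Qed.

Lemma series_bounded : exists2 M : R, 0 < M & forall w x, `|X w x| <= M /\ `|Y w x| <= M.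
Proof.
have [M hM] := wave_series_bounded theta cvg_dom.
exists (Num.max M 1) => [|w x]; first by rewrite lt_max ltr01 orbT.
have h1 := hM _ _ w (dominated_re lambda phi_bounded a_summable x).
have h2 := hM _ _ w (dominated_im lambda phi_bounded a_summable x).
by split; rewrite le_max; apply/orP; left.
Qed.

Lemma coef_lipschitz n : exists2 dl : R, 0 < dl & exists2 K : R, 0 <= K &
  forall x y, `|x - y| <= dl -> `|coef_re phi a lambda n x - coef_re phi a lambda n y| <= K * `|x - y| /\
    `|coef_im phi a lambda n x - coef_im phi a lambda n y| <= K * `|x - y|.
Proof.
have [L [dl [L1 dl0 bil]]] := phi_bilip.
have ln0 : 0 < lambda n := lt_le_trans ltr01 (lambda_ge1 n).
have L0 : 0 < L := lt_le_trans ltr01 L1.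
exists (dl / lambda n); first by rewrite divr_gt0.
exists (Normc.normc (a n) * (L * lambda n)) => [|x y xy].
  by rewrite !mulr_ge0 ?normc_ge0// ltW.
have lD : distR (lambda n * x) (lambda n * y) = lambda n * `|x - y|.
  by rewrite /distR -mulrBr normrM gtr0_norm.
have lDd : distR (lambda n * x) (lambda n * y) <= dl.
  by rewrite lD mulrC -ler_pdivlMr.
have /andP[_ h] := bil n _ _ lDd; rewrite lD in h.
set D := distC _ _ in h.
have D0 : 0 <= D by exact: normc_ge0.
have e := coef_diff phi a lambda n x y; rewrite -/D in e.
have nD : 0 <= Normc.normc (a n) * D by rewrite mulr_ge0 ?normc_ge0.
have bd : Normc.normc (a n) * D <= Normc.normc (a n) * (L * lambda n) * `|x - y|.
  by rewrite -mulrA ler_wpM2l ?normc_ge0// -mulrA.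
have hr (u v z : R) : 0 <= z -> u ^+ 2 + v ^+ 2 = z ^+ 2 -> `|u| <= z.
  move=> z0 euv; rewrite -ler_sqr ?nnegrE// real_normK ?num_real// -euv lerDl sqr_ge0.
  by [].
split; apply: le_trans bd; first exact: hr nD e.
by apply: hr nD _; rewrite addrC; exact: e.
Qed.

(** Valid for every [w] and not just almost surely: tails are uniformly small and partial sums are
    Lipschitz at small distances, though with a radius that shrinks with [N]. *)
Lemma wave_series_continuous (A B : nat -> R -> R) w :
  (forall x, dominated dom (A ^~ x) (B ^~ x)) ->
  (forall n, exists2 dl : R, 0 < dl & exists2 K : R, 0 <= K & forall x y, `|x - y| <= dl ->
     `|A n x - A n y| <= K * `|x - y| /\ `|B n x - B n y| <= K * `|x - y|) ->
  continuous (fun x => wave_series theta (A ^~ x) (B ^~ x) w).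
Proof.
move=> domAB lip x; apply/cvgrPdist_le => e e0.
have e3 : 0 < e / 3 by rewrite divr_gt0.
have [N hN] := wave_tail theta cvg_dom e3.
have [dl dl0 [K K0 hK]] : exists2 dl : R, 0 < dl & exists2 K : R, 0 <= K & forall y, `|x - y| <= dl ->
    `|wave_partial theta (A ^~ x) (B ^~ x) N w - wave_partial theta (A ^~ y) (B ^~ y) N w| <= K * `|x - y|.
  elim: N {hN} => [|N [dl dl0 [K K0 IH]]].
    by exists 1 => //; exists 0 => // y _; rewrite /wave_partial !big_geq// subrr normr0 mul0r.
  have [dl' dl'0 [K' K'0 h]] := lip N.
  exists (Num.min dl dl'); first by rewrite lt_min dl0.
  exists (K + (K' + K')) => [|y]; first by rewrite !addr_ge0.
  rewrite le_min => /andP[/IH h1 /h[h2 h3]].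
  rewrite /wave_partial !big_nat_recr//= -!/(wave_partial _ _ _ _ _).
  set p := wave_partial _ _ _ _ _ in h1 *; set p' := wave_partial _ _ _ _ _ in h1 *.
  rewrite opprD addrACA; apply: (le_trans (ler_normD _ _)); rewrite mulrDl; apply: lerD => //.
  rewrite /wave; set c := cos _; set z := sin _.
  rewrite (_ : _ - _ = (A N x - A N y) * c + (B N x - B N y) * z); last by ring.
  apply: (le_trans (ler_normD _ _)); rewrite [leRHS]mulrDl; apply: lerD; rewrite normrM.
    by apply: le_trans h2; rewrite ler_piMr// cos_max.
  by apply: le_trans h3; rewrite ler_piMr// sin_max.
have hd : 0 < Num.min dl (e / 3 / (K + 1)).
  by rewrite lt_min dl0/= divr_gt0// ltr_wpDl.
apply/nbhs_ballP; exists (Num.min dl (e / 3 / (K + 1))) => //= y; rewrite /ball/= lt_min => /andP[y1 y2].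
have K1 : 0 < K + 1 by rewrite ltr_wpDl.
have hp : `|wave_partial theta (A ^~ x) (B ^~ x) N w - wave_partial theta (A ^~ y) (B ^~ y) N w| <= e / 3.
  apply: le_trans (hK y (ltW y1)) _; rewrite ltr_pdivlMr// in y2.
  by have := normr_ge0 (x - y); lra.
have hx := hN N _ _ w (leqnn N) (domAB x); have hy := hN N _ _ w (leqnn N) (domAB y).
set u := wave_series _ _ _ _ in hx *; set v := wave_series _ _ _ _ in hy *.
set p := wave_partial _ _ _ _ _ in hx hp; set p' := wave_partial _ _ _ _ _ in hy hp.
rewrite (_ : u - v = (u - p) + (p - p') - (v - p')); last by ring.
apply: (le_trans (ler_normB _ _)); have := ler_normD (u - p) (p - p'); lra.
Qed.

Lemma series_re_continuous w : continuous (X w).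
Proof.
apply: (wave_series_continuous (A := coef_re phi a lambda) (B := fun n x => - coef_im phi a lambda n x)).
  by move=> x; exact: dominated_re.
move=> n; have [dl dl0 [K K0 h]] := coef_lipschitz n.
exists dl => //; exists K => // x y /h[h1 h2]; split => //.
by rewrite -opprD normrN.
Qed.

Lemma series_im_continuous w : continuous (Y w).
Proof.
apply: (wave_series_continuous (A := coef_im phi a lambda) (B := coef_re phi a lambda)).
  by move=> x; exact: dominated_im.
move=> n; have [dl dl0 [K K0 h]] := coef_lipschitz n.
by exists dl => //; exists K => // x y /h[h1 h2].
Qed.

Let frostman_setup A s d0 : measurable A -> 0 < s -> (s%:E < hausdorff_dim (@distR R) A)%E ->
  0 < d0 -> d0 <= 1 -> exists K (c : R), [/\ compact K, K `<=` A,
    forall x y, K x -> K y -> `|x - y| <= d0, 0 < c & forall N, exists mu, frostman_at K s c N mu].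
Proof.
move=> mA s0 sA d00 d01.
have [K [b [cK KA Kb K0]]] := compact_content_subset mA s0 d00 sA.
have [c c0 fr] := frostman_measures s0 d01 Kb K0.
exists K, c; split => // x y /Kb/= + /Kb/=; rewrite !in_itv/= => /andP[? ?] /andP[? ?].
by rewrite ler_norml; apply/andP; split; lra.
Qed.

Lemma image_dimension_lower A t s b : measurable A -> 0 < t -> (upper_exponent q lambda a < t%:E)%E ->
  0 < b -> b < 2 -> t * b < s -> (s%:E < hausdorff_dim (@distR R) A)%E ->
  {ae P, forall w, (b%:E <= hausdorff_dim (@distC R) (S w @` A))%E}.
Proof.
move=> mA t0 ht b0 b2 tbs sA.
have s0 : 0 < s by apply: lt_trans tbs; rewrite mulr_gt0.
have [c [d0 [c0 d00 d01 dec]]] := decorrelation theta_indep theta_unif phi_bounded phi_bilip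
  a_summable lambda_ge1 q_gt1 3 t0 ht.
have [K [c' [cK KA Kd c'0 fr]]] := frostman_setup mA s0 sA d00 d01.
have [mu [hmu ae]] := dyadic_energy_often bounded_rv_series_re bounded_rv_series_im t0 c0 d01 dec s0 Kd fr b0 b2 tbs.
apply: filterS ae => w [B hB].
apply: (image_dimension_ge (series_re_continuous (w := w)) (series_im_continuous (w := w)) cK c'0 b0 (ltW b2) _ _ hB).
- by move=> J p pJ; have [M [h _ _]] := hmu J; exact: h.
- by move=> J; have [M [_ h _]] := hmu J.
by move=> _ [x Kx <-]; exists x; [exact: KA|rewrite SE].
Qed.

Lemma image_area_positive A t s : measurable A -> 0 < t -> (upper_exponent q lambda a < t%:E)%E ->
  2 * t < s -> (s%:E < hausdorff_dim (@distR R) A)%E ->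
  {ae P, forall w, (0 < lebesgue2 (S w @` A))%E}.
Proof.
move=> mA t0 ht ts sA.
have s0 : 0 < s by apply: lt_trans ts; rewrite mulr_gt0.
have [c [d0 [c0 d00 d01 dec]]] := decorrelation theta_indep theta_unif phi_bounded phi_bilip
  a_summable lambda_ge1 q_gt1 3 t0 ht.
have [K [c' [cK KA Kd c'0 fr]]] := frostman_setup mA s0 sA d00 d01.
have [mu [hmu ae]] := top_energy_often bounded_rv_series_re bounded_rv_series_im t0 c0 d01 dec s0 Kd fr ts.
have [M M0 hM] := series_bounded.
apply: filterS ae => w [B hB].
apply: (image_area_gt0 (series_re_continuous (w := w)) (series_im_continuous (w := w)) cK c'0 (M := M) _ _ _ hB).
- by move=> x _; exact: hM.
- by move=> J p pJ; have [N [h _ _]] := hmu J; exact: h.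
- by move=> J; have [N [_ h _]] := hmu J.
by move=> _ [x Kx <-]; exists x; [exact: KA|rewrite SE].
Qed.

Lemma frostman_mass K s c N (mu : seq (R * R)) : 0 < s -> 0 < c -> frostman_at K s c N mu ->
  \sum_(p <- mu) p.1 <= frostman_const s 0.
Proof.
move=> s0 c0 [hmu cmu pot].
have [e|[p pmu]] : mu = [::] \/ exists p, p \in mu.
  by case: (mu) => [|p l]; [left|right; exists p; rewrite inE eqxx].
  by move: cmu; rewrite e big_nil leNgt c0.
have [Kp _] := hmu p pmu; apply: le_trans (pot 0 p.2 (lexx 0) s0 Kp).
by rewrite big_seq [leRHS]big_seq; apply: ler_sum => p' _; rewrite oppr0 powRr0 mulr1.
Qed.

Lemma image_interior A t s : measurable A -> 0 < t -> (upper_exponent q lambda a < t%:E)%E ->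
  4 * t < s -> (s%:E < hausdorff_dim (@distR R) A)%E ->
  {ae P, forall w, has_interior (S w @` A)}.
Proof.
move=> mA t0 ht ts sA.
have s0 : 0 < s by apply: lt_trans ts; rewrite mulr_gt0.
have [c [d0 [c0 d00 d01 dec]]] := decorrelation theta_indep theta_unif phi_bounded phi_bilip
  a_summable lambda_ge1 q_gt1 3 t0 ht.
have [K [c' [cK KA Kd c'0 fr]]] := frostman_setup mA s0 sA d00 d01.
have [M M0 hM] := series_bounded.
(* Rescaling brings the image into the square of half side 1/4 that [image_contains_box] requires;
   only the constant of decorrelation changes, to [c * h^2]. *)
pose h := (4 * M)^-1.
have h0 : 0 < h by rewrite invr_gt0 mulr_gt0.
pose X' w x := h * X w x; pose Y' w x := h * Y w x.
have bX' x : bounded_rv (fun w => X' w x) by apply: bounded_rvZ; exact: bounded_rv_series_re.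
have bY' x : bounded_rv (fun w => Y' w x) by apply: bounded_rvZ; exact: bounded_rv_series_im.
have ch0 : 0 < c * h ^+ 2 by rewrite mulr_gt0// exprn_gt0.
have dec' : decorrelated P X' Y' t (c * h ^+ 2) d0.
  move=> x y xy xyd u v; have := dec x y xy xyd (u * h) (v * h).
  rewrite (_ : c * ((u * h) ^+ 2 + (v * h) ^+ 2) = c * h ^+ 2 * (u ^+ 2 + v ^+ 2)); last by ring.
  rewrite (_ : (fun w => cos (u * (X' w x - X' w y) + v * (Y' w x - Y' w y))) =
    (fun w => cos (u * h * (X w x - X w y) + v * h * (Y w x - Y w y)))) //.
  by apply/funext => w; congr cos; rewrite /X' /Y'; ring.
have [e [e0 e1 [mu [hmu ae]]]] := fourier_energy_often bX' bY' t0 ch0 d01 dec' ts Kd fr.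
apply: filterS ae => w [B hB].
have cX' : continuous (X' w).
  by move=> x; apply: cvgMr; exact: series_re_continuous.
have cY' : continuous (Y' w).
  by move=> x; apply: cvgMr; exact: series_im_continuous.
have small x : K x -> `|X' w x| <= 4^-1 /\ `|Y' w x| <= 4^-1.
  move=> _; have [h1 h2] := hM w x.
  have e4 : h * M = 4^-1 by rewrite /h; field; rewrite gt_eqF.
  by rewrite /X' /Y' !normrM gtr0_norm// -e4; split; apply: ler_wpM2l => //; exact: ltW.
have pos J p : p \in mu J -> K p.2 /\ 0 <= p.1.
  by move=> pJ; have [N [hJ _ _]] := hmu J; have := hJ p pJ.
have mass J : c' <= \sum_(p <- mu J) p.1 <= frostman_const s 0.
  by have [N hJ] := hmu J; have [_ h1 _] := hJ; rewrite h1 (frostman_mass s0 c'0 hJ).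
have [x Kx [r r0 hr]] := image_contains_box cX' cY' cK c'0 e0 e1 small pos mass hB.
exists (X w x, Y w x); apply/nbhs_ballP; exists (r / h); first by rewrite /= divr_gt0.
move=> z [/= z1 z2].
have [|//|y Ky [y1 y2]] := hr (h * z.1, h * z.2).
  rewrite /= /X' -mulrBr normrM gtr0_norm// mulrC -ltr_pdivlMr// distrC; exact: z1.
  rewrite /= /Y' -mulrBr normrM gtr0_norm// mulrC -ltr_pdivlMr// distrC; exact: z2.
exists (S w y); first by exists y => //; exact: KA.
have inj (u v : R) : h * u = h * v -> u = v by apply: mulfI; rewrite gt_eqF.
by rewrite SE /toR2 /= (inj _ _ y1) (inj _ _ y2) -surjective_pairing.
Qed.

(** The quantifiers over [h] and [s] stand inside the event: the exceptional set comes from the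
    dyadic increments and depends on [g] alone. *)
Lemma image_dimension_upper A g : 0 < g -> g <= 1 -> (g%:E < lower_exponent q lambda a)%E ->
  {ae P, forall w, forall h s, 0 < h -> h < g -> 0 <= s -> hausdorff_measure (@distR R) s A = 0%E ->
    (hausdorff_dim (@distC R) (S w @` A) <= (s / h)%:E)%E}.
Proof.
move=> g0 g1 hg.
have [V [V0 sub]] := subgaussian_increment theta_indep theta_unif phi_bounded phi_bilip
  a_summable lambda_ge1 q_gt1 (ltW g0) g1 hg.
have := ae_foralln (fun T => dyadic_increments bounded_rv_series_re bounded_rv_series_im V0 sub T.+1).
apply: filterS => w hw h s h0 hhg s0 HA.
have h1 : h <= 1 by rewrite (le_trans (ltW hhg)).
apply: hausdorff_dim_le; first by rewrite divr_ge0// ltW.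
have -> : S w @` A = \bigcup_T (S w @` (A `&` [set x | `|x| <= T%:R])).
  apply/seteqP; split => [_ [x Ax <-]|_ [T _ [x [Ax _] <-]]]; last by exists x.
  exists (Num.bound `|x|) => //; exists x => //; split => //=.
  by apply: ltW; exact: archi_boundP.
apply: hausdorff_null_bigcup => T.
have [C C0 hC] := hw T.
have [C1 C10 hol1] := holder_of_dyadic (series_re_continuous (w := w)) C0 h0 hhg h1
  (fun n k k1 k2 => proj1 (hC n k k1 k2)).
have [C2 C20 hol2] := holder_of_dyadic (series_im_continuous (w := w)) C0 h0 hhg h1
  (fun n k k1 k2 => proj2 (hC n k k1 k2)).
apply: (@hausdorff_null_image R (S w) _ s h (C1 + C2)) => //; first exact: addr_gt0.
  move=> x y [_ xT] [_ yT] xy; rewrite SE; apply: (le_trans (distC_le_ReIm _ _)) => /=.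
  by rewrite mulrDl; apply: lerD; [exact: hol1|exact: hol2].
apply: cover_hausdorff_null => delta e d0 e0.
have [U [dU AU hU]] := hausdorff_null_cover HA d0 e0.
by exists U; split => //; [move=> x [/AU]|exact: ltW].
Qed.

Lemma image_dimension_le2 A w : (hausdorff_dim (@distC R) (S w @` A) <= 2%:E)%E.
Proof.
have [M M0 hM] := series_bounded.
apply/lee_addgt0Pr => e e0; rewrite -EFinD.
apply: hausdorff_dim_le; first by rewrite addr_ge0// ltW.
apply: (@hausdorff_null_bounded R _ _ (Num.bound M)); first by rewrite ltrDl.
have Mb : M <= (Num.bound M)%:R by apply: ltW; apply: archi_boundP; exact: ltW.
move=> _ [x _ <-]; rewrite SE /=; have [h1 h2] := hM w x.
by split; [exact: le_trans h1 Mb|exact: le_trans h2 Mb].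
Qed.

End ImageOfSeries.

Section ExponentGap.
Context (R : realType).
Implicit Types (D : \bar R) (k u : R).

(** The lemmas on the image use strict inequalities on both sides, [t] above the exponent [u] and
    [s] below the dimension [D]; [k] will be 2, 4 or a target dimension. *)
Lemma exponent_gap k u D : 0 < k -> 0 <= u -> ((u * k)%:E < D)%E ->
  exists t s, [/\ u < t, 0 < t, t * k < s & (s%:E < D)%E].
Proof.
move=> k0 u0 uD.
have [s us sD] : exists2 s, u * k < s & (s%:E < D)%E.
  case: D uD => [r||] // uD; last by exists (u * k + 1); rewrite ?ltrDl ?ltry.
  by exists ((u * k + r) / 2); rewrite ?lte_fin in uD *; lra.
have usk : u < s / k by rewrite ltr_pdivlMr.
exists ((u + s / k) / 2), s; split => //; first by lra.
  by lra.
by rewrite -ltr_pdivlMr//; lra.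
Qed.

(** Exceptional events depend on the exponent chosen; with rational exponents countably many
    suffice. *)
Lemma ae_forall_rat (d : measure_display) (Omega : measurableType d) (P : probability Omega R)
    (Q : rat -> Omega -> Prop) :
  (forall r, {ae P, forall w, Q r w}) -> {ae P, forall w, forall r, Q r w}.
Proof.
move=> aeQ.
have /ae_foralln : forall n, {ae P, forall w, if choice.unpickle n is Some r then Q r w else True}.
  by move=> n; case: (choice.unpickle n) => [r|]; [exact: aeQ|exact: aeW].
by apply: filterS => w h r; have := h (choice.pickle r); rewrite choice.pickleK.
Qed.

End ExponentGap.

Theorem theorem1p1 (R : realType) (d : measure_display)
    (Omega : measurableType d) (P : probability Omega R)
    (theta : nat -> {RV P >-> R})
    (phi : nat -> R -> R[i]) (a : nat -> R[i]) (lambda : nat -> R) (q : R)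
    (theta_indep : mutually_independent theta)
    (theta_unif : forall n, uniform01 (theta n))
    (phi_bounded : uniformly_bounded phi)
    (phi_bilip : locally_uniformly_bilipschitz phi)
    (a_neq0 : forall n, a n != 0)
    (a_summable : cvgn (series (fun n => Normc.normc (a n))))
    (lambda_incr : nondecreasing_seq lambda)
    (lambda0 : lambda 0%N = 1)
    (q_sup : ereal_sup (range (fun n => (lambda n.+1 / lambda n)%:E)) = q%:E)
    (q_gt1 : 1 < q) :
  let sigma := lower_exponent q lambda a in
  let tau := upper_exponent q lambda a in
  let S := random_series a lambda phi theta in
  let dimR := hausdorff_dim (@distR R) in
  let dimC := hausdorff_dim (@distC R) in
  ((0 < sigma)%E -> (sigma <= tau)%E -> (tau < +oo)%E ->
   forall A : set R, measurable A ->
   [/\ {ae P, forall w,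
         (mine 2%:E (dimR A / tau) <= dimC (S w @` A))%E /\
         (dimC (S w @` A) <= mine 2%:E (dimR A / mine sigma 1%:E))%E},
       ((0 < tau)%E -> (tau < (2^-1)%:E * dimR A)%E ->
         {ae P, forall w, (0 < lebesgue2 (S w @` A))%E}) &
       ((0 < tau)%E -> (tau < (4^-1)%:E * dimR A)%E ->
         {ae P, forall w, has_interior (S w @` A)})]) /\
  (tau = 0%E ->
   forall A : set R, measurable A -> (0 < dimR A)%E ->
   {ae P, forall w, has_interior (S w @` A)}).

Proof.
move=> sigma tau S dimR dimC.
have lambda_ge1 n : 1 <= lambda n by rewrite -lambda0; exact: lambda_incr.
split=> [sigma0 st tauoo A mA|tau0 A mA A0].
  have [ta ta0 tauE] : exists2 ta : R, 0 < ta & tau = ta%:E.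
    have := lt_le_trans sigma0 st; case: (tau) tauoo => [r||]// _ r0.
    by exists r.
  have sub k : 0 < k -> (tau < (k^-1)%:E * dimR A)%E ->
      exists t s, [/\ ta < t, 0 < t, t * k < s & (s%:E < dimR A)%E].
    move=> k0; rewrite tauE lte_pdivlMl// -EFinM mulrC => h.
    exact: exponent_gap k0 (ltW ta0) h.
  split.
  - have low : {ae P, forall w (r : rat), 0 < ratr r :> R -> ratr r < 2 :> R ->
        ((ta * ratr r)%:E < dimR A)%E -> ((ratr r)%:E <= dimC (S w @` A))%E}.
      apply: ae_forall_rat => r.
      have [[r0 r2 rA]|n] := pselect ([/\ 0 < ratr r :> R, ratr r < 2 :> R & ((ta * ratr r)%:E < dimR A)%E]).
        have [t [s [tat t0 ts sA]]] := exponent_gap r0 (ltW ta0) rA.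
        have := image_dimension_lower theta_indep theta_unif phi_bounded phi_bilip a_summable lambda_ge1 q_gt1
          mA t0 _ r0 r2 ts sA.
        rewrite -/tau tauE lte_fin => /(_ tat); apply: filterS => w h _ _ _; exact: h.
      by apply: aeW => w r0 r2 rA; case: n.
    have [m [m0 m1 mE mlt]] : exists m : R, [/\ 0 < m, m <= 1, mine sigma 1%:E = m%:E & forall g : R, g < m -> (g%:E < sigma)%E].
      have sr : sigma = (fine sigma)%:E.
        rewrite fineK// ge0_fin_numE ?ltW//; exact: le_lt_trans st tauoo.
      exists (Num.min (fine sigma) 1); rewrite lt_min ge_min lexx orbT ltr01 andbT; split => //.
      - by rewrite -lte_fin -sr.
      - by rewrite sr /= EFin_min.
      - by move=> g; rewrite lt_min sr lte_fin => /andP[].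
    have upp : {ae P, forall w (r : rat), 0 < ratr r :> R -> ratr r < m :> R ->
        forall h s, 0 < h -> h < ratr r :> R -> 0 <= s -> hausdorff_measure (@distR R) s A = 0%E ->
        (dimC (S w @` A) <= (s / h)%:E)%E}.
      apply: ae_forall_rat => r.
      have [[r0 rm]|n] := pselect (0 < ratr r :> R /\ ratr r < m :> R).
        have := image_dimension_upper theta_indep theta_unif phi_bounded phi_bilip a_summable lambda_ge1 q_gt1
          A r0 (le_trans (ltW rm) m1) (mlt _ rm).
        by apply: filterS => w h _ _; exact: h.
      by apply: aeW => w r0 rm; case: n.
    apply: filterS2 low upp => w low upp.
    have [D [D0 D2 DE]] : exists D : R, [/\ 0 <= D, D <= 2 & dimC (S w @` A) = D%:E].
      have h2 := image_dimension_le2 theta lambda phi_bounded a_summable A w.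
      have h0 : (0 <= dimC (S w @` A))%E by exact: hausdorff_dim_ge0.
      have fD : dimC (S w @` A) \is a fin_num by rewrite ge0_fin_numE// (le_lt_trans h2)// ltry.
      by exists (fine (dimC (S w @` A))); rewrite -!lee_fin fineK.
    rewrite DE in low upp *; split.
      (* Otherwise a rational lies strictly between the dimension of the image and the claimed
         bound, against [low]. The auxiliary [z] is a real bound at most 2, since [dimR A / tau] may
         be infinite. *)
      rewrite leNgt; apply/negP => h.
      have [z Dz [z2 zA]] : exists2 z : R, D < z & z <= 2 /\ (z%:E <= dimR A / tau)%E.
        move: h; rewrite lt_min lte_fin => /andP[h1 h2].
        case: (dimR A / tau)%E h2 => [v||]// h2; last by exists 2; rewrite // leey.
        exists (Num.min v 2); first by rewrite lt_min h1 -lte_fin h2.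
        by rewrite lee_fin !ge_min !lexx orbT.
      have [r] := rat_in_itvoo Dz; rewrite in_itv/= => /andP[Dr rz].
      have : ((ratr r)%:E <= D%:E)%E.
        apply: low; [exact: le_lt_trans Dr|exact: lt_le_trans z2|].
        rewrite mulrC EFinM -lte_pdivlMr//.
        by move: zA; rewrite tauE inver gt_eqF// => zA; apply: lt_le_trans zA; rewrite lte_fin.
      by rewrite lee_fin leNgt Dr.
    rewrite le_min lee_fin D2/= mE inver gt_eqF//= lee_pdivlMr// -EFinM.
    apply: le_ereal_inf_tmp => _ [s [s0 HA] <-]; rewrite lee_fin leNgt; apply/negP => sD.
    have Dp : 0 < D.
      by rewrite lt_neqAle D0 andbT; apply/negP => /eqP e; move: sD; rewrite -e mul0r ltNge s0.
    (* A rational [r] between [s / D] and [m], and [h] midway between [s / D] and [r], give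
       [D <= s / h < D]. *)
    have sm : s / D < m by rewrite ltr_pdivrMr// mulrC.
    have [r] := rat_in_itvoo sm; rewrite in_itv/= => /andP[sr rm].
    have sD0 : 0 <= s / D by rewrite divr_ge0.
    have h0 : 0 < (s / D + ratr r) / 2 by lra.
    have := upp r (le_lt_trans sD0 sr) rm ((s / D + ratr r) / 2) s h0 _ s0 HA.
    rewrite lee_fin ler_pdivlMr// => /(_ _) h.
    have : D * ((s / D + ratr r) / 2) <= s by apply: h; lra.
    rewrite mulrC -ler_pdivlMr//; lra.
  - move=> _ /(sub _ (ltr0n _ 2)) [t [s [tat t0 ts sA]]].
    have tt : (upper_exponent q lambda a < t%:E)%E by rewrite -/tau tauE lte_fin.
    rewrite mulrC in ts.
    exact: (image_area_positive theta_indep theta_unif phi_bounded phi_bilip a_summable lambda_ge1 q_gt1 mA t0 tt ts sA).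
  - move=> _ /(sub _ (ltr0n _ 4)) [t [s [tat t0 ts sA]]].
    have tt : (upper_exponent q lambda a < t%:E)%E by rewrite -/tau tauE lte_fin.
    rewrite mulrC in ts.
    exact: (image_interior theta_indep theta_unif phi_bounded phi_bilip a_summable lambda_ge1 q_gt1 mA t0 tt ts sA).
(* With [tau = 0] any positive dimension leaves room for some [t > 0] with [4 t] below it, so the
   case is covered by [image_interior]. *)
have A0' : ((0 * 4)%:E < dimR A)%E by rewrite mul0r.
have [t [s [_ t0 ts sA]]] := exponent_gap (ltr0n R 4) (lexx 0) A0'.
have tt : (upper_exponent q lambda a < t%:E)%E by rewrite -/tau tau0 lte_fin.
rewrite mulrC in ts.
exact: (image_interior theta_indep theta_unif phi_bounded phi_bilip a_summable lambda_ge1 q_gt1 mA t0 tt ts sA).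
Qed.
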